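(* For every $n\in\mathbb{N}$ there exists a positive integer $e(n)$ (depending only on $n$) such that for every $d$ and every $1\le q<e(n)d/(e(n)d-1)$, $W_q^{\mathrm{in}}$ is a finite distance on $P_{n,d}$ and the metric space $(P_{n,d},W_q^{\mathrm{in}})$ is compact.
   Context: $P_{n,d}$ is the projectivization of the space of complex homogeneous polynomials of degree $d$ in $n+1$ variables. $\mu:P_{n,d}\to\mathscr{P}(\mathbb{C}\mathrm{P}^n)$ is given by $\int f\,\mathrm{d}\mu(p)=\frac1d\int_{\mathbb{G}(1,n)}\sum_{z\in Z(p)\cap\ell}m_z(p|_\ell)f(z)\,\mathrm{vol}_{\mathbb{G}(1,n)}(\mathrm{d}\ell)$ ($U(n+1)$-invariant probability on the Grassmannian of lines, $m_z(p|_\ell)$ the multiplicity of $z$ as a zero of $p|_\ell$). $W_q$ is the $q$-Wasserstein distance on $\mathscr{P}(\mathbb{C}\mathrm{P}^n)$ with Fubini–Study cost, and $|\dot\mu_t|_q=\lim_{h\to0}W_q(\mu_{t+h},\mu_t)/|h|$ the metric speed of a curve in $AC^q$ (curves with $W_q(\mu_s,\mu_t)\le\int_s^tm$ for some $m\in L^q$). The inner distance is $W_q^{\mathrm{in}}(p_0,p_1)^q=\inf\int_0^1|\dot\mu_t|_q^q\,\mathrm{d}t$, the infimum over curves $\gamma:[0,1]\to P_{n,d}$ with $\gamma(0)=p_0,\gamma(1)=p_1$ and $\mu_t=\mu(\gamma(t))$ in $AC^q([0,1];(\mathscr{P}(\mathbb{C}\mathrm{P}^n),W_q))$. *)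

(* Defs.v *)
From HB Require Import structures.
From mathcomp Require Import all_boot all_order all_algebra.
From mathcomp Require Import complex.
From mathcomp Require Import all_classical all_reals all_analysis.
Unset Printing Implicit Defensive.
Import Order.TTheory GRing.Theory Num.Theory.
Import numFieldNormedType.Exports.
Local Open Scope classical_set_scope.
Local Open Scope ring_scope.

Section Defs.
Variable R : realType.
Local Notation C := (complex R).

Definition cnorm2 (z : C) : R := complex.Re z ^+ 2 + complex.Im z ^+ 2.

Definition adjmx {m} (M : 'M[C]_m) : 'M[C]_m := (map_mx (@conjc R) M)^T.

Definition is_proj (k : nat) {m} (P : 'M[C]_m) : bool :=
  [&& adjmx P == P, P *m P == P & \tr P == k%:R].

(* CP^n := rank-1 orthogonal projections of C^{n+1} (the point [x] is x x^*/|x|^2),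
   G(1,n) := rank-2 orthogonal projections (the line P(V), dim V = 2). *)
Record CP (n : nat) := MkCP { cpm : 'M[C]_(n.+1) ; cpm_proj : is_proj 1 cpm }.
Record Gr (n : nat) := MkGr { grm : 'M[C]_(n.+2) ; grm_proj : is_proj 2 grm }.

Arguments cpm {n}. Arguments grm {n}.
HB.instance Definition _ n := [isSub for @cpm n].
HB.instance Definition _ n := [Choice of CP n by <:].
HB.instance Definition _ n := [isSub for @grm n].
HB.instance Definition _ n := [Choice of Gr n by <:].

(* Fubini--Study distance: d([x],[y]) = arccos |<x,y>| / (|x||y|);
   for projections tr(P Q) = |<x,y>|^2/(|x|^2|y|^2). *)
Definition dFS {n} (P Q : CP n) : R := acos (Num.sqrt (complex.Re (\tr (cpm P *m cpm Q)))).

Definition dmx {m} (A B : 'M[C]_m) : R :=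
  Num.sqrt (\sum_(i < m) \sum_(j < m) cnorm2 (A i j - B i j)).

Definition e00 n : 'M[C]_(n.+1) := delta_mx ord0 ord0.

Lemma e00_proj n : is_proj 1 (e00 n).
Proof.
apply/and3P; split.
- apply/eqP/matrixP => i j; rewrite /adjmx /e00 !mxE.
  by rewrite andbC rmorph_nat.
- by rewrite /e00 mul_delta_mx.
- rewrite /e00 /mxtrace (bigD1 ord0) //= mxE !eqxx big1 ?addr0 //.
  by move=> i ne; rewrite mxE (negbTE ne).
Qed.

HB.instance Definition _ n := isPointed.Build (CP n) (@MkCP n _ (e00_proj n)).

Definition g01 n : 'M[C]_(n.+2) := diag_mx (\row_(i < n.+2) ((i < 2)%N)%:R).

Lemma g01_proj n : is_proj 2 (g01 n).
Proof.
apply/and3P; split.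
- apply/eqP/matrixP => i j; rewrite /adjmx /g01 !mxE eq_sym.
  by case: eqP => [->|_]; rewrite ?mulr0n ?mulr1n ?rmorph0 ?rmorph_nat.
- apply/eqP/matrixP => i j; rewrite /g01 mul_diag_mx !mxE.
  case: eqP => [->|_]; rewrite ?mulr0n ?mulr1n ?mulr0 //.
  by case: (j < 2)%N; rewrite ?mul0r ?mul1r.
- rewrite /g01 /mxtrace (bigD1 ord0) //= (bigD1 (lift ord0 ord0)) //= !mxE.
  rewrite big1 ?addr0 //; last first.
    move=> i /andP [ne0 ne1]; rewrite !mxE eqxx.
    by case: i ne0 ne1 => [[|[|i]] Hi].
Qed.

HB.instance Definition _ n := isPointed.Build (Gr n) (@MkGr n _ (g01_proj n)).

Definition ballsCP n : set (set (CP n)) :=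
  fun A => exists (P : CP n) (r : R), A = [set Q | dFS P Q < r].
Definition CPm n := g_sigma_algebraType (ballsCP n).
Definition ballsGr n : set (set (Gr n)) :=
  fun A => exists (L : Gr n) (r : R), A = [set L' | dmx (grm L) (grm L') < r].
Definition Grm n := g_sigma_algebraType (ballsGr n).

Definition Gr_invariant m (vol : probability (Grm m) R) : Prop :=
  forall U : 'M[C]_(m.+2), adjmx U *m U = 1%:M ->
  forall A : set (Grm m), measurable A ->
    vol [set L : Grm m | exists2 L' : Gr m, A L' & grm L' = U *m grm L *m adjmx U]
    = vol A.

(* homogeneous polynomials of degree d in n+1 variables, as coefficient
   vectors indexed by exponent vectors of total degree d *)
Definition mono n d := {ffun 'I_(n.+1) -> 'I_(d.+1)}.
Definition mdeg {n d} (a : mono n d) : nat := (\sum_i (a i : nat))%N.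
Definition Hpoly n d := mono n d -> C.

Definition heval {n d} {S : comNzRingType} (f : C -> S) (p : Hpoly n d)
  (x : 'I_(n.+1) -> S) : S :=
  \sum_(a : mono n d | mdeg a == d) f (p a) * \prod_i x i ^+ (a i : nat).

Definition hnonzero {n d} (p : Hpoly n d) : Prop := exists a, mdeg a = d /\ p a != 0.
Definition hprop {n d} (p p' : Hpoly n d) : Prop :=
  exists c : C, c != 0 /\ forall a, mdeg a = d -> p' a = c * p a.

(* a nonzero column of M (0 if none): for a rank-1 projection x x^*, a
   nonzero multiple of x *)
Definition vec_of {k} (M : 'M[C]_k) : 'I_k -> C :=
  if [pick j | col j M != 0] is Some j then fun i => M i j else fun _ => 0.

Definition onLine {m} (z : CP m.+1) (L : Gr m) : bool := grm L *m cpm z == cpm z.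

(* multiplicity of z as a zero of p restricted to the line L (for z on L):
   with w spanning z and w' spanning the orthogonal complement of z in L,
   the order of vanishing at t = 0 of t |-> p(w + t w').  Lines on which p
   vanishes identically are given multiplicity 0. *)
Definition mult {m d} (p : Hpoly m.+1 d) (L : Gr m) (z : CP m.+1) : nat :=
  let w := vec_of (cpm z) in
  let w' := vec_of (grm L - cpm z) in
  let g : {poly C} := heval polyC p (fun i => (w i)%:P + 'X * (w' i)%:P) in
  if g == 0 then 0%N else mup 0 g.

Definition lineCount {m d} (p : Hpoly m.+1 d) (L : Gr m) (A : set (CP m.+1)) : R :=
  \sum_(z \in A `&` [set z | onLine z L]) ((mult p L z)%:R : R).

Definition muP {m d} (vol : probability (Grm m) R) (p : Hpoly m.+1 d)
  : set (CPm m.+1) -> \bar R :=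
  fun A => (((d%:R)^-1)%:E * \int[vol]_L (lineCount p L A)%:E)%E.

Definition coupling {k} (m1 m2 : set (CPm k) -> \bar R)
  (pi : probability (CPm k * CPm k)%type R) : Prop :=
  forall A : set (CPm k), measurable A ->
    pi (fst @^-1` A) = m1 A /\ pi (snd @^-1` A) = m2 A.

Definition Wq {k} (q : R) (m1 m2 : set (CPm k) -> \bar R) : \bar R :=
  ((ereal_inf [set \int[pi]_x ((@dFS k x.1 x.2) `^ q)%:E | pi in coupling m1 m2])
    `^ q^-1)%E.

Definition ACq {k} (q : R) (mu : R -> set (CPm k) -> \bar R) : Prop :=
  exists mf : R -> R,
    measurable_fun (`[0%R, 1%R]%classic : set R) mf /\
    (\int[lebesgue_measure]_(t in (`[0%R, 1%R]%classic : set R)) ((`|mf t| `^ q)%:E) < +oo)%E /\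
    forall s t : R, 0 <= s -> s <= t -> t <= 1 ->
      (Wq q (mu s) (mu t) <= \int[lebesgue_measure]_(x in `[s, t]%classic) (mf x)%:E)%E.

Definition speed {k} (q : R) (mu : R -> set (CPm k) -> \bar R) (t : R) : R :=
  lim ((fun h : R => fine (Wq q (mu (t + h)) (mu t)) / `|h|) @ 0^').

Definition action {k} (q : R) (mu : R -> set (CPm k) -> \bar R) : \bar R :=
  \int[lebesgue_measure]_(t in (`[0%R, 1%R]%classic : set R)) ((speed q mu t) `^ q)%:E.

Definition admissible {m d} (vol : probability (Grm m) R) (q : R)
  (p0 p1 : Hpoly m.+1 d) (g : R -> Hpoly m.+1 d) : Prop :=
  hprop (g 0) p0 /\ hprop (g 1) p1 /\
  (forall t, 0 <= t <= 1 -> hnonzero (g t)) /\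
  ACq q (fun t => muP vol (g t)).

Definition Win {m d} (vol : probability (Grm m) R) (q : R) (p0 p1 : Hpoly m.+1 d)
  : \bar R :=
  ((ereal_inf [set action q (fun t => muP vol (g t)) | g in admissible vol q p0 p1])
    `^ q^-1)%E.

End Defs.

Definition is_finite_distance {R : realType} {T : Type} (P : T -> Prop)
  (equiv : T -> T -> Prop) (D : T -> T -> \bar R) : Prop :=
  [/\ (forall x y, P x -> P y -> (0 <= D x y < +oo)%E),
     (forall x y, P x -> P y -> (D x y = 0%E <-> equiv x y)),
     (forall x y, P x -> P y -> D x y = D y x) &
     (forall x y z, P x -> P y -> P z -> (D x z <= D x y + D y z)%E)].

Definition is_compact_metric {R : realType} {T : Type} (P : T -> Prop)
  (D : T -> T -> \bar R) : Prop :=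
  forall F : set (set T),
    (forall U, F U -> forall x, U x -> P x ->
       exists r : R, 0 < r /\ forall y, P y -> (D x y < r%:E)%E -> U y) ->
    (forall x, P x -> exists2 U, F U & U x) ->
    exists (k : nat) (V : 'I_k -> set T),
      (forall i, F (V i)) /\ (forall x, P x -> exists i, V i x).

(* Main.v *)
(* Every form is a combination of powers l_j^d of finitely many linear forms, so two polynomials are joined by legs
  p -> p + t c l^d, 0 <= t <= 1. On a line, take the affine coordinate with the zero of l at infinity: there p becomes
  a polynomial f with leading coefficient a (the value of p at that zero), l^d becomes a constant, and the zeros at
  time t solve f(s) + t k = 0. With th = 1/(e d), their speed is at most C |k / a|^th times a sum of terms
  |t - y|^(th - 1), one for each critical value of f and one for f(0). This is in L^q with respect to t, and
  |a|^(- th q) is integrable over the Grassmannian by a sublevel estimate with exponent of order 1/d. Thus the length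
  of a leg tends to 0 with c, and compactness is inherited from the unit sphere of the coefficients.
  By the existence of metric derivatives W_in is an infimum over curves with a bound m of the speed, so concatenation
  gives the triangle inequality. If W_in (f, g) = 0, then mu(f) = mu(g). Suppose that the orders k of f and k' of g at
  some point differ, with k + k' minimal. Nearby zeros of f and g do not split, so k' mu(f) = k mu(g) near that point,
  where both measures are positive: a contradiction. *)
Require Import Defs.
From HB Require Import structures.
From mathcomp Require Import all_boot all_order all_algebra fingroup perm.
From mathcomp Require Import complex zify ring lra.
From mathcomp Require Import all_classical all_reals all_analysis measurable_realfun.
Import Order.TTheory GRing.Theory Num.Theory.
Import numFieldNormedType.Exports.
Local Open Scope classical_set_scope.
Local Open Scope ring_scope.
Set Implicit Arguments.
Unset Strict Implicit.
Unset Printing Implicit Defensive.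

Local Notation Re := complex.Re.
Local Notation Im := complex.Im.
Local Notation meas := (measurable_fun setT).
Local Notation mpow := (measurableT_comp (measurable_powR _)).
Local Notation via y := (@le_trans _ _ y _ _).
Local Notation mcomp f := (@measurableT_comp _ _ _ _ _ _ f _ _).
Local Notation I01 := (`[0%R, 1%R]%classic).

Section ProjectiveSpace.
Context {R : realType}.
Notation C := (complex R).
Notation cpm := (@cpm R _).
Notation grm := (@grm R _).
Notation Grm := (Grm R).
Notation hnonzero := (hnonzero R).
Notation Hpoly := (Hpoly R).
Notation CPm := (CPm R).
Notation Gr := (Gr R).
Notation adjmx := (adjmx R).
Notation CP := (CP R).
Notation muP := (muP R).
Notation "x %:C" := (real_complex _ x) : ring_scope.

(** The constant is [e = 4 * 2 ^ (2 * (m + 2))], with [m + 2] the number of homogeneous coordinates: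
    the sublevel estimate runs over [2 * (m + 2)] real parameters and loses a square root for each.
    The hypothesis on [q] says exactly that [(1 - th) q < 1], integrability in time; as it forces
    [q < 2], the factor 4 yields [th q < 1 / (2 d 2^(2 (m + 2)))], integrability over lines. Only
    the unitary invariance of [vol] is given, so sublevel sets of lines are estimated by averaging
    over a finite grid of Householder reflections. The value [a] is taken on the hyperplane [l = 0],
    where the base polynomial must not vanish identically; hence the linear forms depend on it.
    Zeros have no canonical order: measurable labels are built over the Grassmannian, and two
    labellings are compared up to a permutation depending measurably on the line. Near critical
    times no speed bound holds, and these are crossed by mere continuity of roots. Couplings are
    glued only approximately, through finite partitions, and equality of measures is tested on
    closed balls. *)

Lemma mEFin d (T : measurableType d) (D : set T) (f : T -> R) : meas f -> measurable_fun D (EFin \o f).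
Proof. by move=> mf; apply/measurable_EFinP/measurable_funTS. Qed.

Lemma EpowR_ge0 (x a : R) : (0 <= (x `^ a)%:E)%E. Proof. by rewrite lee_fin powR_ge0. Qed.

Lemma measurable_pre d d' (T : measurableType d) (T' : measurableType d') (f : T -> T') (A : set T') :
 meas f -> measurable A -> measurable (f @^-1` A).
Proof. by move=> mf mA; rewrite -[X in measurable X]setTI; exact: mf. Qed.

(** * Complex modulus; location and continuity of roots *)

Section ComplexModulus.
Implicit Types (z w : C) (P Q : {poly C}).

Definition cabs (z : C) : R := Normc.normc z.

Lemma cabsE z : cabs z = Num.sqrt (cnorm2 R z). Proof. by case: z. Qed.
Lemma cabs_ge0 z : 0 <= cabs z. Proof. by rewrite cabsE sqrtr_ge0. Qed.
Hint Resolve cabs_ge0 : core.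
Lemma cnorm2_ge0 z : 0 <= cnorm2 R z.
Proof. by rewrite /cnorm2 addr_ge0 ?sqr_ge0. Qed.
Lemma sqr_cabs z : cabs z ^+ 2 = cnorm2 R z.
Proof. by rewrite cabsE sqr_sqrtr ?cnorm2_ge0. Qed.
Lemma cabs0 : cabs 0 = 0. Proof. exact: Normc.normc0. Qed.
Lemma cabs1 : cabs 1 = 1. Proof. exact: Normc.normc1. Qed.
Lemma cabsM z w : cabs (z * w) = cabs z * cabs w.
Proof. exact: Normc.normcM. Qed.
Lemma cabsV z : cabs z^-1 = (cabs z)^-1. Proof. exact: Normc.normcV. Qed.
Lemma cabsX z n : cabs (z ^+ n) = cabs z ^+ n.
Proof. by elim: n => [|n IH]; rewrite ?expr0 ?cabs1// !exprS cabsM IH. Qed.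
Lemma cabsN z : cabs (- z) = cabs z. Proof. exact: normcN. Qed.
Lemma cabs_le z w : cabs (z + w) <= cabs z + cabs w.
Proof. exact: le_normcD. Qed.
Lemma cabs_eq0 z : (cabs z == 0) = (z == 0).
Proof.
by apply/eqP/eqP => [/Normc.eq0_normc|->]; rewrite ?cabs0.
Qed.
Lemma cabs_gt0 z : (0 < cabs z) = (z != 0).
Proof. by rewrite lt_def cabs_eq0 cabs_ge0 andbT. Qed.
Lemma cabsB z w : cabs (z - w) = cabs (w - z).
Proof. by rewrite -cabsN opprB. Qed.
Lemma cabs_leB z w : cabs z - cabs w <= cabs (z - w).
Proof. by rewrite lerBlDr -{1}(subrK w z) cabs_le. Qed.
Lemma cabs_triB u z w : cabs (z - w) <= cabs (z - u) + cabs (u - w).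
Proof. by have := cabs_le (z - u) (u - w); rewrite addrA subrK. Qed.
Lemma cabs_conj z : cabs (conjc z) = cabs z.
Proof. by case: z => a b; rewrite !cabsE /cnorm2 /= sqrrN. Qed.
Lemma cabs_sum I (r : seq I) (p : pred I) (F : I -> C) :
 cabs (\sum_(i <- r | p i) F i) <= \sum_(i <- r | p i) cabs (F i).
Proof.
elim/big_ind2: _ => [|x1 x2 y1 y2 h1 h2|//]; first by rewrite cabs0.
by rewrite (le_trans (cabs_le _ _)) ?lerD.
Qed.
Lemma cabs_prod I (r : seq I) (p : pred I) (F : I -> C) :
 cabs (\prod_(i <- r | p i) F i) = \prod_(i <- r | p i) cabs (F i).
Proof. by apply: (big_morph cabs cabsM cabs1). Qed.
Lemma cabs_real (x : R) : cabs (real_complex R x) = `|x|.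
Proof. by rewrite cabsE /cnorm2 /= expr0n addr0 sqrtr_sqr. Qed.
Lemma cabs_nat n : cabs n%:R = n%:R.
Proof. by rewrite -(rmorph_nat (real_complex R)) cabs_real ger0_norm ?ler0n. Qed.
Lemma Re_cabs z : `|Re z| <= cabs z.
Proof.
rewrite cabsE -sqrtr_sqr ler_sqrt ?cnorm2_ge0//.
by rewrite /cnorm2 lerDl sqr_ge0.
Qed.
Lemma Im_cabs z : `|Im z| <= cabs z.
Proof.
rewrite cabsE -sqrtr_sqr ler_sqrt ?cnorm2_ge0//.
by rewrite /cnorm2 lerDr sqr_ge0.
Qed.
Lemma cabs_ReIm z : cabs z <= `|Re z| + `|Im z|.
Proof.
rewrite -(@ler_pXn2r _ 2) ?nnegrE ?addr_ge0//.
rewrite sqr_cabs /cnorm2 sqrrD !real_normK ?num_real//.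
by rewrite -addrA lerD2l lerDr mulrn_wge0// mulr_ge0.
Qed.
Lemma conjcMm z w : conjc (z * w) = conjc z * conjc w. Proof. exact: rmorphM. Qed.
Lemma conjcD z w : conjc (z + w) = conjc z + conjc w. Proof. exact: rmorphD. Qed.
Lemma conjcN z : conjc (- z) = - conjc z. Proof. exact: rmorphN. Qed.
Lemma conjc_sum I (r : seq I) (p : pred I) (F : I -> C) :
 conjc (\sum_(i <- r | p i) F i) = \sum_(i <- r | p i) conjc (F i).
Proof. exact: rmorph_sum. Qed.
Lemma realcD (x y : R) : (x + y)%:C = x%:C + y%:C. Proof. exact: rmorphD. Qed.
Lemma realcM (x y : R) : (x * y)%:C = x%:C * y%:C. Proof. exact: rmorphM. Qed.
Lemma conjcM_cabs z : conjc z * z = real_complex R (cabs z ^+ 2).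
Proof.
rewrite sqr_cabs /cnorm2; case: z => a b /=.
by apply/eqP; rewrite eq_complex /=; apply/andP; split; apply/eqP; ring.
Qed.

Lemma seq_argmin (T : eqType) (f : T -> R) (s : seq T) :
 s != [::] -> exists2 x, x \in s & forall y, y \in s -> f x <= f y.
Proof.
elim: s => // a s IH _; have [->|s0] := eqVneq s [::].
 by exists a; rewrite ?mem_head// => y; rewrite inE => /eqP->.
have [x xs xm] := IH s0; have [ax|xa] := leP (f a) (f x).
 exists a; first exact: mem_head.
 by move=> y; rewrite inE => /predU1P[->//|/xm]; exact: le_trans.
exists x; first by rewrite inE xs orbT.
by move=> y; rewrite inE => /predU1P[->|/xm//]; exact: ltW.
Qed.

Lemma poly_roots P : P != 0 ->
 exists2 zs : seq C, size zs = (size P).-1 &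
  P = lead_coef P *: \prod_(z <- zs) ('X - z%:P).
Proof.
move=> P0; have [zs Pzs] := closed_field_poly_normal P.
exists zs => //; rewrite {1}Pzs size_scale ?lead_coef_eq0//.
by rewrite size_prod_XsubC.
Qed.

Lemma horner_prodXsubC (zs : seq C) (s : C) :
 (\prod_(z <- zs) ('X - z%:P)).[s] = \prod_(z <- zs) (s - z).
Proof. by rewrite horner_prod; apply: eq_bigr => z _; rewrite hornerXsubC. Qed.

Lemma deriv_prodXsubC0 (zs : seq C) : all (fun z => z != 0) zs ->
 (\prod_(z <- zs) ('X - z%:P))^`().[0] =
 (\prod_(z <- zs) ('X - z%:P)).[0] * \sum_(z <- zs) (- z^-1).
Proof.
elim: zs => [|z zs IH] /=.
 by rewrite !big_nil mulr0 -[1%R]/(1%:P) derivC horner0.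
move=> /andP[z0 /IH h]; rewrite !big_cons derivM derivXsubC mul1r hornerD !hornerM.
rewrite h mulrDr hornerXsubC sub0r; congr (_ + _); last by rewrite mulrA.
by rewrite mulrAC mulrNN divff// mul1r.
Qed.

(** [P'(0) / P(0)] is minus the sum of the inverse roots, hence at most [d] over the modulus of the
    smallest root. This is the quantitative step that follows a root when the constant term
    changes. *)
Lemma near_root P (d : nat) : (size P <= d.+1)%N -> P^`().[0] != 0 ->
 exists2 s, root P s & cabs s * cabs P^`().[0] <= d%:R * cabs P.[0].
Proof.
move=> sP P'0; have P0 : P != 0.
 by apply: contraNneq P'0 => ->; rewrite deriv0 horner0.
have [P00|P00] := eqVneq P.[0] 0.
 by exists 0; rewrite ?rootE ?P00// cabs0 mul0r mulr_ge0.
have [zs szs Pzs] := poly_roots P0; set a := lead_coef P in Pzs.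
have rP z : z \in zs -> root P z.
 move=> zzs; rewrite Pzs rootE hornerZ horner_prodXsubC.
 by rewrite (big_rem z)//= subrr mul0r mulr0.
have zs0 : all (fun z => z != 0) zs.
 apply/allP => z /rP; apply: contraTneq => ->; by rewrite rootE.
have zsN : zs != [::].
 apply: contraNneq P'0 => zs_nil; rewrite Pzs zs_nil big_nil.
 by rewrite derivZ -[1%R]/(1%:P) derivC scaler0 horner0.
have [z zzs zm] := seq_argmin cabs zsN.
exists z; first exact: rP.
have z0 : 0 < cabs z by rewrite cabs_gt0 (allP zs0).
have -> : P^`().[0] = P.[0] * \sum_(z <- zs) (- z^-1).
 by rewrite Pzs derivZ !hornerZ deriv_prodXsubC0// mulrA.
rewrite cabsM mulrCA mulrC ler_wpM2r//.
rewrite mulrC -ler_pdivlMr//; apply: le_trans (cabs_sum _ _ _) _.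
apply: (via (\sum_(y <- zs) (cabs z)^-1)).
 rewrite big_seq [leRHS]big_seq; apply: ler_sum => y yzs.
 by rewrite cabsN cabsV lef_pV2 ?posrE ?zm// cabs_gt0 (allP zs0).
rewrite big_const_seq count_predT iter_addr_0 -[leLHS]mulr_natl.
rewrite ler_wpM2r ?invr_ge0// ler_nat szs -ltnS (leq_trans _ sP)//.
by rewrite prednK// lt0n size_poly_eq0.
Qed.

(** Up to the leading coefficient, [|P(c)|] is the product of the distances from [c] to the [d]
    roots, so at least the [d]-th power of the smallest distance. *)
Lemma root_of_lead P (d : nat) c : size P = d.+1 -> (0 < d)%N ->
 exists2 s, root P s & cabs (lead_coef P) * cabs (c - s) ^+ d <= cabs P.[c].
Proof.
move=> sP d0; have P0 : P != 0 by rewrite -size_poly_eq0 sP.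
have [zs szs Pzs] := poly_roots P0; rewrite sP /= in szs.
have zsN : zs != [::] by rewrite -size_eq0 szs -lt0n.
have [z zzs zm] := seq_argmin (fun s => cabs (c - s)) zsN.
exists z.
 by rewrite Pzs rootE hornerZ horner_prodXsubC (big_rem z)//= subrr mul0r mulr0.
rewrite [in leRHS]Pzs hornerZ horner_prodXsubC cabsM ler_wpM2l// cabs_prod.
rewrite -szs -[size zs]count_predT -iter_mulr_1 -big_const_seq.
rewrite big_seq [leRHS]big_seq; apply: ler_prod => y yzs.
by rewrite cabs_ge0 zm.
Qed.

Lemma size_XsubC_mul P (z : C) : P != 0 ->
 size (('X - z%:P) * P) = (size P).+1.
Proof. by move=> P0; rewrite size_monicM ?monicXsubC// size_XsubC. Qed.

Lemma coef_mulXsubC P (z : C) i :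
 (('X - z%:P) * P)`_i.+1 = P`_i - z * P`_i.+1.
Proof. by rewrite mulrBl coefB coefXM coefCM. Qed.

(** Synthetic division from the top: [P_i] is the coefficient of degree [i + 1] of [(X - z) P] plus
    [z P_(i+1)], and likewise for [Q] and [w]. The error is 0 from degree [D] on, and each step down
    applies the affine map that is iterated in the bound. *)
Lemma quotient_close (P Q : {poly C}) (z w : C) (D : nat) (B e d : R) :
 (size P <= D)%N -> (size Q <= D)%N -> 0 <= e -> 0 <= d ->
 cabs w <= B -> (forall i, cabs P`_i <= B) -> cabs (w - z) <= e ->
 (forall i, cabs ((('X - w%:P) * Q)`_i - (('X - z%:P) * P)`_i) <= d) ->
 forall j i, (D <= i + j)%N ->
  cabs (Q`_i - P`_i) <= iter j (fun c => (1 + B) + B * c) 0 * (d + e).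
Proof.
move=> sP sQ e0 d0 wB PB wz QP; have B0 : 0 <= B := le_trans (cabs_ge0 w) wB.
elim=> [|j IH] i.
 rewrite addn0 => Di; rewrite !nth_default ?(leq_trans _ Di)//.
 by rewrite subrr cabs0 /= mul0r.
rewrite addnS -addSn => Di; have := IH _ Di; set c := iter j _ _ => ihc /=.
have -> : Q`_i - P`_i = ((('X - w%:P) * Q)`_i.+1 - (('X - z%:P) * P)`_i.+1)
  + w * (Q`_i.+1 - P`_i.+1) + (w - z) * P`_i.+1.
 by rewrite !coef_mulXsubC; ring.
apply: le_trans (cabs_le _ _) _; rewrite cabsM.
have h1 : cabs (w - z) * cabs P`_i.+1 <= e * B by rewrite ler_pM.
apply: le_trans (lerD (cabs_le _ _) h1) _; rewrite cabsM.
have h2 : cabs w * cabs (Q`_i.+1 - P`_i.+1) <= B * (c * (d + e)).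
 by rewrite ler_pM.
have h3 := QP i.+1.
have h4 : 0 <= B * d by rewrite mulr_ge0.
have h5 : 0 <= B * e by rewrite mulr_ge0.
rewrite -/c; nra.
Qed.

(** Induction by deflation: [Q] is small at the first root [z], so it has a root [w] near [z], and
    the quotients by [X - z] and [X - w] have close coefficients. The roots come out matched index
    by index, multiple roots included. *)
Lemma roots_cont (zs : seq C) (e : R) : 0 < e -> exists2 d : R, 0 < d &
 forall Q, Q \is monic -> size Q = (size zs).+1 ->
  (forall i, cabs (Q`_i - (\prod_(z <- zs) ('X - z%:P))`_i) <= d) ->
 exists ws, [/\ size ws = size zs, Q = \prod_(w <- ws) ('X - w%:P) &
  forall i, cabs (nth 0 zs i - nth 0 ws i) < e].
Proof.
elim: zs e => [|z zs IH] e e0.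
 exists 1 => // Q Qm sQ _; exists [::]; split => //.
  move: sQ => /eqP/size_poly1P[c c0 Qc].
  by move: Qm; rewrite Qc monicE lead_coefC => /eqP ->; rewrite big_nil.
 by move=> i; rewrite !nth_nil subrr cabs0.
have [d1 d10 Hd1] := IH e e0.
set P1 := \prod_(z <- zs) ('X - z%:P); pose D := (size zs).+1.
have sP1 : size P1 = D by rewrite size_prod_XsubC.
pose B := 2 + cabs z + \sum_(i < D) cabs P1`_i.
have S0 : 0 <= \sum_(i < D) cabs P1`_i by apply: sumr_ge0.
have B0 : 0 <= B by rewrite /B !addr_ge0.
have P1B i : cabs P1`_i <= B.
 have [iD|Di] := ltnP i D; last by rewrite nth_default ?cabs0// sP1.
 apply: (via (\sum_(i < D) cabs P1`_i)); last by rewrite lerDr addr_ge0.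
 by rewrite (bigD1 (Ordinal iD))//= lerDl sumr_ge0.
pose c := iter D (fun c => (1 + B) + B * c) 0.
have c0 : 0 <= c.
 by rewrite /c; elim: (D) => //= k IHk; rewrite !addr_ge0// mulr_ge0.
(* [eta] will bound [|w - z|]: [e / 2] serves this root, and [d1 / (2 (c + 1))] brings the error
   [c (d + eta)] of the quotient below [d1]. *)
pose eta := Num.min 1 (Num.min (e / 2) (d1 / (2 * (c + 1)))).
have eta0 : 0 < eta.
 by rewrite !lt_min ltr01/= divr_gt0//= divr_gt0// mulr_gt0// ltr_wpDl.
pose S := \sum_(i < D.+1) cabs z ^+ i.
have S0' : 0 <= S by apply: sumr_ge0 => i _; rewrite exprn_ge0.
(* [S] sums the powers of [|z|], so coefficients within [d] give [|Q(z)| <= eta ^ D], hence a root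
   within [eta]. *)
pose d := Num.min eta (eta ^+ D / (1 + S)).
have d0 : 0 < d by rewrite lt_min eta0 divr_gt0 ?exprn_gt0// ltr_pwDl.
exists d => // Q Qm sQ QP; rewrite big_cons -/P1 in QP.
have Qz : cabs Q.[z] <= eta ^+ D.
 have -> : Q.[z] = (Q - ('X - z%:P) * P1).[z].
  by rewrite hornerD hornerN hornerM hornerXsubC subrr mul0r subr0.
 rewrite (@horner_coef_wide _ D.+1); last first.
  rewrite (leq_trans (size_polyD _ _))// size_polyN geq_max sQ leqnn/=.
  by rewrite size_XsubC_mul ?sP1// -size_poly_eq0 sP1.
 apply: le_trans (cabs_sum _ _ _) _.
 apply: (via (\sum_(i < D.+1) d * cabs z ^+ i)).
  by apply: ler_sum => i _; rewrite cabsM cabsX ler_wpM2r ?exprn_ge0// coefB.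
 rewrite -mulr_sumr -/S.
 apply: (via (eta ^+ D / (1 + S) * S)).
  by rewrite ler_wpM2r// ge_min lexx orbT.
 rewrite -mulrA -[leRHS]mulr1 ler_wpM2l ?exprn_ge0 ?(ltW eta0)//.
 by rewrite mulrC ler_pdivrMr ?ltr_pwDl// mul1r lerDr.
have [w rw wz] := @root_of_lead Q D z sQ isT.
have {}wz : cabs (w - z) <= eta.
 rewrite cabsB; move: wz; rewrite (monicP Qm) cabs1 mul1r => wz.
 by rewrite -(@ler_pXn2r _ D) ?nnegrE ?(ltW eta0)// (le_trans wz).
move/factor_theorem: rw => [Q1 QQ1]; rewrite mulrC in QQ1.
have Q10 : Q1 != 0 by apply: contraTneq Qm => Q10; rewrite QQ1 Q10 mulr0 monicE lead_coef0 eq_sym oner_eq0.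
have Q1m : Q1 \is monic by move: Qm; rewrite QQ1 monicMl ?monicXsubC.
have sQ1 : size Q1 = (size zs).+1.
 by apply: succn_inj; rewrite -sQ QQ1 size_XsubC_mul.
have [e1 e2 e3] : [/\ eta <= 1, eta <= e / 2 & eta <= d1 / (2 * (c + 1))].
 by split; rewrite /eta !ge_min ?lexx ?orbT.
have wB : cabs w <= B.
 have := cabs_le (w - z) z; rewrite subrK /B => h.
 by move: wz e1 S0 h; lra.
have clo := @quotient_close P1 Q1 z w D B eta d (eq_leq sP1) (eq_leq sQ1) (ltW eta0) (ltW d0) wB P1B wz.
rewrite -QQ1 in clo; have {}clo := clo QP D.
have [ws [sws Qws wsz]] : exists ws, [/\ size ws = size zs, Q1 = \prod_(w <- ws) ('X - w%:P) &
  forall i, cabs (nth 0 zs i - nth 0 ws i) < e].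
 apply: Hd1 => // i; apply: le_trans (clo i (leq_addl _ _)) _; rewrite -/c.
 have : d <= eta by rewrite ge_min lexx.
 move: e3; rewrite ler_pdivlMr; last by rewrite mulr_gt0// ltr_wpDl.
 move: c0 eta0; nra.
exists (w :: ws); split; first by rewrite /= sws.
 by rewrite big_cons -Qws.
case=> [|i] /=; last exact: wsz.
by rewrite cabsB (le_lt_trans wz)// (le_lt_trans e2)// ltr_pdivrMr// ltr_pMr// ltr1n.
Qed.

End ComplexModulus.
Hint Extern 0 (is_true (_ <= cabs _)) => solve [exact: cabs_ge0] : core.

(** * Sublevel sets of polynomials on finite grids *)

Lemma card_near_nat (M : nat) (a r : R) : 0 <= r ->
 (#|[set i : 'I_M | `|i%:R - a| <= r]%SET|%:R <= 2 * r + 1 :> R).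
Proof.
move=> r0; set A := [set i | _]%SET.
have [->|[i0 i0A]] := set_0Vmem A; first by rewrite cards0 addr_ge0// mulr_ge0.
have [i iA imin] := @arg_minnP _ i0 (mem A) (fun i => nat_of_ord i) i0A.
have iAP j : j \in A -> (j - i < (Num.truncn (2 * r)).+1)%N.
 move=> jA; rewrite ltnS truncn_ge_nat ?mulr_ge0//.
 rewrite natrB ?imin//; move: (jA) (iA); rewrite !inE !ler_norml.
 move=> /andP[_ h1] /andP[h2 _]; lra.
pose f (j : 'I_M) : 'I_(Num.truncn (2 * r)).+1 := inord (j - i).
have finj : {in A &, injective f}.
 move=> j k jA kA /(congr1 (@nat_of_ord _)); rewrite !inordK ?iAP// => h.
 by apply: val_inj; rewrite /= -(subnK (imin _ jA)) -(subnK (imin _ kA)) h.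
have : (#|A| <= (Num.truncn (2 * r)).+1)%N.
 by rewrite -(card_in_imset finj) (leq_trans (max_card _))// card_ord.
rewrite -(ler_nat R) => /le_trans; apply.
by rewrite -natr1 lerD2r truncn_le// mulr_ge0.
Qed.

(** Counting on the grid of step [2 / M] in [[-1, 1)] replaces Lebesgue measure on a cube: Fubini
    becomes an exchange of finite sums, and the error terms vanish as [M] grows. *)
Definition gpt (M : nat) (i : nat) : R := 2 * i%:R / M%:R - 1.

Lemma gpt_itv M i : (i < M)%N -> -1 <= gpt M i <= 1.
Proof.
move=> iM; have M0 : 0 < M%:R :> R by rewrite ltr0n (leq_trans _ iM).
rewrite /gpt lerBrDr addNr divr_ge0 ?mulr_ge0//= lerBlDr ler_pdivrMr//.
by rewrite ler_pM2l// ler_nat ltnW.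
Qed.

Lemma card_gpt_near (M : nat) (a r : R) : (0 < M)%N -> 0 <= r ->
 (#|[set i : 'I_M | `|gpt M i - a| <= r]%SET|%:R <= r * M%:R + 1 :> R).
Proof.
move=> M0 r0; have M0' : 0 < M%:R :> R by rewrite ltr0n.
have h0 : 0 <= r * M%:R / 2 by rewrite divr_ge0 ?mulr_ge0.
have := @card_near_nat M ((a + 1) * M%:R / 2) (r * M%:R / 2) h0.
rewrite (_ : 2 * (r * M%:R / 2) = r * M%:R); last by field.
apply: le_trans.
rewrite ler_nat; apply: subset_leq_card; apply/fintype.subsetP => i.
rewrite !inE => h.
have -> : i%:R - (a + 1) * M%:R / 2 = (gpt M i - a) * (M%:R / 2).
 by rewrite /gpt; field; rewrite lt0r_neq0.
by rewrite normrM (ger0_norm (_ : 0 <= M%:R / 2)) ?divr_ge0// mulrA ler_wpM2r ?ler_wpM2r.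
Qed.

Lemma prod_lt_exists (T : eqType) (s : seq T) (f : T -> R) (b : R) :
 0 <= b -> (forall x, x \in s -> 0 <= f x) ->
 \prod_(x <- s) f x < b ^+ size s -> exists2 x, x \in s & f x < b.
Proof.
move=> b0 f0 h; apply: contrapT => hn; move: h; apply/negP; rewrite -leNgt.
rewrite -[size s]count_predT -iter_mulr_1 -big_const_seq.
rewrite [leLHS]big_seq [leRHS]big_seq; apply: ler_prod => x xs.
by rewrite b0 /= leNgt; apply/negP => fb; apply: hn; exists x.
Qed.

(** If [|P(x)| < e] and [|P(x0)| >= c], the product over the roots [z] of [|x - z| / |x0 - z|] is
    below [e / c = t^D], so some factor is below [t]. As [|x0 - z| <= 2 + |x - z|], that root
    satisfies [|x - z| <= 2 t / (1 - t)]. *)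
Lemma sublevel1 (P : {poly C}) (D M : nat) (x0 e c : R) :
 (size P <= D.+1)%N -> (0 < D)%N -> (0 < M)%N -> -1 <= x0 <= 1 ->
 0 < e -> e <= c -> c <= cabs P.[x0%:C] ->
 (#|[set i : 'I_M | (cabs P.[(gpt M i)%:C] < e)%R]%SET|%:R <=
  D%:R * (3 * (e / c) `^ D%:R^-1 * M%:R + 1) :> R).
Proof.
move=> sP D0 M0 x01 e0 ec cP; have c0 : 0 < c := lt_le_trans e0 ec.
have P0 : P != 0 by apply: contraTneq cP => ->; rewrite horner0 cabs0 -ltNge.
have [zs szs Pzs] := poly_roots P0.
set t := (e / c) `^ D%:R^-1.
have t0 : 0 < t by rewrite powR_gt0// divr_gt0.
have t1 : t <= 1.
 have -> : 1 = 1 `^ D%:R^-1 :> R by rewrite powR1.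
 rewrite ge0_ler_powR ?invr_ge0 ?nnegrE ?divr_ge0 ?(ltW e0) ?(ltW c0)//.
 by rewrite ler_pdivrMr// mul1r.
have tD : t ^+ D = e / c.
 by rewrite -powR_mulrn ?(ltW t0)// -powRrM mulVf ?pnatr_eq0 -?lt0n// powRr1// divr_ge0 ?ltW.
have D1 : 1 <= D%:R :> R by rewrite ler1n.
(* For [t >= 1/3] the claim exceeds the trivial bound [M]; for [t < 1/3], [2 t / (1 - t)] is at most
   [3 t]. *)
have [t3|t3] := leP 3^-1 t.
 apply: (via M%:R).
  by rewrite ler_nat; apply: leq_trans (max_card _) _; rewrite card_ord.
 have h1 : 3^-1 * M%:R <= t * M%:R by rewrite ler_wpM2r.
 apply: (via (3 * t * M%:R + 1)); first by rewrite -mulrA; lra.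
 rewrite -[leLHS]mul1r ler_wpM2r// addr_ge0// mulr_ge0// mulr_ge0//.
 exact: ltW.
have szD : (size zs <= D)%N by rewrite szs -ltnS (leq_trans _ sP)// prednK// lt0n size_poly_eq0.
have key (x : R) : -1 <= x <= 1 -> cabs P.[x%:C] < e ->
  exists2 z, z \in zs & `|x - Re z| <= 3 * t.
 move=> x1 Px.
 pose f z := cabs (x%:C - z) / cabs (x0%:C - z).
 have lP0 : 0 < cabs (lead_coef P) by rewrite cabs_gt0 lead_coef_eq0.
 have Px0 : 0 < \prod_(z <- zs) cabs (x0%:C - z).
  rewrite -cabs_prod -horner_prodXsubC.
  move: (lt_le_trans c0 cP); rewrite {1}Pzs hornerZ cabsM.
  by rewrite pmulr_rgt0.
 have x0z z : z \in zs -> 0 < cabs (x0%:C - z).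
  move=> zzs; rewrite lt_def cabs_ge0 andbT; apply: contraTneq Px0 => h.
  by rewrite (big_rem z)//= h mul0r ltxx.
 have : \prod_(z <- zs) f z < t ^+ size zs.
  apply: (@lt_le_trans _ _ (t ^+ D)); last by rewrite ler_wiXn2l ?(ltW t0).
  have PE y : cabs P.[y] = cabs (lead_coef P) * \prod_(z <- zs) cabs (y - z).
   by rewrite {1}Pzs hornerZ cabsM horner_prodXsubC cabs_prod.
  rewrite /f big_split/= tD prodfV.
  rewrite ltr_pdivrMr// mulrAC ltr_pdivlMr//.
  rewrite -(ltr_pM2l lP0) mulrA -PE [ltRHS]mulrCA -PE.
  by apply: (@lt_le_trans _ _ (e * c)); rewrite ?ltr_pM2r ?ler_pM2l.
 have f0 z : z \in zs -> 0 <= f z.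
  by move=> _; exact: (divr_ge0 (cabs_ge0 _) (cabs_ge0 _)).
 move=> h; have [z zzs fz] := prod_lt_exists (ltW t0) f0 h.
 exists z => //; have := Re_cabs (x%:C - z); rewrite raddfB /= => /le_trans; apply.
 move: fz; rewrite /f ltr_pdivrMr ?x0z// => fz.
 have : cabs (x0%:C - z) <= 2 + cabs (x%:C - z).
  apply: le_trans (cabs_triB x%:C _ _) _; rewrite lerD2r -rmorphB cabs_real.
  by move: x1 x01; rewrite ler_norml => /andP[? ?] /andP[? ?]; apply/andP; split; lra.
 have h0 := cabs_ge0 (x%:C - z).
 set A := cabs _ in fz h0 *; set B := cabs _ in fz *.
 move=> h1; clear -h0 fz h1 t0 t3.
 have h2 : t * B <= t * (2 + A) by rewrite ler_pM2l.
 have h3 : t * A <= 3^-1 * A by rewrite ler_wpM2r// ltW.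
 by move: h2; rewrite mulrDr; lra.
apply: (via (\sum_(z <- zs) (#|[set i : 'I_M | `|gpt M i - Re z| <= 3 * t]%SET|%:R : R))).
 rewrite -natr_sum ler_nat.
 apply: (@leq_trans #|(\bigcup_(z <- zs) [set i : 'I_M | `|gpt M i - Re z| <= 3 * t])%SET|).
  apply: subset_leq_card; apply/fintype.subsetP => i; rewrite inE.
  move=> /(key _ (gpt_itv (ltn_ord i)))[z zzs hz].
  by rewrite (big_rem z)//= inE inE hz.
 elim: (zs) => [|z s IH]; first by rewrite !big_nil cards0.
 rewrite !big_cons (leq_trans (leq_card_setU _ _))// leq_add2l.
 exact: IH.
apply: (via (\sum_(z <- zs) (3 * t * M%:R + 1))).
 by apply: ler_sum => z _; apply: card_gpt_near => //; rewrite mulr_ge0 ?(ltW t0).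
rewrite big_const_seq count_predT iter_addr_0 -[leLHS]mulr_natl ler_wpM2r ?ler_nat//.
by rewrite addr_ge0 ?mulr_ge0// ltW.
Qed.

(** Coordinates are consumed one at a time from a predicate on lists, so that an induction on the
    dimension can freeze the first coordinate. *)
Fixpoint gcnt (M k : nat) (g : seq R -> bool) : nat :=
 if k is k'.+1 then \sum_(i < M) gcnt M k' (fun s => g (gpt M i :: s))
 else g [::].

Lemma gcnt_max M k g : (gcnt M k g <= M ^ k)%N.
Proof.
elim: k g => [|k IH] g /=; first by case: (g _).
rewrite (leq_trans (leq_sum _ (fun i _ => IH _)))//.
by rewrite sum_nat_const card_ord expnS.
Qed.

Lemma gcnt_mono M k (g h : seq R -> bool) :
 (forall s, size s = k -> all (fun x => -1 <= x <= 1) s -> g s -> h s) ->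
 (gcnt M k g <= gcnt M k h)%N.
Proof.
elim: k g h => [|k IH] g h gh /=.
 by have := gh [::] erefl erefl; case: (g _) => // ->.
apply: leq_sum => i _; apply: IH => s ss sa; apply: gh; rewrite /= ?ss//.
by rewrite gpt_itv// sa.
Qed.

Fixpoint sepoly (D k : nat) (g : seq R -> C) : Prop :=
 if k is k'.+1 then
  (forall s, size s = k' -> exists2 P : {poly C}, (size P <= D.+1)%N &
    forall x, g (x :: s) = P.[x%:C]) /\
  (forall x, sepoly D k' (fun s => g (x :: s)))
 else True.

(** Induction on the dimension with the intermediate level [e1 = sqrt (e c)]. First coordinates at
    which the polynomial is below [e1] at the remaining coordinates of the good point are few, by
    the case of one variable; for the others the induction hypothesis applies between the levels [e]
    and [e1]. Both ratios equal [(e / c)^(1/2)], so the exponent is halved for each variable. The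
    term in [1 / M] is the error of the grid. *)
Lemma sublevel (D k : nat) : (0 < D)%N -> exists2 A : R, 0 < A &
 forall (g : seq R -> C) (e c : R) (M : nat), sepoly D k g ->
  0 < e -> e <= c -> (0 < M)%N ->
  (exists s, [/\ size s = k, all (fun x => -1 <= x <= 1) s & c <= cabs (g s)]) ->
  (gcnt M k (fun s => (cabs (g s) < e)%R))%:R <=
   M%:R ^+ k * (A * (e / c) `^ (D * 2 ^ k)%:R^-1 + A / M%:R).
Proof.
move=> D0; elim: k => [|k [A A0 IH]].
 exists 1 => // g e c M _ e0 ec M0 [s [/size0nil -> _ cg]] /=.
 rewrite ltNge (le_trans ec)//= expr0 mul1r mul1r.
 by rewrite addr_ge0 ?powR_ge0// divr_ge0.
exists (A + 3 * D%:R); first by rewrite ltr_wpDr// mulr_ge0.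
move=> g e c M [gP gr] e0 ec M0 [[|x0 s] [ss sa cg]]; first by [].
move: ss sa => /= [ss] /andP[x01 s1].
have c0 : 0 < c := lt_le_trans e0 ec.
have M0' : 0 < M%:R :> R by rewrite ltr0n.
have [P sP gPs] := gP s ss.
pose e1 := Num.sqrt (e * c).
have e1sq : e1 ^+ 2 = e * c by rewrite sqr_sqrtr// mulr_ge0// ltW.
have e10 : 0 < e1 by rewrite sqrtr_gt0 mulr_gt0.
have ee1 : e <= e1.
 by rewrite -ler_sqr ?nnegrE ?(ltW e0) ?(ltW e10)// e1sq expr2 ler_pM2l.
have e1c : e1 <= c.
 by rewrite -ler_sqr ?nnegrE ?(ltW c0) ?(ltW e10)// e1sq expr2 ler_pM2r.
pose u := e / c.
have u0 : 0 < u by rewrite divr_gt0.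
have u1 : u <= 1 by rewrite ler_pdivrMr// mul1r.
have e1cE : e1 / c = u `^ 2^-1.
 rewrite powR12_sqrt ?(ltW u0)//.
 have -> : u = (e1 / c) ^+ 2 by rewrite exprMn e1sq /u; field; rewrite gt_eqF.
 by rewrite sqrtr_sqr ger0_norm// divr_ge0 ?ltW.
have ee1E : e / e1 = u `^ 2^-1.
 rewrite -e1cE {1}(_ : e = e1 * e1 / c); first by field; rewrite !gt_eqF.
 by rewrite -expr2 e1sq mulfK ?gt_eqF.
set a := (D * 2 ^ k.+1)%:R^-1.
have aE : (D * 2 ^ k)%:R^-1 / 2 = a :> R.
 by rewrite /a expnS mulnCA [in RHS]natrM invfM mulrC.
have a1 : a <= 2^-1 / D%:R.
 rewrite -invfM lef_pV2 ?posrE ?ltr0n ?muln_gt0 ?D0 ?expn_gt0// ?mulr_gt0 ?ltr0n//.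
 by rewrite -natrM ler_nat mulnC leq_mul2l expnS leq_pmulr ?orbT// expn_gt0.
pose bad := [set i : 'I_M | (cabs P.[(gpt M i)%:C] < e1)%R]%SET.
have bad_le : #|bad|%:R <= D%:R * (3 * u `^ a * M%:R + 1).
 have cP : c <= cabs P.[x0%:C] by rewrite -gPs.
 apply: le_trans (sublevel1 sP D0 M0 x01 e10 e1c cP) _.
 rewrite ler_wpM2l// lerD2r ler_wpM2r// ler_wpM2l// e1cE -powRrM.
 by apply: ger_powR; rewrite ?u0.
have goodle i : i \notin bad -> (gcnt M k (fun s => (cabs (g (gpt M i :: s)) < e)%R))%:R <=
  M%:R ^+ k * (A * u `^ a + A / M%:R).
 rewrite inE -leNgt => iP.
 have := IH (fun s => g (gpt M i :: s)) e e1 M (gr _) e0 ee1 M0.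
 rewrite ee1E -powRrM [2^-1 * _]mulrC aE; apply; exists s; split => //.
 by rewrite gPs.
rewrite /= natr_sum (bigID (mem bad))/=.
have h1 : \sum_(i < M | i \in bad) (gcnt M k (fun s => (cabs (g (gpt M i :: s)) < e)%R))%:R
  <= #|bad|%:R * M%:R ^+ k :> R.
 rewrite -natr_sum -natrX -natrM ler_nat -sum_nat_const; apply: leq_sum => i _.
 exact: gcnt_max.
have h2 : \sum_(i < M | i \notin bad) (gcnt M k (fun s => (cabs (g (gpt M i :: s)) < e)%R))%:R
  <= M%:R * (M%:R ^+ k * (A * u `^ a + A / M%:R)).
 apply: le_trans (ler_sum _ goodle) _.
 rewrite sumr_const -[leLHS]mulr_natl ler_wpM2r//.
  by rewrite mulr_ge0 ?exprn_ge0// addr_ge0 ?divr_ge0 ?mulr_ge0 ?powR_ge0 ?(ltW A0).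
 rewrite ler_nat; apply: leq_trans (max_card _) _; by rewrite card_ord.
apply: le_trans (lerD h1 h2) _.
apply: (via (D%:R * (3 * u `^ a * M%:R + 1) * M%:R ^+ k + M%:R * (M%:R ^+ k * (A * u `^ a + A / M%:R)))).
 by rewrite lerD2r ler_wpM2r ?exprn_ge0.
rewrite -/u exprS.
have -> : M%:R * M%:R ^+ k * ((A + 3 * D%:R) * u `^ a + (A + 3 * D%:R) / M%:R) =
  D%:R * (3 * u `^ a * M%:R + 3) * M%:R ^+ k + M%:R * (M%:R ^+ k * (A * u `^ a + A / M%:R)).
 by field; rewrite gt_eqF.
rewrite lerD2r ler_wpM2r ?exprn_ge0// ler_wpM2l// lerD2l; lra.
Qed.

(** * Hermitian vectors; projections of rank one and two *)

Section Vectors.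
Context {N : nat}.
Notation vec := ('I_N -> C).
Implicit Types (x y z : vec) (a b c : C).

Definition dotc x y : C := \sum_i conjc (x i) * y i.
Definition nr2 x : R := \sum_i cnorm2 R (x i).
Definition vnorm x : R := Num.sqrt (nr2 x).
Definition lin2 a x b y : vec := fun i => a * x i + b * y i.
Definition outer x : 'M[C]_N := \matrix_(i, j) (x i * conjc (x j)).
Definition mv (M : 'M[C]_N) x : vec := fun i => \sum_j M i j * x j.

Lemma nr2_ge0 x : 0 <= nr2 x.
Proof. by apply: sumr_ge0 => i _; exact: cnorm2_ge0. Qed.
Lemma vnorm_ge0 x : 0 <= vnorm x. Proof. exact: sqrtr_ge0. Qed.
Lemma sqr_vnorm x : vnorm x ^+ 2 = nr2 x.
Proof. by rewrite sqr_sqrtr ?nr2_ge0. Qed.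
Lemma dotcxx x : dotc x x = (nr2 x)%:C.
Proof.
rewrite /dotc /nr2 rmorph_sum; apply: eq_bigr => i _.
by rewrite conjcM_cabs sqr_cabs.
Qed.
Lemma dotcC x y : dotc y x = conjc (dotc x y).
Proof.
by rewrite /dotc conjc_sum; apply: eq_bigr => i _; rewrite conjcMm conjcK mulrC.
Qed.
Lemma dotc_linr z a x b y : dotc z (lin2 a x b y) = a * dotc z x + b * dotc z y.
Proof.
rewrite /dotc !mulr_sumr -big_split; apply: eq_bigr => i _ /=.
by rewrite /lin2 mulrDr !(mulrCA (conjc _)).
Qed.
Lemma dotc_linl z a x b y :
 dotc (lin2 a x b y) z = conjc a * dotc x z + conjc b * dotc y z.
Proof. by rewrite dotcC dotc_linr conjcD !conjcMm -!dotcC. Qed.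

Lemma nr2_eq0 x : (nr2 x == 0) = [forall i, x i == 0].
Proof.
rewrite /nr2 psumr_eq0; last by move=> i _; exact: cnorm2_ge0.
apply/allP/forallP => [h i|h i _]; last first.
 by rewrite (eqP (h i)) /cnorm2 /= expr0n addr0.
by have := h i (mem_index_enum _); rewrite -sqr_cabs sqrf_eq0 cabs_eq0.
Qed.
Lemma nr2_gt0 x : (0 < nr2 x) = [exists i, x i != 0].
Proof.
by rewrite lt_def nr2_ge0 andbT nr2_eq0 negb_forall.
Qed.
Lemma cabs_le_vnorm x i : cabs (x i) <= vnorm x.
Proof.
rewrite -ler_sqr ?nnegrE ?vnorm_ge0// sqr_vnorm sqr_cabs /nr2 (bigD1 i)//=.
by rewrite lerDl sumr_ge0// => j _; exact: cnorm2_ge0.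
Qed.
Lemma nr2_scale a x : nr2 (fun i => a * x i) = cabs a ^+ 2 * nr2 x.
Proof.
rewrite /nr2 mulr_sumr; apply: eq_bigr => i _.
by rewrite -!sqr_cabs cabsM exprMn.
Qed.
Lemma vnorm_scale a x : vnorm (fun i => a * x i) = cabs a * vnorm x.
Proof. by rewrite /vnorm nr2_scale sqrtrM ?sqr_ge0// sqrtr_sqr ger0_norm ?cabs_ge0. Qed.

Lemma nr2_lin2 a x b y : nr2 (lin2 a x b y) =
 cabs a ^+ 2 * nr2 x + cabs b ^+ 2 * nr2 y
  + 2 * Re (conjc a * b * dotc x y).
Proof.
apply: (@complexI R); rewrite -dotcxx dotc_linr !dotc_linl !dotcxx.
rewrite (dotcC x y) !mulrDr !realcD !realcM.
have hr (w : C) : 2%:C * (Re w)%:C = w + conjc w.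
 case: w => u v; apply/eqP; rewrite eq_complex /= !mul0r subr0 addr0 subrr.
 by apply/andP; split; apply/eqP; ring.
have ha w : (cabs w)%:C * (cabs w)%:C = conjc w * w.
 by rewrite conjcM_cabs expr2 realcM.
by rewrite hr !ha !conjcMm conjcK; ring.
Qed.

Lemma cauchy_schwarz x y : cabs (dotc x y) ^+ 2 <= nr2 x * nr2 y.
Proof.
have [x0|x0] := eqVneq (nr2 x) 0.
 have xz : forall i, x i = 0 by move=> i; move/eqP: x0; rewrite nr2_eq0 => /forallP/(_ i)/eqP.
 rewrite x0 mul0r /dotc big1 ?cabs0 ?expr0n// => i _.
 by rewrite xz conjc0 mul0r.
have xp : 0 < nr2 x by rewrite lt_def x0 nr2_ge0.
have := nr2_ge0 (lin2 (- dotc x y) x (nr2 x)%:C y).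
rewrite nr2_lin2 cabsN cabs_real (ger0_norm (ltW xp)).
have -> : conjc (- dotc x y) * (nr2 x)%:C * dotc x y =
  (- (nr2 x * cabs (dotc x y) ^+ 2))%:C.
 by rewrite rmorphN mulNr mulNr mulrAC conjcM_cabs -rmorphM -rmorphN mulrC.
rewrite /= => h; rewrite -(ler_pM2l xp); move: h; lra.
Qed.

Lemma mv_outer x y : mv (outer x) y =1 fun i => dotc x y * x i.
Proof.
move=> i; rewrite /mv /dotc mulr_suml; apply: eq_bigr => j _.
by rewrite mxE -mulrA mulrC.
Qed.
Lemma mv_add (A B : 'M[C]_N) x i : mv (A + B) x i = mv A x i + mv B x i.
Proof. by rewrite /mv -big_split; apply: eq_bigr => j _; rewrite mxE mulrDl. Qed.
Lemma mv_lin2 (A : 'M[C]_N) a x b y i :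
 mv A (lin2 a x b y) i = a * mv A x i + b * mv A y i.
Proof.
rewrite /mv !mulr_sumr -big_split; apply: eq_bigr => j _ /=.
by rewrite /lin2 mulrDr !(mulrCA (A i j)).
Qed.
Lemma mv_mul (A B : 'M[C]_N) x : mv (A *m B) x =1 mv A (mv B x).
Proof.
move=> i; rewrite /mv; under eq_bigr do rewrite mxE mulr_suml.
rewrite exchange_big /=; apply: eq_bigr => j _; rewrite mulr_sumr.
by apply: eq_bigr => k _; rewrite mulrA.
Qed.

Lemma outer_adj x : adjmx (outer x) = outer x.
Proof.
by apply/matrixP => i j; rewrite !mxE conjcMm conjcK mulrC.
Qed.
Lemma outer_mul x y : outer x *m outer y = dotc x y *: (\matrix_(i, j) (x i * conjc (y j))).
Proof.
apply/matrixP => i j; rewrite !mxE /dotc mulr_suml; apply: eq_bigr => k _.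
rewrite !mxE; ring.
Qed.
Lemma tr_outer x : \tr (outer x) = (nr2 x)%:C.
Proof. by rewrite -dotcxx; apply: eq_bigr => i _; rewrite mxE mulrC. Qed.
Lemma tr_outer_mul x y : \tr (outer x *m outer y) = (cabs (dotc x y) ^+ 2)%:C.
Proof.
rewrite outer_mul linearZ /= -conjcM_cabs mulrC; congr (_ * _).
by rewrite -dotcC; apply: eq_bigr => i _; rewrite mxE mulrC.
Qed.
Lemma outer_scale a x : outer (fun i => a * x i) = (cabs a ^+ 2)%:C *: outer x.
Proof. by apply/matrixP => i j; rewrite !mxE conjcMm -conjcM_cabs; ring. Qed.

Lemma tr_adj_mul (Q : 'M[C]_N) :
 \tr (adjmx Q *m Q) = (\sum_i \sum_j cnorm2 R (Q j i))%:C.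
Proof.
rewrite rmorph_sum; apply: eq_bigr => i _; rewrite mxE rmorph_sum.
by apply: eq_bigr => j _; rewrite !mxE conjcM_cabs sqr_cabs.
Qed.

(** The sum of the [|Q_ij|^2] is the trace of [adjmx Q *m Q = Q], which is 0. *)
Lemma proj_tr0 (Q : 'M[C]_N) : is_proj R 0 Q -> Q = 0.
Proof.
move=> /and3P[/eqP Qa /eqP QQ /eqP trQ].
have := tr_adj_mul Q; rewrite Qa QQ trQ => /(congr1 (@Re R)) /= /esym/eqP.
rewrite psumr_eq0; last by move=> i _; apply: sumr_ge0 => j _; exact: cnorm2_ge0.
move=> /allP h; apply/matrixP => i j; have := h j (mem_index_enum _).
rewrite psumr_eq0; last by move=> k _; exact: cnorm2_ge0.
move=> /allP /(_ i (mem_index_enum _)).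
by rewrite -sqr_cabs sqrf_eq0 cabs_eq0 mxE => /eqP.
Qed.

Lemma adjmx_add (A B : 'M[C]_N) : adjmx (A + B) = adjmx A + adjmx B.
Proof. by apply/matrixP => i j; rewrite !mxE conjcD. Qed.
Lemma adjmx_sub (A B : 'M[C]_N) : adjmx (A - B) = adjmx A - adjmx B.
Proof. by apply/matrixP => i j; rewrite !mxE rmorphB. Qed.
Lemma adjmx_mul (A B : 'M[C]_N) : adjmx (A *m B) = adjmx B *m adjmx A.
Proof.
apply/matrixP => i j; rewrite !mxE conjc_sum; apply: eq_bigr => k _.
by rewrite !mxE conjcMm mulrC.
Qed.

Lemma mul_outer (A : 'M[C]_N) x : mv A x =1 x -> A *m outer x = outer x.
Proof.
move=> Ax; apply/matrixP => i j; rewrite !mxE -[in RHS](Ax i) /mv mulr_suml.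
by apply: eq_bigr => k _; rewrite mxE mulrA.
Qed.

Lemma proj_sub_outer k (P : 'M[C]_N) x : is_proj R k.+1 P -> nr2 x = 1 ->
 mv P x =1 x -> is_proj R k (P - outer x).
Proof.
move=> /and3P[/eqP Pa /eqP PP /eqP trP] x1 Px.
have Po := mul_outer Px.
have oP : outer x *m P = outer x.
 by rewrite -[LHS]/(outer x *m P) -{1}(outer_adj x) -{1}Pa -adjmx_mul Po outer_adj.
have oo : outer x *m outer x = outer x by rewrite outer_mul dotcxx x1 scale1r.
apply/and3P; split; apply/eqP.
- by rewrite adjmx_sub Pa outer_adj.
- by rewrite mulmxBl !mulmxBr PP Po oP oo subrr subr0.
- by rewrite linearB /= trP tr_outer x1 -natr1 addrK.
Qed.

(** A nonzero column of [P] is fixed by [P] because [P] is idempotent; it remains to normalize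
    it. *)
Lemma proj_unit k (P : 'M[C]_N) : is_proj R k.+1 P ->
 exists2 x, nr2 x = 1 & mv P x =1 x.
Proof.
move=> /and3P[/eqP Pa /eqP PP /eqP trP].
have [i [j Pij]] : exists i j, P i j != 0.
 apply: contrapT => h; have P0 : P = 0.
  apply/matrixP => i j; rewrite mxE; apply/eqP; apply: contrapT => /negP hh.
  by apply: h; exists i, j.
 by move/eqP: trP; rewrite P0 linear0 eq_sym pnatr_eq0.
pose y : vec := fun l => P l j.
have y0 : 0 < nr2 y by rewrite nr2_gt0; apply/existsP; exists i.
pose t := ((vnorm y)^-1)%:C; exists (fun l => t * y l).
 rewrite nr2_scale cabs_real ger0_norm ?invr_ge0 ?vnorm_ge0// exprVn sqr_vnorm.
 by rewrite mulVf// gt_eqF.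
move=> l; rewrite /mv; under eq_bigr do rewrite mulrCA.
rewrite -mulr_sumr; congr (_ * _); rewrite /y -[in RHS]PP mxE.
by apply: eq_bigr.
Qed.

End Vectors.

Lemma outer_proj n (x : 'I_n.+1 -> C) : nr2 x = 1 -> is_proj R 1 (outer x).
Proof.
move=> x1; apply/and3P; split; rewrite ?outer_adj//.
 by rewrite outer_mul dotcxx x1 scale1r.
by rewrite tr_outer x1.
Qed.

(** The zero vector goes to the first basis vector, so that the norm is always 1 and [pt] is
    total. *)
Definition vunit n (x : 'I_n.+1 -> C) : 'I_n.+1 -> C :=
 if nr2 x == 0 then fun i => (i == ord0)%:R
 else fun i => ((vnorm x)^-1)%:C * x i.

Lemma nr2_vunit n (x : 'I_n.+1 -> C) : nr2 (vunit x) = 1.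
Proof.
rewrite /vunit; case: eqP => [_|/eqP x0].
 rewrite /nr2 (bigD1 (@ord0 n))//= big1.
  by rewrite /cnorm2 /= expr1n expr0n !addr0.
 by move=> i /negbTE ->; rewrite /cnorm2 /= expr0n addr0.
rewrite nr2_scale cabs_real ger0_norm ?invr_ge0 ?vnorm_ge0//.
by rewrite exprVn sqr_vnorm mulVf.
Qed.

Definition pt n (x : 'I_n.+1 -> C) : CP n := @MkCP R n _ (outer_proj (nr2_vunit x)).

Lemma CP_inj n (z w : CP n) : cpm z = cpm w -> z = w.
Proof. exact: val_inj. Qed.

Lemma cpm_pt n (x : 'I_n.+1 -> C) : nr2 x != 0 ->
 cpm (pt x) = ((nr2 x)^-1)%:C *: outer x.
Proof.
move=> x0 /=; rewrite /vunit (negbTE x0) outer_scale cabs_real.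
by rewrite ger0_norm ?invr_ge0 ?vnorm_ge0// exprVn sqr_vnorm.
Qed.

Lemma cpm_pt1 n (x : 'I_n.+1 -> C) : nr2 x = 1 -> cpm (pt x) = outer x.
Proof. by move=> x1; rewrite cpm_pt x1 ?oner_eq0// invr1 scale1r. Qed.

Lemma CPP n (z : CP n) : exists2 x, nr2 x = 1 & z = pt x.
Proof.
have [x x1 Px] := proj_unit (@cpm_proj R n z); exists x => //.
apply: CP_inj; rewrite cpm_pt1//; apply/eqP; rewrite -subr_eq0.
by apply/eqP/proj_tr0/proj_sub_outer => //; exact: (@cpm_proj R n).
Qed.

Lemma pt_scale n (x : 'I_n.+1 -> C) c : c != 0 -> pt (fun i => c * x i) = pt x.
Proof.
move=> c0; have [x0|x0] := eqVneq (nr2 x) 0.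
 apply: CP_inj; rewrite /= /vunit x0 eqxx nr2_scale x0 mulr0 eqxx//.
have cc : cabs c != 0 by rewrite cabs_eq0.
apply: CP_inj; rewrite !cpm_pt ?nr2_scale ?mulf_neq0 ?sqrf_eq0//.
rewrite outer_scale scalerA -realcM invfM mulrAC mulVf ?sqrf_eq0// mul1r//.
Qed.

Definition frame m (L : Gr m) (e f : 'I_m.+2 -> C) : Prop :=
 [/\ nr2 e = 1, nr2 f = 1, dotc e f = 0 & grm L = outer e + outer f].

Lemma frame_of m (L : Gr m) e : nr2 e = 1 -> mv (grm L) e =1 e ->
 exists f, frame L e f.
Proof.
move=> e1 Le; have h := proj_sub_outer (@grm_proj R m L) e1 Le.
have [f f1 Lf] := proj_unit h.
have := proj_tr0 (proj_sub_outer h f1 Lf) => /eqP.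
rewrite subr_eq0 subr_eq addrC => /eqP LE; exists f; split => //.
have := proj_sub_outer h f1 Lf => _.
have h3 i : mv (outer e) f i + (1 - 1) * f i = 0.
 rewrite subrr mul0r addr0.
 have : mv (grm L) (mv (grm L - outer e) f) i = mv (grm L - outer e) f i.
  have /and3P[_ /eqP PP _] := @grm_proj R m L.
  have oo : grm L *m (grm L - outer e) = grm L - outer e.
   by rewrite mulmxBr PP mul_outer.
  by rewrite -mv_mul oo.
 have -> : mv (grm L) (mv (grm L - outer e) f) i = mv (grm L) f i.
  by rewrite /mv; apply: eq_bigr => j _; congr (_ * _); exact: Lf.
 rewrite Lf -{1}(Lf i) => h4.
 have := mv_add (grm L - outer e) (outer e) f i; rewrite subrK.
 by rewrite h4 -[X in X = _]addr0 Lf => /addrI/esym.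
have h5 i : dotc e f * e i = 0.
 by have := h3 i; rewrite subrr mul0r addr0 mv_outer.
have e0 : 0 < nr2 e by rewrite e1.
move: e0; rewrite nr2_gt0 => /existsP[i ei].
by have /eqP := h5 i; rewrite mulf_eq0 (negbTE ei) orbF => /eqP.
Qed.

Lemma frame_exists m (L : Gr m) : exists e f, frame L e f.
Proof.
have [e e1 Le] := proj_unit (@grm_proj R m L).
by have [f ef] := frame_of e1 Le; exists e, f.
Qed.

Lemma frame_lin m (L : Gr m) e f w : frame L e f -> mv (grm L) w =1 w ->
 w =1 lin2 (dotc e w) e (dotc f w) f.
Proof.
by move=> [e1 f1 ef ->] Lw i; rewrite -[LHS]Lw mv_add !mv_outer.
Qed.

Lemma frame_dot m (L : Gr m) e f a b c d : frame L e f ->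
 dotc (lin2 a e b f) (lin2 c e d f) = conjc a * c + conjc b * d.
Proof.
move=> [e1 f1 ef _]; rewrite dotc_linr !dotc_linl !dotcxx e1 f1 ef (dotcC e f) ef.
rewrite conjc0 !mulr0 !addr0 !add0r; ring.
Qed.

Lemma frame_nr2 m (L : Gr m) e f a b : frame L e f ->
 nr2 (lin2 a e b f) = cabs a ^+ 2 + cabs b ^+ 2.
Proof.
by move=> [e1 f1 ef _]; rewrite nr2_lin2 e1 f1 ef mulr0 /= mulr0 addr0 !mulr1.
Qed.

Lemma frame_mv m (L : Gr m) e f a b : frame L e f ->
 mv (grm L) (lin2 a e b f) =1 lin2 a e b f.
Proof.
move=> [e1 f1 ef ->] i; rewrite mv_add !mv_outer !dotc_linr !dotcxx e1 f1 ef.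
by rewrite (dotcC e f) ef conjc0 !mulr0 addr0 add0r !mulr1.
Qed.

Lemma frame_rot m (L : Gr m) e f a b : frame L e f ->
 cabs a ^+ 2 + cabs b ^+ 2 = 1 ->
 frame L (lin2 a e b f) (lin2 (- conjc b) e (conjc a) f).
Proof.
move=> F ab; have [e1 f1 ef LE] := F; split; rewrite ?(frame_nr2 _ _ F)//.
- by rewrite cabsN !cabs_conj addrC.
- by rewrite (frame_dot _ _ _ _ F); ring.
- rewrite LE; apply/matrixP => i j; rewrite !mxE /lin2.
 rewrite !conjcD !conjcMm !conjcN !conjcK.
 have h : conjc a * a + conjc b * b = 1 by rewrite !conjcM_cabs -realcD ab.
 transitivity ((conjc a * a + conjc b * b) * (e i * conjc (e j) + f i * conjc (f j))).
  by rewrite h mul1r.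
 ring.
Qed.

Lemma onLineP m (L : Gr m) (x : 'I_m.+2 -> C) : nr2 x != 0 ->
 reflect (mv (grm L) x =1 x) (onLine R (pt x) L).
Proof.
move=> x0; apply: (iffP eqP); rewrite cpm_pt//; last first.
 by move=> h; rewrite -scalemxAr mul_outer.
rewrite -scalemxAr => /(scalerI _) h i.
have {}h : grm L *m outer x = outer x.
 apply: h; rewrite -(rmorph0 (real_complex R)) (inj_eq (@complexI R)) invr_eq0//.
have : 0 < nr2 x by rewrite lt_def x0 nr2_ge0.
rewrite nr2_gt0 => /existsP[j xj].
have /matrixP/(_ i j) := h; rewrite !mxE.
under eq_bigr do rewrite mxE mulrA.
by rewrite -mulr_suml => /mulIf; apply; rewrite conjc_eq0.
Qed.

Lemma vec_of_outer n (x : 'I_n.+1 -> C) : nr2 x != 0 ->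
 exists2 c : C, c != 0 & vec_of R (outer x) =1 fun i => c * x i.
Proof.
move=> x0; have : 0 < nr2 x by rewrite lt_def x0 nr2_ge0.
rewrite nr2_gt0 => /existsP[i0 xi0].
rewrite /vec_of; case: pickP => [j cj|h].
 exists (conjc (x j)); last by move=> i; rewrite mxE mulrC.
 apply: contraNneq cj => xj; apply/eqP/matrixP => i k.
 by rewrite !mxE xj mulr0.
have := h i0 => /negbT; rewrite negbK => /eqP/matrixP/(_ i0 ord0).
rewrite !mxE => /eqP; rewrite mulf_eq0 conjc_eq0 orbb => /eqP xx.
by rewrite xx eqxx in xi0.
Qed.

(** * Homogeneous polynomials restricted to lines *)

Section PolyExt.
Implicit Types P Q : {poly C}.

Lemma horner_ext P Q : (forall s, P.[s] = Q.[s]) -> P = Q.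
Proof.
move=> h; apply/eqP; rewrite -subr_eq0; apply/eqP.
pose s := [seq i%:R : C | i <- iota 0 (size (P - Q))].
apply: (@roots_geq_poly_eq0 _ _ s); last by rewrite size_map size_iota.
 apply/allP => _ /mapP[i _ ->].
 by rewrite rootE hornerD hornerN h subrr.
rewrite map_inj_uniq ?iota_uniq// => i j /eqP.
by rewrite eqr_nat => /eqP.
Qed.

(** A top coefficient of formal degree [k], possibly 0, so that products and powers can be computed
    before knowing whether the top term vanishes. *)
Definition topc (k : nat) P (c : C) := (size P <= k.+1)%N /\ P`_k = c.

Lemma topc_mul k l P Q c e : topc k P c -> topc l Q e -> topc (k + l) (P * Q) (c * e).
Proof.
move=> [sP <-] [sQ <-]; split.
 have := size_polyMleq P Q; lia.
rewrite coefM (bigD1 (Ordinal (leq_addr l k.+1 : k < (k + l).+1)%N))//= addKn.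
rewrite big1 ?addr0// => j jk; have [jk'|jk'|jk'] := ltngtP j k.
- by rewrite [Q`__]nth_default ?mulr0// (leq_trans sQ)//; lia.
- by rewrite nth_default ?mul0r// (leq_trans sP).
- by move: jk; rewrite -val_eqE /= jk' eqxx.
Qed.

Lemma topc_exp k P c n : topc k P c -> topc (k * n) (P ^+ n) (c ^+ n).
Proof.
move=> h; elim: n => [|n IH]; first by rewrite muln0 !expr0; split; rewrite ?size_poly1 ?coef1.
by rewrite !exprS mulnS; exact: topc_mul.
Qed.

Lemma topc_prod (I : finType) (k : I -> nat) (P : I -> {poly C}) (c : I -> C) :
 (forall i, topc (k i) (P i) (c i)) ->
 topc (\sum_i k i) (\prod_i P i) (\prod_i c i).
Proof.
move=> h; elim: (index_enum I) => [|i s IH].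
 by rewrite !big_nil; split; rewrite ?size_poly1 ?coef1.
by rewrite !big_cons; exact: topc_mul.
Qed.

End PolyExt.

Section Homogeneous.
Context {n d : nat}.
Notation vec := ('I_n.+1 -> C).
Implicit Types (p : Hpoly n d) (x y w v : vec).

Definition pe p x : C := heval R (fun c : C => c) p x.
(** The line through [w] and [v] in the affine coordinate [s] of [w + s v]: the point at infinity is
    [v], and the coefficient of degree [d] is [p(v)]. *)
Definition lp p w v : {poly C} := heval R polyC p (fun i => (w i)%:P + 'X * (v i)%:P).

Lemma pe_ext p x y : x =1 y -> pe p x = pe p y.
Proof.
move=> xy; apply: eq_bigr => a _; congr (_ * _).
by apply: eq_bigr => i _; rewrite xy.
Qed.

Lemma pe_scale p c x : pe p (fun i => c * x i) = c ^+ d * pe p x.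
Proof.
rewrite /pe /heval mulr_sumr; apply: eq_bigr => a /eqP ad.
rewrite mulrCA; congr (_ * _); have -> : c ^+ d = c ^+ mdeg a by rewrite ad.
rewrite /mdeg.
under eq_bigr do rewrite exprMn.
by rewrite big_split/= -expr_sum.
Qed.

Lemma horner_lp p w v s : (lp p w v).[s] = pe p (fun i => w i + s * v i).
Proof.
rewrite /lp /pe /heval horner_sum; apply: eq_bigr => a _.
rewrite hornerM hornerC horner_prod; congr (_ * _); apply: eq_bigr => i _.
by rewrite horner_exp hornerD hornerM hornerX !hornerC.
Qed.

Lemma lp_topc p w v : topc d (lp p w v) (pe p v).
Proof.
have h (a : mono n d) : mdeg a == d ->
  topc d ((p a)%:P * \prod_i ((w i)%:P + 'X * (v i)%:P) ^+ (a i : nat))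
   (p a * \prod_i v i ^+ (a i : nat)).
 move=> /eqP ad; rewrite -[X in topc X]add0n -{1}ad; apply: topc_mul.
  by split; rewrite ?coefC// size_polyC; case: (_ != _).
 rewrite /mdeg; apply: topc_prod => i.
 rewrite -[X in topc X]mul1n; apply: topc_exp; split.
  rewrite (leq_trans (size_polyD _ _))// geq_max size_polyC; apply/andP; split.
   by case: (_ != _).
  rewrite mulrC (leq_trans (size_polyMleq _ _))// size_polyX size_polyC.
  by case: (_ != _).
 by rewrite coefD coefC coefXM coefC add0r.
split.
 rewrite /lp /heval; apply: (big_ind (fun P : {poly C} => (size P <= d.+1)%N)).
 - by rewrite size_poly0.
 - by move=> P Q sP sQ; rewrite (leq_trans (size_polyD _ _))// geq_max sP.
 - by move=> a /h[].
by rewrite /lp /heval coef_sum; apply: eq_bigr => a /h[].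
Qed.

Lemma size_lp p w v : (size (lp p w v) <= d.+1)%N.
Proof. by have [] := lp_topc p w v. Qed.

Lemma lead_lp p w v : pe p v != 0 -> size (lp p w v) = d.+1 /\ lead_coef (lp p w v) = pe p v.
Proof.
move=> v0; have [sl cl] := lp_topc p w v.
have s : size (lp p w v) = d.+1.
 apply/eqP; rewrite eqn_leq sl ltnNge; apply: contra v0 => h.
 by rewrite -cl nth_default.
by rewrite lead_coefE s.
Qed.

(** The factorization is required in both homogeneous coordinates, hence survives a change of basis
    of the line. When [p(v)] is not 0, it says that the zeros are the points [w + s v]. *)
Definition roots_on p w v (zs : seq C) := size zs = d /\
 forall a b, pe p (lin2 a w b v) = pe p v * \prod_(s <- zs) (b - a * s).

Lemma roots_onP p w v zs : size zs = d ->
 lp p w v = pe p v *: \prod_(s <- zs) ('X - s%:P) -> roots_on p w v zs.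
Proof.
move=> szs h; split=> // a b.
have [->|a0] := eqVneq a 0.
 have -> : pe p (lin2 0 w b v) = pe p (fun i => b * v i).
  by apply: pe_ext => i; rewrite /lin2 mul0r add0r.
 rewrite pe_scale mulrC; congr (_ * _); under eq_bigr do rewrite mul0r subr0.
 by rewrite big_const_seq count_predT iter_mulr_1 szs.
have -> : pe p (lin2 a w b v) = pe p (fun i => a * (w i + (b / a) * v i)).
 apply: pe_ext => i; rewrite /lin2; by field.
rewrite pe_scale -horner_lp h hornerZ horner_prodXsubC mulrCA; congr (_ * _).
rewrite -szs -[size zs]count_predT -iter_mulr_1 -big_const_seq -big_split.
by apply: eq_bigr => s _ /=; field.
Qed.

Lemma roots_on_exists p w v : pe p v != 0 -> exists zs, roots_on p w v zs.
Proof.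
move=> v0; have [s1 s2] := lead_lp w v0.
have l0 : lp p w v != 0 by rewrite -size_poly_eq0 s1.
have [zs szs h] := poly_roots l0; exists zs; apply: roots_onP.
 by rewrite szs s1.
by rewrite [LHS]h s2.
Qed.

Lemma lp_roots_on p w v zs a b a' b' : roots_on p w v zs ->
 lp p (lin2 a w b v) (lin2 a' w b' v) =
 pe p v *: \prod_(s <- zs) ((b - a * s)%:P + 'X * (b' - a' * s)%:P).
Proof.
move=> [_ h]; apply: horner_ext => t; rewrite horner_lp hornerZ horner_prod.
rewrite (_ : pe _ _ = pe p (lin2 (a + t * a') w (b + t * b') v)); last first.
 by apply: pe_ext => i; rewrite /lin2; ring.
rewrite h; congr (_ * _); apply: eq_bigr => s _.
by rewrite hornerD hornerM hornerX !hornerC; ring.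
Qed.

End Homogeneous.

(** * Multiplicities of zeros on a line *)

Section LineCount.
Context {m d : nat}.
Notation vec := ('I_m.+2 -> C).
Implicit Types (p : Hpoly m.+1 d) (L : Gr m).

Lemma pt_eqP (n : nat) (x y : 'I_n.+1 -> C) : nr2 x != 0 -> nr2 y != 0 -> pt x = pt y ->
 exists2 c, c != 0 & y =1 fun i => c * x i.
Proof.
move=> x0 y0 /(congr1 cpm); rewrite !cpm_pt// => /matrixP h.
have : 0 < nr2 y by rewrite lt_def y0 nr2_ge0.
rewrite nr2_gt0 => /existsP[j yj].
pose u := ((nr2 x)^-1)%:C; pose v := ((nr2 y)^-1)%:C.
pose c := (u / v) * (conjc (x j) / conjc (y j)).
have yc i : y i = c * x i.
 have := h i j; rewrite !mxE -/u -/v => hij.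
 have v0 : v != 0.
  by rewrite /v -(rmorph0 (real_complex R)) (inj_eq (@complexI R)) invr_eq0.
 have yj' : conjc (y j) != 0 by rewrite conjc_eq0.
 apply: (mulIf yj'); apply: (mulfI v0).
 rewrite -hij /c; clear c; clearbody u v.
 by field; rewrite ?yj' ?v0.
exists c => //; apply: contraNneq yj => c0.
by rewrite yc c0 mul0r.
Qed.

Lemma mup_prod_lin (zs : seq C) (u v : C -> C) :
 (forall s, s \in zs -> u s == 0 -> v s != 0) ->
 \prod_(s <- zs) ((u s)%:P + 'X * (v s)%:P) != 0 /\
 mup 0 (\prod_(s <- zs) ((u s)%:P + 'X * (v s)%:P)) = count (fun s => u s == 0) zs.
Proof.
elim: zs => [|s zs IH] h.
 by rewrite big_nil oner_eq0 mupNroot// root1.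
have [|P0 ih] := IH; first by move=> t tz; apply: h; rewrite inE tz orbT.
have hs := h s (mem_head _ _).
have F0 : (u s)%:P + 'X * (v s)%:P != 0.
 apply/eqP => /polyP E; have := E 0%N; have := E 1%N.
 rewrite !coefD !coefXM !coefC /= add0r addr0 => v0 u0.
 by move: hs; rewrite u0 eqxx v0 eqxx => /(_ isT).
rewrite big_cons /=; split; first by rewrite mulf_neq0.
rewrite mupM// ih; congr (_ + _)%N; have [us0|us0] := eqVneq (u s) 0.
 rewrite us0 add0r mupMl; last by rewrite rootC hs ?us0.
 by have := mup_XsubCX 1 (0 : C) 0; rewrite eqxx expr1 subr0 => ->.
by rewrite mupNroot// rootE hornerD hornerM hornerX !hornerC mul0r addr0.
Qed.

Lemma mupZ0 (c : C) (P : {poly C}) : c != 0 -> mup 0 (c *: P) = mup 0 P.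
Proof. by move=> c0; rewrite -mul_polyC mupMr// rootC. Qed.

Lemma nr2_neq0 (n : nat) (x : 'I_n.+1 -> C) : nr2 x = 1 -> nr2 x != 0.
Proof. by move=> ->; rewrite oner_eq0. Qed.

(** [mult] uses its own basis of the line, adapted to [z]. In that basis the factor of a root [s]
    becomes [c (b - a s) + X c' (conjc a + conjc b s)], which vanishes at 0 iff [e + s f] represents
    [z], and is never the zero polynomial because [|a|^2 + |b|^2 = 1]. *)
Lemma mult_frame p L (e f : vec) zs z : frame L e f -> pe p f != 0 ->
 roots_on p e f zs -> onLine R z L ->
 mult R p L z = count (fun s => pt (lin2 1 e s f) == z) zs.
Proof.
move=> F f0 rz zL; have [w w1 zE] := CPP z; subst z.
have w0 := nr2_neq0 w1.
move: zL => /(onLineP _ w0) Lw.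
set a := dotc e w; set b := dotc f w.
have wE : w =1 lin2 a e b f := frame_lin F Lw.
have ab : cabs a ^+ 2 + cabs b ^+ 2 = 1.
 rewrite -(frame_nr2 _ _ F) -w1; apply: eq_bigr => i _; by rewrite wE.
have [e1 f1 ef LE] := F.
have FR := frame_rot F ab; have [_ r1 _ LE'] := FR.
have woE : outer w = outer (lin2 a e b f).
 by apply/matrixP => i j; rewrite !mxE !wE.
rewrite /mult cpm_pt1// woE.
have -> : grm L - outer (lin2 a e b f) = outer (lin2 (- conjc b) e (conjc a) f).
 by rewrite LE' addrAC subrr add0r.
have n1 : nr2 (lin2 a e b f) != 0 by rewrite (frame_nr2 _ _ F) ab oner_eq0.
have [c c0 cE] := vec_of_outer n1.
have [c' c'0 c'E] := vec_of_outer (nr2_neq0 r1).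
set g := heval _ _ _ _.
have gE : g = pe p f *: \prod_(s <- zs) ((c * (b - a * s))%:P + 'X * (c' * (conjc a + conjc b * s))%:P).
 transitivity (lp p (lin2 (c * a) e (c * b) f) (lin2 (- (c' * conjc b)) e (c' * conjc a) f)).
  rewrite /g /lp /heval; apply: eq_bigr => k _; congr (_ * _).
  apply: eq_bigr => i _; rewrite cE c'E; congr ((_%:P + 'X * _%:P) ^+ _).
   by rewrite /lin2; ring.
  by rewrite /lin2; ring.
 rewrite (lp_roots_on _ _ _ _ rz); congr (_ *: _); apply: eq_bigr => s _.
 by congr (_%:P + 'X * _%:P); ring.
have hv s : s \in zs -> c * (b - a * s) == 0 -> c' * (conjc a + conjc b * s) != 0.
 move=> _; rewrite mulf_eq0 (negbTE c0)/= subr_eq0 => /eqP bE.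
 rewrite mulf_neq0//; apply: contra_eq_neq ab => h.
 apply/eqP => ab; have : a * (conjc a + conjc b * s) = 1.
  rewrite mulrDr mulrCA -bE mulrC !conjcM_cabs -realcD ab//.
 by rewrite h mulr0 => /eqP; rewrite eq_sym oner_eq0.
have [G0 mE] := mup_prod_lin hv.
have -> : (g == 0) = false.
 by apply/negbTE; rewrite gE scaler_eq0 negb_or f0.
rewrite gE mupZ0// mE; apply: eq_count => s; rewrite mulf_eq0 (negbTE c0)/= subr_eq0.
have ns : nr2 (lin2 1 e s f) != 0.
 by rewrite (frame_nr2 _ _ F) cabs1 expr1n gt_eqF// ltr_pwDl// sqr_ge0.
apply/eqP/eqP => [bE|].
 have a0 : a != 0.
  by apply: contra_eqN ab => /eqP a0; rewrite bE a0 mul0r cabs0 expr0n add0r eq_sym oner_eq0.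
 rewrite -(pt_scale (lin2 1 e s f) a0); congr pt; apply/funext => i.
 by rewrite wE /lin2 bE; ring.
move=> /(pt_eqP ns w0)[k k0 wk].
have aE : a = k.
 rewrite /a (_ : w = fun i => k * lin2 1 e s f i); last exact/funext.
 rewrite (_ : (fun i => _) = lin2 k e (k * s) f); last by apply/funext => i; rewrite /lin2; ring.
 by rewrite dotc_linr dotcxx e1 ef mulr0 addr0 mulr1.
rewrite /b (_ : w = lin2 k e (k * s) f); last by apply/funext => i; rewrite wk /lin2; ring.
by rewrite dotc_linr dotcxx f1 (dotcC e f) ef conjc0 mulr0 add0r mulr1 aE.
Qed.

(** A sum over labelled roots, regrouped by their positions. It trades the sum over a set of points
    for a sum over a list, whose entries can be chosen measurably in the line. *)
Lemma lineCountE p L (e f : vec) zs A : frame L e f -> pe p f != 0 ->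
 roots_on p e f zs ->
 lineCount R p L A = \sum_(s <- zs) ((pt (lin2 1 e s f) \in A)%:R : R).
Proof.
move=> F f0 rz; rewrite /lineCount.
have onl s : onLine R (pt (lin2 1 e s f)) L.
 apply/onLineP; last exact: (frame_mv _ _ F).
 by rewrite (frame_nr2 _ _ F) cabs1 expr1n gt_eqF// ltr_pwDl// sqr_ge0.
set pts := fun s => pt (lin2 1 e s f).
pose r := undup [seq z <- map pts zs | z \in A].
rewrite (fsbigE r) ?undup_uniq//; last 2 first.
- move=> z; rewrite /= mem_undup mem_filter => /andP[zA /mapP[s _ zs']].
 by split; [rewrite inE in zA|rewrite /= zs' onl].
- move=> z [zA zL]; rewrite mem_undup mem_filter mem_set//= => zn.
 rewrite (mult_frame F f0 rz)// (@eq_in_count _ _ pred0) ?count_pred0// => s szs.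
 apply/negbTE; apply: contra zn => /eqP <-; exact: map_f.
transitivity (\sum_(z <- r) \sum_(s <- zs) ((pts s == z)%:R : R)).
 rewrite big_seq_cond [RHS]big_seq_cond; apply: eq_big => z.
  rewrite andbT; have [|//] := boolP (z \in r).
  rewrite mem_undup mem_filter => /andP[zA /mapP[s _ zs']] /=.
  by apply/mem_set; split; [rewrite inE in zA|rewrite /= zs' onl].
 move=> /andP[zr _]; move: zr; rewrite mem_undup mem_filter => /andP[zA /mapP[s _ zs']].
 rewrite (mult_frame F f0 rz) ?zs'//; last exact: onl.
 by rewrite -sum1_count natr_sum big_mkcond/=; apply: eq_bigr => t _; case: (_ == _).
rewrite exchange_big /= big_seq [RHS]big_seq; apply: eq_bigr => s szs.
have [sA|sA] := boolP (pts s \in A).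
 have sr : pts s \in r by rewrite mem_undup mem_filter sA map_f.
 rewrite (bigD1_seq (pts s)) ?undup_uniq//= eqxx big1 ?addr0// => z.
 by rewrite eq_sym => /negbTE ->.
rewrite big_seq big1// => z zr; case: eqP => // sz.
by move: zr sA; rewrite mem_undup mem_filter -sz => /andP[->].
Qed.

End LineCount.

(** * The Fubini--Study metric *)

Section Trig.
Implicit Types (c t : R).

Lemma acos_anti (a b : R) : -1 <= a -> a <= b -> b <= 1 -> acos b <= acos a.
Proof.
move=> a1 ab b1; rewrite leNgt; apply/negP => h.
have hA : -1 <= a <= 1 by rewrite a1 (le_trans ab).
have hB : -1 <= b <= 1 by rewrite (le_trans a1).
have : cos (acos b) < cos (acos a).
 by rewrite ltr_cos// in_itv /= acos_ge0// acos_lepi.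
by rewrite !acosK ?in_itv //= ltNge ab.
Qed.

Lemma sin_le_id t : 0 <= t -> sin t <= t.
Proof.
move=> t0; have [|c _] := @MVT_segment R sin cos 0 t t0 (fun x _ => is_derive_sin x).
 by apply: continuous_subspaceT => x; exact: continuous_sin.
rewrite sin0 !subr0 => ->; rewrite -[leRHS]mul1r ler_wpM2r//; exact: cos_le1.
Qed.

Lemma mul_cos_le_sin t : 0 <= t <= pi / 2 -> t * cos t <= sin t.
Proof.
move=> /andP[t0 t1]; have [|c] := @MVT_segment R sin cos 0 t t0 (fun x _ => is_derive_sin x).
 by apply: continuous_subspaceT => x; exact: continuous_sin.
rewrite in_itv/= => /andP[c0 ct]; rewrite sin0 !subr0 => ->; rewrite mulrC ler_wpM2r//.
have pi0 : (pi : R) / 2 <= pi by rewrite ler_pdivrMr// ler_peMr ?pi_ge0// ler1n.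
move: ct; rewrite le_eqVlt => /predU1P[->//|ct].
by rewrite ltW// ltr_cos// in_itv/= ?c0 ?t0/= ?(le_trans (ltW ct))// (le_trans t1).
Qed.

(** For [c >= 1/3] use [t cos t <= sin t]; for [c < 1/3] the sine is at least [2/3] while [t <= 2].
    Both cases give the constant 3. *)
Lemma acos_le_sqrt c : 0 <= c <= 1 -> acos c <= 3 * Num.sqrt (1 - c ^+ 2).
Proof.
move=> /andP[c0 c1]; have hc : -1 <= c <= 1 by rewrite c1 andbT (le_trans _ c0)// lerN10.
rewrite -sin_acos//; set t := acos c.
have t0 : 0 <= t by rewrite acos_ge0.
have t1 : t <= pi / 2 by rewrite -acos0 acos_anti ?lerN10.
have ct : cos t = c by rewrite acosK ?in_itv.
have s0 : 0 <= sin t by rewrite sin_ge0_pi// t0 acos_lepi.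
have [c3|c3] := leP 3^-1 c.
 have := mul_cos_le_sin (_ : 0 <= t <= pi / 2); rewrite t0 t1 ct => /(_ isT) h.
 have : t * 3^-1 <= t * c by rewrite ler_wpM2l.
 lra.
have := sin2cos2 t; rewrite ct => h2.
have t2 : t <= 2 by rewrite (le_trans t1)// ltW// pihalf_lt2.
have : 2 / 3 <= sin t.
 rewrite -ler_sqr ?nnegrE ?divr_ge0// h2.
 have : c ^+ 2 <= 3^-1 ^+ 2 by rewrite ler_sqr ?nnegrE ?invr_ge0// ltW.
 lra.
lra.
Qed.

Lemma sqrt_le_acos c : 0 <= c <= 1 -> Num.sqrt (1 - c ^+ 2) <= acos c.
Proof.
move=> /andP[c0 c1]; have hc : -1 <= c <= 1 by rewrite c1 andbT (le_trans _ c0)// lerN10.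
by rewrite -sin_acos// sin_le_id// acos_ge0.
Qed.

End Trig.

Section Metric.
Notation dFS := (@dFS R _).

Definition ctr n (z w : CP n) : R := Re (\tr (cpm z *m cpm w)).

Lemma ReN (z : C) : Re (- z) = - Re z. Proof. by case: z. Qed.

Lemma ctr_unit n (x y : 'I_n.+1 -> C) : nr2 x = 1 -> nr2 y = 1 ->
 ctr (pt x) (pt y) = cabs (dotc x y) ^+ 2.
Proof. by move=> x1 y1; rewrite /ctr !cpm_pt1// tr_outer_mul. Qed.

Lemma cs_unit n (x y : 'I_n -> C) : nr2 x = 1 -> nr2 y = 1 -> cabs (dotc x y) <= 1.
Proof.
move=> x1 y1; have := cauchy_schwarz x y; rewrite x1 y1 mulr1.
by rewrite expr_le1// cabs_ge0.
Qed.

Lemma ctr_itv n (z w : CP n) : 0 <= ctr z w <= 1.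
Proof.
have [x x1 ->] := CPP z; have [y y1 ->] := CPP w.
by rewrite ctr_unit// sqr_ge0 expr_le1//= cs_unit.
Qed.

Lemma ctrC n (z w : CP n) : ctr z w = ctr w z.
Proof. by rewrite /ctr mxtrace_mulC. Qed.

Lemma sqrt_ctr_itv n (z w : CP n) : 0 <= Num.sqrt (ctr z w) <= 1.
Proof.
have /andP[h0 h1] := ctr_itv z w; rewrite sqrtr_ge0/=.
by rewrite -sqrtr1 ler_sqrt.
Qed.

Lemma sqrt_ctr_itv' n (z w : CP n) : -1 <= Num.sqrt (ctr z w) <= 1.
Proof. by have /andP[h0 ->] := sqrt_ctr_itv z w; rewrite (le_trans _ h0)// lerN10. Qed.

Lemma dFSE n (z w : CP n) : dFS z w = acos (Num.sqrt (ctr z w)).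
Proof. by []. Qed.

Lemma dFS_ge0 n (z w : CP n) : 0 <= dFS z w.
Proof. by rewrite dFSE acos_ge0// sqrt_ctr_itv'. Qed.

Lemma dFS_lepi n (z w : CP n) : dFS z w <= pi.
Proof. by rewrite dFSE acos_lepi// sqrt_ctr_itv'. Qed.

Lemma dFSC n (z w : CP n) : dFS z w = dFS w z.
Proof. by rewrite !dFSE ctrC. Qed.

Lemma dFS_le_ctr n (z w : CP n) : dFS z w <= 3 * Num.sqrt (1 - ctr z w).
Proof.
have := acos_le_sqrt (sqrt_ctr_itv z w).
by rewrite sqr_sqrtr//; have /andP[] := ctr_itv z w.
Qed.

Lemma ctr_le_dFS n (z w : CP n) : 1 - ctr z w <= dFS z w ^+ 2.
Proof.
have /andP[h0 h1] := ctr_itv z w.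
have := sqrt_le_acos (sqrt_ctr_itv z w); rewrite sqr_sqrtr// -dFSE => h.
rewrite -[leLHS]sqr_sqrtr ?subr_ge0// ler_sqr ?nnegrE ?sqrtr_ge0 ?dFS_ge0//.
Qed.

Lemma dFS_ltP n (z w : CP n) (r : R) : 0 <= r <= pi ->
 (dFS z w < r) = (cos r < Num.sqrt (ctr z w)).
Proof.
move=> hr; rewrite -[in RHS](@acosK R (Num.sqrt (ctr z w))); last first.
 by rewrite in_itv /= sqrt_ctr_itv'.
by rewrite ltr_cos// in_itv/= ?acos_ge0 ?acos_lepi// sqrt_ctr_itv'.
Qed.

Lemma dFS_refl n (z : CP n) : dFS z z = 0.
Proof.
have [x x1 ->] := CPP z; rewrite dFSE ctr_unit// dotcxx x1.
by rewrite cabs1 expr1n sqrtr1 acos1.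
Qed.

(** [p] and [q] are the components of [x] and [v] orthogonal to [y], with norms the sines of the two
    distances. Cauchy--Schwarz for [p] and [q] bounds [|<x,v>|] below by [cos (acos a + acos b)]. *)
Lemma dFS_tri n (w z u : CP n) : dFS z u <= dFS z w + dFS w u.
Proof.
have [x x1 ->] := CPP z; have [y y1 ->] := CPP w; have [v v1 ->] := CPP u.
rewrite !dFSE !ctr_unit// !sqrtr_sqr !ger0_norm//.
set a := cabs (dotc x y); set b := cabs (dotc y v); set c := cabs (dotc x v).
have ha : -1 <= a <= 1 by rewrite cs_unit// andbT (le_trans _ (cabs_ge0 _))// lerN10.
have hb : -1 <= b <= 1 by rewrite cs_unit// andbT (le_trans _ (cabs_ge0 _))// lerN10.
have hc : -1 <= c <= 1 by rewrite cs_unit// andbT (le_trans _ (cabs_ge0 _))// lerN10.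
have [pab|pab] := leP (acos a + acos b) pi; last first.
 by rewrite (le_trans _ (ltW pab))// acos_lepi.
rewrite -[leRHS]cosK ?in_itv/= ?pab ?addr_ge0 ?acos_ge0//.
apply: acos_anti; [exact: cos_geN1| |by have /andP[] := hc].
rewrite cosD !acosK ?in_itv//= !sin_acos//.
pose p := lin2 1 x (- dotc y x) y; pose q := lin2 1 v (- dotc y v) y.
have np : nr2 p = 1 - a ^+ 2.
 rewrite nr2_lin2 x1 y1 !mulr1 cabs1 expr1n cabsN conjc1 mul1r.
 rewrite (dotcC x y) cabs_conj mulNr conjcM_cabs ReN /= -/a; ring.
have nq : nr2 q = 1 - b ^+ 2.
 rewrite nr2_lin2 v1 y1 !mulr1 cabs1 expr1n cabsN conjc1 mul1r.
 rewrite mulNr (dotcC y v) [dotc y v * _]mulrC conjcM_cabs ReN /= -/b; ring.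
have pq : dotc p q = dotc x v - dotc x y * dotc y v.
 rewrite dotc_linr !dotc_linl !dotcxx y1 conjcN conjc1 -dotcC; ring.
have := cauchy_schwarz p q; rewrite np nq pq => h.
have h2 : cabs (dotc x v - dotc x y * dotc y v) <= Num.sqrt (1 - a ^+ 2) * Num.sqrt (1 - b ^+ 2).
 rewrite -ler_sqr ?nnegrE ?mulr_ge0 ?sqrtr_ge0// exprMn !sqr_sqrtr//.
  by rewrite -nq nr2_ge0.
 by rewrite -np nr2_ge0.
have := cabs_leB (dotc x y * dotc y v) (dotc x v).
rewrite cabsB cabsM -/a -/b -/c; lra.
Qed.

Lemma ctr_pt n (x y : 'I_n.+1 -> C) : nr2 x != 0 -> nr2 y != 0 ->
 ctr (pt x) (pt y) = cabs (dotc x y) ^+ 2 / (nr2 x * nr2 y).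
Proof.
move=> x0 y0; rewrite /ctr !cpm_pt// -scalemxAl -scalemxAr !linearZ /= tr_outer_mul.
by rewrite -!realcM /= invfM; ring.
Qed.

(** [1 - ctr] is the squared sine of the angle; times [nr2 y] it is the squared distance from [y] to
    the complex line of [x], at most the squared distance from [y] to [x]. *)
Lemma one_sub_ctr_le n (x y : 'I_n.+1 -> C) : nr2 x != 0 -> nr2 y != 0 ->
 1 - ctr (pt x) (pt y) <= nr2 (fun i => y i - x i) / nr2 y.
Proof.
move=> x0 y0; rewrite ctr_pt//.
have xp : 0 < nr2 x by rewrite lt_def x0 nr2_ge0.
have yp : 0 < nr2 y by rewrite lt_def y0 nr2_ge0.
set v : 'I_n.+1 -> C := fun i => y i - x i.
have yE : y = lin2 1 x 1 v by apply/funext => i; rewrite /lin2 /v; ring.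
have h1 : nr2 y = nr2 x + nr2 v + 2 * Re (dotc x v).
 by rewrite {1}yE nr2_lin2 cabs1 conjc1 !mul1r !expr1n !mul1r.
have h2 : cabs (dotc x y) ^+ 2 = nr2 x ^+ 2 + 2 * nr2 x * Re (dotc x v) + cabs (dotc x v) ^+ 2.
 rewrite {1}yE dotc_linr dotcxx !mul1r !sqr_cabs /cnorm2; case: (dotc x v) => a b /=; ring.
rewrite ler_pdivlMr// mulrBl mul1r.
have -> : cabs (dotc x y) ^+ 2 / (nr2 x * nr2 y) * nr2 y = cabs (dotc x y) ^+ 2 / nr2 x.
 by field; rewrite x0 y0.
rewrite -(ler_pM2l xp) mulrBr [nr2 x * (_ / _)]mulrCA divff// mulr1 h2 h1.
have := sqr_ge0 (cabs (dotc x v)); lra.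
Qed.

Lemma dFS_pt_le n (x y : 'I_n.+1 -> C) : nr2 x != 0 -> nr2 y != 0 ->
 dFS (pt x) (pt y) <= 3 * (vnorm (fun i => y i - x i) / vnorm y).
Proof.
move=> x0 y0; apply: le_trans (dFS_le_ctr _ _) _; rewrite ler_wpM2l//.
rewrite /vnorm -sqrtrV ?nr2_ge0// -sqrtrM ?nr2_ge0// ler_wsqrtr//.
exact: one_sub_ctr_le.
Qed.

Lemma ctr_sub n (z w : CP n) :
 1 - ctr z w = (\sum_i \sum_j cnorm2 R (cpm z j i - cpm w j i)) / 2.
Proof.
have hz (u : CP n) : \tr (cpm u *m cpm u) = 1 /\ adjmx (cpm u) = cpm u.
 by have /and3P[/eqP ua /eqP uu /eqP tu] := @cpm_proj R n u; rewrite uu tu ua.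
have [z1 za] := hz z; have [w1 wa] := hz w.
have := tr_adj_mul (cpm z - cpm w).
rewrite adjmx_sub za wa mulmxBl !mulmxBr !linearB /= z1 w1.
rewrite (mxtrace_mulC (cpm w) (cpm z)) => /(congr1 (@Re R)) /=.
have -> : (\sum_i \sum_j cnorm2 R ((cpm z - cpm w) j i)) = (\sum_i \sum_j cnorm2 R (cpm z j i - cpm w j i)).
 by apply: eq_bigr => i _; apply: eq_bigr => j _; rewrite !mxE.
move=> <-; rewrite /ctr; case: (\tr _) => a b /=; lra.
Qed.

End Metric.

(** * Measurability on projective space and on the Grassmannian *)

Lemma measurable_fun_of_lt d (X : measurableType d) (f : X -> R) :
 (forall r, measurable [set x | f x < r]) -> meas f.
Proof.
move=> h; apply: (measurability _ (RGenInftyO.measurableE R)).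
move=> _ [_ [x ->] <-]; rewrite setTI.
rewrite (_ : f @^-1` _ = [set y | f y < x]); first exact: h.
by apply/seteqP; split => y /=; rewrite in_itv.
Qed.

Lemma measurable_ltf d (X : measurableType d) (f g : X -> R) :
 meas f -> meas g ->
 measurable [set x | f x < g x].
Proof.
move=> mf mg; have := measurable_fun_ltr mf mg => /(_ measurableT [set true]).
by rewrite setTI; apply.
Qed.

Lemma measurable_lef d (X : measurableType d) (f g : X -> R) :
 meas f -> meas g ->
 measurable [set x | f x <= g x].
Proof.
move=> mf mg; have := measurable_fun_ler mf mg => /(_ measurableT [set true]).
by rewrite setTI; apply.
Qed.

(** Separability in finitely many real coordinates [phi]: for each box with rational center and
    radius [1 / (k + 1)], keep one point that falls in it, if there is any. *)
Lemma countable_dense (T : pointedType) (I : finType) (phi : T -> I -> R) :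
 exists u : nat -> T, forall x (e : R), 0 < e ->
  exists k, forall i, `|phi (u k) i - phi x i| < e.
Proof.
pose good (A : {ffun I -> rat}) (k : nat) x := forall i, `|phi x i - ratr (A i)| < k.+1%:R^-1.
pose u n : T := if @unpickle ({ffun I -> rat} * nat)%type n is Some Ak
  then xget point (good Ak.1 Ak.2) else point.
exists u => x e e0.
have [k ke] : exists k, k.+1%:R^-1 < e / 2.
 have e2 : 0 < e / 2 by rewrite divr_gt0.
 exists (Num.truncn (e / 2)^-1); rewrite invf_plt ?posrE//.
 exact: truncnS_gt.
have k0 : 0 < k.+1%:R^-1 :> R by rewrite invr_gt0.
have /choice[A hA] : forall i, exists q : rat, `|phi x i - ratr q| < k.+1%:R^-1.
 move=> i; have [|q] := @rat_in_itvoo R (phi x i - k.+1%:R^-1) (phi x i + k.+1%:R^-1).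
  by rewrite ltrD2l gt0_cp.
 by rewrite in_itv /= => h; exists q; rewrite distrC ltr_distl.
pose A' := [ffun i => A i].
have gx : good A' k x by move=> i; rewrite ffunE.
exists (pickle (A', k)) => i; rewrite /u pickleK /=.
have := xgetPex point (ex_intro _ x gx) => /(_ i).
set y := xget _ _; have := gx i; rewrite -[X in _ -> _ -> `|X| < _](subrKA (ratr (A' i))).
move=> h1 h2; rewrite (le_lt_trans (ler_normD _ _))//.
by rewrite [X in _ + X]distrC (splitr e) ltrD// (lt_trans _ ke).
Qed.

(** With a countable dense sequence, a sublevel set of a continuous function is a countable union of
    balls. Continuity is phrased with a common center [y0] of both points, so that it can be used
    with a ball around a point of the sequence directly. *)
Lemma ball_measurable (T : pointedType) (dist : T -> T -> R) (f : T -> R)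
  (G := [set A : set T | exists x r, A = [set y | dist x y < r]]) (u : nat -> T) :
 (forall x e, 0 < e -> exists k, dist (u k) x < e) ->
 (forall x e, 0 < e -> exists2 r, 0 < r & forall y0 y, dist y0 x < r -> dist y0 y < r ->
   `|f y - f x| < e) ->
 meas (f : g_sigma_algebraType G -> R).
Proof.
move=> ud fc; apply: measurable_fun_of_lt => c.
pose U : set T := [set x | f x < c].
pose B k j := [set y | dist (u k) y < j.+1%:R^-1].
rewrite (_ : [set _ | _] = \bigcup_k \bigcup_j (if `[< B k j `<=` U >] then B k j else set0)).
 apply: bigcup_measurable => k _; apply: bigcup_measurable => j _.
 case: ifP => _; last exact: measurable0.
 by apply: sub_sigma_algebra; exists (u k), j.+1%:R^-1.
apply/seteqP; split => x /=; last first.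
 by move=> [k _ [j _]]; case: ifPn => // /asboolP; apply.
move=> fx; have cf : 0 < c - f x by rewrite subr_gt0.
have [r r0 hr] := fc x _ cf.
pose j := Num.truncn r^-1.
have jr : j.+1%:R^-1 < r by rewrite invf_plt ?posrE//; exact: truncnS_gt.
have j0 : 0 < j.+1%:R^-1 :> R by rewrite invr_gt0.
have [k hk] := ud x _ j0.
exists k => //; exists j => //; case: ifPn => // /asboolP; case=> y /= hy.
have := hr (u k) y (lt_trans hk jr) (lt_trans hy jr).
by rewrite /U /= ltr_norml => /andP[_]; rewrite ltrBlDr subrK.
Qed.

Section Borel.
Notation dFS := (@dFS R _).

Definition mcfun d (X : measurableType d) (f : X -> C) : Prop :=
 meas (fun x : X => Re (f x)) /\
 meas (fun x : X => Im (f x)).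

Section McfunTheory.
Context {d} {X : measurableType d}.
Implicit Types f g : X -> C.

Lemma mcfun_cst (c : C) : mcfun (fun _ : X => c).
Proof. by split; exact: measurable_cst. Qed.
Lemma mcfunD f g : mcfun f -> mcfun g -> mcfun (fun x => f x + g x).
Proof.
move=> [f1 f2] [g1 g2]; split.
 rewrite (_ : (fun _ => _) = (fun x => Re (f x)) \+ (fun x => Re (g x))).
  exact: measurable_funD.
 by apply/funext => x /=; case: (f x) => ? ?; case: (g x).
rewrite (_ : (fun _ => _) = (fun x => Im (f x)) \+ (fun x => Im (g x))).
 exact: measurable_funD.
by apply/funext => x /=; case: (f x) => ? ?; case: (g x).
Qed.
Lemma mcfunM f g : mcfun f -> mcfun g -> mcfun (fun x => f x * g x).
Proof.
move=> [f1 f2] [g1 g2]; split.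
 rewrite (_ : (fun _ => _) = ((fun x => Re (f x)) \* (fun x => Re (g x)))
   \- ((fun x => Im (f x)) \* (fun x => Im (g x)))).
  by apply: measurable_funB; apply: measurable_funM.
 by apply/funext => x /=; case: (f x) => ? ?; case: (g x).
rewrite (_ : (fun _ => _) = ((fun x => Re (f x)) \* (fun x => Im (g x)))
   \+ ((fun x => Im (f x)) \* (fun x => Re (g x)))).
 by apply: measurable_funD; apply: measurable_funM.
by apply/funext => x /=; case: (f x) => ? ?; case: (g x).
Qed.
Lemma mcfun_real (h : X -> R) : meas h -> mcfun (fun x => (h x)%:C).
Proof. by move=> mh; split => //=; exact: measurable_cst. Qed.
Lemma mcfunN f : mcfun f -> mcfun (fun x => - f x).
Proof.
move=> mf; rewrite (_ : (fun _ => _) = (fun x => -1 * f x)).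
 by apply: mcfunM => //; exact: mcfun_cst.
by apply/funext => x; rewrite mulN1r.
Qed.
Lemma mcfun_conj f : mcfun f -> mcfun (fun x => conjc (f x)).
Proof.
move=> [f1 f2]; split.
 by rewrite (_ : (fun _ => _) = (fun x => Re (f x)))//; apply/funext => x; case: (f x).
rewrite (_ : (fun _ => _) = \- (fun x => Im (f x))); first exact: measurableT_comp.
by apply/funext => x /=; case: (f x).
Qed.
Lemma mcfun_sum I (s : seq I) (P : pred I) (h : I -> X -> C) :
 (forall i, mcfun (h i)) -> mcfun (fun x => \sum_(i <- s | P i) h i x).
Proof.
move=> mh; elim: s => [|i s IH].
 by under eq_fun do rewrite big_nil; exact: mcfun_cst.
under eq_fun do rewrite big_cons.
by case: (P i) => //; exact: mcfunD.
Qed.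
Lemma mcfun_prod I (s : seq I) (h : I -> X -> C) :
 (forall i, mcfun (h i)) -> mcfun (fun x => \prod_(i <- s) h i x).
Proof.
move=> mh; elim: s => [|i s IH].
 by under eq_fun do rewrite big_nil; exact: mcfun_cst.
by under eq_fun do rewrite big_cons; exact: mcfunM.
Qed.
Lemma mcfunX f n : mcfun f -> mcfun (fun x => f x ^+ n).
Proof.
move=> mf; elim: n => [|n IH].
 by under eq_fun do rewrite expr0; exact: mcfun_cst.
by under eq_fun do rewrite exprS; exact: mcfunM.
Qed.
Lemma measurable_cabs2 f : mcfun f -> meas (fun x : X => cabs (f x) ^+ 2).
Proof.
move=> [f1 f2]; under eq_fun do rewrite sqr_cabs /cnorm2.
by apply: measurable_funD; exact: measurable_funX.
Qed.
Lemma measurable_sqrt (h : X -> R) : meas h ->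
 meas (fun x : X => Num.sqrt (h x)).
Proof.
move=> mh; exact: (measurableT_comp (continuous_measurable_fun (@sqrt_continuous R)) mh).
Qed.
Lemma measurable_pos_inv (h : X -> R) : (forall x, 0 <= h x) ->
 meas h -> meas (fun x : X => (h x)^-1).
Proof.
move=> h0 mh; under eq_fun do rewrite -powR_inv1//.
exact: (measurableT_comp (@measurable_powR R (-1)) mh).
Qed.
Lemma measurable_cabs f : mcfun f -> meas (fun x : X => cabs (f x)).
Proof.
move=> mf; rewrite (_ : (fun _ => _) = fun x => Num.sqrt (cabs (f x) ^+ 2)).
 by apply: measurable_sqrt; exact: measurable_cabs2.
by apply/funext => x; rewrite sqrtr_sqr (ger0_norm (cabs_ge0 _)).
Qed.
Lemma mcfunV f : mcfun f -> mcfun (fun x => (f x)^-1).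
Proof.
move=> mf; rewrite (_ : (fun _ => _) = fun x => conjc (f x) * ((cabs (f x) ^+ 2)^-1)%:C).
 apply: mcfunM; first exact: mcfun_conj.
 by apply/mcfun_real/measurable_pos_inv => [x|]; [exact: sqr_ge0|exact: measurable_cabs2].
apply/funext => x; have [->|fx] := eqVneq (f x) 0.
 by rewrite invr0 conjc0 mul0r.
apply: (mulfI fx); rewrite divff// mulrCA mulrA conjcM_cabs -realcM mulfV//.
by rewrite sqrf_eq0 cabs_eq0.
Qed.
Lemma mcfun_if (b : X -> bool) f g : measurable [set x | b x] -> mcfun f -> mcfun g ->
 mcfun (fun x => if b x then f x else g x).
Proof.
move=> mb [f1 f2] [g1 g2].
have mb' : meas b.
 by apply: (measurable_fun_bool true); rewrite setTI preimage_true.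
split.
 rewrite (_ : (fun _ => _) = fun x => if b x then Re (f x) else Re (g x)).
  by apply: measurable_fun_ifT.
 by apply/funext => x; case: (b x).
rewrite (_ : (fun _ => _) = fun x => if b x then Im (f x) else Im (g x)).
 by apply: measurable_fun_ifT.
by apply/funext => x; case: (b x).
Qed.
Lemma measurable_mc_eq0 f : mcfun f -> measurable [set x | f x == 0].
Proof.
move=> mf; rewrite (_ : [set _ | _] = [set x | cabs (f x) <= 0]).
 by apply: measurable_lef; [exact: measurable_cabs|exact: measurable_cst].
by apply/seteqP; split => x /=; rewrite -cabs_eq0 eq_le cabs_ge0 andbT.
Qed.

End McfunTheory.

Lemma cnorm2_le (z : C) (e : R) : cabs z <= e -> cnorm2 R z <= e ^+ 2.
Proof.
move=> h; rewrite -sqr_cabs ler_sqr ?nnegrE//; exact: le_trans (cabs_ge0 z) h.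
Qed.

Lemma cabs_small (z : C) (e : R) : 0 < e -> `|Re z| < e / 2 -> `|Im z| < e / 2 -> cabs z < e.
Proof.
move=> e0 h1 h2; apply: le_lt_trans (cabs_ReIm z) _.
by rewrite (splitr e) ltrD.
Qed.

Lemma sum_cnorm2_le N (A B : 'M[C]_N) (e : R) : 0 <= e ->
 (forall i j, cabs (A i j - B i j) <= e) ->
 Num.sqrt (\sum_i \sum_j cnorm2 R (A j i - B j i)) <= N%:R * e.
Proof.
move=> e0 h; rewrite -[leRHS](@ger0_norm _ (N%:R * e)) ?mulr_ge0// -sqrtr_sqr ler_wsqrtr//.
apply: (via (\sum_(i < N) \sum_(j < N) e ^+ 2)).
 by apply: ler_sum => i _; apply: ler_sum => j _; exact: cnorm2_le.
by rewrite !sumr_const !card_ord -mulrnA -[e ^+ 2 *+ _]mulr_natl natrM exprMn expr2.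
Qed.

Lemma le_sum_cnorm2 N (A B : 'M[C]_N) i j :
 cabs (A i j - B i j) <= Num.sqrt (\sum_i \sum_j cnorm2 R (A j i - B j i)).
Proof.
rewrite -[leLHS]ger0_norm// -sqrtr_sqr ler_wsqrtr// sqr_cabs.
rewrite (bigD1 j)//= (bigD1 i)//= -addrA lerDl addr_ge0// sumr_ge0// => k _.
 exact: cnorm2_ge0.
by apply: sumr_ge0 => l _; exact: cnorm2_ge0.
Qed.

Lemma dmxE N (A B : 'M[C]_N) : dmx R A B = Num.sqrt (\sum_i \sum_j cnorm2 R (A j i - B j i)).
Proof. by rewrite /dmx exchange_big. Qed.

Lemma dFS_entries n (z w : CP n) (e : R) : 0 <= e ->
 (forall i j, cabs (cpm z i j - cpm w i j) <= e) -> dFS z w <= 3 * (n.+1%:R * e).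
Proof.
move=> e0 h; apply: le_trans (dFS_le_ctr _ _) _; rewrite ler_wpM2l// ctr_sub.
apply: le_trans (sum_cnorm2_le e0 h); rewrite ler_wsqrtr// ler_pdivrMr// ler_peMr ?ler1n//.
by apply: sumr_ge0 => i _; apply: sumr_ge0 => j _; exact: cnorm2_ge0.
Qed.

Lemma entries_dFS n (z w : CP n) i j : cabs (cpm z i j - cpm w i j) <= 2 * dFS z w.
Proof.
apply: le_trans (le_sum_cnorm2 _ _ _ _) _.
rewrite -[leRHS]ger0_norm ?mulr_ge0 ?dFS_ge0// -sqrtr_sqr ler_wsqrtr// exprMn.
have := ctr_le_dFS z w; rewrite ctr_sub.
set S := (\sum_i _); have : 0 <= dFS z w ^+ 2 by exact: sqr_ge0.
lra.
Qed.

Definition ReIm_entry (T : Type) N (m : T -> 'M[C]_N) (x : T) (k : 'I_N * 'I_N * bool) : R :=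
 if k.2 then Re (m x k.1.1 k.1.2) else Im (m x k.1.1 k.1.2).

Lemma entries_dense (T : pointedType) N (m : T -> 'M[C]_N) : exists u : nat -> T,
 forall x e, 0 < e -> exists k, forall i j, cabs (m (u k) i j - m x i j) <= e.
Proof.
have [u hu] := countable_dense (ReIm_entry m); exists u => x e e0.
have [k hk] := hu x (e / 2) (divr_gt0 e0 (ltr0n _ 2)).
exists k => i j; apply/ltW/cabs_small => //.
 by have := hk (i, j, true); rewrite /ReIm_entry /=; case: (m _ i j) (m _ i j) => ? ? [].
by have := hk (i, j, false); rewrite /ReIm_entry /=; case: (m _ i j) (m _ i j) => ? ? [].
Qed.

Lemma CP_dense n : exists u : nat -> CP n, forall x e, 0 < e -> exists k, dFS (u k) x < e.
Proof.
have [u hu] := entries_dense (fun z : CP n => cpm z); exists u => x e e0.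
have c0 : 0 < 3 * n.+1%:R :> R by rewrite mulr_gt0.
have d0 : 0 < e / (3 * n.+1%:R) / 2 by rewrite !divr_gt0.
have [k hk] := hu x _ d0; exists k.
apply: le_lt_trans (dFS_entries (ltW d0) hk) _.
have c1 : 0 < n.+1%:R :> R by [].
move: c1; set c := n.+1%:R => c1.
have -> : 3 * (c * (e / (3 * c) / 2)) = e / 2 by field; rewrite gt_eqF.
by rewrite ltr_pdivrMr// ltr_pMr// ltr1n.
Qed.

Lemma Gr_dense m : exists u : nat -> Gr m, forall x e, 0 < e ->
 exists k, dmx R (grm (u k)) (grm x) < e.
Proof.
have [u hu] := entries_dense (fun z : Gr m => grm z); exists u => x e e0.
have c0 : 0 < m.+2%:R :> R by [].
have d0 : 0 < e / m.+2%:R / 2 by rewrite !divr_gt0.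
have [k hk] := hu x _ d0; exists k; rewrite dmxE.
apply: le_lt_trans (sum_cnorm2_le (ltW d0) hk) _.
move: c0; set c := m.+2%:R => c1.
have -> : c * (e / c / 2) = e / 2 by field; rewrite gt_eqF.
by rewrite ltr_pdivrMr// ltr_pMr// ltr1n.
Qed.

Lemma ReB (z w : C) : Re (z - w) = Re z - Re w.
Proof. by case: z => ? ?; case: w. Qed.
Lemma ImB (z w : C) : Im (z - w) = Im z - Im w.
Proof. by case: z => ? ?; case: w. Qed.

Lemma mcfun_cpm n i j : mcfun (fun z : CPm n => cpm z i j).
Proof.
have [u hu] := CP_dense n.
have key (f : CPm n -> R) : (forall z w : CP n, `|f z - f w| <= cabs (cpm z i j - cpm w i j)) ->
  meas f.
 move=> hf; apply: (@ball_measurable (CP n) (fun z w => dFS z w) f u hu) => x e e0.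
 exists (e / 4); first by rewrite divr_gt0.
 move=> y0 y h1 h2; apply: le_lt_trans (hf _ _) _.
 apply: le_lt_trans (entries_dFS _ _ _ _) _.
 have := dFS_tri y0 y x; rewrite (dFSC y y0) => h3.
 by move: h1 h2 h3; lra.
split; apply: key => z w; rewrite -?ReB -?ImB; [exact: Re_cabs|exact: Im_cabs].
Qed.

Lemma dmx_tri N (A B D : 'M[C]_N) i j : cabs (A i j - B i j) <= dmx R D A + dmx R D B.
Proof.
apply: le_trans (cabs_triB (D i j) _ _) _; rewrite lerD// dmxE ?[cabs (A _ _ - _)]cabsB;
 exact: le_sum_cnorm2.
Qed.

Lemma mcfun_grm m i j : mcfun (fun L : Grm m => grm L i j).
Proof.
have [u hu] := Gr_dense m.
have key (f : Grm m -> R) : (forall z w : Gr m, `|f z - f w| <= cabs (grm z i j - grm w i j)) ->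
  meas f.
 move=> hf; apply: (@ball_measurable (Gr m) (fun z w => dmx R (grm z) (grm w)) f u hu) => x e e0.
 exists (e / 2); first by rewrite divr_gt0.
 move=> y0 y h1 h2; apply: le_lt_trans (hf _ _) _.
 apply: le_lt_trans (dmx_tri _ _ (grm y0) _ _) _.
 by move: h1 h2; lra.
split; apply: key => z w; rewrite -?ReB -?ImB; [exact: Re_cabs|exact: Im_cabs].
Qed.

Lemma measurable_ctr d (X : measurableType d) n (f g : X -> CPm n) :
 (forall i j, mcfun (fun x => cpm (f x) i j)) ->
 (forall i j, mcfun (fun x => cpm (g x) i j)) ->
 meas (fun x : X => ctr (f x) (g x)).
Proof.
move=> mf mg; have [] // : mcfun (fun x => \tr (cpm (f x) *m cpm (g x))).
rewrite /mxtrace; apply: mcfun_sum => i; under eq_fun do rewrite mxE.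
by apply: mcfun_sum => j; apply: mcfunM.
Qed.

Lemma measurable_dFS d (X : measurableType d) n (f g : X -> CPm n) :
 (forall i j, mcfun (fun x => cpm (f x) i j)) ->
 (forall i j, mcfun (fun x => cpm (g x) i j)) ->
 meas (fun x : X => dFS (f x) (g x)).
Proof.
move=> mf mg; apply: measurable_fun_of_lt => r.
have [r0|r0] := ltP r 0.
 rewrite (_ : [set _ | _] = set0) ?measurable0// -subset0 => x /=.
 by rewrite ltNge (le_trans (ltW r0))// dFS_ge0.
have [rpi|rpi] := ltP pi r.
 rewrite (_ : [set _ | _] = setT) // -subTset => x _ /=.
 by rewrite (le_lt_trans (dFS_lepi _ _)).
rewrite (_ : [set _ | _] = [set x | cos r < Num.sqrt (ctr (f x) (g x))]).
 apply: measurable_ltf; first exact: measurable_cst.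
 exact/measurable_sqrt/measurable_ctr.
by apply/seteqP; split => x /=; rewrite dFS_ltP// r0.
Qed.

Lemma measurable_to_CP d (X : measurableType d) n (f : X -> CPm n) :
 (forall i j, mcfun (fun x => cpm (f x) i j)) -> meas f.
Proof.
move=> mf; apply: (measurability _ (erefl (@measurable _ (CPm n)))).
move=> _ [A [z [r ->]] <-]; rewrite setTI.
have := @measurable_dFS _ X n (fun _ => z) f (fun i j => mcfun_cst _) mf.
move=> /measurable_ltf/(_ (measurable_cst r)); exact.
Qed.

Lemma measurable_dFS2 n :
 meas (fun x : CPm n * CPm n => dFS x.1 x.2).
Proof.
apply: measurable_dFS => i j; have [h1 h2] := mcfun_cpm i j.
 by split; [exact: (measurableT_comp h1 measurable_fst)|exact: (measurableT_comp h2 measurable_fst)].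
by split; [exact: (measurableT_comp h1 measurable_snd)|exact: (measurableT_comp h2 measurable_snd)].
Qed.

Lemma mcfun_vunit disp (X : measurableType disp) n (x : X -> 'I_n.+1 -> C) :
 (forall i, mcfun (fun t => x t i)) -> forall i, mcfun (fun t => vunit (x t) i).
Proof.
move=> mx k.
have mn : meas (fun t : X => nr2 (x t)).
 rewrite /nr2; apply: measurable_sum => l.
 by under eq_fun do rewrite -sqr_cabs; exact: measurable_cabs2.
rewrite (_ : (fun _ => _) = (fun t => if nr2 (x t) == 0 then (k == ord0)%:R
  else ((vnorm (x t))^-1)%:C * x t k)); last first.
 by apply/funext => t; rewrite /vunit; case: ifP.
apply: mcfun_if; [|exact: mcfun_cst|apply: mcfunM => //].
 rewrite (_ : [set _ | _] = [set t | nr2 (x t) <= 0]).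
  by apply: measurable_lef => //; exact: measurable_cst.
 by apply/seteqP; split => t /=; rewrite eq_le nr2_ge0 andbT.
by apply/mcfun_real/measurable_pos_inv => [t|]; [exact: vnorm_ge0|exact: measurable_sqrt].
Qed.


Lemma mcfun_pt d (X : measurableType d) n (x : X -> 'I_n.+1 -> C) :
 (forall i, mcfun (fun t => x t i)) ->
 meas (fun t : X => pt (x t) : CPm n).
Proof.
move=> mx; apply: measurable_to_CP => i j.
have mu := mcfun_vunit mx.
under eq_fun do rewrite /= mxE.
by apply: mcfunM => //; exact: mcfun_conj.
Qed.

Lemma mcfun_pe d (X : measurableType d) n e (p : Hpoly n e) (x : X -> 'I_n.+1 -> C) :
 (forall i, mcfun (fun t => x t i)) -> mcfun (fun t => pe p (x t)).
Proof.
move=> mx; apply: mcfun_sum => a; apply: mcfunM; first exact: mcfun_cst.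
by apply: mcfun_prod => i; exact: mcfunX.
Qed.

End Borel.

(** * Measurable selection of roots *)

Section MeasurableRoots.
Context {disp : measure_display} {X : measurableType disp}.

Definition mcpoly (P : X -> {poly C}) := forall i, mcfun (fun x => (P x)`_i).

Lemma mcpolyC f : mcfun f -> mcpoly (fun x => (f x)%:P).
Proof.
move=> mf i; under eq_fun do rewrite coefC.
by case: (i == 0%N) => //; exact: mcfun_cst.
Qed.
Lemma mcpolyX : mcpoly (fun _ => 'X).
Proof. by move=> i; exact: mcfun_cst. Qed.
Lemma mcpolyD P Q : mcpoly P -> mcpoly Q -> mcpoly (fun x => P x + Q x).
Proof.
by move=> mP mQ i; under eq_fun do rewrite coefD; exact: mcfunD.
Qed.
Lemma mcpolyM P Q : mcpoly P -> mcpoly Q -> mcpoly (fun x => P x * Q x).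
Proof.
move=> mP mQ i; under eq_fun do rewrite coefM.
by apply: mcfun_sum => j; exact: mcfunM.
Qed.
Lemma mcpoly_prod I (s : seq I) (P : I -> X -> {poly C}) : (forall i, mcpoly (P i)) ->
 mcpoly (fun x => \prod_(i <- s) P i x).
Proof.
move=> mP; elim: s => [|i s IH].
 by under eq_fun do rewrite big_nil; move=> i; exact: mcfun_cst.
by under eq_fun do rewrite big_cons; exact: mcpolyM.
Qed.
Lemma mcpolyXn P n : mcpoly P -> mcpoly (fun x => P x ^+ n).
Proof.
move=> mP; elim: n => [|n IH].
 by under eq_fun do rewrite expr0; move=> i; exact: mcfun_cst.
by under eq_fun do rewrite exprS; exact: mcpolyM.
Qed.
Lemma mcpoly_sum I (s : seq I) (p : pred I) (P : I -> X -> {poly C}) :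
 (forall i, mcpoly (P i)) -> mcpoly (fun x => \sum_(i <- s | p i) P i x).
Proof.
move=> mP j; under eq_fun do rewrite coef_sum.
by apply: mcfun_sum => i; exact: mP.
Qed.
Lemma mcfun_horner P (s : C) k : mcpoly P -> (forall x, (size (P x) <= k)%N) ->
 mcfun (fun x => (P x).[s]).
Proof.
move=> mP sP; rewrite (_ : (fun _ => _) = fun x => \sum_(i < k) (P x)`_i * s ^+ i).
 by apply: mcfun_sum => i; apply: mcfunM => //; exact: mcfun_cst.
by apply/funext => x; rewrite (horner_coef_wide _ (sP x)).
Qed.

Lemma poly_near_small (P : {poly C}) z (e : R) : root P z -> 0 < e ->
 exists2 r, 0 < r & forall s, cabs (s - z) < r -> cabs P.[s] < e.
Proof.
move=> /factor_theorem[Q ->] e0.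
pose B := \sum_(i < size Q) cabs Q`_i * (cabs z + 1) ^+ i.
have B0 : 0 <= B by apply: sumr_ge0 => i _; rewrite mulr_ge0 ?exprn_ge0 ?addr_ge0.
exists (Num.min 1 (e / (B + 1))).
 by rewrite lt_min ltr01 divr_gt0// ltr_wpDl.
move=> s; rewrite lt_min => /andP[s1 s2].
rewrite hornerM hornerXsubC cabsM.
have QB : cabs Q.[s] <= B.
 rewrite horner_coef; apply: le_trans (cabs_sum _ _ _) _; apply: ler_sum => i _.
 rewrite cabsM cabsX ler_wpM2l// lerXn2r ?nnegrE ?addr_ge0//.
 by have := cabs_le (s - z) z; rewrite subrK; lra.
apply: (@le_lt_trans _ _ (B * cabs (s - z))); first by rewrite ler_wpM2r.
apply: (@le_lt_trans _ _ ((B + 1) * cabs (s - z))); first by rewrite ler_wpM2r// lerDl.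
by rewrite mulrC -ltr_pdivlMr// ltr_wpDl.
Qed.

Lemma rat_complex_dense (z : C) (e : R) : 0 < e ->
 exists q : rat * rat, cabs ((ratr q.1 : R) +i* (ratr q.2 : R) - z)%C < e.
Proof.
move=> e0; case: z => a b.
have h (x : R) : exists q : rat, `|ratr q - x| < e / 2.
 have [|q] := @rat_in_itvoo R (x - e / 2) (x + e / 2).
  by rewrite ltrD2l gt0_cp// divr_gt0.
 by rewrite in_itv /= => hq; exists q; rewrite ltr_distl.
have [q1 h1] := h a; have [q2 h2] := h b; exists (q1, q2).
exact: cabs_small.
Qed.

(** A countable description of the existence of a root in an open quadrant: a rational point [s]
    with [|P(s)| < e_j ^ (k + 1)] has a root within [e_j], as [P] is monic of degree [k + 1], and
    the margin [e_j] keeps that root in the quadrant. Conversely, rational points close enough to a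
    root of the quadrant qualify. *)
Lemma measurable_root_lt (P : X -> {poly C}) k (b1 b2 : X -> R) : mcpoly P ->
 (forall x, P x \is monic) -> (forall x, size (P x) = k.+2) ->
 meas b1 -> meas b2 ->
 measurable [set x | exists2 z, root (P x) z & Re z < b1 x /\ Im z < b2 x].
Proof.
move=> mP monP sP mb1 mb2.
pose s (q r : rat) : C := ((ratr q : R) +i* (ratr r : R))%C.
pose e (j : nat) : R := j.+1%:R^-1.
have e0 j : 0 < e j by rewrite invr_gt0.
pose U j q r := [set x | cabs (P x).[s q r] < e j ^+ k.+1] `&`
  ([set x | ratr q + e j < b1 x] `&` [set x | ratr r + e j < b2 x]).
rewrite (_ : [set _ | _] = \bigcup_j \bigcup_q \bigcup_r U j q r); last first.
 apply/seteqP; split => x /=.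
  move=> [z rz [h1 h2]].
  pose g := Num.min (b1 x - Re z) (b2 x - Im z).
  have g0 : 0 < g by rewrite lt_min !subr_gt0 h1.
  pose j := Num.truncn (g / 2)^-1.
  have jg : e j < g / 2 by rewrite /e invf_plt ?posrE ?divr_gt0//; exact: truncnS_gt.
  have [r r0 hr] := @poly_near_small (P x) z (e j ^+ k.+1) rz (exprn_gt0 _ (e0 j)).
  have rj0 : 0 < Num.min r (e j) by rewrite lt_min r0 e0.
  have [[q1 q2] hq] := rat_complex_dense z rj0.
  move: hq; rewrite lt_min => /andP[hq1 hq2].
  exists j => //; exists q1 => //; exists q2 => //; split; first exact: hr.
  have [g1 g2] : g <= b1 x - Re z /\ g <= b2 x - Im z.
   by rewrite /g !ge_min !lexx orbT.
  have := le_lt_trans (Re_cabs _) hq2; rewrite ReB /= ltr_norml => /andP[_ a1].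
  have := le_lt_trans (Im_cabs _) hq2; rewrite ImB /= ltr_norml => /andP[_ a2].
  by split => /=; lra.
 move=> [j _ [q _ [r _ [/= h [h1 h2]]]]].
 have [z rz hz] := @root_of_lead (P x) k.+1 (s q r) (sP x) isT.
 exists z => //; move: hz; rewrite (monicP (monP x)) cabs1 mul1r => hz.
 have {}hz : cabs (s q r - z) < e j.
  by rewrite -(@ltr_pXn2r _ k.+1) ?nnegrE ?(ltW (e0 j))// (le_lt_trans hz).
 have := le_lt_trans (Re_cabs _) hz; rewrite ReB /= ltr_norml => /andP[a1 _].
 have := le_lt_trans (Im_cabs _) hz; rewrite ImB /= ltr_norml => /andP[a2 _].
 by split; lra.
apply: bigcup_measurable => j _; apply: bigcupT_measurable_rat => q.
apply: bigcupT_measurable_rat => r; apply: measurableI; last apply: measurableI.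
- apply: measurable_ltf; last exact: measurable_cst.
 by apply: measurable_cabs; apply: (@mcfun_horner _ _ k.+2) => // x; rewrite sP.
- by apply: measurable_ltf => //; exact: measurable_cst.
- by apply: measurable_ltf => //; exact: measurable_cst.
Qed.

Lemma seq_lexmin (zs : seq C) : zs != [::] -> exists2 z, z \in zs &
 forall w, w \in zs -> Re z < Re w \/
  (Re z = Re w /\ Im z <= Im w).
Proof.
elim: zs => // a s IH _; have [->|/IH[z zs zm]] := eqVneq s [::].
 by exists a; rewrite ?mem_head// => w; rewrite inE => /eqP->; right.
have [az|za] := boolP ((Re a < Re z) || ((Re a == Re z) && (Im a <= Im z))).
 exists a; first exact: mem_head.
 move=> w; rewrite inE => /predU1P[->|/zm]; first by right.
 move: az => /orP[az|/andP[/eqP az1 az2]] [zw|[zw1 zw2]].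
 - by left; exact: lt_trans zw.
 - by left; rewrite -zw1.
 - by left; rewrite az1.
 - by right; split; [rewrite az1|exact: le_trans zw2].
exists z; first by rewrite inE zs orbT.
move=> w; rewrite inE => /predU1P[->|/zm//].
move: za; rewrite negb_or negb_and -leNgt -ltNge => /andP[h1 /orP[h2|h2]].
 by left; rewrite lt_neqAle eq_sym h2.
by move: h1; rewrite le_eqVlt => /predU1P[->|]; [right; split => //; exact: ltW|left].
Qed.

(** The lexicographically least root is a canonical choice. Its real part is tested on an increasing
    union of quadrants, its imaginary part among the roots whose real part is almost minimal. *)
Lemma measurable_root (P : X -> {poly C}) k : mcpoly P ->
 (forall x, P x \is monic) -> (forall x, size (P x) = k.+2) ->
 exists2 z : X -> C, mcfun z & forall x, root (P x) (z x).
Proof.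
move=> mP monP sP.
have : forall x, exists z, root (P x) z /\ forall w, root (P x) w ->
  Re z < Re w \/ (Re z = Re w /\ Im z <= Im w).
 move=> x; have P0 : P x != 0 by rewrite -size_poly_eq0 sP.
 have [zs szs Pzs] := poly_roots P0.
 have rE w : root (P x) w = (w \in zs).
  by rewrite Pzs rootZ ?lead_coef_eq0// root_prod_XsubC.
 have zsN : zs != [::] by rewrite -size_eq0 szs sP.
 by have [z zzs zm] := seq_lexmin zsN; exists z; split => [|w]; rewrite rE//; exact: zm.
move=> /choice[z hz]; exists z; last by move=> x; have [] := hz x.
have mRe : meas (fun x : X => Re (z x)).
 apply: measurable_fun_of_lt => c.
 rewrite (_ : [set _ | _] = \bigcup_n [set x | exists2 z, root (P x) z &
   Re z < c /\ Im z < n%:R]).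
  apply: bigcup_measurable => n _; apply: (measurable_root_lt mP monP sP);
  exact: measurable_cst.
 apply/seteqP; split => x /=.
  move=> zc; exists (Num.truncn (Im (z x))).+1 => //=.
  exists (z x); first by have [] := hz x.
  by split => //; exact: truncnS_gt.
 move=> [n _ [w rw [wc _]]]; have [_ /(_ w rw)[/lt_trans|[-> _]//]] := hz x.
 exact.
split=> //; apply: measurable_fun_of_lt => c.
rewrite (_ : [set _ | _] = \bigcap_n [set x | exists2 w, root (P x) w &
   Re w < Re (z x) + n.+1%:R^-1 /\ Im w < c]).
 apply: bigcapT_measurable => n; apply: (measurable_root_lt mP monP sP).
  by apply: measurable_funD => //; exact: measurable_cst.
 exact: measurable_cst.
apply/seteqP; split => x /=.
 move=> zc n _ /=; exists (z x); first by have [] := hz x.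
 by rewrite ltrDl invr_gt0.
move=> h; have [rz zm] := hz x.
apply: contrapT => /negP; rewrite -leNgt => cz.
have P0 : P x != 0 by rewrite -size_poly_eq0 sP.
have [zs szs Pzs] := poly_roots P0.
have rE w : root (P x) w = (w \in zs).
 by rewrite Pzs rootZ ?lead_coef_eq0// root_prod_XsubC.
(* There are finitely many roots, so a gap [e] separates the minimal real part from the others, and
   a root with real part below [Re (z x) + e] attains the minimum. *)
have [e e0 he] : exists2 e : R, 0 < e & forall w, w \in zs -> Re (z x) < Re w ->
  Re (z x) + e <= Re w.
 elim: (zs) => [|a s [e e0 IH]]; first by exists 1.
 have [za|za] := ltP (Re (z x)) (Re a).
  exists (Num.min e (Re a - Re (z x))); first by rewrite lt_min e0 subr_gt0.
  move=> w; rewrite inE => /predU1P[->|ws] hw.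
   by rewrite -lerBrDl ge_min lexx orbT.
  by apply: le_trans (IH w ws hw); rewrite lerD2l ge_min lexx.
 exists e => // w; rewrite inE => /predU1P[->|]; first by rewrite ltNge za.
 exact: IH.
pose n := Num.truncn e^-1.
have ne : n.+1%:R^-1 < e by rewrite invf_plt ?posrE//; exact: truncnS_gt.
have [w rw [w1 w2]] := h n I.
have [zw|[zw1 zw2]] := zm w rw.
 have := he w; rewrite -rE rw => /(_ isT zw) h1.
 by move: w1 h1 ne; set t := n.+1%:R^-1; lra.
by have := le_lt_trans (le_trans cz zw2) w2; rewrite ltxx.
Qed.

(** One root is removed at a time; the coefficients of the quotient are measurable by synthetic
    division from the top. *)
Lemma measurable_roots (P : X -> {poly C}) k : mcpoly P ->
 (forall x, P x \is monic) -> (forall x, size (P x) = k.+1) ->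
 exists zs : seq (X -> C), [/\ size zs = k, (forall z, List.In z zs -> mcfun z) &
  forall x, P x = \prod_(z <- zs) ('X - (z x)%:P)].
Proof.
elim: k P => [|k IH] P mP monP sP.
 exists [::]; split => // x; rewrite big_nil.
 have /eqP/size_poly1P[c c0 Pc] := sP x.
 by move: (monP x); rewrite Pc monicE lead_coefC => /eqP ->.
have [z mz rz] := measurable_root mP monP sP.
have /choice[Q hQ] : forall x, exists Q, P x = ('X - (z x)%:P) * Q.
 by move=> x; have /factor_theorem[Q ->] := rz x; exists Q; rewrite mulrC.
have Q0 x : Q x != 0.
 by apply: contraTneq (monP x) => Qx0; rewrite hQ Qx0 mulr0 monicE lead_coef0 eq_sym oner_eq0.
have sQ x : size (Q x) = k.+1.
 by apply: succn_inj; rewrite -(sP x) hQ size_XsubC_mul.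
have Qm x : Q x \is monic by have := monP x; rewrite hQ monicMl ?monicXsubC.
have mQ : mcpoly Q.
 suff h j i : (k.+1 <= i + j)%N -> mcfun (fun x => (Q x)`_i).
  by move=> i; apply: (h k.+1); rewrite leq_addl.
 elim: j i => [|j IHj] i.
  rewrite addn0 => ki; rewrite (_ : (fun _ => _) = fun _ => 0); first exact: mcfun_cst.
  by apply/funext => x; rewrite nth_default// sQ.
 rewrite addnS -addSn => ki; rewrite (_ : (fun _ => _) = fun x => (P x)`_i.+1 + z x * (Q x)`_i.+1).
  by apply: mcfunD => //; apply: mcfunM => //; exact: IHj.
 by apply/funext => x; rewrite hQ coef_mulXsubC subrK.
have [zs [szs mzs Pzs]] := IH Q mQ Qm sQ.
exists (z :: zs); split; first by rewrite /= szs.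
 by move=> y /= [<-//|]; exact: mzs.
by move=> x; rewrite big_cons -Pzs hQ.
Qed.

(** Selecting the first index that works makes choices from a dense sequence measurable; [c0] is the
    value where no index works. *)
Lemma measurable_first (b : nat -> X -> bool) (F : nat -> X -> C) (c0 : C) :
 (forall n, measurable [set x | b n x]) -> (forall n, mcfun (F n)) ->
 exists2 g : X -> C, mcfun g & forall x,
  (forall n, b n x -> (forall k, (k < n)%N -> ~~ b k x) -> g x = F n x).
Proof.
move=> mb mF.
pose fst n := [set x | b n x] `&` \bigcap_(k in [set k | (k < n)%N]) [set x | ~~ b k x].
have mfst n : measurable (fst n).
 apply: measurableI => //; rewrite bigcap_mkord; apply: bigsetI_measurable => k _.
 rewrite (_ : [set _ | _] = ~` [set x | b k x]); first exact: measurableC.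
 by apply/seteqP; split => x /= /negP.
pose g x := if pselect (exists n, fst n x) is left h then F (sval (cid h)) x else c0.
have funiq x n k : fst n x -> fst k x -> n = k.
 move=> [/= bn hn] [/= bk hk]; apply/eqP; rewrite eqn_leq; apply/andP; split; rewrite leqNgt.
  by apply/negP => /hn /=; rewrite bk.
 by apply/negP => /hk /=; rewrite bn.
have gE x n : fst n x -> g x = F n x.
 move=> fn; rewrite /g; case: pselect => [h|[]]; last by exists n.
 by case: (cid h) => k fk /=; rewrite (funiq _ _ _ fn fk).
exists g; last first.
 by move=> x n bn hn; apply: gE; split => // k /= kn; exact: hn.
have mg (h : C -> R) : (forall f, mcfun f -> meas (fun x : X => h (f x))) ->
  meas (fun x : X => h (g x)).
 move=> mh; apply: measurable_fun_of_lt => c.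
 rewrite (_ : [set _ | _] = (\bigcup_n (fst n `&` [set x | h (F n x) < c])) `|`
   ((~` \bigcup_n fst n) `&` [set x | h c0 < c])); last first.
  apply/seteqP; split => x /=.
   move=> gc; have [[n _ fn]|nf] := pselect ((\bigcup_n fst n) x).
    by left; exists n => //; split => //=; rewrite -(gE _ _ fn).
   right; split => //; move: gc; rewrite /g; case: pselect => // [[n fn]].
   by exfalso; apply: nf; exists n.
  move=> [[n _ [fn /=]]|[nf /= hc]]; first by rewrite (gE _ _ fn).
  rewrite /g; case: pselect => // [[n fn]].
  by exfalso; apply: nf; exists n.
 apply: measurableU.
  apply: bigcup_measurable => n _; apply: measurableI => //.
  by apply: measurable_ltf; [exact: mh|exact: measurable_cst].
 apply: measurableI; first by apply: measurableC; exact: bigcup_measurable.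
 by apply: measurable_ltf; exact: measurable_cst.
by split; apply: mg => f [].
Qed.

End MeasurableRoots.

(** * Convergence of polynomials along filters *)

Section ComplexConvergence.
Context {T : Type} {F : set_system T} {FF : Filter F}.

Definition ccvg (F : set_system T) (f : T -> C) (l : C) :=
 forall e : R, 0 < e -> F [set t | cabs (f t - l) < e].

Lemma ccvg_cst c : ccvg F (fun _ => c) c.
Proof. by move=> e e0; apply: filterS filterT => t _ /=; rewrite subrr cabs0. Qed.
Lemma ccvgD f g a b : ccvg F f a -> ccvg F g b -> ccvg F (fun t => f t + g t) (a + b).
Proof.
move=> fa gb e e0; have e2 : 0 < e / 2 by rewrite divr_gt0.
apply: filterS2 (fa _ e2) (gb _ e2) => t /= h1 h2.
by rewrite opprD addrACA (le_lt_trans (cabs_le _ _))// (splitr e) ltrD.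
Qed.
Lemma ccvgM f g a b : ccvg F f a -> ccvg F g b -> ccvg F (fun t => f t * g t) (a * b).
Proof.
move=> fa gb e e0; pose B := cabs a + cabs b + 1.
have B0 : 0 < B by rewrite ltr_wpDl// addr_ge0.
pose e1 := Num.min 1 (e / (2 * B)).
have e10 : 0 < e1 by rewrite lt_min ltr01 divr_gt0// mulr_gt0.
apply: filterS2 (fa _ e10) (gb _ e10) => t /= h1 h2.
have -> : f t * g t - a * b = (f t - a) * g t + a * (g t - b) by ring.
rewrite (le_lt_trans (cabs_le _ _))// !cabsM.
have e11 : e1 <= 1 by rewrite ge_min lexx.
have gB : cabs (g t) <= cabs b + 1.
 have := cabs_le (g t - b) b; rewrite subrK => h; lra.
have e1B : e1 * (2 * B) <= e by rewrite -ler_pdivlMr ?mulr_gt0// ge_min lexx orbT.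
have a1 : cabs (f t - a) * cabs (g t) <= e1 * (cabs b + 1) by rewrite ler_pM// ltW.
have a2 : cabs a * cabs (g t - b) <= e1 * cabs a by rewrite mulrC ler_wpM2r// ltW.
have a3 : 0 < e1 * B by rewrite mulr_gt0.
have : e1 * (cabs b + 1) + e1 * cabs a = e1 * B by rewrite /B; ring.
lra.
Qed.
Lemma ccvg_sum I (s : seq I) (P : pred I) (f : I -> T -> C) (a : I -> C) :
 (forall i, ccvg F (f i) (a i)) ->
 ccvg F (fun t => \sum_(i <- s | P i) f i t) (\sum_(i <- s | P i) a i).
Proof.
move=> h; elim: s => [|i s IH].
 by rewrite big_nil; under eq_fun do rewrite big_nil; exact: ccvg_cst.
rewrite big_cons; under eq_fun do rewrite big_cons.
by case: (P i) => //; exact: ccvgD.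
Qed.
Lemma ccvg_prod I (s : seq I) (f : I -> T -> C) (a : I -> C) :
 (forall i, ccvg F (f i) (a i)) ->
 ccvg F (fun t => \prod_(i <- s) f i t) (\prod_(i <- s) a i).
Proof.
move=> h; elim: s => [|i s IH].
 by rewrite big_nil; under eq_fun do rewrite big_nil; exact: ccvg_cst.
by rewrite big_cons; under eq_fun do rewrite big_cons; exact: ccvgM.
Qed.
Lemma ccvgX f a n : ccvg F f a -> ccvg F (fun t => f t ^+ n) (a ^+ n).
Proof.
move=> h; elim: n => [|n IH].
 by rewrite expr0; under eq_fun do rewrite expr0; exact: ccvg_cst.
by rewrite exprS; under eq_fun do rewrite exprS; exact: ccvgM.
Qed.
Lemma ccvg_neq0 f a : a != 0 -> ccvg F f a -> F [set t | f t != 0].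
Proof.
move=> a0 fa; have a0' : 0 < cabs a by rewrite cabs_gt0.
apply: filterS (fa _ a0') => t /=; apply: contraTneq => ->.
by rewrite sub0r cabsN ltxx.
Qed.

Definition pcvg (F : set_system T) (P : T -> {poly C}) (Q : {poly C}) :=
 forall i, ccvg F (fun t => (P t)`_i) Q`_i.

Lemma pcvgC f a : ccvg F f a -> pcvg F (fun t => (f t)%:P) a%:P.
Proof.
move=> h i; rewrite coefC; under eq_fun do rewrite coefC.
by case: (i == 0%N) => //; exact: ccvg_cst.
Qed.
Lemma pcvg_cst Q : pcvg F (fun _ => Q) Q.
Proof. by move=> i; exact: ccvg_cst. Qed.
Lemma pcvgD P Q A B : pcvg F P A -> pcvg F Q B -> pcvg F (fun t => P t + Q t) (A + B).
Proof.
move=> h1 h2 i; rewrite coefD; under eq_fun do rewrite coefD.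
exact: ccvgD.
Qed.
Lemma pcvgM P Q A B : pcvg F P A -> pcvg F Q B -> pcvg F (fun t => P t * Q t) (A * B).
Proof.
move=> h1 h2 i; rewrite coefM; under eq_fun do rewrite coefM.
by apply: ccvg_sum => j; exact: ccvgM.
Qed.
Lemma pcvg_sum I (s : seq I) (p : pred I) (P : I -> T -> {poly C}) (Q : I -> {poly C}) :
 (forall i, pcvg F (P i) (Q i)) ->
 pcvg F (fun t => \sum_(i <- s | p i) P i t) (\sum_(i <- s | p i) Q i).
Proof.
move=> h; elim: s => [|i s IH].
 by rewrite big_nil; under eq_fun do rewrite big_nil; exact: pcvg_cst.
rewrite big_cons; under eq_fun do rewrite big_cons.
by case: (p i) => //; exact: pcvgD.
Qed.
Lemma pcvg_prod I (s : seq I) (P : I -> T -> {poly C}) (Q : I -> {poly C}) :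
 (forall i, pcvg F (P i) (Q i)) ->
 pcvg F (fun t => \prod_(i <- s) P i t) (\prod_(i <- s) Q i).
Proof.
move=> h; elim: s => [|i s IH].
 by rewrite big_nil; under eq_fun do rewrite big_nil; exact: pcvg_cst.
by rewrite big_cons; under eq_fun do rewrite big_cons; exact: pcvgM.
Qed.
Lemma pcvgXn P A n : pcvg F P A -> pcvg F (fun t => P t ^+ n) (A ^+ n).
Proof.
move=> h; elim: n => [|n IH].
 by rewrite expr0; under eq_fun do rewrite expr0; exact: pcvg_cst.
by rewrite exprS; under eq_fun do rewrite exprS; exact: pcvgM.
Qed.

Lemma ccvg_pe n d (p : T -> Hpoly n d) (p0 : Hpoly n d)
  (x : T -> 'I_n.+1 -> C) (x0 : 'I_n.+1 -> C) :
 (forall a, ccvg F (fun t => p t a) (p0 a)) ->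
 (forall i, ccvg F (fun t => x t i) (x0 i)) -> ccvg F (fun t => pe (p t) (x t)) (pe p0 x0).
Proof.
move=> hp hx; apply: ccvg_sum => a; apply: ccvgM => //.
by apply: ccvg_prod => i; exact: ccvgX.
Qed.

Lemma pcvg_lp n d (p : T -> Hpoly n d) (p0 : Hpoly n d)
  (x y : T -> 'I_n.+1 -> C) (x0 y0 : 'I_n.+1 -> C) :
 (forall a, ccvg F (fun t => p t a) (p0 a)) ->
 (forall i, ccvg F (fun t => x t i) (x0 i)) -> (forall i, ccvg F (fun t => y t i) (y0 i)) ->
 pcvg F (fun t => lp (p t) (x t) (y t)) (lp p0 x0 y0).
Proof.
move=> hp hx hy; apply: pcvg_sum => a; apply: pcvgM; first exact: pcvgC.
apply: pcvg_prod => i; apply: pcvgXn; apply: pcvgD; first exact: pcvgC.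
by apply: pcvgM; [exact: pcvg_cst|exact: pcvgC].
Qed.

End ComplexConvergence.

Section VectorFilter.
Context {N : nat}.

Definition vnbhs (x : 'I_N -> C) : set_system ('I_N -> C) :=
 [set A | exists2 r : R, 0 < r & forall y, (forall i, cabs (y i - x i) < r) -> A y].

Global Instance vnbhs_filter x : Filter (vnbhs x).
Proof.
split; first by exists 1.
 move=> A B [r1 r10 h1] [r2 r20 h2]; exists (Num.min r1 r2).
  by rewrite lt_min r10.
 move=> y hy; split; [apply: h1|apply: h2] => i; have := hy i;
 by rewrite lt_min => /andP[].
by move=> A B AB [r r0 h]; exists r => // y /h; exact: AB.
Qed.

Lemma ccvg_vnbhs x i : ccvg (vnbhs x) (fun y => y i) (x i).
Proof. by move=> e e0; exists e => // y; exact. Qed.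

Lemma ccvg_mv (M : 'M[C]_N) x i : ccvg (vnbhs x) (fun y => mv M y i) (mv M x i).
Proof.
apply: ccvg_sum => j; apply: ccvgM; [exact: ccvg_cst|exact: ccvg_vnbhs].
Qed.

Definition qvec (n : nat) : 'I_N -> C :=
 if @unpickle {ffun 'I_N -> rat * rat} n is Some q
 then fun i => ((ratr (q i).1 : R) +i* (ratr (q i).2 : R))%C else fun _ => 0.

Lemma qvec_dense (x : 'I_N -> C) A : vnbhs x A -> exists n, A (qvec n).
Proof.
move=> [e e0 hA]; have /choice[q hq] : forall i, exists q : rat * rat,
  cabs ((ratr q.1 : R) +i* (ratr q.2 : R) - x i)%C < e.
 by move=> i; exact: rat_complex_dense.
exists (pickle [ffun i => q i]); apply: hA => i.
by rewrite /qvec pickleK ffunE.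
Qed.

End VectorFilter.

(** * Measurable frames and labelled zeros on lines *)

Section LabelledRoots.
Context {m d : nat}.
Notation vec := ('I_m.+2 -> C).

(** These are the lines on which [p] is not identically zero; on all others [mult] is 0 by
    convention. *)
Definition nondeg (p : Hpoly m.+1 d) (L : Gr m) :=
 exists2 w : vec, mv (grm L) w =1 w & pe p w != 0.

Lemma mv_grm_idem (L : Gr m) (x : vec) : mv (grm L) (mv (grm L) x) =1 mv (grm L) x.
Proof.
have /and3P[_ /eqP LL _] := @grm_proj R m L.
by move=> i; rewrite -mv_mul LL.
Qed.

Lemma mcfun_mv_grm (x : vec) i : mcfun (fun L : Grm m => mv (grm L) x i).
Proof.
by apply: mcfun_sum => j; apply: mcfunM; [exact: mcfun_grm|exact: mcfun_cst].
Qed.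

Lemma frame_project (L : Gr m) (e f : vec) (x : vec) : frame L e f ->
 nr2 (fun i => mv (grm L) x i - dotc f (mv (grm L) x) * f i) != 0 ->
 frame L (vunit (fun i => mv (grm L) x i - dotc f (mv (grm L) x) * f i)) f.
Proof.
move=> fr; have [e1 f1 ef gE] := fr.
set y := mv (grm L) x; set g := (fun i => _) => g0.
have gE' : g =1 fun i => dotc e y * e i.
 have := frame_lin fr (mv_grm_idem L x); rewrite -/y => h i.
 by rewrite /g h /lin2 addrK.
have c0 : dotc e y != 0.
 apply: contraNneq g0 => c0; rewrite nr2_eq0; apply/forallP => i.
 by rewrite gE' c0 mul0r.
have nE : nr2 g = cabs (dotc e y) ^+ 2.
 by rewrite (_ : g = fun i => dotc e y * e i) ?nr2_scale ?e1 ?mulr1//; apply/funext.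
pose u := ((vnorm g)^-1)%:C * dotc e y.
have uE : vunit g =1 fun i => u * e i.
 by move=> i; rewrite /vunit (negbTE g0) gE' mulrA.
have u1 : cabs u = 1.
 rewrite /u cabsM cabs_real ger0_norm ?invr_ge0 ?vnorm_ge0//.
 by rewrite /vnorm nE sqrtr_sqr ger0_norm// mulVf// cabs_eq0.
have -> : vunit g = fun i => u * e i by apply/funext.
split => //.
- by rewrite nr2_scale u1 e1 expr1n mulr1.
- rewrite -[LHS](_ : dotc (lin2 u e 0 e) f = _); last first.
  by apply: eq_bigr => i _; rewrite /lin2 mul0r addr0.
 by rewrite dotc_linl ef conjc0 mulr0 mul0r addr0.
- by rewrite gE outer_scale u1 expr1n scale1r.
Qed.

Lemma pe0 (p : Hpoly m.+1 d) (x : vec) : (0 < d)%N -> nr2 x = 0 -> pe p x = 0.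
Proof.
move=> d0 /eqP; rewrite nr2_eq0 => /forallP h.
have -> : pe p x = pe p (fun i => 0 * x i).
 by apply: pe_ext => i; rewrite mul0r; exact/eqP.
by rewrite pe_scale expr0n gtn_eqF ?mul0r.
Qed.

Lemma measurable_pe_neq0 (p : Hpoly m.+1 d) n : measurable [set L : Grm m | pe p (mv (grm L) (qvec n)) != 0].
Proof.
rewrite (_ : [set _ | _] = ~` [set L | pe p (mv (grm L) (qvec n)) == 0]).
 by apply/measurableC/measurable_mc_eq0/mcfun_pe => i; exact: mcfun_mv_grm.
by apply/seteqP; split => L /= /negP.
Qed.

Lemma nondeg_qvec (p : Hpoly m.+1 d) L : nondeg p L -> exists n, pe p (mv (grm L) (qvec n)) != 0.
Proof.
move=> [w Lw pw]; have pw' : pe p (mv (grm L) w) != 0 by rewrite (pe_ext p Lw).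
have [|n hn] := @qvec_dense _ w [set x | pe p (mv (grm L) x) != 0]; last by exists n.
by apply: (ccvg_neq0 pw'); apply: ccvg_pe => [a|i]; [exact: ccvg_cst|exact: ccvg_mv].
Qed.

(** Rational vectors [qvec n] are projected to the line: [f] comes from the first projection at
    which [p] does not vanish, and [e] from the first one with a nonzero component orthogonal to
    [f]. *)
Lemma frame_measurable (p : Hpoly m.+1 d) : (0 < d)%N -> exists e f : Grm m -> vec,
 [/\ forall i, mcfun (fun L => e L i), forall i, mcfun (fun L => f L i) &
  forall L, nondeg p L -> frame L (e L) (f L) /\ pe p (f L) != 0].
Proof.
move=> d0; pose b1 n (L : Grm m) := pe p (mv (grm L) (qvec n)) != 0.
have mb1 n : measurable [set L | b1 n L] by exact: measurable_pe_neq0.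
have /choice[g1 hg1] : forall i, exists g : Grm m -> C, mcfun g /\ forall L,
  (forall n, b1 n L -> (forall k, (k < n)%N -> ~~ b1 k L) -> g L = mv (grm L) (qvec n) i).
 move=> i; have [g mg hg] := measurable_first 0 mb1 (fun n => mcfun_mv_grm (qvec n) i).
 by exists g.
pose f L := vunit (fun i => g1 i L).
have mf i : mcfun (fun L => f L i).
 by apply: mcfun_vunit => j; have [] := hg1 j.
pose G n (L : Grm m) : vec :=
 fun i => mv (grm L) (qvec n) i - dotc (f L) (mv (grm L) (qvec n)) * f L i.
have mG n i : mcfun (fun L => G n L i).
 apply: mcfunD; first exact: mcfun_mv_grm.
 apply: mcfunN; apply: mcfunM => //; apply: mcfun_sum => j.
 by apply: mcfunM; [exact: mcfun_conj|exact: mcfun_mv_grm].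
pose b2 n (L : Grm m) := nr2 (G n L) != 0.
have mb2 n : measurable [set L | b2 n L].
 rewrite (_ : [set _ | _] = [set L | 0 < nr2 (G n L)]).
  apply: measurable_ltf; first exact: measurable_cst.
  apply: measurable_sum => k.
  by under eq_fun do rewrite -sqr_cabs; exact: measurable_cabs2.
 by apply/seteqP; split => L /=; rewrite lt_def nr2_ge0 andbT.
have /choice[g2 hg2] : forall i, exists g : Grm m -> C, mcfun g /\ forall L,
  (forall n, b2 n L -> (forall k, (k < n)%N -> ~~ b2 k L) -> g L = G n L i).
 move=> i; have [g mg hg] := measurable_first 0 mb2 (fun n => mG n i).
 by exists g.
pose e L := vunit (fun i => g2 i L).
have first_ex (b : pred nat) : (exists n, b n) -> exists2 n, b n & forall k, (k < n)%N -> ~~ b k.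
 move=> h; exists (ex_minn h); first by case: ex_minnP.
 case: ex_minnP => n bn nmin k kn; apply/negP => /nmin.
 by rewrite leqNgt kn.
exists e, f; split => //.
 by move=> i; apply: mcfun_vunit => j; have [] := hg2 j.
move=> L /nondeg_qvec ndL.
have [n1 bn1 hn1] : exists2 n, b1 n L & forall k, (k < n)%N -> ~~ b1 k L by exact: first_ex.
have g1E i : g1 i L = mv (grm L) (qvec n1) i by have [_ /(_ L n1 bn1 hn1)] := hg1 i.
have g1E' : (fun i => g1 i L) = mv (grm L) (qvec n1) by apply/funext.
have x0 : nr2 (mv (grm L) (qvec n1)) != 0.
 by apply: contraNneq bn1 => x0; rewrite pe0.
have fE : f L = fun i => ((vnorm (mv (grm L) (qvec n1)))^-1)%:C * mv (grm L) (qvec n1) i.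
 by rewrite /f g1E' /vunit (negbTE x0).
have f1 : nr2 (f L) = 1 by exact: nr2_vunit.
have Lf : mv (grm L) (f L) =1 f L.
 move=> i; rewrite fE; have := mv_lin2 (grm L) ((vnorm (mv (grm L) (qvec n1)))^-1)%:C
  (mv (grm L) (qvec n1)) 0 (fun=> 0) i.
 rewrite mul0r addr0 mv_grm_idem => <-.
 by congr mv; apply/funext => k; rewrite /lin2 mul0r addr0.
have pf : pe p (f L) != 0.
 rewrite fE pe_scale mulf_neq0// expf_neq0//.
 rewrite -cabs_eq0 cabs_real normr_eq0 invr_eq0 /vnorm sqrtr_eq0 -ltNge.
 by rewrite lt_def x0 nr2_ge0.
split=> //; have [e0 fr0] := frame_of f1 Lf.
have fr : frame L (fun i => - e0 i) (f L).
 have [a1 a2 a3 a4] := fr0; have eN : (fun i => - e0 i) = fun i => -1 * e0 i.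
  by apply/funext => i; rewrite mulN1r.
 split => //.
 - by rewrite eN nr2_scale cabsN cabs1 expr1n mul1r.
 - have -> : dotc (fun i => - e0 i) (f L) = dotc (lin2 (-1) e0 0 e0) (f L).
   by apply: eq_bigr => i _; rewrite /lin2 mul0r addr0 mulN1r.
  by rewrite dotc_linl (dotcC (f L) e0) a3 conjc0 !mulr0 addr0.
 - by rewrite a4 eN outer_scale cabsN cabs1 expr1n scale1r addrC.
have [n2 bn2 hn2] : exists2 n, b2 n L & forall k, (k < n)%N -> ~~ b2 k L.
 apply: first_ex; have [a1 _ a3 _] := fr; set e1 := fun i => _ in a1 a3 fr.
 have /existsP[i ei] : [exists i, e1 i != 0] by rewrite -nr2_gt0 a1.
 pose h (x : vec) := mv (grm L) x i - dotc (f L) (mv (grm L) x) * f L i.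
 have he : h e1 = e1 i.
  have [_ _ _ gE] := fr; have Le k : mv (grm L) e1 k = e1 k.
   have := frame_mv 1 0 fr k; rewrite (_ : lin2 1 e1 0 (f L) = e1)//.
   by apply/funext => l; rewrite /lin2 mul1r mul0r addr0.
  rewrite /h Le (_ : dotc _ _ = 0) ?mul0r ?subr0//.
  rewrite -[RHS](conjc0 R) -a3 -dotcC; apply: eq_bigr => k _; by rewrite Le.
 have [|n hn] := @qvec_dense _ e1 [set x | h x != 0].
  apply: (@ccvg_neq0 _ _ _ _ (h e1)); first by rewrite he.
  apply: ccvgD; first exact: ccvg_mv.
  rewrite -mulN1r; under eq_fun do rewrite -mulN1r.
  apply: ccvgM; first exact: ccvg_cst.
  apply: ccvgM; last exact: ccvg_cst.
  apply: ccvg_sum => k; apply: ccvgM; [exact: ccvg_cst|exact: ccvg_mv].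
 exists n; rewrite /b2 nr2_eq0; apply/forallPn; exists i; exact: hn.
have g2E : (fun i => g2 i L) = G n2 L.
 by apply/funext => i; have [_ /(_ L n2 bn2 hn2)] := hg2 i.
by rewrite /e g2E; exact: (frame_project fr (x := qvec n2) bn2).
Qed.

(** Division by [p(f)] gives a monic polynomial with measurable coefficients, to which
    [measurable_roots] applies; ['X^d] stands in where [p(f) = 0]. *)
Lemma labelled_roots (p : Hpoly m.+1 d) : (0 < d)%N -> exists zs : seq (Grm m -> CPm m.+1),
 [/\ size zs = d, (forall z, List.In z zs -> meas z) &
  forall L, nondeg p L -> exists e f ss, [/\ frame L e f, pe p f != 0, roots_on p e f ss &
   [seq z L | z <- zs] = [seq (pt (lin2 1 e s f) : CPm m.+1) | s <- ss]]].
Proof.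
move=> d0; have [e [f [me mf ef]]] := frame_measurable p d0.
pose P (L : Grm m) : {poly C} := if pe p (f L) == 0 then 'X^d
  else (pe p (f L))^-1 *: lp p (e L) (f L).
have mpf : mcfun (fun L => pe p (f L)) by exact: mcfun_pe.
have mP : mcpoly P.
 move=> i; rewrite /P; under eq_fun do rewrite (fun_if (fun q : {poly C} => q`_i)) coefZ.
 apply: mcfun_if; first exact: measurable_mc_eq0.
  exact: mcfun_cst.
 apply: mcfunM; first exact: mcfunV.
 move: i; apply: mcpoly_sum => a; apply: mcpolyM; first by move=> i; exact: mcfun_cst.
 apply: mcpoly_prod => i; apply: mcpolyXn; apply: mcpolyD; first exact: mcpolyC.
 by apply: mcpolyM; [exact: mcpolyX|exact: mcpolyC].
have monP L : P L \is monic.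
 rewrite /P; case: eqP => [_|/eqP pf]; first exact: monicXn.
 by rewrite monicE lead_coefZ (lead_lp _ pf).2 mulVf.
have sP L : size (P L) = d.+1.
 rewrite /P; case: eqP => [_|/eqP pf]; first by rewrite size_polyXn.
 by rewrite size_scale ?invr_eq0// (lead_lp _ pf).1.
have [ss [sss mss Pss]] := measurable_roots mP monP sP.
exists [seq (fun L => pt (lin2 1 (e L) (s L) (f L))) | s <- ss]; split.
- by rewrite size_map.
- move=> z; elim: (ss) mss => //= s t IH mst [<-|]; last by apply: IH => y yt; apply: mst; right.
 apply: mcfun_pt => i; apply: mcfunD.
  by apply: mcfunM => //; exact: mcfun_cst.
 by apply: mcfunM => //; apply: mst; left.
move=> L /ef[fr pf]; exists (e L), (f L), [seq s L | s <- ss]; split => //.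
 apply: roots_onP; first by rewrite size_map.
 have := Pss L; rewrite /P (negbTE pf) big_map => <-.
 by rewrite scalerA mulfV// scale1r.
by rewrite -!map_comp.
Qed.

End LabelledRoots.

(** * Constructions of probability measures *)

Section ProbabilityConstructions.
Local Open Scope ereal_scope.

Section OfMeasure.
Context d (T : measurableType d) (mu : {measure set T -> \bar R}) (mu1 : mu setT = 1).
Definition prob_of := let _ := mu1 in (mu : set T -> \bar R).
HB.instance Definition _ := Measure.on prob_of.
HB.instance Definition _ := Measure_isProbability.Build _ _ _ prob_of mu1.
Definition probability_of : probability T R := prob_of.
End OfMeasure.

Lemma pushprob d1 d2 (X : measurableType d1) (Y : measurableType d2) (P : probability X R)
  (f : X -> Y) : meas f ->
 exists Q : probability Y R, (forall A, Q A = P (f @^-1` A)) /\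
  forall g : Y -> \bar R, meas g -> (forall y, 0 <= g y) ->
   \int[Q]_y g y = \int[P]_x g (f x).
Proof.
move=> mf; pose mf' := [the {mfun X >-> Y} of mfun_Sub (mem_set mf)].
exists (distribution P mf'); split => // g mg g0.
by rewrite ge0_integral_distribution.
Qed.

Lemma mixture d (T : measurableType d) (n : nat) (c : nat -> R) (Q : nat -> probability T R) :
 (forall i, (0 <= c i)%R) -> (\sum_(i < n) c i = 1)%R ->
 exists P : probability T R, (forall A, P A = \sum_(i < n) (c i)%:E * Q i A) /\
  forall g : T -> \bar R, meas g -> (forall y, 0 <= g y) ->
   \int[P]_y g y = \sum_(i < n) (c i)%:E * \int[Q i]_x g x.
Proof.
move=> c0 c1; pose m i : {measure set T -> \bar R} := mscale (NngNum (c0 i)) (Q i).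
have h1 : msum m n setT = 1.
 rewrite (_ : msum m n setT = \sum_(i < n) (c i)%:E * Q i setT)//.
 under eq_bigr do rewrite probability_setT mule1.
 by rewrite sumEFin c1.
exists (probability_of h1); split => // g mg g0.
rewrite ge0_integral_measure_sum//; apply: eq_bigr => i _.
by rewrite ge0_integral_mscale.
Qed.

(** Conditioning on [B] in product form, so that a null [B] is no exception: any [Q] serves
    there. *)
Lemma cond_prob d (T : measurableType d) (P : probability T R) (B : set T) : measurable B ->
 exists Q : probability T R, forall A, measurable A -> P (A `&` B) = P B * Q A.
Proof.
move=> mB; have [PB0|PB0] := eqVneq (P B) 0.
 exists P => A mA; rewrite PB0 mul0e; apply/eqP; rewrite eq_le measure_ge0 andbT -PB0.
 by apply: le_measure; rewrite ?inE//; exact: measurableI.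
have fB : P B \is a fin_num by exact: fin_num_measure.
have c0 : (0 <= (fine (P B))^-1)%R by rewrite invr_ge0 fine_ge0.
have fB0 : fine (P B) != 0%R by rewrite fine_eq0.
have h1 : mscale (NngNum c0) (mrestr P mB) setT = 1.
 rewrite (_ : mscale _ _ _ = ((fine (P B))^-1)%:E * P (setT `&` B))// setTI -[P B]fineK//.
 by rewrite -EFinM mulVf.
exists (probability_of h1) => A mA.
by rewrite /= /prob_of /= /mscale /mrestr /= muleA -[P B]fineK// -EFinM mulfV// mul1e.
Qed.

End ProbabilityConstructions.

Lemma round_near (x y K : R) : 0 < K -> 0 <= x -> 0 <= y ->
 Num.truncn (x * K) = Num.truncn (y * K) -> `|x - y| <= K^-1.
Proof.
move=> K0 x0 y0 E.
have /andP[a1 a2] := truncn_itv (mulr_ge0 x0 (ltW K0)).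
have /andP[b1 b2] := truncn_itv (mulr_ge0 y0 (ltW K0)).
rewrite E in a1 a2.
have : `|(x - y) * K| <= 1.
 rewrite mulrBl ler_norml; move: a1 a2 b1 b2; rewrite -natr1.
 by set t := (Num.truncn _)%:R; move=> *; apply/andP; split; lra.
by rewrite normrM (gtr0_norm K0) -ler_pdivlMr// mul1r.
Qed.

(** Real and imaginary parts of the entries lie in [[-1, 1]] and are rounded at scale [1 / K]. Equal
    roundings give entries within [2 / K], hence distance at most [3 (n + 1) 2 / K = e]. *)
Lemma finite_cells n (e : R) : 0 < e -> exists (N : nat) (c : CPm n -> nat),
 [/\ forall i, measurable [set z | c z = i], forall z, (c z < N)%N &
   forall z w, c z = c w -> dFS R z w <= e].
Proof.
move=> e0; pose K : R := (e / (6 * n.+1%:R))^-1.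
have K0 : 0 < K by rewrite invr_gt0 divr_gt0// mulr_gt0.
pose I := ('I_n.+1 * 'I_n.+1 * bool)%type.
pose f (z : CPm n) (k : I) : R := ReIm_entry (@Defs.cpm R n) z k + 1.
have fb z k : 0 <= f z k <= 2.
 have ent i j : cabs (cpm z i j) <= 1.
  have [x x1 ->] := CPP z; rewrite cpm_pt1// mxE cabsM cabs_conj.
  have h l : cabs (x l) <= 1 by have := cabs_le_vnorm x l; rewrite /vnorm x1 sqrtr1.
  by rewrite -(mulr1 1) ler_pM.
 rewrite /f /ReIm_entry; case: k => [[i j] []] /=.
  have := le_trans (Re_cabs _) (ent i j); rewrite ler_norml => /andP[]; lra.
 have := le_trans (Im_cabs _) (ent i j); rewrite ler_norml => /andP[]; lra.
pose M := (Num.truncn (2 * K)).+1.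
pose phi z : {ffun I -> 'I_M.+1} := [ffun k => inord (Num.truncn (f z k * K))].
have fM z k : (Num.truncn (f z k * K) < M)%N.
 rewrite ltnS le_truncn// ler_wpM2r ?(ltW K0)//; by have /andP[] := fb z k.
exists #|{: {ffun I -> 'I_M.+1}}|, (fun z => enum_rank (phi z) : nat); split.
- move=> i; have [iN|iN] := ltnP i #|{: {ffun I -> 'I_M.+1}}|; last first.
  rewrite (_ : [set _ | _] = set0)//; apply/seteqP; split => z //= zi.
  by have := ltn_ord (enum_rank (phi z)); rewrite zi ltnNge iN.
 rewrite (_ : [set _ | _] = \big[setI/setT]_(k <- index_enum I)
   [set z | Num.truncn (f z k * K) = enum_val (Ordinal iN) k]).
  apply: bigsetI_measurable => k _.
  set l := nat_of_ord _.
  rewrite (_ : [set _ | _] = [set z | (l%:R <= f z k * K)] `&` [set z | (f z k * K < l.+1%:R)]).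
   have mf : meas (fun z : CPm n => f z k * K).
    apply: measurable_funM; last exact: measurable_cst.
    apply: measurable_funD; last exact: measurable_cst.
    rewrite /ReIm_entry; case: k.2; first by have [] := @mcfun_cpm n k.1.1 k.1.2.
    by have [] := @mcfun_cpm n k.1.1 k.1.2.
   apply: measurableI.
    by apply: measurable_lef => //; exact: measurable_cst.
   by apply: measurable_ltf => //; exact: measurable_cst.
  have h z : 0 <= f z k * K by rewrite mulr_ge0 ?(ltW K0)//; have /andP[] := fb z k.
  apply/seteqP; split => z /=.
   by move=> <-; have /andP[-> ->] := truncn_itv (h z).
  by move=> [h1 h2]; apply/eqP; rewrite truncn_eq// h1 h2.
 apply/seteqP; split => z /=.
  move=> zi; rewrite -bigcap_seq => k _ /=.
  have -> : Ordinal iN = enum_rank (phi z) by exact: val_inj.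
  by rewrite enum_rankK ffunE inordK// ltnS ltnW.
 rewrite -bigcap_seq => h.
 have -> : phi z = enum_val (Ordinal iN).
  apply/ffunP => k; apply: val_inj; rewrite ffunE /= inordK ?ltnS ?(ltnW (fM _ _))//.
  by apply: h => /=; rewrite mem_index_enum.
 by rewrite enum_valK.
- by move=> z; exact: ltn_ord.
move=> z w /ord_inj/enum_rank_inj zw.
have near k : `|ReIm_entry (@Defs.cpm R n) z k - ReIm_entry (@Defs.cpm R n) w k| <= K^-1.
 have /ffunP/(_ k) := zw; rewrite !ffunE => /(congr1 val); rewrite /= !inordK ?ltnS ?(ltnW (fM _ _))// => E.
 have := round_near K0 _ _ E; rewrite /f.
 have /andP[-> _] := fb z k; have /andP[-> _] := fb w k => /(_ isT isT).
 by rewrite opprD addrACA subrr addr0.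
apply: (le_trans (@dFS_entries n z w (2 * K^-1) _ _)).
- by rewrite divr_ge0// ltW.
- move=> i j; apply: le_trans (cabs_ReIm _) _; rewrite ReB ImB.
 have := near (i, j, true); have := near (i, j, false); rewrite /ReIm_entry /=; lra.
by rewrite /K invrK le_eqVlt; apply/orP; left; apply/eqP; field; rewrite nat1r pnatr_eq0.
Qed.

(** * Infima under a [q]-th root, the common form of [Wq] and [Win], and Minkowski's inequality *)

Section RootInf.
Local Open Scope ereal_scope.
Variables (q : R) (q0 : (0 < q)%R) (S : set (\bar R)) (S0 : forall s, S s -> 0 <= s).

Let inf0 : 0 <= ereal_inf S. Proof. exact/le_ereal_inf_tmp. Qed.

Lemma root_inf_le s (r : R) : S s -> (0 <= r)%R -> s <= (r `^ q)%:E ->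
 (ereal_inf S) `^ q^-1 <= r%:E.
Proof.
move=> Ss r0 sr; rewrite (_ : r%:E = ((r `^ q)%:E) `^ q^-1).
 apply: gt0_ler_poweR; rewrite ?invr_ge0 ?(ltW q0)// ?in_itv /= ?leey ?andbT ?lee_fin ?powR_ge0//.
 by apply: le_trans sr; exact: ereal_inf_lbound.
by rewrite poweR_EFin -powRrM mulfV ?gt_eqF// powRr1.
Qed.

Lemma root_inf_lt (r : R) : (ereal_inf S) `^ q^-1 < r%:E -> exists2 s, S s & s < (r `^ q)%:E.
Proof.
move=> h; apply: ereal_inf_lt; rewrite ltNge; apply/negP => h2.
have r0 : (0 <= r)%R by rewrite -lee_fin (le_trans _ (ltW h))// poweR_ge0.
move: h; rewrite ltNge => /negP; apply.
rewrite (_ : r%:E = ((r `^ q)%:E) `^ q^-1).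
 by apply: gt0_ler_poweR => //; rewrite ?invr_ge0 ?(ltW q0)// ?in_itv /= ?leey ?andbT ?lee_fin ?powR_ge0.
by rewrite poweR_EFin -powRrM mulfV ?gt_eqF// powRr1.
Qed.

End RootInf.

Section LqTriangle.
Context {d : measure_display} {T : measurableType d}.
Local Open Scope ereal_scope.
Variables (q : R) (q1 : (1 <= q)%R).

Let q0 : (0 < q)%R. Proof. by apply: lt_le_trans q1. Qed.
Let q0' : (q != 0)%R. Proof. by rewrite gt_eqF. Qed.

Lemma measurable_powRq (f : T -> R) :
 meas f -> meas (fun x : T => (f x `^ q)%:E).
Proof.
move=> mf; apply/measurable_EFinP.
by apply: (mcomp (fun t : R => t `^ q)%R) mf; exact: measurable_powR.
Qed.

Lemma poweR_root (x : \bar R) (s : R) : (0 <= s)%R -> 0 <= x -> x <= (s `^ q)%:E -> x `^ q^-1 <= s%:E.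
Proof.
move=> s0 x0 xs; rewrite (_ : s%:E = ((s `^ q)%:E) `^ q^-1).
 by apply: gt0_ler_poweR; rewrite ?invr_ge0 ?(ltW q0)// ?in_itv /= ?leey ?andbT ?lee_fin ?powR_ge0.
by rewrite poweR_EFin -powRrM mulfV ?gt_eqF// powRr1.
Qed.

Lemma Lnorm_powR (mu : {measure set T -> \bar R}) (h : T -> R) : meas h -> (forall t, 0 <= h t)%R ->
 'N[mu]_q%:E[EFin \o h] = (\int[mu]_t (h t `^ q)%:E) `^ q^-1.
Proof.
move=> mh h0; rewrite unlock /Lnorm; congr (_ `^ _).
by apply: eq_integral => t _; rewrite /= ger0_norm.
Qed.

(** Minkowski's inequality for three terms, the middle one constant. The pointwise bound may fail on
    a null set, because the gluing below controls the middle points only almost surely. *)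
Lemma Lq_add3 (P : probability T R) (f g h : T -> R) (a r b : R) :
 meas f -> meas g -> meas h ->
 (forall t, 0 <= f t)%R -> (forall t, 0 <= g t)%R -> (forall t, 0 <= h t)%R ->
 (0 <= a)%R -> (0 <= r)%R -> (0 <= b)%R ->
 \int[P]_t (f t `^ q)%:E <= (a `^ q)%:E -> \int[P]_t (g t `^ q)%:E <= (b `^ q)%:E ->
 (exists N, [/\ measurable N, P N = 0 & forall t, ~ N t -> (h t <= f t + r + g t)%R]) ->
 \int[P]_t (h t `^ q)%:E <= ((a + r + b) `^ q)%:E.
Proof.
move=> mf mg mh f0 g0 h0 a0 r0 b0 fa gb [N [mN PN hN]].
have intq (u : T -> R) : 0 <= \int[P]_t (u t `^ q)%:E.
 by apply: integral_ge0 => t _; exact: EpowR_ge0.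
pose H t := (f t + r + g t)%R.
have H0 t : (0 <= H t)%R by rewrite !addr_ge0.
have mfr : meas (fun t : T => f t + r)%R.
 by apply: measurable_funD => //; exact: measurable_cst.
have mH : meas H by exact: measurable_funD.
have NH : 'N[P]_q%:E[EFin \o H] <= (a + r + b)%:E.
 apply: le_trans (minkowski_EFin P mfr mg q1) _; rewrite EFinD; apply: leeD; last first.
  by rewrite Lnorm_powR//; exact: poweR_root.
 have mr : meas (cst r : T -> R) by exact: measurable_cst.
 apply: le_trans (minkowski_EFin P mf mr q1) _; rewrite EFinD; apply: leeD.
  by rewrite Lnorm_powR//; exact: poweR_root.
 rewrite Lnorm_powR//; apply: poweR_root => //.
 have -> : \int[P]_t (cst r t `^ q)%:E = (r `^ q)%:E * P setT.
  exact: (integral_cst P measurableT ((r `^ q)%:E)).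
 by rewrite [X in _ * X](_ : _ = 1) ?mule1//; exact: probability_setT.
apply: (via (\int[P]_t (H t `^ q)%:E)).
 apply: ae_ge0_le_integral => //.
 - by move=> *; exact: EpowR_ge0.
 - exact: measurable_powRq.
 - by move=> *; exact: EpowR_ge0.
 - exact: measurable_powRq.
 exists N; split => // t /= h1; apply: contrapT => Nt; apply: h1 => _.
 by rewrite lee_fin ge0_ler_powR ?nnegrE ?(ltW q0)//; exact: hN.
have E : \int[P]_t (H t `^ q)%:E = 'N[P]_q%:E[EFin \o H] `^ q.
 by rewrite Lnorm_powR// -poweRrM mulVf// poweRe1.
rewrite E -poweR_EFin; apply: gt0_ler_poweR NH; rewrite ?(ltW q0)// ?in_itv /= ?leey ?andbT ?Lnorm_ge0//.
by rewrite lee_fin !addr_ge0.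
Qed.

End LqTriangle.

(** * The Wasserstein distance *)

Section Wasserstein.
Context {n : nat}.
Notation CPm := (CPm n).
Notation dFS := (@dFS R n).
Local Open Scope ereal_scope.
Variables (q : R) (q1 : (1 <= q)%R).

Let q0 : (0 < q)%R. Proof. by apply: lt_le_trans q1. Qed.
Let q0' : (q != 0)%R. Proof. by rewrite gt_eqF. Qed.

Definition cost (pi : probability (CPm * CPm)%type R) : \bar R :=
 \int[pi]_x (dFS x.1 x.2 `^ q)%:E.

Lemma cost_ge0 pi : 0 <= cost pi.
Proof. by apply: integral_ge0 => x _; exact: EpowR_ge0. Qed.
Hint Resolve cost_ge0 : core.

Lemma measurable_dFSq : measurable_fun [set: CPm * CPm]
 (fun x => (dFS x.1 x.2 `^ q)%:E).
Proof.
apply/measurable_EFinP; apply: (mcomp (fun t : R => t `^ q)%R).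
 exact: measurable_powR.
exact: measurable_dFS2.
Qed.

Lemma coupling_cost_ge0 (m1 m2 : set CPm -> \bar R) s :
 [set cost pi | pi in coupling R m1 m2] s -> 0 <= s.
Proof. by move=> [pi _ <-]. Qed.

Lemma Wq_ge0 (m1 m2 : set CPm -> \bar R) : 0 <= Wq R q m1 m2.
Proof. exact: poweR_ge0. Qed.

Lemma Wq_le (m1 m2 : set CPm -> \bar R) pi (r : R) : coupling R m1 m2 pi -> (0 <= r)%R ->
 cost pi <= (r `^ q)%:E -> Wq R q m1 m2 <= r%:E.
Proof.
move=> cpi r0 h; apply: (root_inf_le q0 (@coupling_cost_ge0 m1 m2)) h => //.
by exists pi.
Qed.

Lemma Wq_lt (m1 m2 : set CPm -> \bar R) (r : R) : Wq R q m1 m2 < r%:E ->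
 exists2 pi, coupling R m1 m2 pi & cost pi < (r `^ q)%:E.
Proof.
by move=> /(root_inf_lt q0 (@coupling_cost_ge0 m1 m2))[_ [pi cpi <-]] h; exists pi.
Qed.

Lemma Wq_ext (m1 m2 m1' m2' : set CPm -> \bar R) :
 (forall A, measurable A -> m1 A = m1' A) -> (forall A, measurable A -> m2 A = m2' A) ->
 Wq R q m1 m2 = Wq R q m1' m2'.
Proof.
move=> h1 h2; rewrite /Wq; congr (ereal_inf _ `^ _); apply/seteqP.
split => _ [pi cpi <-]; exists pi => // A mA; have [c1 c2] := cpi A mA.
 by rewrite -h1// -h2.
by rewrite h1// h2.
Qed.

Lemma cost_lepi (P : probability (CPm * CPm)%type R) : cost P <= ((@trigo.pi R) `^ q)%:E.
Proof.
rewrite /cost; apply: (via (\int[P]_x ((@trigo.pi R) `^ q)%:E)).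
 apply: ge0_le_integral => //.
 - by move=> *; exact: EpowR_ge0.
 - exact: measurable_dFSq.
 - move=> x _; rewrite lee_fin ge0_ler_powR ?nnegrE ?(ltW q0)// ?dFS_ge0 ?pi_ge0//.
  exact: dFS_lepi.
by rewrite integral_cst// [X in _ * X](_ : _ = 1) ?mule1//; exact: probability_setT.
Qed.

Lemma Wq_lepi (P1 P2 : probability CPm R) : Wq R q P1 P2 <= (@trigo.pi R)%:E.
Proof.
have h1 : (P1 \x P2) setT = 1 by exact: probability_setT.
apply: (@Wq_le _ _ (probability_of h1)); [|exact: pi_ge0|exact: cost_lepi].
move=> A mA; have eqf : fst @^-1` A = A `*` [set: CPm] :> set (CPm * CPm) by apply/seteqP; split => x //= [].
have eqs : snd @^-1` A = [set: CPm] `*` A :> set (CPm * CPm) by apply/seteqP; split => x //= [].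
split; rewrite /= /prob_of.
 by rewrite eqf product_measure1E// [X in _ * X](_ : _ = 1) ?mule1//; exact: probability_setT.
by rewrite eqs product_measure1E// [X in X * _](_ : _ = 1) ?mul1e//; exact: probability_setT.
Qed.

Lemma Wq_fin (P1 P2 : probability CPm R) : Wq R q P1 P2 \is a fin_num.
Proof. by rewrite ge0_fin_numE ?Wq_ge0// (le_lt_trans (Wq_lepi _ _))// ltry. Qed.

Lemma Wq_refl (P1 : probability CPm R) : Wq R q P1 P1 = 0.
Proof.
have md : meas (fun x : CPm => (x, x)) by exact: measurable_fun_pair.
have [pi [piE piI]] := pushprob P1 md.
apply/eqP; rewrite eq_le Wq_ge0 andbT; apply: (@Wq_le _ _ pi) => //.
rewrite /cost (piI _ measurable_dFSq); last by move=> *; exact: EpowR_ge0.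
by under eq_integral do rewrite dFS_refl powR0//; rewrite integral0 powR0.
Qed.

Lemma coupling_swap (P1 P2 : set CPm -> \bar R) pi : coupling R P1 P2 pi ->
 exists2 pi', coupling R P2 P1 pi' & cost pi' = cost pi.
Proof.
move=> cpi; have ms : meas (fun x : CPm * CPm => (x.2, x.1)).
 exact: measurable_fun_pair.
have [pi' [piE piI]] := pushprob pi ms.
exists pi'; first by move=> A mA; rewrite !piE; have [a b] := cpi A mA.
rewrite /cost (piI _ measurable_dFSq); last by move=> *; exact: EpowR_ge0.
by apply: eq_integral => x _; rewrite /= dFSC.
Qed.

Lemma Wq_sym (P1 P2 : set CPm -> \bar R) : Wq R q P1 P2 = Wq R q P2 P1.
Proof.
rewrite /Wq -/(cost _); congr (ereal_inf _ `^ _); apply/seteqP.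
by split => _ [pi /coupling_swap[pi' cpi' c'] <-]; exists pi'.
Qed.

Lemma measurable_dFS_comp d (X : measurableType d) (f g : X -> CPm) :
 meas f -> meas g ->
 meas (fun x : X => dFS (f x) (g x)).
Proof.
move=> mf mg; apply: (@measurableT_comp _ _ _ _ _ _ (fun x : CPm * CPm => dFS x.1 x.2) _
 (fun x => (f x, g x))); first exact: measurable_dFS2.
exact: measurable_fun_pair.
Qed.

Section Coordinates.
Notation T := ((CPm * CPm) * (CPm * CPm))%type.
Lemma measurable_c11 : meas (fun t : T => t.1.1).
Proof. exact: (mcomp fst measurable_fst measurable_fst). Qed.
Lemma measurable_c12 : meas (fun t : T => t.1.2).
Proof. exact: (mcomp snd measurable_snd measurable_fst). Qed.
Lemma measurable_c21 : meas (fun t : T => t.2.1).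
Proof. exact: (mcomp fst measurable_fst measurable_snd). Qed.
Lemma measurable_c22 : meas (fun t : T => t.2.2).
Proof. exact: (mcomp snd measurable_snd measurable_snd). Qed.
End Coordinates.
Hint Resolve measurable_c11 measurable_c12 measurable_c21 measurable_c22 : core.

Lemma measure_cells d (T : measurableType d) (mu : {measure set T -> \bar R}) N (c : T -> nat) A :
 (forall i, measurable [set x | c x = i]) -> (forall x, (c x < N)%N) -> measurable A ->
 mu A = \sum_(i < N) mu (A `&` [set x | c x = i]).
Proof.
move=> mc cN mA.
rewrite {1}(_ : A = \big[setU/set0]_(i < N) (A `&` [set x | c x = i])); last first.
 rewrite -(bigcup_mkord N (fun i => A `&` [set x | c x = i])); apply/seteqP; split => [x Ax|x [i _ []//]].
 by exists (c x) => //=; exact: cN.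
rewrite measure_semi_additive_ord//.
- by move=> i; exact: measurableI.
- by move=> i j _ _ [x [[_ /= hi] [_ /= hj]]]; apply: ord_inj; rewrite -hi.
- by apply: bigsetU_measurable => i _; exact: measurableI.
Qed.

(** Gluing without disintegration: cut the middle space into cells of diameter at most [e],
    condition [p12] and [p23] on each cell, take the product of the two, and mix with the weights
    [P2 (B i)]. The two middle points need not be equal but lie in one cell; [Wq_tri] lets [e] tend
    to 0. *)
Lemma glue (P1 P2 P3 : probability CPm R) (p12 p23 : probability (CPm * CPm)%type R) (e : R) :
 (0 < e)%R -> coupling R P1 P2 p12 -> coupling R P2 P3 p23 ->
 exists P : probability ((CPm * CPm) * (CPm * CPm))%type R,
 [/\ forall A, measurable A -> P (fst @^-1` A) = p12 A,
   forall A, measurable A -> P (snd @^-1` A) = p23 A &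
   P [set t | e < dFS t.1.2 t.2.1]%R = 0].
Proof.
move=> e0 c12 c23; have [N [c [mc cN cd]]] := @finite_cells n e e0.
pose B i := [set z : CPm | c z = i].
have ms (A : set CPm) : measurable A -> measurable (snd @^-1` A : set (CPm * CPm)).
 exact: (measurable_pre measurable_snd).
have mf (A : set CPm) : measurable A -> measurable (fst @^-1` A : set (CPm * CPm)).
 exact: (measurable_pre measurable_fst).
have /choice[Q12 h12] := fun i => cond_prob p12 (ms _ (mc i)).
have /choice[Q23 h23] := fun i => cond_prob p23 (mf _ (mc i)).
pose w i := fine (P2 (B i)).
have wE i : (w i)%:E = P2 (B i) by rewrite /w fineK//; apply: fin_num_measure; exact: mc.
have w12 i : (w i)%:E = p12 (snd @^-1` (B i)) by rewrite wE; have [_ ->] := c12 _ (mc i).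
have w23 i : (w i)%:E = p23 (fst @^-1` (B i)) by rewrite wE; have [-> _] := c23 _ (mc i).
have w0 i : (0 <= w i)%R by rewrite fine_ge0.
have w1 : (\sum_(i < N) w i = 1)%R.
 apply: EFin_inj; rewrite -sumEFin -(@probability_setT _ _ _ P2) (measure_cells P2 mc cN)//.
 by apply: eq_bigr => i _; rewrite wE setTI.
pose Qp i : probability ((CPm * CPm) * (CPm * CPm))%type R := (Q12 i \x Q23 i)%E.
have QpE i A B' : measurable A -> measurable B' -> Qp i (A `*` B') = Q12 i A * Q23 i B'.
 exact: product_measure1E.
have [P [PE _]] := mixture Qp w0 w1.
have rf (A : set (CPm * CPm)) : fst @^-1` A = A `*` [set: CPm * CPm] :> set ((CPm * CPm) * (CPm * CPm)).
 by apply/seteqP; split => x //= [].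
have rs (A : set (CPm * CPm)) : snd @^-1` A = [set: CPm * CPm] `*` A :> set ((CPm * CPm) * (CPm * CPm)).
 by apply/seteqP; split => x //= [].
exists P; split.
- move=> A mA; rewrite PE rf (@measure_cells _ _ p12 N (c \o snd) A _ _ mA); last 2 first.
 + by move=> i; exact: (ms _ (mc i)).
 + by move=> x; exact: cN.
 apply: eq_bigr => i _; rewrite QpE// [X in _ * (_ * X)](_ : _ = 1) ?mule1 ?w12 -?h12//; exact: probability_setT.
- move=> A mA; rewrite PE rs (@measure_cells _ _ p23 N (c \o fst) A _ _ mA); last 2 first.
 + by move=> i; exact: (mf _ (mc i)).
 + by move=> x; exact: cN.
 apply: eq_bigr => i _; rewrite QpE// [X in _ * (X * _)](_ : _ = 1) ?mul1e ?w23 -?h23//; exact: probability_setT.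
have mS : measurable [set t : (CPm * CPm) * (CPm * CPm) | (e < dFS t.1.2 t.2.1)%R].
 apply: measurable_ltf; first exact: measurable_cst.
 exact: measurable_dFS_comp.
rewrite PE big1// => i _; have [->|wi] := eqVneq (w i) 0%R; first by rewrite mul0e.
have mB : measurable (~` B i) by apply: measurableC; exact: mc.
have z12 : Q12 i (snd @^-1` (~` B i)) = 0.
 apply/eqP; have := h12 i _ (ms _ mB); rewrite -w12 -preimage_setI setICl preimage_set0 measure0.
 by move/esym/eqP; rewrite mule_eq0 eqe (negbTE wi).
have z23 : Q23 i (fst @^-1` (~` B i)) = 0.
 apply/eqP; have := h23 i _ (mf _ mB); rewrite -w23 -preimage_setI setICl preimage_set0 measure0.
 by move/esym/eqP; rewrite mule_eq0 eqe (negbTE wi).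
rewrite (_ : Qp i _ = 0) ?mule0//; apply/eqP; rewrite eq_le measure_ge0 andbT.
apply: (via (Qp i
  ((snd @^-1` (~` B i)) `*` [set: CPm * CPm] `|` [set: CPm * CPm] `*` (fst @^-1` (~` B i))))).
 apply: le_measure; rewrite ?inE//.
  by apply: measurableU; apply: measurableX => //; [exact: ms|exact: mf].
 move=> t /= et; have [b1|b1] := pselect (B i t.1.2); last by left.
 right; split => // b2; move: et; rewrite ltNge => /negP; apply.
 by apply: cd; rewrite b1 b2.
apply: le_trans (measureU2 _ _ _) _.
- by apply: measurableX => //; exact: ms.
- by apply: measurableX => //; exact: mf.
rewrite [X in X + _](_ : _ = 0) ?[X in _ + X](_ : _ = 0) ?adde0//.
 by apply: etrans (QpE _ _ _ measurableT (mf _ mB)) _; rewrite z23 mule0.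
by apply: etrans (QpE _ _ _ (ms _ mB) measurableT) _; rewrite z12 mul0e.
Qed.

Lemma Wq_tri (P1 P2 P3 : probability CPm R) : Wq R q P1 P3 <= Wq R q P1 P2 + Wq R q P2 P3.
Proof.
have lin (A B C D E r : R) : (A <= B + C -> C <= D + E -> D <= r -> A <= B + r + E)%R by lra.
rewrite -(fineK (Wq_fin P1 P2)) -(fineK (Wq_fin P2 P3)).
set a := fine _; set b := fine _.
apply/lee_addgt0Pr => e e0; pose r := (e / 3)%R; have r0 : (0 < r)%R by rewrite divr_gt0.
have a0 : (0 <= a)%R by rewrite fine_ge0// Wq_ge0.
have b0 : (0 <= b)%R by rewrite fine_ge0// Wq_ge0.
have [p12 c12 k12] : exists2 pi, coupling R P1 P2 pi & cost pi < ((a + r) `^ q)%:E.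
 by apply: Wq_lt; rewrite -(fineK (Wq_fin P1 P2)) lte_fin ltrDl.
have [p23 c23 k23] : exists2 pi, coupling R P2 P3 pi & cost pi < ((b + r) `^ q)%:E.
 by apply: Wq_lt; rewrite -(fineK (Wq_fin P2 P3)) lte_fin ltrDl.
have [P [Pf Ps PD]] := glue r0 c12 c23.
pose T := ((CPm * CPm) * (CPm * CPm))%type.
have mf : meas (fun t : T => dFS t.1.1 t.1.2).
 exact: measurable_dFS_comp.
have mg : meas (fun t : T => dFS t.2.1 t.2.2).
 exact: measurable_dFS_comp.
have mp : meas (fun t : T => (t.1.1, t.2.2)).
 exact: measurable_fun_pair.
have [p13 [p13E p13I]] := pushprob P mp.
have c13 : coupling R P1 P3 p13.
 move=> A mA; rewrite !p13E; split.
  rewrite (_ : _ @^-1` _ = fst @^-1` (fst @^-1` A))// Pf; last first.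
   exact: (measurable_pre measurable_fst).
  by have [-> _] := c12 A mA.
 rewrite (_ : _ @^-1` _ = snd @^-1` (snd @^-1` A))// Ps; last first.
  exact: (measurable_pre measurable_snd).
 by have [_ ->] := c23 A mA.
apply: (@Wq_le _ _ p13); [exact: c13|by rewrite !addr_ge0// ltW|].
rewrite /cost (p13I _ measurable_dFSq); last by move=> *; exact: EpowR_ge0.
rewrite (_ : (a + b + e = (a + r) + r + (b + r))%R); last by rewrite /r; field.
have mfst : meas (@fst (CPm * CPm)%type (CPm * CPm)%type) by exact: measurable_fst.
have msnd : meas (@snd (CPm * CPm)%type (CPm * CPm)%type) by exact: measurable_snd.
have cf : \int[P]_t (dFS t.1.1 t.1.2 `^ q)%:E <= ((a + r) `^ q)%:E.
 apply: le_trans (ltW k12); have [Q [QE QI]] := pushprob P mfst.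
 rewrite -(QI _ measurable_dFSq); last by move=> *; exact: EpowR_ge0.
 rewrite (@eq_measure_integral _ _ _ _ p12)// => A mA _.
 exact: etrans (QE A) (Pf A mA).
have cg : \int[P]_t (dFS t.2.1 t.2.2 `^ q)%:E <= ((b + r) `^ q)%:E.
 apply: le_trans (ltW k23); have [Q [QE QI]] := pushprob P msnd.
 rewrite -(QI _ measurable_dFSq); last by move=> *; exact: EpowR_ge0.
 rewrite (@eq_measure_integral _ _ _ _ p23)// => A mA _.
 exact: etrans (QE A) (Ps A mA).
have mh : meas (fun t : T => dFS t.1.1 t.2.2) by exact: measurable_dFS_comp.
apply: (Lq_add3 q1 mf mg mh _ _ _ _ _ _ cf cg).
- by move=> t; exact: dFS_ge0.
- by move=> t; exact: dFS_ge0.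
- by move=> t; exact: dFS_ge0.
- by rewrite addr_ge0// ltW.
- exact: ltW.
- by rewrite addr_ge0// ltW.
exists [set t : T | (r < dFS t.1.2 t.2.1)%R]; split => //.
 by apply: measurable_ltf; [exact: measurable_cst|exact: measurable_dFS_comp].
move=> t /= /negP; rewrite -leNgt => tr.
exact: (lin _ _ _ _ _ _ (dFS_tri t.1.2 t.1.1 t.2.2) (dFS_tri t.2.1 t.1.2 t.2.2) tr).
Qed.

(** The two averages are coupled label by label: the joint law of [(z i, w i)] under [P], averaged
    over [i]. *)
Lemma Wq_avg d (X : measurableType d) (P : probability X R) N (z w : nat -> X -> CPm)
  (m1 m2 : set CPm -> \bar R) (K : X -> R) (s : R) : (0 < N)%N ->
 (forall i, meas (z i)) -> (forall i, meas (w i)) ->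
 (forall A, measurable A -> m1 A = \sum_(i < N) (N%:R^-1)%:E * P (z i @^-1` A)) ->
 (forall A, measurable A -> m2 A = \sum_(i < N) (N%:R^-1)%:E * P (w i @^-1` A)) ->
 meas K -> (forall x i, (i < N)%N -> dFS (z i x) (w i x) <= K x)%R ->
 (0 <= s)%R -> \int[P]_x (K x `^ q)%:E <= (s `^ q)%:E -> Wq R q m1 m2 <= s%:E.
Proof.
move=> N0 mz mw m1E m2E mK zK s0 Ks.
have mzw i : meas (fun x : X => (z i x, w i x)) by exact: measurable_fun_pair.
have /choice[Q hQ] := fun i => pushprob P (mzw i).
have c0 : nat -> (0 <= N%:R^-1 :> R)%R by move=> _; rewrite invr_ge0.
have c1 : (\sum_(i < N) N%:R^-1 = 1 :> R)%R.
 by rewrite sumr_const card_ord -[LHS]mulr_natr mulVf// pnatr_eq0 -lt0n.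
have [pi [piE piI]] := mixture Q c0 c1.
apply: (@Wq_le _ _ pi) => //.
 move=> A mA; rewrite !piE m1E// m2E//; split; apply: eq_bigr => i _; by have [-> _] := hQ i.
apply: le_trans Ks; rewrite /cost (piI _ measurable_dFSq); last by move=> *; exact: EpowR_ge0.
have -> : \int[P]_x (K x `^ q)%:E = \sum_(i < N) (N%:R^-1)%:E * \int[P]_x (K x `^ q)%:E.
 rewrite -ge0_sume_distrl; last by move=> i _; rewrite lee_fin.
 by rewrite sumEFin c1 mul1e.
apply: lee_sum => i _; apply: lee_wpmul2l; first by rewrite lee_fin.
have [_ ->] := hQ i.
- apply: ge0_le_integral => //.
 + by move=> *; exact: EpowR_ge0.
 + by apply: (measurable_powRq q (f := fun x => dFS (z i x) (w i x))); exact: measurable_dFS_comp.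
 + exact: measurable_powRq.
 + move=> x _; rewrite lee_fin ge0_ler_powR ?nnegrE ?(ltW q0)// ?dFS_ge0 ?zK//.
  by rewrite (le_trans _ (zK x i _))// dFS_ge0.
- exact: measurable_dFSq.
- by move=> *; exact: EpowR_ge0.
Qed.

Lemma measurable_cball (z0 : CPm) (r : R) : measurable [set z : CPm | (dFS z0 z <= r)%R].
Proof.
apply: measurable_lef; last exact: measurable_cst.
by apply: measurable_dFS_comp => //; exact: measurable_cst.
Qed.

(** Couplings of arbitrarily small cost move by [t] or more with arbitrarily small probability. So
    [P1] of the ball of radius [r] is at most [P2] of the ball of radius [r + t], and the closed
    balls decrease to that of radius [r] as [t] tends to 0. *)
Lemma Wq0_le_ball (P1 P2 : probability CPm R) (z0 : CPm) (r : R) : Wq R q P1 P2 = 0 ->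
 P1 [set z | (dFS z0 z <= r)%R] <= P2 [set z | (dFS z0 z <= r)%R].
Proof.
move=> W0; pose A t := [set z : CPm | (dFS z0 z <= t)%R].
have step t : (0 < t)%R -> P1 (A r) <= P2 (A (r + t)%R).
 move=> t0; apply/lee_addgt0Pr => e e0.
 (* The cost is below [t^q e], so Markov's inequality at level [t^q] leaves mass at most [e]. *)
 have [pi cpi kpi] : exists2 pi, coupling R P1 P2 pi & cost pi < ((t * e `^ q^-1) `^ q)%:E.
  by apply: Wq_lt; rewrite W0 lte_fin mulr_gt0// powR_gt0.
 have [<- _] := cpi _ (measurable_cball z0 r); have [_ <-] := cpi _ (measurable_cball z0 (r + t)).
 pose D := [set x : CPm * CPm | t `^ q <= (dFS x.1 x.2) `^ q]%R.
 have mD : measurable D.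
  have h := measurable_dFSq; apply: measurable_lef; first exact: measurable_cst.
  exact/measurable_EFinP.
 have piD : pi D <= e%:E.
  have tq : (0 < t `^ q)%R by rewrite powR_gt0.
  have := le_integral_abse pi measurableT measurable_dFSq tq.
  rewrite setTI (_ : [set x | _] = D); last first.
   by apply/seteqP; split => x /=; rewrite lee_fin ger0_norm ?powR_ge0.
  under eq_integral do rewrite gee0_abs ?lee_fin ?powR_ge0//.
  move=> h; have := le_trans h (ltW kpi).
  rewrite powRM ?powR_ge0 ?(ltW t0)// -powRrM mulVf// powRr1 ?(ltW e0)// EFinM.
  by rewrite lee_pmul2l// lte_fin.
 have ms (B : set CPm) : measurable B -> measurable (snd @^-1` B : set (CPm * CPm)).
  exact: (measurable_pre measurable_snd).
 have mf (B : set CPm) : measurable B -> measurable (fst @^-1` B : set (CPm * CPm)).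
  exact: (measurable_pre measurable_fst).
 apply: (via (pi (snd @^-1` (A (r + t)%R) `|` D))).
  apply: le_measure; rewrite ?inE.
  - by apply: mf; exact: measurable_cball.
  - by apply: measurableU => //; apply: ms; exact: measurable_cball.
  move=> x /= xr; have [h|h] := leP (t `^ q)%R (dFS x.1 x.2 `^ q)%R; first by right.
  left; rewrite /A /=; apply: le_trans (dFS_tri x.1 z0 x.2) _; apply: lerD => //.
  rewrite leNgt; apply/negP => h2; move: h; rewrite ltNge => /negP; apply.
  by rewrite ge0_ler_powR ?nnegrE ?(ltW q0)// ?dFS_ge0 ?ltW.
 apply: le_trans (measureU2 _ _ _) _ => //; first by apply: ms; exact: measurable_cball.
 exact: leeD.
have cvgA : P2 (A (r + n.+1%:R^-1)%R) @[n --> \oo] --> P2 (A r).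
 rewrite (_ : A r = \bigcap_n A (r + n.+1%:R^-1)%R); last first.
  apply/seteqP; split => z /=; first by move=> zr k _ /=; rewrite /A /=; apply: le_trans zr _; rewrite lerDl invr_ge0.
  move=> h; apply/ler_addgt0Pr => e e0.
  pose k := Num.truncn e^-1.
  have ke : (k.+1%:R^-1 < e)%R by rewrite invf_plt ?posrE//; exact: truncnS_gt.
  by rewrite (le_trans (h k I))// lerD2l ltW.
 apply: nonincreasing_cvg_mu.
 - by rewrite -ge0_fin_numE ?fin_num_measure//; exact: measurable_cball.
 - by move=> k; exact: measurable_cball.
 - by apply: bigcapT_measurable => k; exact: measurable_cball.
 - apply/nonincreasing_seqP => k; apply/subsetPset => z /= h.
  by rewrite /A /=; apply: le_trans h _; rewrite lerD2l lef_pV2 ?posrE// ler_nat.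
rewrite -(cvg_lim _ cvgA)//; apply: lime_ge; first by apply/cvg_ex; exists (P2 (A r)).
by near=> k; apply: step; rewrite invr_gt0.
Unshelve. all: by end_near. Qed.

Lemma Wq0_ball (P1 P2 : probability CPm R) (z0 : CPm) (r : R) : Wq R q P1 P2 = 0 ->
 P1 [set z | (dFS z0 z <= r)%R] = P2 [set z | (dFS z0 z <= r)%R].
Proof.
move=> W0; apply/eqP; rewrite eq_le !Wq0_le_ball//.
by rewrite Wq_sym.
Qed.

End Wasserstein.

(** * Measurable choices among finitely many functions *)

Section Measurability.
Context {d : measure_display} {X : measurableType d}.

Lemma measurable_argmin (I : finType) (i0 : I) (c : I -> X -> R) :
 (forall i, meas (c i)) ->
 exists g : X -> I, (forall i, measurable [set x | g x = i]) /\
  forall x i, c (g x) x <= c i x.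
Proof.
move=> mc; suff [g [mg cg]] : exists g : X -> I, (forall i, measurable [set x | g x = i]) /\
  forall x i, i \in enum I -> c (g x) x <= c i x.
 by exists g; split => // x i; apply: cg; rewrite mem_enum.
elim: (enum I) => [|a s [g [mg cg]]].
 exists (fun=> i0); split => // i; have [<-|ne] := eqVneq i0 i.
  by rewrite (_ : [set _ | _] = setT)//; apply/seteqP; split.
 rewrite (_ : [set _ | _] = set0)//; apply/seteqP; split => x //= /eqP.
 by rewrite (negbTE ne).
pose h x := \big[Num.min/c a x]_(i <- enum I) c i x.
have mS : measurable [set x | c a x <= c (g x) x].
 rewrite (_ : [set _ | _] = \big[setU/set0]_(i <- index_enum I)
   ([set x | g x = i] `&` [set x | c a x <= c i x])).
  apply: bigsetU_measurable => i _; apply: measurableI => //.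
  exact: measurable_lef.
 rewrite -bigcup_seq; apply/seteqP; split => [x /= cx|x [i _ [/= <-]]//].
 by exists (g x) => //=; rewrite mem_index_enum.
exists (fun x => if c a x <= c (g x) x then a else g x); split.
 move=> i; rewrite (_ : [set _ | _] = ([set x | c a x <= c (g x) x] `&` [set x | a = i]) `|`
   (~` [set x | c a x <= c (g x) x] `&` [set x | g x = i])).
  apply: measurableU; last by apply: measurableI => //; exact: measurableC.
  apply: measurableI => //; have [<-|ne] := eqVneq a i.
   by rewrite (_ : [set _ | _] = setT)//; apply/seteqP; split.
  rewrite (_ : [set _ | _] = set0)//; apply/seteqP; split => x //= /eqP.
  by rewrite (negbTE ne).
 apply/seteqP; split => x /=; first by case: ifP => [h1 h2|/negP h1 h2]; [left|right].
 by move=> [[-> ->]|[/negP/negbTE -> ->]].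
move=> x i; rewrite inE => /predU1P[->|/cg h1]; first by case: ifP => //; case: ltP => // /ltW.
case: ifP => // h2; exact: le_trans h2 (h1 x).
Qed.

Lemma measure_fincells (mu : {measure set X -> \bar R}) (I : finType) (g : X -> I) A :
 (forall i, measurable [set x | g x = i]) -> measurable A ->
 mu A = (\sum_(i <- index_enum I) mu (A `&` [set x | g x = i]))%E.
Proof.
move=> mg mA; pose c x : nat := enum_rank (g x).
have cE (i : 'I_#|I|) : [set x | c x = i] = [set x | g x = enum_val i].
 by apply/seteqP; split => x /=; [move=> /ord_inj <-; rewrite enum_rankK|rewrite /c => ->; rewrite enum_valK].
have mc i : measurable [set x | c x = i].
 have [iN|iN] := ltnP i #|I|; first by have := cE (Ordinal iN) => /= ->.
 rewrite (_ : [set _ | _] = set0)//; apply/seteqP; split => x //= ci.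
 by have := ltn_ord (enum_rank (g x)); rewrite -/(c x) ci ltnNge iN.
rewrite (@measure_cells _ _ mu #|I| c A mc _ mA); last by move=> x; exact: ltn_ord.
rewrite (reindex (@enum_val I predT)) /=; last first.
 by exists enum_rank => i _; rewrite ?enum_rankK ?enum_valK.
by apply: eq_bigr => i _; rewrite cE.
Qed.

Lemma measurable_select d' (Y : measurableType d') (I : finType) (g : X -> I) (w : I -> X -> Y) :
 (forall i, measurable [set x | g x = i]) -> (forall i, meas (w i)) ->
 meas (fun x : X => w (g x) x).
Proof.
move=> mg mw _ A mA; rewrite setTI.
rewrite (_ : _ @^-1` _ = \big[setU/set0]_(i <- index_enum I)
   ([set x | g x = i] `&` (w i @^-1` A))).
 apply: bigsetU_measurable => i _; apply: measurableI => //.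
 exact: (measurable_pre (mw _)).
rewrite -bigcup_seq; apply/seteqP; split => [x /= cx|x [i _ [/= <-]]//].
by exists (g x) => //=; rewrite mem_index_enum.
Qed.

Lemma measurable_bigmax (I : Type) (s : seq I) (f : I -> X -> R) (c : R) :
 (forall i, meas (f i)) ->
 meas (fun x : X => \big[Num.max/c]_(i <- s) f i x).
Proof.
move=> mf; elim: s => [|i s IH].
 by under eq_fun do rewrite big_nil; exact: measurable_cst.
by under eq_fun do rewrite big_cons; exact: measurable_maxr.
Qed.

End Measurability.

(** * The measure of a polynomial through labelled zeros *)

Section LineMeasure.
Context {m d : nat}.
Notation dFS := (@dFS R _).
Implicit Types (p : Hpoly m.+1 d) (L : Gr m).

(** A list of the zeros of [p] on [L] in some frame and some order; by [lpts_perm] only the order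
    depends on the choices. *)
Definition lpts p L (x : seq (CP m.+1)) := exists e f ss,
 [/\ frame L e f, pe p f != 0, roots_on p e f ss & x = [seq pt (lin2 1 e s f) | s <- ss]].

Lemma lpts_count p L x A : lpts p L x ->
 lineCount R p L A = \sum_(z <- x) ((z \in A)%:R : R).
Proof.
move=> [e [f [ss [fr pf rs ->]]]]; rewrite (lineCountE A fr pf rs).
by rewrite big_map.
Qed.

(** [lineCount] of a set counts the members of the list in it, and its definition does not involve
    the frame. *)
Lemma lpts_perm p L x y : lpts p L x -> lpts p L y -> perm_eq x y.
Proof.
move=> px py; apply/seq.permP => a; apply/eqP; rewrite -(eqr_nat R).
have h z : lpts p L z -> (count a z)%:R = lineCount R p L [set u | a u].
 move=> pz; rewrite (lpts_count _ pz) -sum1_count natr_sum big_mkcond.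
 by apply: eq_bigr => i _; rewrite (_ : (i \in [set u | a u]) = a i) ?mem_setE//; case: (a i).
by rewrite (h _ px) (h _ py).
Qed.

Lemma lpts_fun p L x (z : 'I_d -> CP m.+1) : lpts p L x -> lpts p L [seq z i | i <- enum 'I_d] ->
 exists a : {perm 'I_d}, forall i : 'I_d, nth point x i = z (a i).
Proof.
move=> px pz; have := lpts_perm px pz.
rewrite (_ : [seq z i | i <- enum 'I_d] = [tuple z i | i < d])//.
move=> /tuple_permP[a ->]; exists a => i.
rewrite (nth_map i) /=; last by rewrite size_enum_ord.
by rewrite tnth_map tnth_ord_tuple nth_ord_enum.
Qed.

Lemma lineCount_deg p L A : ~ nondeg p L -> lineCount R p L A = 0.
Proof.
move=> deg; rewrite /lineCount fsbig1// => z [_ /= zL].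
rewrite /mult; set w := vec_of R (cpm z); set w' := vec_of R _; set g := heval _ _ _ _.
suff g0 : lp p w w' = 0 by rewrite (_ : g = 0)//= eqxx.
apply: horner_ext => s; rewrite horner0 horner_lp.
apply/eqP/negPn/negP => h; apply: deg; exists (fun i => w i + s * w' i) => //.
have onL (M : 'M[C]_m.+2) : grm L *m M = M -> mv (grm L) (vec_of R M) =1 vec_of R M.
 move=> LM; rewrite /vec_of; case: pickP => [j _|_] i.
  by rewrite -{2}LM /mv mxE.
 by rewrite /mv big1// => j _; rewrite mulr0.
have Lz : grm L *m cpm z = cpm z by exact/eqP.
have LL : grm L *m grm L = grm L by have /and3P[_ /eqP] := @grm_proj R m L.
move=> i; have := mv_lin2 (grm L) 1 w s w' i; rewrite /lin2.
rewrite (onL _ Lz) (onL _ _) ?mul1r; last by rewrite mulmxBr LL Lz.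
by move=> <-; congr mv; apply/funext => k; rewrite mul1r.
Qed.

Lemma measurable_nondeg p : measurable [set L : Grm m | nondeg p L].
Proof.
rewrite (_ : [set _ | _] = \bigcup_n [set L | pe p (mv (grm L) (qvec n)) != 0]).
 by apply: bigcup_measurable => n _; exact: measurable_pe_neq0.
apply/seteqP; split => [L /nondeg_qvec[n]|L [n _ pn]]; first by exists n.
by exists (mv (grm L) (qvec n)) => //; exact: mv_grm_idem.
Qed.

Lemma measurable_deg p : measurable [set L : Grm m | ~ nondeg p L].
Proof.
rewrite (_ : [set _ | _] = ~` [set L | nondeg p L])//; apply: measurableC.
exact: measurable_nondeg.
Qed.

Variables (vol : probability (Grm m) R) (d0 : (0 < d)%N).

Definition aenondeg p := vol [set L | ~ nondeg p L] = 0%E.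

Lemma muP_labels p : aenondeg p -> exists z : 'I_d -> Grm m -> CPm m.+1,
 [/\ forall i, meas (z i),
   forall A, measurable A -> (muP vol p A = \sum_(i < d) (d%:R^-1)%:E * vol (z i @^-1` A))%E &
   forall L, nondeg p L -> lpts p L [seq z i L | i <- enum 'I_d]].
Proof.
move=> nd; have [zs [szs mzs lzs]] := labelled_roots p d0.
pose z (i : 'I_d) := nth (fun=> point) zs i.
have mz i : meas (z i).
 rewrite /z; move: (i : nat); elim: (zs) mzs => [|y s IH] mzs' [|j] /=; try exact: measurable_cst.
  by apply: mzs'; left.
 by apply: IH => u us; apply: mzs'; right.
have zE L : [seq z i L | i <- enum 'I_d] = [seq y L | y <- zs].
 apply: (@eq_from_nth _ point); first by rewrite size_map size_enum_ord size_map szs.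
 move=> i; rewrite size_map size_enum_ord => id.
 have id' : (i < size (enum 'I_d))%N by rewrite size_enum_ord.
 rewrite (nth_map (Ordinal id))// (nth_map (fun=> point)) ?szs// /z.
 by rewrite nth_enum_ord.
have lz L : nondeg p L -> lpts p L [seq z i L | i <- enum 'I_d].
 by move=> /lzs[e [f [ss [fr pf rs E]]]]; exists e, f, ss; split => //; rewrite zE E.
exists z; split => // A mA; rewrite /muP.
have mzA i : measurable (z i @^-1` A) by exact: measurable_pre.
have -> : (\int[vol]_L (lineCount R p L A)%:E = \int[vol]_L (\sum_(i < d) (\1_(z i @^-1` A) L)%:E))%E.
 transitivity (\int[vol]_L ((\1_[set L | nondeg p L] L * \sum_(i < d) \1_(z i @^-1` A) L)%:E))%E.
  apply: eq_integral => L _; congr EFin; rewrite indicE.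
  have [ndL|ndL] := pselect (nondeg p L); last first.
   by rewrite lineCount_deg// memNset// mul0r.
  rewrite mem_set// mul1r (lpts_count _ (lz _ ndL)) big_map big_enum /=.
  by apply: eq_bigr => i _; rewrite indicE.
 apply: ge0_ae_eq_integral => //.
 - apply/measurable_EFinP; apply: measurable_funM.
   by apply: measurable_indic; exact: measurable_nondeg.
  by apply: measurable_sum => i; exact: measurable_indic.
 - by apply: emeasurable_sum => i; apply/measurable_EFinP; exact: measurable_indic.
 - by move=> L _; rewrite lee_fin mulr_ge0// sumr_ge0.
 - by move=> L _; apply: sume_ge0 => i _; rewrite lee_fin.
 exists [set L | ~ nondeg p L]; split => //.
  exact: measurable_deg.
 move=> L /=; apply: contra_not => ndL _.
 by rewrite sumEFin indicE mem_set// mul1r.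
rewrite ge0_integral_sum//; last by move=> i; apply/measurable_EFinP; exact: measurable_indic.
rewrite ge0_sume_distrr; last by move=> i _; apply: integral_ge0 => L _; rewrite lee_fin.
by apply: eq_bigr => i _; rewrite integral_indic// setIT.
Qed.

Lemma muP_prob p : aenondeg p -> exists P : probability (CPm m.+1) R,
 forall A, measurable A -> muP vol p A = P A.
Proof.
move=> /muP_labels[z [mz zE _]].
have /choice[Q hQ] := fun i => pushprob vol (mz i).
pose Q' i := if insub i is Some j then Q j else Q (Ordinal d0).
have c0 : nat -> 0 <= (d%:R^-1 : R) by move=> _; rewrite invr_ge0.
have c1 : (\sum_(i < d) d%:R^-1 = 1 :> R)%R.
 by rewrite sumr_const card_ord -[LHS]mulr_natr mulVf// pnatr_eq0 -lt0n.
have [P [PE _]] := mixture Q' c0 c1.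
exists P => A mA; rewrite PE zE//; apply: eq_bigr => i _.
by have [<- _] := hQ i; rewrite /Q' valK.
Qed.

(** The labels [z] and [w] are unrelated, so at each line the permutation with the least maximal
    displacement is chosen, measurably since there are finitely many. Permuting the labels [w] line
    by line does not change the average of their laws. The minimum over finitely many permutations
    absorbs the slack [e]. *)
Lemma Wq_muP_le q p p' (K : Grm m -> R) (s : R) : 1 <= q -> aenondeg p -> aenondeg p' ->
 meas K ->
 (forall L, nondeg p L -> nondeg p' L -> forall e, 0 < e -> exists x y, [/\ lpts p L x, lpts p' L y &
   forall i, (i < d)%N -> dFS (nth point x i) (nth point y i) <= K L + e]) ->
 0 <= s -> (\int[vol]_L (K L `^ q)%:E <= (s `^ q)%:E)%E ->
 (Wq R q (muP vol p) (muP vol p') <= s%:E)%E.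
Proof.
move=> q1 nd nd' mK hK s0 Ks; have q0 : 0 < q by exact: lt_le_trans q1.
have [z [mz zE zL]] := muP_labels nd; have [w [mw wE wL]] := muP_labels nd'.
pose c (g : {perm 'I_d}) (L : Grm m) := \big[Num.max/0]_(i <- enum 'I_d) dFS (z i L) (w (g i) L).
have mc g : meas (c g).
 by apply: measurable_bigmax => i; exact: measurable_dFS_comp.
have [g [mg cg]] := measurable_argmin 1%g mc.
pose X : Type := Grm m.
pose ext (u : 'I_d -> Grm m -> CPm m.+1) i := if insub i is Some j then u j else u (Ordinal d0).
have extE u (i : 'I_d) : ext u i = u i by rewrite /ext valK.
have mext u : (forall i, meas (u i)) -> forall i, meas (ext u i).
 by move=> mu i; rewrite /ext; case: insub.
pose w' (i : 'I_d) (L : Grm m) : CPm m.+1 := w (g L i) L.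
have mw' i : meas (w' i).
 exact: (measurable_select (w := fun h : {perm 'I_d} => w (h i)) mg).
have mKm : meas (fun L : Grm m => c (g L) L).
 exact: (measurable_select mg mc).
have c_ge0 h L : 0 <= c h L by rewrite /c; elim/big_ind: _ => [//|x y x0 y0|i _]; [rewrite le_max x0|exact: dFS_ge0].
apply: (@Wq_avg m.+1 q q1 _ _ vol d (ext z) (ext w') _ _ (fun L => c (g L) L)) => //.
- exact: mext.
- exact: mext.
- by move=> A mA; rewrite zE//; apply: eq_bigr => i _; rewrite extE.
- move=> A mA; rewrite wE//.
 have mf B i : measurable B -> measurable (w i @^-1` B).
  exact: (measurable_pre (mw _)).
 have mf' B i : measurable B -> measurable (w' i @^-1` B).
  exact: (measurable_pre (mw' _)).
 rewrite -!ge0_sume_distrr//; congr (_ * _)%E.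
 transitivity (\sum_(i < d) \sum_(h <- index_enum {perm 'I_d}) vol (w i @^-1` A `&` [set L | g L = h]))%E.
  by apply: eq_bigr => i _; rewrite (measure_fincells vol mg)//; exact: mf.
 transitivity (\sum_(i < d) \sum_(h <- index_enum {perm 'I_d}) vol (w' i @^-1` A `&` [set L | g L = h]))%E.
  rewrite exchange_big [RHS]exchange_big; apply: eq_bigr => h _ /=.
  rewrite (reindex_perm h)/=; apply: eq_bigr => i _; congr (vol _).
  by apply/seteqP; split => L /= [h1 h2]; split => //; move: h1; rewrite /= /w' h2.
 by apply: eq_bigr => i _; rewrite extE (measure_fincells vol mg)//; exact: mf'.
- move=> L i id; have -> : i = val (Ordinal id) by []; rewrite !extE /c.
 by rewrite (bigD1_seq (Ordinal id)) ?mem_enum ?enum_uniq//= le_max lexx.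
apply: le_trans Ks; apply: ae_ge0_le_integral => //.
- by move=> *; exact: EpowR_ge0.
- exact: measurable_powRq.
- by move=> *; exact: EpowR_ge0.
- exact: measurable_powRq.
exists ([set L | ~ nondeg p L] `|` [set L | ~ nondeg p' L]); split.
- by apply: measurableU; exact: measurable_deg.
- apply/eqP; rewrite eq_le measure_ge0 andbT.
 apply: le_trans (measureU2 _ (measurable_deg p) (measurable_deg p')) _.
 have le0 (a : \bar R) : (a = 0 -> a <= 0)%E by move=> ->.
 by rewrite -[leRHS]adde0; apply: leeD; apply: le0; [exact: nd|exact: nd'].
move=> L /=; apply: contra_notP; rewrite not_orE !notE => -[ndL ndL'] _.
have h : c (g L) L <= K L.
 apply/ler_addgt0Pr => e e0; have [x [y [px py xy]]] := hK L ndL ndL' e e0.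
 have [a ha] := lpts_fun px (zL L ndL); have [b hb] := lpts_fun py (wL L ndL').
 apply: le_trans (cg L (a^-1 * b)%g) _; rewrite /c.
 have Ke0 : 0 <= K L + e by apply: le_trans (xy 0 d0); exact: dFS_ge0.
 elim/big_ind: _ => // [x0 y0 h1 h2|i _]; first by rewrite ge_max h1.
 by rewrite permM -{1}(permKV a i) -ha -hb xy.
by rewrite lee_fin ge0_ler_powR ?nnegrE ?(ltW q0)// (le_trans (c_ge0 _ _) h).
Qed.

End LineMeasure.

(** * Reflections, the unitary action on lines, and averages over a grid *)

Section Householder.
Context {N : nat}.
Notation vec := ('I_N -> C).
Notation adj := adjmx.

(** For [a = 0] this is the identity, so it is unitary for every value of the parameter. *)
Definition hh (a : vec) : 'M[C]_N := 1%:M - (2 / nr2 a)%:C *: outer a.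

Lemma mv_hh (a x : vec) i : mv (hh a) x i = x i - (2 / nr2 a)%:C * dotc a x * a i.
Proof.
have -> : mv (hh a) x i = mv 1%:M x i - (2 / nr2 a)%:C * mv (outer a) x i.
 rewrite /mv mulr_sumr -sumrB; apply: eq_bigr => j _.
 by rewrite /hh; move: (1%:M : 'M[C]_N) (outer a) => A B; rewrite !mxE mulrBl mulrA.
rewrite mv_outer mulrA; congr (_ - _).
rewrite /mv (bigD1 i)//= mxE eqxx mul1r big1 ?addr0// => j ji.
by rewrite mxE eq_sym (negbTE ji) mul0r.
Qed.

Lemma adj_hh (a : vec) : adj (hh a) = hh a.
Proof.
rewrite /hh adjmx_sub; congr (_ - _).
 by apply/matrixP => i j; rewrite !mxE eq_sym rmorph_nat.
apply/matrixP => i j; rewrite !mxE !conjcMm conjcK.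
rewrite (_ : conjc (2 / nr2 a)%:C = (2 / nr2 a)%:C); first by rewrite (mulrC (a i)).
by rewrite /= oppr0.
Qed.

Lemma hh_unitary (a : vec) : adj (hh a) *m hh a = 1%:M.
Proof.
rewrite adj_hh /hh mulmxBl mul1mx mulmxBr mulmx1 -scalemxAr -scalemxAl outer_mul dotcxx.
rewrite (_ : \matrix_(i, j) _ = outer a)// !scalerA.
have [a0|a0] := eqVneq (nr2 a) 0; first by rewrite a0 invr0 mulr0 (_ : (0 : R)%:C = 0)// !mul0r !scale0r !subr0.
rewrite -!realcM (_ : 2 / nr2 a * (2 / nr2 a) * nr2 a = 2 / nr2 a + 2 / nr2 a); last by field.
by rewrite realcD scalerDl opprB addrK subrK.
Qed.

(* mapping v to a unimodular multiple of w by a reflection along v - c w, with c chosen so that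
  this vector stays away from 0 *)
Lemma hh_reflect (u v w : vec) : nr2 v = 1 -> nr2 w = 1 -> dotc u v = 0 -> dotc u w = 0 ->
 exists a c, [/\ dotc u a = 0, 2 <= nr2 a <= 4, cabs c = 1 &
  forall i, (nr2 a)%:C * v i - 2 * dotc a v * a i = (nr2 a)%:C * (c * w i)].
Proof.
move=> v1 w1 uv uw; pose t := cabs (dotc w v).
have [c c1 cwv] : exists2 c : C, cabs c = 1 & conjc c * dotc w v = - t%:C.
 have [wv0|wv0] := eqVneq (dotc w v) 0.
  by exists 1; rewrite ?cabs1// wv0 mulr0 /t wv0 cabs0 oppr0.
 exists (- (dotc w v / t%:C)).
  rewrite cabsN cabsM cabsV cabs_real (ger0_norm (cabs_ge0 _)) -/t divff//.
  by rewrite /t cabs_eq0.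
 have tn : t%:C != 0 by rewrite -cabs_eq0 cabs_real normr_eq0 /t cabs_eq0.
 rewrite conjcN conjcMm mulNr mulrAC conjcM_cabs -/t; congr (- _).
 rewrite (_ : conjc (t%:C)^-1 = (t%:C)^-1); last first.
  by rewrite -[t%:C^-1](rmorphV _) ?unitfE /= ?oppr0// /t cabs_eq0.
 by rewrite expr2 realcM mulfK.
pose a := lin2 1 v (- c) w.
have vw : dotc v w * - c = t%:C.
 rewrite mulrN mulrC; apply: (can_inj (@conjcK R)); rewrite conjcN conjcMm -dotcC cwv opprK /=.
 by rewrite oppr0.
have nra : nr2 a = 2 + 2 * t.
 rewrite /a nr2_lin2 cabs1 cabsN c1 v1 w1 expr1n !mulr1 conjc1 mul1r (mulrC (- c)) vw /=; ring.
have av : dotc a v = (1 + t)%:C.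
 by rewrite /a dotc_linl dotcxx v1 conjc1 mul1r conjcN mulNr cwv opprK realcD.
have t1 : t <= 1.
 have := cauchy_schwarz w v; rewrite w1 v1 mulr1 -/t => t2.
 by have t0 : 0 <= t := cabs_ge0 _; nra.
have t0 : 0 <= t := cabs_ge0 _.
exists a, c; split => //.
- by rewrite /a dotc_linr uv uw !mulr0 addr0.
- rewrite nra; apply/andP; split; lra.
move=> i; rewrite nra av /a /lin2.
have -> : (2 + 2 * t)%:C = 2 * (1 + t)%:C :> C.
 by rewrite (_ : 2 + 2 * t = 2 * (1 + t)) ?realcM; [congr (_ * _); rewrite rmorph_nat|ring].
ring.
Qed.

Lemma mv_hh_reflect (a v w : vec) (c : C) : nr2 a != 0 ->
 (forall i, (nr2 a)%:C * v i - 2 * dotc a v * a i = (nr2 a)%:C * (c * w i)) ->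
 forall i, mv (hh a) v i = c * w i.
Proof.
move=> a0 h i; have a0' : (nr2 a)%:C != 0 :> C by rewrite -cabs_eq0 cabs_real normr_eq0.
apply: (mulfI a0'); rewrite -h mv_hh mulrBr; congr (_ - _).
rewrite !mulrA; congr (_ * _ * _); rewrite -realcM mulrC divfK//.
by rewrite rmorph_nat.
Qed.

End Householder.

Section Action.
Context {m : nat}.
Notation adj := adjmx.

Lemma act_proj (U : 'M[C]_m.+2) (L : Gr m) : adj U *m U = 1%:M ->
 is_proj R 2 (U *m grm L *m adj U).
Proof.
have adjK (M : 'M[C]_m.+2) : adj (adj M) = M.
 by apply/matrixP => i j; rewrite !mxE conjcK.
move=> UU; have /and3P[/eqP LA /eqP LL /eqP LT] := @grm_proj R m L.
apply/and3P; split; apply/eqP.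
- by rewrite !adjmx_mul adjK LA mulmxA.
- by rewrite !mulmxA -(mulmxA _ (adj U) U) UU mulmx1 -(mulmxA U) LL.
- by rewrite mxtrace_mulC mulmxA UU mul1mx.
Qed.

Definition act (U : 'M[C]_m.+2) (L : Gr m) : Gr m :=
 match pselect (adj U *m U = 1%:M) with
 | left h => @MkGr R m _ (act_proj L h) | right _ => L end.

Lemma grm_act U L : adj U *m U = 1%:M -> grm (act U L) = U *m grm L *m adj U.
Proof. by move=> h; rewrite /act; case: pselect. Qed.

Lemma Gr_inj (L L' : Gr m) : grm L = grm L' -> L = L'.
Proof. by move=> h; apply: val_inj. Qed.

Lemma act_mv U L x : adj U *m U = 1%:M -> mv (grm L) x =1 x ->
 mv (grm (act U L)) (mv U x) =1 mv U x.
Proof.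
move=> UU Lx i; rewrite grm_act// -mv_mul -mulmxA UU mulmx1 mv_mul.
by congr mv; apply/funext.
Qed.

Lemma nr2_unitary (U : 'M[C]_m.+2) x : adj U *m U = 1%:M -> nr2 (mv U x) = nr2 x.
Proof.
move=> UU; have dotU y z : dotc (mv U y) (mv U z) = dotc y z.
 transitivity (\sum_j \sum_k conjc (y j) * (adj U *m U) j k * z k).
  rewrite /dotc /mv; under eq_bigr do rewrite conjc_sum mulr_suml.
  rewrite exchange_big; apply: eq_bigr => j _ /=.
  under eq_bigr do rewrite mulr_sumr; rewrite exchange_big; apply: eq_bigr => k _ /=.
  rewrite mxE mulr_sumr mulr_suml; apply: eq_bigr => i _.
  by rewrite !mxE conjcMm; ring.
 rewrite UU; apply: eq_bigr => j _; rewrite (bigD1 j)//= mxE eqxx mulr1 big1 ?addr0// => k kj.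
 by rewrite mxE eq_sym (negbTE kj) mulr0 mul0r.
have := dotU x x; rewrite !dotcxx => /(congr1 (@Re R)) /=.
exact.
Qed.

Lemma measurable_to_Gr d (X : measurableType d) (f : X -> Grm m) :
 (forall i j, mcfun (fun x => grm (f x) i j)) -> meas f.
Proof.
move=> mf; apply: (measurability _ (erefl (@measurable _ (Grm m)))).
move=> _ [_ [L [r ->]] <-]; rewrite setTI.
rewrite (_ : _ @^-1` _ = [set x | dmx R (grm L) (grm (f x)) < r])//.
apply: measurable_ltf; last exact: measurable_cst.
apply: measurable_sqrt; apply: measurable_sum => i; apply: measurable_sum => j.
under eq_fun do rewrite -sqr_cabs.
by apply: measurable_cabs2; apply: mcfunD; [exact: mcfun_cst|exact: mcfunN].
Qed.

Lemma measurable_act U : meas (act U : Grm m -> Grm m).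
Proof.
rewrite /act; case: pselect => [h|_]; last exact: measurable_id.
apply: measurable_to_Gr => i j /=.
rewrite (_ : (fun _ => _) = fun L : Grm m => \sum_k (\sum_l U i l * grm L l k) * adj U k j).
 apply: mcfun_sum => k; apply: mcfunM; last exact: mcfun_cst.
 by apply: mcfun_sum => l; apply: mcfunM; [exact: mcfun_cst|exact: mcfun_grm].
by apply/funext => L; rewrite !mxE; apply: eq_bigr => k _; rewrite mxE.
Qed.

Lemma vol_act (vol : probability (Grm m) R) (U : 'M[C]_m.+2) (B : set (Grm m)) :
 Gr_invariant R m vol -> adj U *m U = 1%:M -> measurable B ->
 vol [set L | B (act U L)] = vol B.
Proof.
move=> inv UU mB; rewrite -(inv U UU B mB); congr (vol _); apply/seteqP; split => L /=.
 by move=> BL; exists (act U L) => //; rewrite grm_act.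
move=> [L' BL' LE]; rewrite (_ : act U L = L')//; apply: Gr_inj.
by rewrite grm_act.
Qed.

End Action.

Section GridAverage.
Context {d : measure_display} {X : measurableType d}.
Variables (P : probability X R) (M : nat).

Lemma gcnt_average k (T : seq R -> set X) (b : R) : (forall s, measurable (T s)) ->
 (forall s, P (T s) = b%:E) ->
 meas (fun x : X => (gcnt M k (fun s => `[< T s x >]))%:R : R) /\
 (\int[P]_x ((gcnt M k (fun s => `[< T s x >]))%:R)%:E = (M%:R ^+ k * b)%:E)%E.
Proof.
elim: k T => [|k IH] T mT PT.
 have E : (fun x => (`[< T [::] x >] : nat)%:R : R) = \1_(T [::]).
  by apply/funext => x; rewrite indicE; congr (_%:R); rewrite -[in RHS]asboolE.
 split => /=; first by rewrite E; exact: measurable_indic.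
 transitivity (\int[P]_x (\1_(T [::]) x)%:E)%E.
  by apply: eq_integral => x _; congr EFin; exact: (congr1 (@^~ x) E).
 by rewrite integral_indic// setIT expr0 mul1r; exact: PT.
have h (i : 'I_M) := IH (fun s => T (gpt M i :: s)) (fun s => mT _) (fun s => PT _).
have E : (fun x => (gcnt M k.+1 (fun s => `[< T s x >]))%:R : R) =
  fun x => \sum_(i < M) (gcnt M k (fun s => `[< T (gpt M i :: s) x >]))%:R.
 by apply/funext => x; rewrite /= natr_sum.
split; first by rewrite E; apply: measurable_sum => i; have [] := h i.
transitivity (\int[P]_x (\sum_(i < M) ((gcnt M k (fun s => `[< T (gpt M i :: s) x >]))%:R)%:E))%E.
 by apply: eq_integral => x _; rewrite sumEFin; congr EFin; have := congr1 (@^~ x) E.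
rewrite ge0_integral_sum//; last first.
 by move=> i; apply/measurable_EFinP; have [] := h i.
under eq_bigr => i _ do rewrite (h i).2.
by rewrite sumEFin sumr_const card_ord exprS -mulrA mulr_natl.
Qed.

(** Integrate the number of grid points [s] with [x] in [T s]: each [T s] has the probability of
    [B], so the mean is [M^k P(B)], and a pointwise bound on the count passes to [P(B)]. *)
Lemma gcnt_average_le k (T : seq R -> set X) (B : set X) (c : R) : (0 < M)%N ->
 (forall s, measurable (T s)) -> measurable B -> (forall s, P (T s) = P B) ->
 (forall x, (gcnt M k (fun s => `[< T s x >]))%:R <= M%:R ^+ k * c) -> (P B <= c%:E)%E.
Proof.
move=> M0 mT mB PT hc; have PB : (fine (P B))%:E = P B by rewrite fineK// fin_num_measure.
have [] := @gcnt_average k T (fine (P B)) mT _; first by move=> s; rewrite PB.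
move=> mg /esym E; have Mk : 0 < M%:R ^+ k :> R by rewrite exprn_gt0// ltr0n.
rewrite -PB lee_fin -(ler_pM2l Mk) -lee_fin E.
apply: (@le_trans _ _ (\int[P]_x (M%:R ^+ k * c)%:E)%E).
 apply: ge0_le_integral => //; first exact/measurable_EFinP.
 by move=> x _; rewrite lee_fin.
by rewrite integral_cst// [X in (_ * X)%E](_ : _ = 1%E) ?mule1//; exact: probability_setT.
Qed.

End GridAverage.

(** Polynomial of degree at most [D] in the variable at any position, the others fixed, for lists of
    any length. It implies [sepoly] and adds degrees under products, so that degrees can be read off
    from formulas. *)
Definition spoly D (g : seq R -> C) := forall pre post, exists2 P : {poly C},
 (size P <= D.+1)%N & forall x, g (pre ++ x :: post) = P.[x%:C].

Lemma spoly_sepoly D k g : spoly D g -> sepoly D k g.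
Proof.
elim: k g => [//|k IH] g sg; split; first by move=> s _; exact: (sg [::] s).
move=> x; apply: IH => pre post; have [P sP hP] := sg (x :: pre) post.
by exists P => // y; exact: hP.
Qed.

Lemma spoly_leq D D' g : (D <= D')%N -> spoly D g -> spoly D' g.
Proof.
move=> DD' sg pre post; have [P sP hP] := sg pre post.
by exists P => //; rewrite (leq_trans sP).
Qed.

Lemma spoly_ext D g h : g =1 h -> spoly D g -> spoly D h.
Proof.
move=> gh sg pre post; have [P sP hP] := sg pre post.
by exists P => // x; rewrite -gh hP.
Qed.

Lemma spoly_cst c : spoly 0 (fun=> c).
Proof. by move=> pre post; exists c%:P; rewrite ?size_polyC ?leq_b1// => x; rewrite hornerC. Qed.

Lemma spoly_nth i : spoly 1 (fun s => (nth 0 s i)%:C).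
Proof.
move=> pre post; have [E|E|E] := ltngtP i (size pre).
- exists ((nth 0 pre i)%:C)%:P; first by rewrite size_polyC (leq_trans (leq_b1 _)).
 by move=> x; rewrite hornerC nth_cat E.
- exists ((nth 0 post (i - size pre).-1)%:C)%:P; first by rewrite size_polyC (leq_trans (leq_b1 _)).
 move=> x; rewrite hornerC nth_cat ltnNge ltnW//=.
 by case: (i - size pre)%N (subn_gt0 (size pre) i) => [|j]; rewrite ?E.
exists 'X; first by rewrite size_polyX.
by move=> x; rewrite hornerX nth_cat E ltnn subnn.
Qed.

Lemma spolyD D g h : spoly D g -> spoly D h -> spoly D (fun s => g s + h s).
Proof.
move=> sg sh pre post; have [P sP hP] := sg pre post; have [Q sQ hQ] := sh pre post.
exists (P + Q) => [|x]; last by rewrite hornerD hP hQ.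
by rewrite (leq_trans (size_polyD _ _))// geq_max sP.
Qed.

Lemma spolyM D E g h : spoly D g -> spoly E h -> spoly (D + E) (fun s => g s * h s).
Proof.
move=> sg sh pre post; have [P sP hP] := sg pre post; have [Q sQ hQ] := sh pre post.
exists (P * Q) => [|x]; last by rewrite hornerM hP hQ.
rewrite (leq_trans (size_polyMleq _ _))//.
by move: sP sQ; case: (size P) (size Q) => [|a] [|b] /=; lia.
Qed.

Lemma spolyZ D c g : spoly D g -> spoly D (fun s => c * g s).
Proof. by move=> sg; rewrite -[D]add0n; apply: spolyM => //; exact: spoly_cst. Qed.

Lemma spolyX D n g : spoly D g -> spoly (D * n) (fun s => g s ^+ n).
Proof.
move=> sg; elim: n => [|n IH].
 by rewrite muln0; apply: (spoly_ext _ (spoly_cst 1)) => s; rewrite expr0.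
rewrite mulnS; apply: (spoly_ext _ (spolyM sg IH)) => s.
by rewrite exprS.
Qed.

Lemma spoly_sum D I (r : seq I) (P : pred I) (g : I -> seq R -> C) : (forall i, P i -> spoly D (g i)) ->
 spoly D (fun s => \sum_(i <- r | P i) g i s).
Proof.
move=> sg; elim: r => [|i r IH].
 by apply: (spoly_ext _ (spoly_leq (leq0n D) (spoly_cst 0))) => s; rewrite big_nil.
case Pi : (P i).
 apply: (spoly_ext _ (spolyD (sg i Pi) IH)) => s; by rewrite big_cons Pi.
by apply: (spoly_ext _ IH) => s; rewrite big_cons Pi.
Qed.

Lemma spoly_prod I (r : seq I) (D : I -> nat) (g : I -> seq R -> C) : (forall i, spoly (D i) (g i)) ->
 spoly (\sum_(i <- r) D i)%N (fun s => \prod_(i <- r) g i s).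
Proof.
move=> sg; elim: r => [|i r IH].
 by rewrite big_nil; apply: (spoly_ext _ (spoly_cst 1)) => s; rewrite big_nil.
rewrite big_cons; apply: (spoly_ext _ (spolyM (sg i) IH)) => s.
by rewrite big_cons.
Qed.

Lemma spoly_pe n d D (p : Hpoly n d) (g : seq R -> 'I_n.+1 -> C) :
 (forall i, spoly D (fun s => g s i)) -> spoly (D * d) (fun s => pe p (g s)).
Proof.
move=> sg; apply: spoly_sum => a /eqP da; apply: spolyZ.
rewrite -[X in (D * X)%N]da /mdeg big_distrr; apply: spoly_prod => i.
exact: spolyX.
Qed.

(** * The sublevel estimate over random lines *)

Section LineSublevel.
Context {m d : nat}.
Notation vec := ('I_m.+2 -> C).
Notation N := m.+2.
Variables (vol : probability (Grm m) R) (inv : Gr_invariant R m vol) (d0 : (0 < d)%N).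
Variables (u : vec) (hu : nr2 u = 1 \/ nr2 u = 0).

Lemma dotc_nr20 (x y : vec) : nr2 x = 0 -> dotc x y = 0.
Proof.
move=> /eqP; rewrite nr2_eq0 => /forallP x0; rewrite /dotc big1// => i _.
by rewrite (eqP (x0 i)) conjc0 mul0r.
Qed.

(** For a unit vector [u] this projects to the hyperplane orthogonal to [u], so that reflections
    along the image fix [u]; [u = 0] encodes the absence of a constraint. *)
Definition hproj (b : vec) : vec := lin2 1 b (- dotc u b) u.

Lemma dotc_hproj b : dotc u (hproj b) = 0.
Proof.
rewrite /hproj dotc_linr mul1r; case: hu => u1; last by rewrite !(dotc_nr20 _ u1) mulr0 addr0.
by rewrite dotcxx u1 mulr1 subrr.
Qed.

Lemma hproj_id b : dotc u b = 0 -> hproj b =1 b.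
Proof. by move=> ub i; rewrite /hproj /lin2 ub oppr0 mul0r mul1r addr0. Qed.

Lemma nr2_hproj b : nr2 (hproj b) <= nr2 b.
Proof.
case: hu => u1; last first.
 rewrite /hproj (dotc_nr20 _ u1) (_ : lin2 _ _ _ _ = b)//; apply/funext => i.
 by rewrite /lin2 oppr0 mul0r mul1r addr0.
rewrite /hproj nr2_lin2 cabs1 cabsN u1 expr1n !mulr1 mul1r conjc1 mul1r.
rewrite mulNr (dotcC u b) (mulrC (dotc u b)) conjcM_cabs ReN /=.
have := sqr_ge0 (cabs (dotc u b)); lra.
Qed.

(** The [2 N] real parameters are the real and imaginary parts of the vector along which to
    reflect. *)
Definition bvec (s : seq R) : vec :=
 fun i => (nth 0 s (2 * i)%N)%:C + (0 +i* 1)%C * (nth 0 s (2 * i).+1)%:C.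
Definition avec s := hproj (bvec s).
(** This evaluates [p] at [nr2 a] times the reflected vector, with [a = avec s]: the factor [nr2 a]
    clears the denominator and leaves entries of degree 2 in each parameter. *)
Definition hhpoly (p : Hpoly m.+1 d) (v : vec) (s : seq R) : C :=
 pe p (fun i => (nr2 (avec s))%:C * v i - 2 * dotc (avec s) v * avec s i).

Lemma spoly_bvec i : spoly 1 (fun s => bvec s i).
Proof. by apply: spolyD; [|apply: spolyZ]; exact: spoly_nth. Qed.

Lemma spoly_bvec_conj i : spoly 1 (fun s => conjc (bvec s i)).
Proof.
apply: (spoly_ext (g := fun s => (nth 0 s (2 * i)%N)%:C + conjc (0 +i* 1)%C * (nth 0 s (2 * i).+1)%:C)).
 by move=> s; rewrite /bvec conjcD conjcMm /= !oppr0.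
by apply: spolyD; [|apply: spolyZ]; exact: spoly_nth.
Qed.

Lemma spoly_avec i : spoly 1 (fun s => avec s i).
Proof.
apply: (spoly_ext (g := fun s => bvec s i + (- u i) * dotc u (bvec s))).
 by move=> s; rewrite /avec /hproj /lin2; ring.
apply: spolyD; first exact: spoly_bvec.
apply: spolyZ; apply: spoly_sum => j _; apply: spolyZ; exact: spoly_bvec.
Qed.

Lemma spoly_avec_conj i : spoly 1 (fun s => conjc (avec s i)).
Proof.
apply: (spoly_ext (g := fun s => conjc (bvec s i) + (- conjc (u i)) * \sum_j u j * conjc (bvec s j))).
 move=> s; rewrite /avec /hproj /lin2 [RHS]conjcD mul1r [in RHS](conjcMm (- dotc u (bvec s)) (u i)) conjcN [in RHS]mulNr [in LHS]mulNr [in LHS]mulrC.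
 congr (_ - _ * _); rewrite /dotc conjc_sum; apply: eq_bigr => j _.
 by rewrite conjcMm conjcK.
apply: spolyD; first exact: spoly_bvec_conj.
apply: spolyZ; apply: spoly_sum => j _; apply: spolyZ; exact: spoly_bvec_conj.
Qed.

Lemma spoly_hhpoly p v : spoly (2 * d) (hhpoly p v).
Proof.
apply: spoly_pe => i; apply: spolyD.
 apply: (spoly_ext (g := fun s => v i * \sum_j conjc (avec s j) * avec s j)).
  by move=> s; rewrite -dotcxx mulrC.
 apply: spolyZ; apply: spoly_sum => j _; apply: (@spolyM 1 1).
  exact: spoly_avec_conj.
 exact: spoly_avec.
apply: (spoly_ext (g := fun s => -2 * (dotc (avec s) v * avec s i))).
 by move=> s; rewrite mulrA !mulNr.
apply: spolyZ; apply: (@spolyM 1 1); last exact: spoly_avec.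
apply: (spoly_ext (g := fun s => \sum_j v j * conjc (avec s j))).
 by move=> s; apply: eq_bigr => j _; rewrite mulrC.
by apply: spoly_sum => j _; apply: spolyZ; exact: spoly_avec_conj.
Qed.

Lemma nr2_avec s : all (fun x => -1 <= x <= 1) s -> nr2 (avec s) <= (2 * N)%:R.
Proof.
move=> hs; apply: le_trans (nr2_hproj _) _.
have h k : (nth 0 s k) ^+ 2 <= 1.
 have [ks|ks] := ltnP k (size s); last by rewrite nth_default// expr0n.
 have /andP[h1 h2] := allP hs _ (mem_nth 0 ks).
 by nra.
apply: (via (\sum_(i < N) 2)); last by rewrite sumr_const card_ord -[leLHS]mulr_natr -natrM.
apply: ler_sum => i _; rewrite /bvec /cnorm2 /= !mul0r !mulr0 !mul1r !add0r ?addr0 ?subr0 ?oppr0 ?addr0.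
by rewrite -[leRHS]/(1 + 1) lerD.
Qed.

(** By [hh_reflect] some reflection takes [v] to a unimodular multiple of [vs], with
    [2 <= nr2 a <= 4]. The parameter encodes [a / 2], to stay in [[-1, 1]]; its squared norm is at
    least [1/2], whence the factor [2^(-d)]. *)
Lemma hhpoly_large p v vs c0 : 0 < c0 -> nr2 v = 1 -> dotc u v = 0 -> nr2 vs = 1 -> dotc u vs = 0 ->
 c0 <= cabs (pe p vs) ->
 exists s, [/\ size s = (2 * N)%N, all (fun x => -1 <= x <= 1) s & c0 / 2 ^+ d <= cabs (hhpoly p v s)].
Proof.
move=> c00 v1 uv vs1 uvs pvs; have [a [c [ua /andP[a2 a4] c1 aE]]] := hh_reflect v1 vs1 uv uvs.
have ai i : cabs (a i) <= 2.
 apply: le_trans (cabs_le_vnorm a i) _; rewrite /vnorm -[leRHS]ger0_norm// -sqrtr_sqr ler_wsqrtr//.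
 by rewrite -natrX.
pose s : seq R := mkseq (fun k => if odd k then Im (a (inord k./2)) / 2
  else Re (a (inord k./2)) / 2) (2 * N).
have bE : bvec s = fun i => 2^-1 * a i.
 apply/funext => i; have i2 : (i < N)%N by [].
 rewrite /bvec !nth_mkseq; [|by lia..].
 rewrite !mul2n /= odd_double /= doubleK uphalf_double inord_val.
 case: (a i) => x y /=; apply/eqP; rewrite eq_complex /=.
 by apply/andP; split; apply/eqP; field.
have aE2 : avec s = fun i => 2^-1 * a i.
 apply/funext => i; rewrite /avec hproj_id; first by rewrite bE.
 by rewrite bE -[RHS](mulr0 2^-1) -ua /dotc mulr_sumr; apply: eq_bigr => j _; ring.
exists s; split; first by rewrite size_mkseq.
 apply/allP => x /mapP[k _ ->]; rewrite -ler_norml.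
 case: (odd k); rewrite normrM (ger0_norm (_ : 0 <= 2^-1)) ?invr_ge0// ler_pdivrMr// mul1r.
  exact: le_trans (Im_cabs _) (ai _).
 exact: le_trans (Re_cabs _) (ai _).
have h2 : conjc (2^-1 : C) = 2^-1.
 have -> : 2^-1 = (2^-1 : R)%:C :> C by rewrite rmorphV ?unitfE// rmorph_nat.
 by rewrite /= oppr0.
have nE : nr2 (avec s) = nr2 a / 4.
 by rewrite aE2 nr2_scale cabsV cabs_nat; field.
have -> : hhpoly p v s = pe p (fun i => (4^-1 * (nr2 a)%:C * c) * vs i); last first.
 rewrite pe_scale cabsM cabsX !cabsM c1 mulr1 cabsV cabs_nat cabs_real ger0_norm ?nr2_ge0//.
 have h24 : 2^-1 <= 4^-1 * nr2 a by lra.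
 have h24d : (2^-1) ^+ d <= (4^-1 * nr2 a) ^+ d.
  by rewrite lerXn2r ?nnegrE ?mulr_ge0 ?invr_ge0 ?nr2_ge0.
 by rewrite [leRHS]mulrC -exprVn ler_pM// ?(ltW c00)// exprn_ge0// invr_ge0.
rewrite /hhpoly; apply: pe_ext => i; rewrite -!mulrA -aE nE aE2.
have -> : dotc (fun i => 2^-1 * a i) v = 2^-1 * dotc a v.
 by rewrite /dotc mulr_sumr; apply: eq_bigr => j _; rewrite conjcMm h2; ring.
rewrite realcM (_ : (4^-1)%:C = 4^-1); last by rewrite rmorphV ?unitfE// rmorph_nat.
by field.
Qed.

Lemma hh_sub p v s e : all (fun x => -1 <= x <= 1) s -> 0 < e ->
 cabs (pe p (mv (hh (avec s)) v)) < e -> cabs (hhpoly p v s) < e * (2 * N)%:R ^+ d.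
Proof.
move=> hs e0; have na := nr2_avec hs; set a := avec s => pv.
have [a0|a0] := eqVneq (nr2 a) 0.
 rewrite /hhpoly -/a pe0// ?cabs0; first by rewrite mulr_gt0// exprn_gt0// ltr0n.
 apply/eqP; rewrite nr2_eq0; apply/forallP => i.
 move: (a0) => /eqP; rewrite nr2_eq0 => /forallP/(_ i)/eqP ->.
 by rewrite a0 mul0r mulr0 subrr.
rewrite /hhpoly -/a (_ : (fun i => _) = fun i => (nr2 a)%:C * mv (hh a) v i); last first.
 apply/funext => i; rewrite mv_hh mulrBr; congr (_ - _); rewrite !mulrA -realcM mulrC.
 by rewrite (_ : nr2 a * (2 / nr2 a) = 2) ?rmorph_nat ?(mulrC (a i))//; field.
rewrite pe_scale cabsM cabsX cabs_real ger0_norm ?nr2_ge0// mulrC.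
apply: (@lt_le_trans _ _ (e * nr2 a ^+ d)).
 by rewrite ltr_pM2r// exprn_gt0// lt_def a0 nr2_ge0.
by rewrite ler_pM2l// lerXn2r ?nnegrE ?nr2_ge0.
Qed.

(** By invariance [vol B] is the mean, over a grid of parameters [s], of the measure of the lines
    that [hh (avec s)] sends into [B]. For a fixed line these [s] lie in a sublevel set of [hhpoly],
    and [sublevel] with degree [2 d] in [2 N] variables says that they are few. Refining the grid
    removes its error term. *)
Lemma line_sublevel : exists2 A : R, 0 < A & forall (p : Hpoly m.+1 d) c0 vs e (B : set (Grm m)),
 0 < c0 -> nr2 vs = 1 -> dotc u vs = 0 -> c0 <= cabs (pe p vs) -> 0 < e -> measurable B ->
 (forall L : Gr m, exists v, [/\ nr2 v = 1, dotc u v = 0 & forall a, dotc u a = 0 ->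
   B (act (hh a) L) -> cabs (pe p (mv (hh a) v)) < e]) ->
 (vol B <= (A * (e / c0) `^ ((2 * d) * 2 ^ (2 * N))%:R^-1)%:E)%E.
Proof.
have dd : (0 < 2 * d)%N by rewrite muln_gt0.
have [A0 A00 sub] := @sublevel (2 * d) (2 * N) dd.
set b := ((2 * d) * 2 ^ (2 * N))%:R^-1 : R in sub *.
pose K : R := (2 * N)%:R ^+ d * 2 ^+ d.
have K0 : 0 < K by rewrite mulr_gt0 ?exprn_gt0 ?ltr0n.
have b0 : 0 <= b by rewrite invr_ge0.
pose A := Num.max A0 1 * K `^ b.
exists A; first by rewrite mulr_gt0 ?powR_gt0// lt_max ltr01 orbT.
move=> p c0 vs e B c00 vs1 uvs pvs e0 mB hB.
pose e' := e * (2 * N)%:R ^+ d; pose c := c0 / 2 ^+ d.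
have e'0 : 0 < e' by rewrite mulr_gt0 ?exprn_gt0 ?ltr0n.
have c'0 : 0 < c by rewrite divr_gt0 ?exprn_gt0.
have ecE : (e' / c) `^ b = K `^ b * (e / c0) `^ b.
 rewrite -powRM ?divr_ge0 ?ltW//; congr (_ `^ b); rewrite /e' /c /K.
 by field; rewrite gt_eqF//= expf_neq0.
have -> : A * (e / c0) `^ b = Num.max A0 1 * (e' / c) `^ b by rewrite ecE /A mulrA.
have [ec|ce] := leP e' c; last first.
 have h : 1 <= (e' / c) `^ b.
  rewrite -[leLHS](powRr0 (e' / c)) ler_powR// ler_pdivlMr// mul1r ltW//.
 apply: (via 1%E); first exact: probability_le1.
 by rewrite lee_fin -[leLHS]mulr1 ler_pM// le_max lexx orbT.
have PB : (fine (vol B))%:E = vol B by rewrite fineK// fin_num_measure.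
rewrite -PB lee_fin; apply/ler_addgt0Pr => t t0.
pose M := (Num.truncn (A0 / t)).+1.
have M0 : 0 < (M%:R : R) by rewrite ltr0n.
have Mt : A0 / M%:R <= t.
 rewrite ler_pdivrMr// mulrC -ler_pdivrMr// ltW//; exact: truncnS_gt.
rewrite -lee_fin PB.
pose T (s : seq R) : set (Grm m) := [set L | B (act (hh (avec s)) L)].
apply: (@gcnt_average_le _ _ vol M (2 * N) T B) => //.
- move=> s; exact: (measurable_pre (measurable_act _)).
- by move=> s; rewrite -(vol_act inv (hh_unitary (avec s)) mB).
move=> L; have [v [v1 uv hv]] := hB L.
apply: (@le_trans _ _ (gcnt M (2 * N) (fun s => cabs (hhpoly p v s) < e'))%:R).
 rewrite ler_nat; apply: gcnt_mono => s ss hs /asboolP Ts.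
 by apply: hh_sub => //; apply: hv => //; exact: dotc_hproj.
have := sub (hhpoly p v) e' c M (spoly_sepoly _ (spoly_hhpoly p v)) e'0 ec isT (hhpoly_large c00 v1 uv vs1 uvs pvs).
move=> /le_trans; apply; rewrite ler_wpM2l ?exprn_ge0// lerD// ler_wpM2r ?powR_ge0// le_max lexx//.
Qed.

End LineSublevel.

(** * Integrals of negative powers *)

Section TailIntegral.
Context {d : measure_display} {X : measurableType d}.
Variables (P : probability X R) (A b g : R) (A0 : 0 <= A) (g0 : 0 < g) (gb : g < b).

Lemma half_pow_gt0 (j : nat) : 0 < (2^-1 : R) ^+ j.
Proof. by rewrite exprn_gt0. Qed.

Lemma half_pow_small (e : R) : 0 < e -> exists j, (2^-1 : R) ^+ j <= e.
Proof.
move=> e0; exists (Num.truncn e^-1).+1.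
have h n : n%:R <= (2 : R) ^+ n by rewrite -natrX ler_nat ltnW// ltn_expl.
rewrite -[leRHS]invrK exprVn lef_pV2 ?posrE ?exprn_gt0 ?invr_gt0//.
by apply: le_trans (h _); apply/ltW/truncnS_gt.
Qed.

Lemma negpow_dyadic (x : R) : 0 < x -> x < 1 -> exists j, x < 2^-1 ^+ j /\
 x `^ (- g) <= (2 `^ g) ^+ j.+1.
Proof.
move=> x0 x1; have [|k hk kmin] := @ex_minnP (fun j => (2^-1 : R) ^+ j <= x).
 by have [j hj] := half_pow_small x0; exists j.
case: k hk kmin => [|j] hk kmin; first by move: hk; rewrite expr0 leNgt x1.
exists j; split; first by rewrite ltNge; apply/negP => /kmin; rewrite ltnn.
rewrite powRN -[leRHS]invrK lef_pV2 ?posrE ?powR_gt0 ?invr_gt0 ?exprn_gt0 ?powR_gt0//.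
rewrite -exprVn -powR_inv1 ?powR_ge0// -powRrM mulrN1 -powR_mulrn ?powR_ge0// -powRrM.
rewrite (_ : - g * j.+1%:R = (- (j.+1%:R)) * g); last by ring.
by rewrite powRrM powRN powR_mulrn// -exprVn ge0_ler_powR ?nnegrE ?(ltW g0) ?(ltW x0)// ltW// half_pow_gt0.
Qed.

(** Dyadic layers: [a^(-g)] is at most 1 plus the sum over [j] of [2^(g (j + 1))] on [{a < 2^(-j)}],
    which integrates to a geometric series of ratio [2^(g - b)]. Where [a = 0] the integrand is 0 by
    the convention for powers. *)
Lemma tail_integral (a : X -> R) : meas a -> (forall x, 0 <= a x) ->
 (forall e : R, 0 < e -> (P [set x | (a x < e)%R] <= (A * e `^ b)%:E)%E) ->
 (\int[P]_x (a x `^ (- g))%:E <= (1 + A * (2 `^ g / (1 - 2 `^ (g - b))))%:E)%E.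
Proof.
move=> ma a0 tail; pose S j := [set x | a x < 2^-1 ^+ j].
have mS j : measurable (S j) by apply: measurable_ltf => //; exact: measurable_cst.
pose c j : R := (2 `^ g) ^+ j.+1.
have c0 j : 0 <= c j by rewrite exprn_ge0// powR_ge0.
pose f j x : \bar R := ((c j)%:E * (\1_(S j) x)%:E)%E.
have f0 j x : (0 <= f j x)%E by rewrite mule_ge0 ?lee_fin.
have mf j : meas (f j).
 apply: emeasurable_funM; first exact: measurable_cst.
 by apply/measurable_EFinP; exact: measurable_indic.
apply: (@le_trans _ _ (\int[P]_x (1 + \sum_(j <oo) f j x))%E).
 apply: ge0_le_integral => //.
 - by move=> *; exact: EpowR_ge0.
 - apply/measurable_EFinP; apply: (mcomp (fun t : R => t `^ (- g))) ma.
  exact: measurable_powR.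
 - apply: emeasurable_funD; first exact: measurable_cst.
  by apply: ge0_emeasurable_sum => // k x _ _.
 move=> x _; have S0 : (0 <= \sum_(j <oo) f j x)%E by apply: nneseries_ge0.
 have [ax0|ax0] := eqVneq (a x) 0.
  by rewrite ax0 powR0 ?oppr_eq0 ?gt_eqF// adde_ge0.
 have ax : 0 < a x by rewrite lt_def ax0 a0.
 have [a1|a1] := ltP (a x) 1; last first.
  apply: (via 1%E); last by rewrite leeDl.
  rewrite lee_fin powRN invf_le1 ?powR_gt0// -(powRr0 (a x)) ler_powR// ltW//.
 have [j [h1 h2]] := negpow_dyadic ax a1.
 apply: (@le_trans _ _ (\sum_(j <oo) f j x)%E); last by rewrite leeDr.
 apply: (via (f j x)).
  by rewrite /f indicE mem_set// mule1 lee_fin.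
 apply: le_trans (nneseries_lim_ge j.+1 _) => //.
 by rewrite big_nat_recr//= leeDr// sume_ge0.
rewrite ge0_integralD//; last 2 first.
- by move=> x _; exact: nneseries_ge0.
- by apply: ge0_emeasurable_sum => // k x _ _.
rewrite integral_cst// [X in (1 * X)%E](_ : _ = 1%E); last exact: probability_setT.
rewrite mule1 EFinD leeD2l// integral_nneseries//.
pose r : R := 2 `^ (g - b).
have r0 : 0 <= r by rewrite powR_ge0.
have r1 : r < 1 by rewrite -[ltRHS](powRr0 2) gt0_ltr_powR_exp || (rewrite /r -[X in _ < X](powRr0 2); rewrite /powR ifF ?gt_eqF// ltr_expR ltr_pM2r ?ln_gt0 ?ltr1n// subr_lt0).
apply: lime_le.
 by apply: is_cvg_nneseries => j _ _; exact: integral_ge0.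
apply: nearW => n; apply: (@le_trans _ _ (\sum_(0 <= j < n) (A * 2 `^ g * r ^+ j)%:E)%E).
 apply: lee_sum => j _; rewrite /f ge0_integralZl//; last 2 first.
 - by apply/measurable_EFinP; exact: measurable_indic.
 - by rewrite lee_fin.
 rewrite integral_indic// setIT.
 apply: (@le_trans _ _ ((c j)%:E * (A * (2^-1 ^+ j) `^ b)%:E)%E).
  by apply: lee_wpmul2l; [rewrite lee_fin|exact: tail (half_pow_gt0 j)].
 rewrite -EFinM lee_fin le_eqVlt; apply/orP; left; apply/eqP.
 have E : ((2^-1 : R) ^+ j) `^ b * (2 `^ g) ^+ j = r ^+ j.
  rewrite -[2^-1 ^+ j]powR_mulrn// powRAC powR_mulrn ?powR_ge0// -exprMn; congr (_ ^+ _).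
  rewrite -[2^-1]powR_inv1// -powRrM mulN1r -powRD; first by rewrite addrC.
  by rewrite pnatr_eq0 implybT.
 by rewrite -E /c exprS; ring.
rewrite sumEFin lee_fin -mulr_sumr -mulrA ler_wpM2l// ler_wpM2l ?powR_ge0//.
rewrite big_mkord -div1r ler_pdivlMr ?subr_gt0// -/r.
have := @subrX1 R r n; set s := \sum_(i < n) _ => E.
by have : 0 <= r ^+ n; [rewrite exprn_ge0|nra].
Qed.

End TailIntegral.

(** * Kronecker substitution *)

Section Kronecker.
Context {n d : nat}.

(** Exponents are digits in base [d + 1], so distinct monomials become distinct powers of one
    variable along the curve [kpt]. *)
Definition kcode (a : mono n d) : nat := (\sum_(i < n.+1) a i * d.+1 ^ i)%N.

Lemma base_inj B k (f g : 'I_k -> nat) : (forall i, f i < B)%N -> (forall i, g i < B)%N ->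
 (\sum_(i < k) f i * B ^ i = \sum_(i < k) g i * B ^ i)%N -> f =1 g.
Proof.
elim: k f g => [|k IH] f g fB gB; first by move=> _ [].
rewrite !big_ord_recl !expn0 !muln1 => E.
have sh (h : 'I_k.+1 -> nat) : (\sum_(i < k) h (lift ord0 i) * B ^ lift ord0 i =
  (\sum_(i < k) h (lift ord0 i) * B ^ i) * B)%N.
 by rewrite big_distrl; apply: eq_bigr => i _ /=; rewrite /bump /= expnS; lia.
rewrite !sh in E; have B0 : (0 < B)%N by apply: leq_ltn_trans (fB ord0).
have E0 : f ord0 = g ord0.
 by have := congr1 (modn^~ B) E; rewrite !modnMDr || rewrite !(addnC (_ ord0)) !modnMDl !modn_small.
have E1 : (\sum_(i < k) f (lift ord0 i) * B ^ i = \sum_(i < k) g (lift ord0 i) * B ^ i)%N.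
 move: E; rewrite E0 => /addnI/eqP; rewrite eqn_pmul2r// => /eqP; exact.
move=> i; case: (unliftP ord0 i) => [j ->|-> //].
by move: j; apply: IH.
Qed.

Lemma kcode_inj : injective kcode.
Proof.
move=> a b E; apply/ffunP => i; apply: val_inj => /=; move: i.
exact: (@base_inj d.+1 n.+1 (fun i => a i) (fun i => b i)).
Qed.

Definition kpt (s : C) : 'I_n.+1 -> C := fun i => s ^+ (d.+1 ^ i).

Lemma prod_kpt (s : C) (a : mono n d) : \prod_i kpt s i ^+ a i = s ^+ kcode a.
Proof.
rewrite /kcode -prodr_exp_sum || (rewrite /kcode; elim/big_rec2: _ => [|i x y _ ->]; first by rewrite expr0).
by rewrite exprD /kpt -exprM mulnC.
Qed.

Lemma hnonzero_pe (p : Hpoly n d) : hnonzero p -> exists s : C, pe p (kpt s) != 0.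
Proof.
move=> [a0 [da0 pa0]]; pose Q : {poly C} := \sum_(a : mono n d | mdeg a == d) p a *: 'X^(kcode a).
have QE s : Q.[s] = pe p (kpt s).
 rewrite /Q horner_sum; apply: eq_bigr => a _.
 by rewrite hornerZ hornerXn prod_kpt.
apply: contrapT => h; move: pa0; apply/negP; rewrite negbK.
have Q0 : Q = 0.
 apply: horner_ext => s; rewrite horner0 QE; apply/eqP/negPn/negP => hs.
 by apply: h; exists s.
have := congr1 (fun P : {poly C} => P`_(kcode a0)) Q0; rewrite coef0 coef_sum.
rewrite (bigD1 a0) ?da0//= coefZ coefXn eqxx mulr1 big1 ?addr0; first by move=> ->.
move=> a /andP[_ aa0]; rewrite coefZ coefXn eq_sym.
by rewrite (_ : (kcode a == kcode a0) = false) ?mulr0//; apply/eqP => /kcode_inj/eqP; rewrite (negbTE aa0).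
Qed.

Lemma unit_pe (p : Hpoly n d) (x : 'I_n.+1 -> C) : (0 < d)%N -> pe p x != 0 ->
 exists y, [/\ nr2 y = 1, pe p y != 0 & exists2 c : C, c != 0 & y =1 fun i => c * x i].
Proof.
move=> d0 px; have x0 : nr2 x != 0.
 apply: contraNneq px => x0; have -> : pe p x = pe p (fun i => 0 * x i).
  by apply: pe_ext => i; move/eqP: x0; rewrite nr2_eq0 => /forallP/(_ i)/eqP ->; rewrite mul0r.
 by rewrite pe_scale expr0n gtn_eqF ?mul0r.
have c0 : ((vnorm x)^-1)%:C != 0 :> C.
 by rewrite -cabs_eq0 cabs_real normr_eq0 invr_eq0 /vnorm sqrtr_eq0 -ltNge lt_def x0 nr2_ge0.
exists (vunit x); split; first exact: nr2_vunit.
 by rewrite /vunit (negbTE x0) pe_scale mulf_neq0// expf_neq0.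
by exists ((vnorm x)^-1)%:C => // i; rewrite /vunit (negbTE x0).
Qed.

End Kronecker.

(** * Null and positive sets of lines *)

Section NullPositive.
Context {m : nat}.
Notation vec := ('I_m.+2 -> C).
Notation N := m.+2.
Variables (vol : probability (Grm m) R) (inv : Gr_invariant R m vol).

Lemma small_powR (A c b x : R) : 0 < A -> 0 < c -> 0 < b ->
 (forall e, 0 < e -> x <= A * (e / c) `^ b) -> x <= 0.
Proof.
move=> A0 c0 b0 h; apply/ler_addgt0Pr => t t0; rewrite add0r.
have := h (c * (t / A) `^ b^-1) _; rewrite mulr_gt0// ?powR_gt0 ?divr_gt0// => /(_ isT).
rewrite (mulrC c) mulfK ?gt_eqF// -powRrM mulVf ?gt_eqF// powRr1 ?divr_ge0 ?(ltW t0) ?(ltW A0)//.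
by rewrite mulrC divfK ?gt_eqF.
Qed.

(** [line_sublevel] with [u = 0] and [B] the set of degenerate lines: there [p] vanishes at every
    vector, so the bound holds for all [e], and [small_powR] lets [e] tend to 0. *)
Lemma aenondegP d (p : Hpoly m.+1 d) : (0 < d)%N -> hnonzero p -> aenondeg vol p.
Proof.
move=> d0 /hnonzero_pe[s ps]; have [vs [vs1 pvs _]] := unit_pe d0 ps.
have u0 : nr2 ((fun=> 0) : vec) = 0 by apply/eqP; rewrite nr2_eq0; apply/forallP => i.
have [A A0 hA] := @line_sublevel m d vol inv d0 (fun=> 0) (or_intror u0).
have mB := measurable_deg p.
pose x := fine (vol [set L | ~ nondeg p L]).
have xE : x%:E = vol [set L | ~ nondeg p L] by rewrite /x fineK// fin_num_measure.
have x0 : x <= 0.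
 apply: (@small_powR A (cabs (pe p vs)) ((2 * d) * 2 ^ (2 * N))%:R^-1) => //.
 - by rewrite cabs_gt0.
 - by rewrite invr_gt0 ltr0n muln_gt0 expn_gt0 muln_gt0 d0.
 move=> e e0; rewrite -lee_fin xE; apply: (hA p _ vs) => //.
 - by rewrite cabs_gt0.
 - by rewrite (dotc_nr20 _ u0).
 move=> L; have [v [f fr]] := frame_exists L; have [v1 _ _ _] := fr.
 exists v; split => //; first by rewrite (dotc_nr20 _ u0).
 move=> a _ deg; rewrite (_ : pe p _ = 0) ?cabs0//; apply/eqP/negPn/negP => h; apply: deg.
 exists (mv (hh a) v) => //; apply: act_mv; first exact: hh_unitary.
 move=> i; have := frame_mv 1 0 fr i; rewrite (_ : lin2 1 v 0 f = v)//.
 by apply/funext => k; rewrite /lin2 mul1r mul0r addr0.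
apply/eqP; rewrite eq_le measure_ge0 andbT -xE lee_fin//.
Qed.

Lemma unitary_mul (A B : 'M[C]_N) : adjmx A *m A = 1%:M -> adjmx B *m B = 1%:M ->
 adjmx (A *m B) *m (A *m B) = 1%:M.
Proof.
by move=> hA hB; rewrite adjmx_mul mulmxA -(mulmxA (adjmx B) (adjmx A) A) hA mulmx1.
Qed.

(** Two reflections suffice: one takes [e] to a multiple of [e']; the other, along a vector
    orthogonal to [e'], fixes [e'] and takes the second basis vector to a multiple of [f']. *)
Lemma transitive (L L' : Gr m) : exists U, adjmx U *m U = 1%:M /\ act U L = L'.
Proof.
have [e [f fr]] := frame_exists L; have [e' [f' fr']] := frame_exists L'.
have [e1 f1 ef gL] := fr; have [e1' f1' ef' gL'] := fr'.
have u0 : nr2 ((fun=> 0) : vec) = 0 by apply/eqP; rewrite nr2_eq0; apply/forallP => i.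
have nz (a : vec) : 2 <= nr2 a <= 4 -> nr2 a != 0.
 by move=> /andP[h _]; rewrite gt_eqF// (lt_le_trans _ h).
have [a [c [_ na c1 aE]]] := @hh_reflect _ (fun=> 0) e e' e1 e1' (dotc_nr20 _ u0) (dotc_nr20 _ u0).
pose L1 := act (hh a) L.
have he i : mv (hh a) e i = c * e' i := mv_hh_reflect (nz _ na) aE i.
have Le x y : frame L x y -> mv (grm L) x =1 x.
 move=> frx i; have := frame_mv 1 0 frx i; rewrite (_ : lin2 1 x 0 y = x)//.
 by apply/funext => k; rewrite /lin2 mul1r mul0r addr0.
have c0 : c != 0 by rewrite -cabs_eq0 c1 oner_eq0.
have L1e : mv (grm L1) e' =1 e'.
 move=> i; apply: (mulfI c0); rewrite -he -(act_mv (hh_unitary a) (Le _ _ fr)).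
 rewrite -[RHS](_ : mv (grm (act (hh a) L)) (fun k => c * e' k) i = _); last by congr mv; apply/funext => k; rewrite he.
 by rewrite /mv mulr_sumr; apply: eq_bigr => k _; rewrite mulrCA.
have [g1 frg] := frame_of e1' L1e; have [_ g11 eg gL1] := frg.
have [b [c' [eb nb c1' bE]]] := @hh_reflect _ e' g1 f' g11 f1' eg ef'.
have hg i : mv (hh b) g1 i = c' * f' i := mv_hh_reflect (nz _ nb) bE i.
have he' i : mv (hh b) e' i = e' i.
 by rewrite mv_hh (dotcC e' b) eb conjc0 mulr0 mul0r subr0.
pose L2 := act (hh b) L1.
have outer_act x : outer (mv (hh b) x) = hh b *m outer x *m adjmx (hh b).
 apply/matrixP => i j; rewrite !mxE /mv conjc_sum mulr_suml.
 under [RHS]eq_bigr do rewrite !mxE mulr_suml.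
 rewrite exchange_big; apply: eq_bigr => k _ /=; rewrite mulr_sumr; apply: eq_bigr => l _.
 by rewrite !mxE conjcMm; ring.
have L2E : L2 = L'.
 apply: Gr_inj; rewrite grm_act ?hh_unitary// gL1 mulmxDr mulmxDl -!outer_act.
 rewrite (_ : mv (hh b) e' = e'); last exact/funext.
 rewrite (_ : mv (hh b) g1 = fun i => c' * f' i); last exact/funext.
 by rewrite outer_scale c1' expr1n scale1r gL'.
have UU : adjmx (hh b *m hh a) *m (hh b *m hh a) = 1%:M.
 exact: unitary_mul (hh_unitary b) (hh_unitary a).
exists (hh b *m hh a); split => //.
apply: Gr_inj; rewrite grm_act// -L2E /L2 grm_act ?hh_unitary// /L1 grm_act ?hh_unitary//.
by rewrite adjmx_mul !mulmxA.
Qed.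

Lemma dmx_act (U : 'M[C]_N) (A B : 'M[C]_N) : adjmx U *m U = 1%:M ->
 dmx R (U *m A *m adjmx U) (U *m B *m adjmx U) = dmx R A B.
Proof.
move=> UU; rewrite !dmxE; congr (Num.sqrt _).
have tE (Q D : 'M[C]_N) : \sum_i \sum_j cnorm2 R (Q j i - D j i) = Re (\tr (adjmx (Q - D) *m (Q - D))).
 by rewrite tr_adj_mul /=; apply: eq_bigr => i _; apply: eq_bigr => j _; rewrite !mxE.
rewrite !tE -mulmxBl -mulmxBr; congr Re; set D := A - B.
have adjK (M : 'M[C]_N) : adjmx (adjmx M) = M.
 by apply/matrixP => i j; rewrite !mxE conjcK.
rewrite !adjmx_mul adjK !mulmxA -(mulmxA _ (adjmx U) U) UU mulmx1.
by rewrite mxtrace_mulC !mulmxA UU mul1mx.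
Qed.

Lemma measurable_dmx_ball (L : Gr m) (r : R) : measurable [set L' : Grm m | dmx R (grm L) (grm L') < r].
Proof. by apply: sub_sigma_algebra; exists L, r. Qed.

(** A null ball would make all balls of the same radius null by [transitive], and countably many of
    them cover the Grassmannian. *)
Lemma ball_pos (L : Gr m) (r : R) : 0 < r ->
 (0 < vol [set L' | (dmx R (grm L) (grm L') < r)%R])%E.
Proof.
move=> r0; rewrite lt0e measure_ge0 andbT; apply/negP => /eqP B0.
have [w wd] := @Gr_dense m.
have wB k : vol [set L' | dmx R (grm (w k)) (grm L') < r] = 0%E.
 have [U [UU Uw]] := transitive L (w k).
 rewrite -B0 -(vol_act inv UU (measurable_dmx_ball (w k) r)); congr (vol _).
 by apply/seteqP; split => L' /=; rewrite -Uw !grm_act// dmx_act.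
have : vol (\bigcup_k [set L' | dmx R (grm (w k)) (grm L') < r]) = 0%E.
 apply/eqP; rewrite eq_le measure_ge0 andbT.
 apply: le_trans (generalized_Boole_inequality _ _ _) _.
 - by move=> k; exact: measurable_dmx_ball.
 - by apply: bigcup_measurable => k _; exact: measurable_dmx_ball.
 by rewrite eseries0// => k _ _; exact: wB.
rewrite (_ : \bigcup_k _ = setT); last first.
 by apply/seteqP; split => // L' _; have [k hk] := wd L' r r0; exists k.
rewrite probability_setT => /eqP; by rewrite eqe oner_eq0.
Qed.

End NullPositive.

Arguments cabs : simpl never.

(** * Lower bounds for the derivative of a polynomial *)

Section Majorant.

(** Majorants in the sense of power series; each factor [X - x] of [f'] will be replaced by
    [X + |x|]. *)
Definition maj (Q : {poly C}) (q : {poly R}) := forall j, cabs Q`_j <= q`_j.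

Lemma maj_mul P Q p q : maj P p -> maj Q q -> maj (P * Q) (p * q).
Proof.
move=> mP mQ j; rewrite !coefM; apply: le_trans (cabs_sum _ _ _) _.
by apply: ler_sum => i _; rewrite cabsM ler_pM.
Qed.

Lemma maj_prod (xs : seq C) : maj (\prod_(x <- xs) ('X - x%:P)) (\prod_(x <- xs) ('X + (cabs x)%:P)).
Proof.
elim: xs => [|x xs IH].
 by rewrite !big_nil => j; rewrite !coef1; case: (j == 0%N); rewrite ?cabs1 ?cabs0.
rewrite !big_cons; apply: maj_mul => // j.
rewrite coefB coefD !coefX !coefC; case: j => [|[|j]] /=; rewrite ?sub0r ?cabsN ?add0r// ?subr0 ?addr0 ?cabs1 ?cabs0//.
Qed.

Lemma majZ c Q q : maj Q q -> maj (c *: Q) (cabs c *: q).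
Proof. by move=> mQ j; rewrite !coefZ cabsM ler_wpM2l. Qed.

Lemma horner_split0 (A : comNzRingType) (P : {poly A}) k u : (size P <= k.+1)%N ->
 P.[u] - P.[0] = u * \sum_(j < k) P`_j.+1 * u ^+ j.
Proof.
move=> sP; rewrite (horner_coef_wide _ sP) big_ord_recl expr0 mulr1 horner_coef0 addrC addKr.
rewrite mulr_sumr; apply: eq_bigr => j _; rewrite lift0 exprS; ring.
Qed.

(** The coefficient of degree [j] of [P'] is [(j + 1) P_(j+1)], so [q_j] also dominates
    [P_(j+1)]. *)
Lemma maj_increment (P : {poly C}) (q : {poly R}) (u : C) : maj P^`() q ->
 cabs (P.[u] - P.[0] - u * P^`().[0]) <= cabs u * (q.[cabs u] - q.[0]) /\
 cabs (P.[u] - P.[0]) <= cabs u * q.[cabs u].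
Proof.
move=> mq; pose k := (size P + size q)%N.
have sP : (size P <= k.+2)%N by rewrite /k; lia.
have sq : (size q <= k.+1)%N by rewrite /k; lia.
have cP j : cabs P`_j.+1 <= q`_j.
 have := mq j; rewrite coef_deriv -mulr_natl cabsM cabs_nat => h.
 by apply: le_trans h; rewrite ler_peMl// ler1n.
have h1 : cabs (P.[u] - P.[0] - u * P^`().[0]) <= cabs u * (q.[cabs u] - q.[0]).
 rewrite (horner_split0 u sP) big_ord_recl expr0 mulr1 -mulrBr.
 have -> : P^`().[0] = P`_1 by rewrite horner_coef0 coef_deriv mulr1n.
 rewrite [X in u * (X - _)]addrC addrK cabsM ler_wpM2l// (horner_split0 _ sq) mulr_sumr.
 apply: le_trans (cabs_sum _ _ _) _; apply: ler_sum => j _.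
 rewrite lift0 cabsM cabsX exprS mulrCA ler_wpM2l//.
 by apply: ler_wpM2r; [exact: exprn_ge0|exact: cP].
split=> //; rewrite (horner_split0 u sP) cabsM ler_wpM2l// (horner_coef_wide _ sq).
apply: le_trans (cabs_sum _ _ _) _; apply: ler_sum => j _.
by rewrite cabsM cabsX ler_wpM2r// exprn_ge0.
Qed.

Variables (f : {poly C}) (c : C) (xs : seq C) (fE : f^`() = c *: \prod_(x <- xs) ('X - x%:P)).

Lemma deriv_horner s : cabs f^`().[s] = cabs c * \prod_(x <- xs) cabs (s - x).
Proof. by rewrite fE hornerZ cabsM horner_prodXsubC cabs_prod. Qed.

Let shift s : (f \Po ('X + s%:P))^`() = c *: \prod_(x <- [seq x - s | x <- xs]) ('X - x%:P).
Proof.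
rewrite deriv_comp fE linearZ /= derivD derivX derivC addr0 mulr1; congr (_ *: _).
rewrite rmorph_prod /= big_map; apply: eq_bigr => x _.
by rewrite rmorphB /= comp_polyX comp_polyC polyCB opprB addrA [RHS]addrAC addrAC.
Qed.

(** [maj_increment] translated to the base point [s]. The first bound will give local injectivity,
    the second compares the values of [f] at two points. *)
Lemma increment s u :
 cabs (f.[s + u] - f.[s] - u * f^`().[s]) <=
  cabs u * (cabs c * (\prod_(x <- xs) (cabs u + cabs (s - x)) - \prod_(x <- xs) cabs (s - x))) /\
 cabs (f.[s + u] - f.[s]) <= cabs u * (cabs c * \prod_(x <- xs) (cabs u + cabs (s - x))).
Proof.
have mq : maj (f \Po ('X + s%:P))^`() (cabs c *: \prod_(x <- [seq x - s | x <- xs]) ('X + (cabs x)%:P)).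
 by rewrite shift; apply: majZ; exact: maj_prod.
have := maj_increment u mq; rewrite !horner_comp !hornerD !hornerX !hornerC add0r !hornerZ.
have -> : (f \Po ('X + s%:P))^`().[0] = f^`().[s].
 by rewrite deriv_comp derivD derivX derivC addr0 mulr1 horner_comp !hornerE.
have E v : (\prod_(x <- [seq x - s | x <- xs]) ('X + (cabs x)%:P)).[v] = \prod_(x <- xs) (v + cabs (s - x)).
 by rewrite horner_prod big_map; apply: eq_bigr => x _; rewrite !hornerE cabsB.
have E0 : (\prod_(x <- [seq x - s | x <- xs]) ('X + (cabs x)%:P)).[0] = \prod_(x <- xs) cabs (s - x).
 by rewrite E; apply: eq_bigr => x _; rewrite add0r.
by rewrite E0 E (addrC u s) -mulrBr.
Qed.

End Majorant.

Section RootSpeed.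

Lemma prod_ge (I : eqType) (r : seq I) (F G : I -> R) : (forall i, i \in r -> 0 <= F i <= G i) ->
 \prod_(i <- r) F i <= \prod_(i <- r) G i.
Proof.
by move=> h; rewrite big_seq [leRHS]big_seq; apply: ler_prod => i; exact: h.
Qed.

Lemma prod_const_scale (I : eqType) (r : seq I) (F : I -> R) (k : R) :
 \prod_(i <- r) (k * F i) = k ^+ size r * \prod_(i <- r) F i.
Proof.
elim: r => [|i r IH]; first by rewrite !big_nil expr0 mulr1.
by rewrite !big_cons IH /= exprS; ring.
Qed.

Variables (f : {poly C}) (c : C) (xs : seq C) (fE : f^`() = c *: \prod_(x <- xs) ('X - x%:P)).
Variables (c0 : c != 0) (s : C).
Let n := size xs.
(** [S] is the size of [s] in the projective chart, and [M] the size of [f'] at that scale: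
    [|f'| <= 2^n M] on the disc of radius [S]. *)
Let S := Num.max 1 (cabs s).
Let M := cabs c * \prod_(x <- xs) Num.max S (cabs x).

Let S1 : 1 <= S. Proof. by rewrite le_max lexx. Qed.
Let sS : cabs s <= S. Proof. by rewrite le_max lexx orbT. Qed.
Let S0 : 0 < S. Proof. by apply: lt_le_trans S1. Qed.
Let cc : 0 < cabs c. Proof. by rewrite cabs_gt0. Qed.

Lemma speed_M : cabs c <= S * M.
Proof.
apply: (via M); last by rewrite ler_peMl// mulr_ge0// prodr_ge0// => x _; rewrite le_max (ltW S0).
rewrite ler_peMr//; elim/big_rec: _ => // x y _ y1.
by rewrite -[leLHS]mulr1 ler_pM// le_max S1.
Qed.

Lemma speed_f0 : cabs (f.[s] - f.[0]) <= 2 ^+ n * (S * M).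
Proof.
have [_] := increment fE 0 s; rewrite add0r => /le_trans; apply.
rewrite (_ : 2 ^+ n * (S * M) = S * (cabs c * (2 ^+ n * \prod_(x <- xs) Num.max S (cabs x)))); last by rewrite /M; ring.
rewrite ler_pM ?mulr_ge0// ?prodr_ge0// => [x _|]; first by rewrite addr_ge0.
rewrite ler_wpM2l// -prod_const_scale; apply: prod_ge => x _.
by rewrite addr_ge0//= sub0r cabsN mulr_natl mulr2n lerD// le_max ?sS ?lexx ?orbT.
Qed.

(** Factor by factor, [|s - x|] is compared with [max S |x|]: it is at least [t S] when
    [|x| <= 2 S], and at least [|x| / 2] beyond. *)
Lemma speed_far (t : R) : 0 <= t <= 1 -> (forall x, x \in xs -> t * S <= cabs (s - x)) ->
 M * t ^+ n <= 2 ^+ n * cabs f^`().[s].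
Proof.
move=> /andP[t0 t1] h; rewrite (deriv_horner fE) /M mulrCA -mulrA ler_wpM2l//.
rewrite mulrC -!prod_const_scale; apply: prod_ge => x xx.
have mx : 0 <= Num.max S (cabs x) by rewrite (le_trans (ltW S0))// le_max lexx.
rewrite mulr_ge0//=; have := h x xx; have [xS|xS] := leP (cabs x) (2 * S).
 have : Num.max S (cabs x) <= 2 * S by rewrite ge_max xS andbT ler_peMl// ?ler1n// ltW.
 nra.
have mE : Num.max S (cabs x) = cabs x by apply/max_idPr; have := S0; lra.
rewrite mE => _; have := cabs_le (x - s) s; rewrite subrK cabsB; have := sS; have := S0; nra.
Qed.

(** As [x] is a critical point closest to [s], in [increment] with [u = x - s] each factor
    [|u| + |s - y|] is at most [2 |s - y|]. *)
Lemma speed_near x : x \in xs -> (forall y, y \in xs -> cabs (s - x) <= cabs (s - y)) ->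
 cabs (f.[x] - f.[s]) <= 2 ^+ n * (cabs (s - x) * cabs f^`().[s]).
Proof.
move=> xx hx; have [_] := increment fE s (x - s); rewrite subrKC => /le_trans; apply.
rewrite (deriv_horner fE) (cabsB x s) (mulrCA (2 ^+ n)) ler_wpM2l// (mulrCA (2 ^+ n)) ler_wpM2l//.
rewrite -prod_const_scale; apply: prod_ge => y yx.
by rewrite addr_ge0//= mulr_natl mulr2n lerD// hx.
Qed.

(* the nearest critical point is either at distance >= S, and the speed is controlled by f(s) - f(0),
  or it is close, and then the critical value f(x) also enters *)
Lemma speed_lower (th mu : R) : 0 < th -> th * n.+1%:R <= 1 -> 0 < mu ->
 mu <= cabs (f.[s] - f.[0]) -> (forall x, x \in xs -> mu <= cabs (f.[s] - f.[x])) ->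
 (cabs c) `^ th * mu `^ (1 - th) <= 4 ^+ n * (S * cabs f^`().[s]).
Proof.
move=> th0 thn mu0 hA hB.
have d0 : 0 < n.+1%:R :> R by rewrite ltr0n.
have th1 : th <= 1 by apply: le_trans thn; rewrite ler_peMr ?(ltW th0)// ler1n.
have T0 : 0 < S * M by apply: lt_le_trans speed_M.
have muT : mu <= 2 ^+ n * (S * M) by apply: le_trans hA speed_f0.
have two0 k : 0 < 2 ^+ k :> R by rewrite exprn_gt0.
have four : 4 ^+ n = 2 ^+ n * 2 ^+ n :> R by rewrite -exprMn; congr (_ ^+ _); rewrite -natrM.
have M0 : 0 <= M by rewrite mulr_ge0// prodr_ge0// => x _; rewrite le_max (ltW S0).
have two1 : 1 <= 2 ^+ n :> R by rewrite exprn_ege1// ler1n.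
have interp (a : R) : 0 <= a <= 1 -> (cabs c) `^ a * mu `^ (1 - a) <= 2 ^+ n * (S * M).
 move=> /andP[a0 a1]; have T2 : 0 < 2 ^+ n * (S * M) by rewrite mulr_gt0.
 have hc : cabs c <= 2 ^+ n * (S * M).
  by apply: le_trans speed_M _; rewrite ler_peMl// ltW.
 have h1 : (cabs c) `^ a <= (2 ^+ n * (S * M)) `^ a.
  by rewrite ge0_ler_powR ?nnegrE// ltW.
 have h2 : mu `^ (1 - a) <= (2 ^+ n * (S * M)) `^ (1 - a).
  by rewrite ge0_ler_powR ?nnegrE ?subr_ge0// ltW.
 apply: le_trans (ler_pM (powR_ge0 _ _) (powR_ge0 _ _) h1 h2) _.
 rewrite -powRD ?subrKC ?powRr1 ?(ltW T2)//.
 by rewrite gt_eqF ?implybT.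
have far : (forall x, x \in xs -> 1 * S <= cabs (s - x)) ->
  (cabs c) `^ th * mu `^ (1 - th) <= 4 ^+ n * (S * cabs f^`().[s]).
 move=> h; apply: le_trans (interp th _) _; first by rewrite (ltW th0).
 rewrite four -[leRHS]mulrA; apply: ler_wpM2l; first exact: ltW.
 rewrite [leRHS]mulrCA; apply: ler_wpM2l; first exact: ltW.
 by have := speed_far _ h; rewrite ler01 lexx expr1n mulr1 => /(_ isT).
have [xs0|xsN] := eqVneq xs [::]; first by apply: far => x; rewrite xs0.
have [x xx hx] := seq_argmin (fun x => cabs (s - x)) xsN.
have [Sx|xS] := leP S (cabs (s - x)).
 by apply: far => y /hx; rewrite mul1r; exact: le_trans.
pose F := cabs f^`().[s]; pose D := cabs (s - x).
have muB : mu <= 2 ^+ n * (D * F).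
 by apply: le_trans (speed_near xx hx); rewrite cabsB; exact: hB.
have D0 : 0 <= D := cabs_ge0 _.
have F0 : 0 <= F := cabs_ge0 _.
have MF : M * D ^+ n <= 2 ^+ n * F * S ^+ n.
 have h : forall y, y \in xs -> D / S * S <= cabs (s - y) by move=> y /hx; rewrite divfK ?gt_eqF.
 have := speed_far _ h; rewrite divr_ge0 ?(ltW S0)//= ler_pdivrMr// mul1r (ltW xS) => /(_ isT).
 by rewrite expr_div_n mulrA ler_pdivrMr ?exprn_gt0// -/F.
(* The unknown distance [D] cancels between the [n]-th power of [mu <= 2^n D F] and
   [M D^n <= 2^n F S^n]. Interpolation at the exponent [th (n + 1)] then bounds the [(n + 1)]-th
   power of the left-hand side of the claim. *)
have key : mu ^+ n * (S * M) <= (2 ^+ n * (S * F)) ^+ n.+1.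
 apply: (via ((2 ^+ n * (D * F)) ^+ n * (S * M))).
  by rewrite ler_wpM2r ?(ltW T0)// lerXn2r ?nnegrE ?(ltW mu0)// mulr_ge0 ?mulr_ge0// ltW.
 rewrite (_ : _ * (S * M) = (2 ^+ n) ^+ n * F ^+ n * S * (M * D ^+ n)); last by rewrite !exprMn; ring.
 apply: (via ((2 ^+ n) ^+ n * F ^+ n * S * (2 ^+ n * F * S ^+ n))).
  by rewrite ler_wpM2l// !mulr_ge0 ?exprn_ge0 ?(ltW S0)// exprn_ge0.
 by rewrite le_eqVlt; apply/orP; left; apply/eqP; rewrite !exprMn !exprS; ring.
have i1 : (cabs c) `^ (th * n.+1%:R) * mu `^ (1 - th * n.+1%:R) <= 2 ^+ n * (S * M).
 by apply: interp; rewrite thn mulr_ge0 ?(ltW th0) ?(ltW d0).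
have E : (cabs c `^ th * mu `^ (1 - th)) ^+ n.+1 =
  mu ^+ n * (cabs c `^ (th * n.+1%:R) * mu `^ (1 - th * n.+1%:R)).
 rewrite exprMn -!powR_mulrn ?powR_ge0 ?(ltW mu0)// -!powRrM mulrCA; congr (_ * _).
 rewrite -powRD; last by rewrite (gt_eqF mu0) implybT.
 by congr (_ `^ _); rewrite -natr1; ring.
have fin : (cabs c `^ th * mu `^ (1 - th)) ^+ n.+1 <= (4 ^+ n * (S * F)) ^+ n.+1.
 rewrite E; apply: (via (mu ^+ n * (2 ^+ n * (S * M)))).
  by rewrite ler_wpM2l// exprn_ge0// ltW.
 have -> : (4 ^+ n * (S * F)) ^+ n.+1 = (2 ^+ n) ^+ n.+1 * (2 ^+ n * (S * F)) ^+ n.+1.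
  by rewrite four -mulrA exprMn.
 have e1 : 2 ^+ n <= (2 ^+ n) ^+ n.+1 :> R by rewrite -[leLHS]expr1 ler_weXn2l.
 have e2 : 0 <= mu ^+ n * (S * M) by rewrite mulr_ge0 ?(ltW T0)// exprn_ge0// ltW.
 by rewrite mulrCA; exact: (ler_pM (ltW (two0 n)) e2 e1 key).
have SF0 : 0 <= 4 ^+ n * (S * F) by rewrite mulr_ge0 ?exprn_ge0// mulr_ge0// ltW.
have L0 : 0 <= (cabs c) `^ th * mu `^ (1 - th) by rewrite mulr_ge0 ?powR_ge0.
by move: fin; rewrite ler_pXn2r.
Qed.

End RootSpeed.

(** * Matchings between the roots of two polynomials *)

Section RootMatching.
Context {N : nat}.

Lemma prod_XsubC_perm (zs ws : seq C) :
 \prod_(z <- zs) ('X - z%:P) = \prod_(w <- ws) ('X - w%:P) -> perm_eq zs ws.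
Proof.
elim: zs ws => [|z zs IH] ws E.
 have : size (\prod_(w <- ws) ('X - w%:P)) = 1%N by rewrite -E big_nil size_poly1.
 by rewrite size_prod_XsubC; case: (ws).
have zw : z \in ws by rewrite -root_prod_XsubC -E big_cons rootM root_XsubC eqxx.
apply: (@perm_trans _ (z :: rem z ws)); last by rewrite perm_sym perm_to_rem.
rewrite perm_cons; apply: IH; have X0 : 'X - z%:P != 0 :> {poly C} by rewrite polyXsubC_eq0.
apply: (mulfI X0); rewrite big_cons in E; rewrite E.
by rewrite (perm_big _ (perm_to_rem zw)) big_cons.
Qed.

Lemma uniq_of_deriv (zs : seq C) :
 (forall z, z \in zs -> (\prod_(z <- zs) ('X - z%:P))^`().[z] != 0) -> uniq zs.
Proof.
elim: zs => [//|z zs IH] h /=.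
have E y : (\prod_(z <- z :: zs) ('X - z%:P))^`().[y] =
  (\prod_(z <- zs) ('X - z%:P)).[y] + (y - z) * (\prod_(z <- zs) ('X - z%:P))^`().[y].
 by rewrite big_cons derivM derivXsubC mul1r hornerD hornerM hornerXsubC.
apply/andP; split.
 have := h z (mem_head _ _); rewrite E subrr mul0r addr0.
 by rewrite -root_prod_XsubC.
apply: IH => y yz; have := h y (_ : y \in z :: zs); rewrite inE yz orbT E => /(_ isT).
have /eqP e0 : root (\prod_(z <- zs) ('X - z%:P)) y by rewrite root_prod_XsubC.
by rewrite e0 add0r mulf_eq0 negb_or => /andP[].
Qed.

(* a root z stands for the point w + z v of the projective line through w and v *)
Definition rmatch (d : nat) (w v : 'I_N.+1 -> C) (P Q : {poly C}) (r : R) := exists zs ws : seq C,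
 [/\ size zs = d, size ws = d, P = lead_coef P *: \prod_(z <- zs) ('X - z%:P),
   Q = lead_coef Q *: \prod_(z <- ws) ('X - z%:P) &
   forall i, (i < d)%N -> dFS R (pt (lin2 1 w (nth 0 zs i) v)) (pt (lin2 1 w (nth 0 ws i) v)) <= r].

Lemma rmatch_le d w v P Q r r' : r <= r' -> rmatch d w v P Q r -> rmatch d w v P Q r'.
Proof.
move=> rr' [zs [ws [h1 h2 h3 h4 h5]]]; exists zs, ws; split => // i id.
by apply: le_trans (h5 i id) rr'.
Qed.

(** The two lists of roots of [Q] are permutations of each other, and the second matching is
    transported along that permutation. *)
Lemma rmatch_trans d w v P Q T r r' : lead_coef Q != 0 ->
 rmatch d w v P Q r -> rmatch d w v Q T r' -> rmatch d w v P T (r + r').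
Proof.
move=> Q0 [zs [ws [szs sws Pz Qw zw]]] [ws' [us [sws' sus Qw' Tu wu]]].
have : perm_eq ws ws'.
 by apply: prod_XsubC_perm; apply: (scalerI Q0); rewrite -Qw.
move=> /(perm_iotaP 0)[Is pIs wsE].
have sIs : size Is = d by rewrite (perm_size pIs) size_iota.
pose us' := [seq nth 0 us i | i <- Is].
have pus : perm_eq us' us.
 rewrite -[X in perm_eq _ X](mkseq_nth 0) /mkseq sus -sws'.
 exact: perm_map.
exists zs, us'; split => //; first by rewrite size_map.
 by rewrite (perm_big us)//=.
move=> i id; have Ii : (nth 0%N Is i < d)%N.
 have : nth 0%N Is i \in Is by rewrite mem_nth// sIs.
 by rewrite (perm_mem pIs) mem_iota sws'.
apply: le_trans (dFS_tri (pt (lin2 1 w (nth 0 ws i) v)) _ _) _; apply: lerD; first exact: zw.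
rewrite wsE (nth_map 0%N) ?sIs// (nth_map 0%N) ?sIs//.
exact: wu.
Qed.

Lemma rmatch_sym d (w v : 'I_N.+1 -> C) (P Q : {poly C}) r : rmatch d w v P Q r -> rmatch d w v Q P r.
Proof.
move=> [zs [ws [h1 h2 h3 h4 h5]]]; exists ws, zs; split; [exact: h2|exact: h1|exact: h4|exact: h3|] => i id.
by rewrite dFSC; exact: h5.
Qed.

Lemma rmatch_refl d (w v : 'I_N.+1 -> C) (P : {poly C}) : P != 0 -> size P = d.+1 -> rmatch d w v P P 0.
Proof.
move=> P0 sP; have [zs szs Pz] := poly_roots P0.
exists zs, zs; split => //; rewrite ?szs ?sP// => i _.
by rewrite dFS_refl.
Qed.

(** [w + z v] has norm [sqrt (1 + |z|^2)], at least [max 1 |z|], and the two vectors differ by a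
    vector of norm [|z' - z|]. *)
Lemma dFS_chart (w v : 'I_N.+1 -> C) (z z' : C) : nr2 w = 1 -> nr2 v = 1 -> dotc w v = 0 ->
 dFS R (pt (lin2 1 w z v)) (pt (lin2 1 w z' v)) <= 3 * (cabs (z' - z) / Num.max 1 (cabs z)).
Proof.
move=> w1 v1 wv.
have nE (a : C) : nr2 (lin2 1 w a v) = 1 + cabs a ^+ 2.
 by rewrite nr2_lin2 wv !mulr0 w1 v1 cabs1 expr1n !mulr1 addr0.
have n0 (a : C) : nr2 (lin2 1 w a v) != 0.
 by rewrite nE gt_eqF// ltr_pwDl// sqr_ge0.
rewrite dFSC; apply: le_trans (dFS_pt_le (n0 z') (n0 z)) _.
rewrite ler_wpM2l//.
have -> : vnorm (fun i => lin2 1 w z v i - lin2 1 w z' v i) = cabs (z' - z).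
 rewrite (_ : (fun i => _) = fun i => (z - z') * v i); last by apply/funext => i; rewrite /lin2; ring.
 by rewrite vnorm_scale /vnorm v1 sqrtr1 mulr1 cabsB.
rewrite ler_wpM2l// lef_pV2 ?posrE; last 2 first.
- by rewrite /vnorm sqrtr_gt0 lt_def n0 nr2_ge0.
- by rewrite lt_max ltr01.
rewrite ge_max /vnorm nE; apply/andP; split.
 by rewrite -[leLHS]sqrtr1 ler_wsqrtr// lerDl sqr_ge0.
by rewrite -[leLHS]ger0_norm// -sqrtr_sqr ler_wsqrtr// lerDr.
Qed.

End RootMatching.

Section Step.
Context {N n : nat}.
Variables (w v : 'I_N.+1 -> C) (w1 : nr2 w = 1) (v1 : nr2 v = 1) (wv : dotc w v = 0).
Variables (f : {poly C}) (c : C) (xs : seq C) (fE : f^`() = c *: \prod_(x <- xs) ('X - x%:P)).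
Variables (c0 : c != 0) (sxs : size xs = n) (sf : size f = n.+2).

Let d : R := n.+1%:R.
Let d0 : 0 < d. Proof. by rewrite ltr0n. Qed.

Lemma size_addC (k : C) : size (f + k%:P) = n.+2.
Proof.
rewrite size_polyDl sf// size_polyC; by case: (k != 0).
Qed.

Lemma lead_addC (k : C) : lead_coef (f + k%:P) = lead_coef f.
Proof. by rewrite lead_coefDl// sf size_polyC; case: (k != 0). Qed.

Lemma bernoulli_half (r : R) : 0 <= r -> r * d <= 2^-1 -> (1 + r) ^+ n < 2.
Proof.
move=> r0 rd; have key k : (k <= n)%N -> (1 + r) ^+ k * (1 - k%:R * r) <= 1.
 elim: k => [|k IH] kn; first by rewrite expr0 mul0r subr0 mulr1.
 apply: le_trans (IH (ltnW kn)); rewrite exprS -mulrA mulrCA ler_wpM2l ?exprn_ge0 ?addr_ge0//.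
 rewrite -natr1; have : 0 <= k%:R :> R by []. nra.
have := key n (leqnn _); have : n%:R * r < 2^-1.
 have r2 : n%:R * r <= r * d by rewrite mulrC ler_wpM2l// ler_nat.
 have [->|r00] := eqVneq r 0; first by rewrite mulr0 invr_gt0.
 apply: lt_le_trans rd; by rewrite mulrC ltr_pM2l ?ltr_nat// lt_def r00 r0.
have : 0 <= (1 + r) ^+ n by rewrite exprn_ge0 ?addr_ge0. nra.
Qed.

(** If [f(s + u) = f(s)], then [increment] bounds [|f'(s)|] by [|c|] times the excess of the product
    of the [|u| + |s - x|] over that of the [|s - x|]. For [|u| <= D / (2 d)] this is less than
    [|f'(s)|], by [bernoulli_half]. *)
Lemma local_inj (s u : C) (D : R) : 0 <= D -> (forall x, x \in xs -> D <= cabs (s - x)) -> f^`().[s] != 0 ->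
 u != 0 -> (xs != [::] -> cabs u <= D / (2 * d)) -> f.[s + u] != f.[s].
Proof.
move=> D0 hD fs u0 hu; apply/eqP => E.
have [+ _] := increment fE s u; rewrite E subrr sub0r cabsN cabsM.
have u0' : 0 < cabs u by rewrite cabs_gt0.
rewrite ler_pM2l// (deriv_horner fE) -ler_pdivrMl ?cabs_gt0// mulKf ?cabs_eq0//.
rewrite leNgt => /negP; apply.
have p0 : 0 < \prod_(x <- xs) cabs (s - x).
 have : 0 < cabs f^`().[s] by rewrite cabs_gt0.
 by rewrite (deriv_horner fE) pmulr_rgt0// cabs_gt0.
rewrite ltrBlDr -mulr2n -mulr_natl.
apply: (@le_lt_trans _ _ ((1 + (2 * d)^-1) ^+ n * \prod_(x <- xs) cabs (s - x))); last first.
 rewrite ltr_pM2r//; apply: bernoulli_half; first by rewrite invr_ge0 mulr_ge0// ltW.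
 by rewrite invfM mulfVK ?gt_eqF.
rewrite -sxs -prod_const_scale; apply: prod_ge => x xx.
rewrite addr_ge0//= mulrDl mul1r addrC lerD2l.
have xN : xs != [::] by case: (xs) xx.
apply: le_trans (hu xN) _; rewrite mulrC ler_wpM2l ?invr_ge0 ?mulr_ge0 ?(ltW d0)//.
exact: hD.
Qed.

(** By [near_root] each root [z] is followed to a root [z'] with [|z' - z| |f'(z)| <= d |h|]. The
    bound on [h] keeps [z'] within [|z - x| / (4 d)], where [x] is the critical point closest to
    [z]: half the radius of [local_inj], so two roots cannot be followed to the same one. The
    [n + 1] images are distinct, hence they are all the roots. *)
Lemma step_match (k h : C) (mu r : R) : 0 < mu ->
 (forall s, root (f + k%:P) s -> forall x, x \in xs -> mu <= cabs (f.[s] - f.[x])) ->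
 cabs h <= mu / (2 ^+ n * (4 * d ^+ 2)) ->
 (forall s, root (f + k%:P) s -> f^`().[s] != 0 /\
   3 * (d * cabs h / (Num.max 1 (cabs s) * cabs f^`().[s])) <= r) ->
 rmatch n.+1 w v (f + k%:P) (f + (k + h)%:P) r.
Proof.
move=> mu0 hmu hh hs.
have P0 : f + k%:P != 0 by rewrite -size_poly_eq0 size_addC.
have [zs szs Pz] := poly_roots P0; rewrite size_addC /= in szs.
have rz z : (z \in zs) = root (f + k%:P) z.
 by rewrite Pz rootZ ?lead_coef_eq0// root_prod_XsubC.
have fz z : root (f + k%:P) z -> f.[z] = - k.
 by rewrite /root !hornerE => /eqP/addr0_eq <-; rewrite opprK.
have /choice[g hg] : forall z, exists z', root (f + k%:P) z -> root (f + (k + h)%:P) z' /\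
  cabs (z' - z) * cabs f^`().[z] <= d * cabs h.
 move=> z; have [rzz|] := boolP (root (f + k%:P) z); last by exists 0.
 have [fz0 _] := hs z rzz.
 pose P := (f + (k + h)%:P) \Po ('X + z%:P).
 have sP : (size P <= n.+2)%N by rewrite /P size_comp_poly2 ?size_addC// size_XaddC.
 have dP : P^`().[0] = f^`().[z].
  by rewrite /P deriv_comp !derivD derivX !derivC !addr0 mulr1 horner_comp !hornerE.
 have PP : P.[0] = h by rewrite /P horner_comp !hornerD hornerX !hornerC add0r fz// addKr.
 have [|u ru hu] := near_root sP; first by rewrite dP.
 exists (z + u) => _; split; last by rewrite addrC addKr -dP -PP.
 by move: ru; rewrite /root /P horner_comp !hornerE (addrC u).
have dist z z' : root (f + k%:P) z -> cabs (z' - z) * cabs f^`().[z] <= d * cabs h ->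
  forall x, x \in xs -> (forall y, y \in xs -> cabs (z - x) <= cabs (z - y)) ->
  cabs (z' - z) <= cabs (z - x) / (4 * d).
 move=> rzz hz' x xx hx; have [fz0 _] := hs z rzz.
 have F0 : 0 < cabs f^`().[z] by rewrite cabs_gt0.
 have two0 : 0 < 2 ^+ n :> R by rewrite exprn_gt0.
 rewrite -(ler_pM2r F0); apply: le_trans hz' _.
 have B := speed_near fE xx hx; rewrite sxs in B.
 have muB : mu <= 2 ^+ n * (cabs (z - x) * cabs f^`().[z]).
  by apply: le_trans B; rewrite cabsB; exact: hmu.
 rewrite ler_pdivlMr in hh; last by rewrite mulr_gt0// mulr_gt0// exprn_gt0.
 rewrite mulrAC ler_pdivlMr ?mulr_gt0// -(ler_pM2l two0).
 apply: le_trans muB; apply: le_trans hh; rewrite le_eqVlt; apply/orP; left; apply/eqP; ring.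
have ginj : {in zs &, injective g}.
 move=> z1 z2; rewrite !rz => r1 r2 E.
 have [_ d1] := hg z1 r1; have [_ d2] := hg z2 r2.
 (* Injectivity is applied at the root that is farther from its closest critical point, named
    [z1]. *)
 wlog : z1 z2 r1 r2 E d1 d2 / (forall x1 x2, x1 \in xs -> x2 \in xs ->
   (forall y, y \in xs -> cabs (z1 - x1) <= cabs (z1 - y)) ->
   (forall y, y \in xs -> cabs (z2 - x2) <= cabs (z2 - y)) -> cabs (z2 - x2) <= cabs (z1 - x1)).
  move=> W; have [xs0|xsN] := eqVneq xs [::].
   by apply: (W z1 z2) => // x1 x2; rewrite xs0.
  have [x1 xx1 hx1] := seq_argmin (fun x => cabs (z1 - x)) xsN.
  have [x2 xx2 hx2] := seq_argmin (fun x => cabs (z2 - x)) xsN.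
  have uniq1 y1 : y1 \in xs -> (forall y, y \in xs -> cabs (z1 - y1) <= cabs (z1 - y)) ->
    cabs (z1 - y1) = cabs (z1 - x1).
   by move=> yy1 hy1; apply/eqP; rewrite eq_le hy1// hx1.
  have uniq2 y2 : y2 \in xs -> (forall y, y \in xs -> cabs (z2 - y2) <= cabs (z2 - y)) ->
    cabs (z2 - y2) = cabs (z2 - x2).
   by move=> yy2 hy2; apply/eqP; rewrite eq_le hy2// hx2.
  have [le12|/ltW le12] := leP (cabs (z2 - x2)) (cabs (z1 - x1)).
   by apply: (W z1 z2) => // a b aa bb ha hb; rewrite (uniq1 a)// (uniq2 b).
  by apply/esym; apply: (W z2 z1) => // a b aa bb ha hb; rewrite (uniq2 a)// (uniq1 b).
 move=> le12; apply/eqP; apply: contraT => z12; have [fz0 _] := hs z1 r1.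
 have Ef : f.[z1 + (z2 - z1)] = f.[z1] by rewrite subrKC !fz.
 have u0 : z2 - z1 != 0 by rewrite subr_eq0 eq_sym.
 have [xs0|xsN] := eqVneq xs [::].
  have h0 : forall x, x \in xs -> 0 <= cabs (z1 - x) by [].
  have h1 : xs != [::] -> cabs (z2 - z1) <= 0 / (2 * d) by rewrite xs0.
  by have := local_inj (lexx 0) h0 fz0 u0 h1; rewrite Ef eqxx.
 have [x1 xx1 hx1] := seq_argmin (fun x => cabs (z1 - x)) xsN.
 have [x2 xx2 hx2] := seq_argmin (fun x => cabs (z2 - x)) xsN.
 suff h1 : xs != [::] -> cabs (z2 - z1) <= cabs (z1 - x1) / (2 * d).
  by have := local_inj (cabs_ge0 (z1 - x1)) hx1 fz0 u0 h1; rewrite Ef eqxx.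
 move=> _.
 have a1 := dist z1 _ r1 d1 _ xx1 hx1; have a2 := dist z2 _ r2 d2 _ xx2 hx2.
 have a3 := le12 _ _ xx1 xx2 hx1 hx2.
 apply: le_trans (cabs_triB (g z1) _ _) _; rewrite {1}E.
 rewrite (cabsB z2); apply: le_trans (lerD a2 a1) _.
 have -> : cabs (z1 - x1) / (2 * d) = cabs (z1 - x1) / (4 * d) + cabs (z1 - x1) / (4 * d) by field; rewrite gt_eqF.
 by rewrite lerD2r ler_wpM2r// invr_ge0 mulr_ge0// ltW.
have P'E : (f + k%:P)^`() = f^`() by rewrite derivD derivC addr0.
have zuniq : uniq zs.
 apply: uniq_of_deriv => z; rewrite rz => rzz; have [fz0 _] := hs z rzz.
 by apply: contraNneq fz0 => E; rewrite -P'E Pz derivZ hornerZ E mulr0.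
exists zs, [seq g z | z <- zs]; split => //.
- by rewrite size_map.
- apply: all_roots_prod_XsubC; first by rewrite size_addC size_map szs.
  by apply/allP => _ /mapP[z zz ->]; rewrite rz in zz; have [] := hg z zz.
 by rewrite uniq_rootsE map_inj_in_uniq.
- move=> i iz; rewrite (nth_map 0) ?szs//; set z := nth 0 zs i.
 have rzz : root (f + k%:P) z by rewrite -rz mem_nth// szs.
 have [fz0 hr] := hs z rzz; have [_ hz] := hg z rzz.
 apply: le_trans (dFS_chart _ _ w1 v1 wv) _; apply: le_trans hr; rewrite ler_wpM2l//.
 have S0 : 0 < Num.max 1 (cabs z) by rewrite lt_max ltr01.
 have F0 : 0 < cabs f^`().[z] by rewrite cabs_gt0.
 rewrite ler_pdivrMr// mulrAC ler_pdivlMr ?mulr_gt0//.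
 by rewrite mulrCA [leRHS]mulrC ler_wpM2l// ltW.
Qed.

End Step.

(** * Integrals in time *)

Section TimeIntegrals.
Notation mu := (@lebesgue_measure R).

Lemma ge0_integral_itv_split (f : R -> \bar R) (s t u : R) : s <= t -> t <= u ->
 meas f -> (forall x, 0 <= f x)%E ->
 (\int[mu]_(x in `[s, u]) f x = \int[mu]_(x in `[s, t]) f x + \int[mu]_(x in `[t, u]) f x)%E.
Proof.
move=> st tu mf f0.
have mfD D : measurable_fun D f by apply: measurable_funS mf.
have E : `[s, u]%classic = (`[s, t[ `|` `[t, u])%classic.
 by rewrite -(@itv_bndbnd_setU _ _ _ (BLeft t))// bnd_simp.
have mfU : measurable_fun (`[s, t[ `|` `[t, u])%classic f by exact: mfD.
rewrite E ge0_integral_setU//; last by apply/disj_setPS => x /= []; rewrite !in_itv/= => /andP[_ h1] /andP[h2 _]; move: (lt_le_trans h1 h2); rewrite ltxx.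
by rewrite integral_itv_bndo_bndc.
Qed.

(** [tail_integral] for the uniform law on [[0, 1]] with [A = 2] and [b = 1]: an interval of radius
    [e] has length [2 e]. *)
Lemma abs_pow_integral (g y : R) : 0 < g -> g < 1 ->
 (\int[mu]_(t in I01) (`|t - y| `^ (- g))%:E <= (1 + 2 * (2 `^ g / (1 - 2 `^ (g - 1))))%:E)%E.
Proof.
move=> g0 g1.
pose U := uniform_prob (@ltr01 R).
have ma : meas (fun t : R => `|t - y|).
 by apply: measurableT_comp => //; exact: measurable_funB.
have U1 (x : R) : x \in `[0%R, 1%R] -> uniform_pdf 0 1 x = 1.
 by rewrite in_itv/= /uniform_pdf => ->; rewrite subr0 invr1.
have -> : (\int[mu]_(t in I01) (`|t - y| `^ (- g))%:E = \int[U]_t (`|t - y| `^ (- g))%:E)%E.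
 rewrite integral_uniform//=; last first.
 - by apply/measurable_EFinP; exact: mpow.
 by rewrite subr0 invr1 mul1e.
apply: (@tail_integral _ _ U 2 1 g) => // e e0.
rewrite powRr1 ?(ltW e0)//.
have mB : measurable [set t : R | `|t - y| < e] by exact: measurable_ltf.
suff h : (\int[mu]_(t in [set t : R | (`|t - y| < e)%R]) (uniform_pdf 0 1 t)%:E <= (2 * e)%:E)%E by exact: h.
apply: (@le_trans _ _ (\int[mu]_(t in [set t : R | (`|t - y| < e)%R]) 1)%E).
 apply: ge0_le_integral => //.
 - by move=> x _; rewrite lee_fin uniform_pdf_ge0.
 - by apply: mEFin; exact: measurable_uniform_pdf.
 - move=> x _; rewrite lee_fin /uniform_pdf subr0 invr1; by case: ifP.
rewrite integral_cst// mul1e.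
have -> : [set t : R | (`|t - y| < e)%R] = `]y - e, y + e[%classic.
 by apply/seteqP; split => x /=; rewrite in_itv/= ltr_distl.
have E : mu `]y - e, y + e[%classic = (2 * e)%:E.
 rewrite lebesgue_measure_itv/= lte_fin ltrD2l gtrN// -EFinB; congr (_%:E); ring.
by have := lexx (2 * e)%:E; rewrite -{1}E.
Qed.

End TimeIntegrals.

(* connectedness of [a, b]: chains of small steps on both sides of every point suffice *)
Lemma creep (K : R -> R -> R -> Prop) (J : R -> R -> R) (a b : R) : a <= b ->
 (forall s t r r', r <= r' -> K s t r -> K s t r') ->
 (forall s t u r r', K s t r -> K t u r' -> K s u (r + r')) ->
 (forall s t u, a <= s -> s <= t -> t <= u -> u <= b -> J s t + J t u <= J s u) ->
 (forall t, a <= t <= b -> exists2 e, 0 < e & forall t', a <= t' <= b -> `|t' - t| <= e ->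
   (t <= t' -> K t t' (J t t')) /\ (t' <= t -> K t' t (J t' t))) ->
 K a b (J a b).
Proof.
move=> ab mono tr sup loc.
pose S := [set t | a <= t <= b /\ K a t (J a t)].
have Sa : S a.
 have aab : a <= a <= b by rewrite lexx.
 have [e e0 he] := loc a aab.
 have aa : `|a - a| <= e by rewrite subrr normr0 ltW.
 by split => //; have [h _] := he a aab aa; exact: h.
have Sub : ubound S b by move=> t [] /andP[].
have hS : has_sup S by split; [exists a|exists b].
have next t t' : S t -> t <= t' -> t' <= b -> K t t' (J t t') -> S t'.
 move=> [/andP[at' tb] Kt] tt' t'b Ktt'; split; first by rewrite t'b (le_trans at' tt').
 by apply: mono (tr _ _ _ _ _ Kt Ktt'); exact: sup.
set s := reals.sup S.
have sab : a <= s <= b.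
 by rewrite (ub_le_sup _ Sa)/=; [apply: ge_sup => //; exists a|exists b].
have [e e0 he] := loc s sab; have /andP[sa sb] := sab.
have [t St ts] := sup_adherent e0 hS; rewrite -/s in ts.
have tles : t <= s by apply: ub_le_sup => //; exists b.
have Ss : S s.
 apply: (next t) => //; have [tab _] := St.
 have [] := he t tab _; last by move=> _; apply.
 by rewrite ler_norml; move: ts tles; lra.
have [sb'|sb'] := ltP s b; last by have <- : s = b; [apply/eqP; rewrite eq_le sb|case: Ss].
pose t' := Num.min b (s + e).
have t'b : t' <= b by rewrite ge_min lexx.
have st' : s < t' by rewrite lt_min sb' ltrDl.
have t's : t' <= s + e by rewrite ge_min lexx orbT.
have : S t'.
 apply: (next s) => //; first exact: ltW.
 have [||+ _] := he t'; first by rewrite t'b (le_trans sa (ltW st')).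
  by rewrite ler_norml; move: t's st'; lra.
 by apply; exact: ltW.
move=> /(ub_le_sup (ex_intro _ b Sub)); rewrite -/s => h.
by move: (lt_le_trans st' h); rewrite ltxx.
Qed.

(** * Roots of [f + t kap] along one leg *)

Section Leg.
Context {N n : nat}.
Notation mu := (@lebesgue_measure R).
Variables (w v : 'I_N.+1 -> C) (w1 : nr2 w = 1) (v1 : nr2 v = 1) (wv : dotc w v = 0).
Variables (f : {poly C}) (c : C) (xs : seq C) (fE : f^`() = c *: \prod_(x <- xs) ('X - x%:P)).
Variables (c0 : c != 0) (sxs : size xs = n) (sf : size f = n.+2).
Variables (kap : C) (k0 : kap != 0) (th : R) (th0 : 0 < th) (thn : th * n.+1%:R <= 1) (th1 : th < 1).

Let d : R := n.+1%:R.
Let d0 : 0 < d. Proof. by rewrite ltr0n. Qed.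

(** The real times at which [- t kap], the value of [f] at the moving roots, is closest to [f(0)] or
    to a critical value of [f]. *)
Definition crit := - Re (f.[0] / kap) :: [seq - Re (f.[x] / kap) | x <- xs].
Definition legpoly (t : R) : {poly C} := f + (t%:C * kap)%:P.
Definition legspeed (t : R) : R := \sum_(y <- crit) `|t - y| `^ (- (1 - th)).
(** 3 comes from the chart, [d] from [near_root], [4^n] from [speed_lower]; the outer 2 is spent in
    [legint_lower], where the distance to a critical time may grow from [D] to [2 D]. *)
Definition legcst : R := 2 * (3 * (d * (4 ^+ n * (cabs kap / cabs c) `^ th))).
Definition legint (s t : R) : R := legcst * fine (\int[mu]_(x in `[s, t]) (legspeed x)%:E).

Lemma legspeed_ge0 t : 0 <= legspeed t.
Proof. by apply: sumr_ge0 => y _; exact: powR_ge0. Qed.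

Lemma measurable_legspeed : meas legspeed.
Proof.
apply: measurable_sum => y; apply: mpow.
by apply: measurableT_comp => //; exact: measurable_funB.
Qed.

Lemma legspeed_fin (s t : R) : 0 <= s -> t <= 1 ->
 (\int[mu]_(x in `[s, t]) (legspeed x)%:E)%E \is a fin_num.
Proof.
move=> s0 t1; rewrite ge0_fin_numE; last by apply: integral_ge0 => x _; rewrite lee_fin legspeed_ge0.
have mE D : measurable_fun D (EFin \o legspeed).
 by apply: mEFin; exact: measurable_legspeed.
apply: (@le_lt_trans _ _ (\int[mu]_(x in I01) (legspeed x)%:E)%E).
 apply: ge0_subset_integral => //=; first exact: mE.
 - by move=> x _; rewrite lee_fin legspeed_ge0.
 - by move=> x /=; rewrite !in_itv/= => /andP[h1 h2]; rewrite (le_trans s0 h1) (le_trans h2 t1).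
rewrite /legspeed; under eq_integral do rewrite -sumEFin.
rewrite ge0_integral_sum//; last first.
- move=> y; apply: mEFin; apply: mpow.
 by apply: measurableT_comp => //; exact: measurable_funB.
apply/lte_sum_pinfty => y _; apply: le_lt_trans (abs_pow_integral y _ _) _; rewrite ?ltry//.
- by rewrite subr_gt0.
- by rewrite gtrDl oppr_lt0.
Qed.

Lemma legint_split (s t u : R) : 0 <= s -> s <= t -> t <= u -> u <= 1 ->
 legint s t + legint t u = legint s u.
Proof.
move=> s0 st tu u1; rewrite /legint -mulrDr; congr (_ * _).
have mE : meas (EFin \o legspeed).
 by apply/measurable_EFinP; exact: measurable_legspeed.
rewrite (@ge0_integral_itv_split (EFin \o legspeed) s t u)//; last first.
 by move=> x; rewrite lee_fin legspeed_ge0.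
by rewrite [RHS]fineD//; apply: legspeed_fin => //; [exact: le_trans u1|exact: le_trans st].
Qed.

Lemma legcst_ge0 : 0 <= legcst.
Proof. by rewrite !mulr_ge0// ?powR_ge0 ?ltW// exprn_ge0. Qed.

Lemma legint_ge0 s t : 0 <= legint s t.
Proof.
rewrite mulr_ge0 ?legcst_ge0// fine_ge0// integral_ge0// => x _.
by rewrite lee_fin legspeed_ge0.
Qed.

Lemma legint_lower (s t y D : R) : 0 <= s -> s <= t -> t <= 1 -> 0 < D -> y \in crit ->
 (forall x, s <= x <= t -> 0 < `|x - y| <= 2 * D) ->
 legcst / 2 * ((t - s) * D `^ (- (1 - th))) <= legint s t.
Proof.
move=> s0 st t1 D0 yY h; rewrite /legint -mulrA ler_wpM2l ?legcst_ge0//.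
have := legspeed_fin s0 t1; rewrite -lee_fin => /fineK ->.
have sg : 0 < 1 - th by rewrite subr_gt0.
apply: (@le_trans _ _ (\int[mu]_(x in `[s, t]) (2^-1 * D `^ (- (1 - th)))%:E)%E).
 rewrite integral_cst//= lebesgue_measure_itv/= lte_fin.
 case: ltP => [_|ts]; first by rewrite -EFinB -EFinM lee_fin; nra.
 have -> : t = s by apply/eqP; rewrite eq_le ts.
 by rewrite subrr mul0r mulr0 mule0.
apply: ge0_le_integral => //.
- by move=> x _; rewrite lee_fin mulr_ge0// powR_ge0.
- by apply: mEFin; exact: measurable_legspeed.
move=> x /=; rewrite in_itv/= => xst; have /andP[p0 p2] := h x xst.
rewrite lee_fin; apply: (via (`|x - y| `^ (- (1 - th)))).
 rewrite !powRN -invfM lef_pV2 ?posrE ?mulr_gt0 ?powR_gt0//.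
 apply: (via ((2 * D) `^ (1 - th))).
  by rewrite ge0_ler_powR ?nnegrE// ltW// mulr_gt0.
 rewrite powRM//; last exact: ltW.
 rewrite ler_wpM2r ?powR_ge0// -[leRHS]powRr1//.
 by apply: ler_powR; rewrite ?ler1n// lerBlDr lerDl ltW.
rewrite /legspeed (big_rem y)//= lerDl; apply: sumr_ge0 => z _; exact: powR_ge0.
Qed.

Lemma leg_value (t : R) s z : root (legpoly t) s ->
 cabs kap * `|t - (- Re (f.[z] / kap))| <= cabs (f.[s] - f.[z]).
Proof.

rewrite /root /legpoly hornerD hornerC => /eqP/addr0_eq E.
rewrite opprK -[f.[s]]opprK E -opprD cabsN.
have -> : t%:C * kap + f.[z] = kap * (t%:C + f.[z] / kap) by field.
rewrite cabsM ler_wpM2l//; apply: le_trans (Re_cabs _).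
by rewrite le_eqVlt; apply/orP; left; apply/eqP; case: (f.[z] / kap).
Qed.

Lemma legpolyD (t t' : R) : legpoly t' = f + (t%:C * kap + (t' - t)%:C * kap)%:P.
Proof. by rewrite /legpoly -mulrDl -realcD subrKC. Qed.

(** With [mu = |kap| D], [speed_lower] bounds [max 1 |s| |f'(s)|] below at every root [s], and
    [step_match] turns this into a displacement; the powers of [|kap|] and [|c|] combine to
    [(|kap| / |c|)^th]. *)
Lemma leg_step (t t' D : R) : 0 < D -> (forall y, y \in crit -> D <= `|t - y|) ->
 `|t' - t| <= D / (2 ^+ n * (4 * d ^+ 2)) ->
 rmatch n.+1 w v (legpoly t) (legpoly t') (legcst / 2 * (`|t' - t| * D `^ (- (1 - th)))).
Proof.
move=> D0 hD htt; rewrite (legpolyD t t') {1}/legpoly.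
have kc : 0 < cabs kap by rewrite cabs_gt0.
have cc : 0 < cabs c by rewrite cabs_gt0.
have mu0 : 0 < cabs kap * D by rewrite mulr_gt0.
have muz s z : root (legpoly t) s -> - Re (f.[z] / kap) \in crit ->
  cabs kap * D <= cabs (f.[s] - f.[z]).
 move=> rs /hD h; apply: le_trans (leg_value z rs); exact: ler_wpM2l.
have in0 : - Re (f.[0] / kap) \in crit by rewrite mem_head.
have inx x : x \in xs -> - Re (f.[x] / kap) \in crit.
 by move=> xx; rewrite inE; apply/orP; right; apply/mapP; exists x.
apply: (step_match w1 v1 wv fE c0 sxs sf mu0).
- by move=> s rs x xx; apply: muz => //; exact: inx.
- rewrite cabsM cabs_real mulrC -mulrA ler_wpM2l//.
move=> s rs.
have low : (cabs c) `^ th * (cabs kap * D) `^ (1 - th) <=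
  4 ^+ n * (Num.max 1 (cabs s) * cabs f^`().[s]).
 rewrite -sxs; apply: (speed_lower fE c0 th0 _ mu0); rewrite ?sxs//.
  exact: muz.
 by move=> x xx; apply: muz => //; exact: inx.
have S0 : 0 < Num.max 1 (cabs s) by rewrite lt_max ltr01.
have lpos : 0 < (cabs c) `^ th * (cabs kap * D) `^ (1 - th) by rewrite mulr_gt0 ?powR_gt0.
have SF0 : 0 < Num.max 1 (cabs s) * cabs f^`().[s].
 by have := lt_le_trans lpos low; rewrite pmulr_rgt0// exprn_gt0.
split; first by rewrite -cabs_gt0; move: SF0; rewrite pmulr_rgt0.
rewrite cabsM cabs_real /legcst [2 * _]mulrC mulfK// -[leRHS]mulrA ler_wpM2l//.
rewrite -[leRHS]mulrA -[leLHS]mulrA ler_wpM2l ?(ltW d0)//.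
rewrite powRN.
have cth : (cabs kap / cabs c) `^ th = cabs kap `^ th / cabs c `^ th.
 by rewrite powRM ?invr_ge0// -powR_inv1// -powRrM mulN1r powRN.
have kth : cabs kap = cabs kap `^ th * cabs kap `^ (1 - th).
 rewrite -powRD; last by rewrite (gt_eqF kc) implybT.
 by rewrite subrKC powRr1 ?ltW.
rewrite ler_pdivrMr// cth.
apply: (via (`|t' - t| * (cabs kap `^ th / cabs c `^ th) / (D `^ (1 - th)) *
  (cabs c `^ th * (cabs kap * D) `^ (1 - th)))).
 rewrite {1}kth powRM ?(ltW kc) ?(ltW D0)//.
 have a0 : cabs c `^ th != 0 by rewrite gt_eqF// powR_gt0.
 have b0 : D `^ (1 - th) != 0 by rewrite gt_eqF// powR_gt0.
 rewrite le_eqVlt; apply/orP; left; apply/eqP; by field; rewrite ?a0 ?b0.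
have X0 : 0 <= `|t' - t| * (cabs kap `^ th / cabs c `^ th) / (D `^ (1 - th)).
 by rewrite !mulr_ge0// ?invr_ge0 ?powR_ge0.
apply: le_trans (ler_wpM2l X0 low) _.
rewrite le_eqVlt; apply/orP; left; apply/eqP; ring.
Qed.

Lemma size_legpoly t : size (legpoly t) = n.+2. Proof. exact: size_addC. Qed.

Lemma lead_legpoly t : lead_coef (legpoly t) = lead_coef f. Proof. by rewrite /legpoly (lead_addC sf). Qed.

Lemma leadf0 : lead_coef f != 0.
Proof. by rewrite lead_coef_eq0 -size_poly_eq0 sf. Qed.

(** For critical times, where [leg_step] says nothing: continuity of the roots gives an arbitrarily
    small displacement, without a rate. *)
Lemma leg_cont (t e : R) : 0 < e -> exists2 h : R, 0 < h & forall t', `|t' - t| <= h ->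
 rmatch n.+1 w v (legpoly t) (legpoly t') e.
Proof.
move=> e0; have P0 : legpoly t != 0 by rewrite -size_poly_eq0 size_legpoly.
have [zs szs Pz] := poly_roots P0; rewrite size_legpoly/= in szs.
have e3 : 0 < e / 3 by rewrite divr_gt0.
have [dl dl0 hdl] := roots_cont zs e3.
have kc : 0 < cabs kap by rewrite cabs_gt0.
have lc : 0 < cabs (lead_coef f) by rewrite cabs_gt0 leadf0.
have lf := leadf0.
exists (dl * cabs (lead_coef f) / cabs kap) => [|t' ht]; first by rewrite divr_gt0// mulr_gt0.
pose Q := (lead_coef f)^-1 *: legpoly t'.
have Qm : Q \is monic by rewrite monicE lead_coefZ lead_legpoly mulVf.
have sQ : size Q = (size zs).+1 by rewrite size_scale ?invr_eq0// size_legpoly szs.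
have PzE : \prod_(z <- zs) ('X - z%:P) = (lead_coef f)^-1 *: legpoly t.
 by rewrite [in RHS]Pz lead_legpoly scalerA mulVf// scale1r.
have [|ws [sws Qw hw]] := hdl Q Qm sQ.
 move=> i; rewrite PzE -coefB -scalerBr coefZ cabsM cabsV mulrC ler_pdivrMr//.
 have -> : legpoly t' - legpoly t = ((t' - t)%:C * kap)%:P.
  by rewrite (legpolyD t t') /legpoly polyCD; ring.
 rewrite coefC.
 case: (i == 0%N); last by rewrite cabs0 mulr_ge0// ltW.
 by move: ht; rewrite cabsM cabs_real ler_pdivlMr.
exists zs, ws; split => //; first by rewrite sws.
 by rewrite lead_legpoly -Qw /Q scalerA mulfV// scale1r.
move=> i id; apply: le_trans (dFS_chart _ _ w1 v1 wv) _.
have S0 : 0 < Num.max 1 (cabs (nth 0 zs i)) by rewrite lt_max ltr01.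
rewrite mulrC -ler_pdivlMr// ler_pdivrMr//; apply: le_trans (ltW (_ : _ < e / 3)) _; last first.
 by rewrite ler_peMr ?(ltW e3)// le_max lexx.
by rewrite cabsB; exact: hw.
Qed.

(** [creep] with the majorant [legint] plus [e'] times a count of critical times. Away from them
    [leg_step] is paid by [legint]; at a critical time [leg_cont] is paid by [e'], once for each
    side, which is why [cnt] adds the two half-open intervals and stays below twice the number of
    critical times. *)
Lemma leg_match (a b e : R) : 0 <= a -> a <= b -> b <= 1 -> 0 < e ->
 rmatch n.+1 w v (legpoly a) (legpoly b) (legint a b + e).
Proof.
move=> a0 ab b1 e0.
pose e' := e / (2 * (size crit)%:R).
have sc : 0 < (size crit)%:R :> R by rewrite ltr0n.
have e'0 : 0 < e' by rewrite divr_gt0// mulr_gt0.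
pose cnt (s t : R) : R := \sum_(y <- crit) ((s <= y < t)%R%:R + (s < y <= t)%R%:R).
have cnt0 s t : 0 <= cnt s t by apply: sumr_ge0 => y _; rewrite addr_ge0.
have cntm s t : cnt s t <= 2 * (size crit)%:R.
 rewrite /cnt; apply: (via (\sum_(y <- crit) 2)).
  by apply: ler_sum => y _; case: (s <= y < t); case: (s < y <= t); rewrite /=; lra.
 by rewrite big_const_seq count_predT iter_addr_0 mulr_natr.
apply: (@rmatch_le _ _ _ _ _ _ (legint a b + e' * cnt a b)).
 rewrite lerD2l; apply: (via (e' * (2 * (size crit)%:R))); first by rewrite ler_wpM2l// ltW.
 by rewrite /e' divfK// gt_eqF// mulr_gt0.
apply: (@creep (fun s t r => rmatch n.+1 w v (legpoly s) (legpoly t) r)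
  (fun s t => legint s t + e' * cnt s t)) => //.
- by move=> s t r r' rr'; exact: rmatch_le.
- by move=> s t u r r' h1 h2; apply: rmatch_trans h1 h2; rewrite lead_legpoly leadf0.
- move=> s t u as_ st tu ub.
 rewrite addrACA legint_split//; [|exact: le_trans as_|exact: le_trans b1].
 rewrite lerD2l -mulrDr ler_wpM2l ?(ltW e'0)// /cnt -big_split/=; apply: ler_sum => y _.
 have i1 : (s <= y < t)%R%:R + (t <= y < u)%R%:R <= (s <= y < u)%R%:R :> R.
  have [yt|ty] := ltP y t; first by rewrite (lt_le_trans yt tu) !andbT/= addr0.
  by rewrite (le_trans st ty) andbF/= add0r.
 have i2 : (s < y <= t)%R%:R + (t < y <= u)%R%:R <= (s < y <= u)%R%:R :> R.
  have [yt|ty] := leP y t; first by rewrite (le_trans yt tu) !andbT/= addr0.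
  by rewrite (le_lt_trans st ty) andbF/= add0r.
 by rewrite addrACA lerD.
move=> t tab.
have Kge (t' : R) : 0 <= legint t t' by exact: legint_ge0.
have refl0 : rmatch n.+1 w v (legpoly t) (legpoly t) (legint t t + e' * cnt t t).
 apply: (rmatch_le _ (rmatch_refl _ _ _ _)); rewrite ?size_legpoly//.
 - by rewrite addr_ge0// mulr_ge0// ltW.
 - by rewrite -size_poly_eq0 size_legpoly.
have [tY|tY] := boolP (t \in crit).
 have [h h0 hh] := leg_cont t e'0; exists h => // t' t'ab htt; have Km := hh t' htt.
 have cnt1 : t != t' -> (t < t' -> 1 <= cnt t t') /\ (t' < t -> 1 <= cnt t' t).
  move=> _; split => lt; rewrite /cnt (big_rem t)//= lt lexx/= ?andbT ?lt/=; apply: ler_wpDr.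
  - by apply: sumr_ge0 => y _; rewrite addr_ge0.
  - by rewrite lerDl.
  - by apply: sumr_ge0 => y _; rewrite addr_ge0.
  - by rewrite lerDr.
 have [ltt|ltt|<-] := ltgtP t t'; split => // _.
 - apply: rmatch_le Km; apply: (via (e' * cnt t t')); last by rewrite lerDr.
  by rewrite ler_peMr ?(ltW e'0)//; apply: (cnt1 _).1 => //; rewrite lt_eqF.
 - apply: rmatch_sym; apply: rmatch_le Km; apply: (via (e' * cnt t' t)); last by rewrite lerDr legint_ge0.
  by rewrite ler_peMr ?(ltW e'0)//; apply: (cnt1 _).2 => //; rewrite gt_eqF.
have [y yY hy] := @seq_argmin _ (fun y => `|t - y|) crit isT.
pose D := `|t - y|.
have D0 : 0 < D by rewrite normr_gt0 subr_eq0; apply: contraNneq tY => ->.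
have B0 : 0 < 2 ^+ n * (4 * d ^+ 2) by rewrite mulr_gt0 ?exprn_gt0// mulr_gt0 ?exprn_gt0.
have B4 : 4 <= 2 ^+ n * (4 * d ^+ 2).
 apply: (via (4 * d ^+ 2)).
  by rewrite ler_peMr// exprn_ege1// ler1n.
 by rewrite ler_peMl ?mulr_ge0// exprn_ege1// ler1n.
exists (D / (2 ^+ n * (4 * d ^+ 2))) => [|t' t'ab htt]; first by rewrite divr_gt0.
have Km := leg_step D0 hy htt.
have htt4 : `|t' - t| <= D / 4.
 by apply: le_trans htt _; rewrite ler_wpM2l ?(ltW D0)// lef_pV2 ?posrE.
have near x : `|x - t| <= D / 4 -> 0 < `|x - y| <= 2 * D.
 move=> hx; have h1 : D <= `|t - x| + `|x - y| by exact: ler_distD.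
 have h2 : `|x - y| <= `|x - t| + D by exact: ler_distD.
 by move: h1 h2 hx; rewrite (distrC t x); move: D0; lra.
have /andP[ta tb] := tab; have /andP[ta' tb'] := t'ab.
split => le.
- apply: rmatch_le Km; rewrite ger0_norm ?subr_ge0//.
 apply: (via (legint t t')); last by rewrite lerDl mulr_ge0// ltW.
 apply: (legint_lower (y := y)) => //; [exact: le_trans ta|exact: le_trans b1|].
 move=> x /andP[h1 h2]; apply: near; apply: le_trans htt4.
 by rewrite !ger0_norm ?subr_ge0// lerB.
- apply: rmatch_sym; apply: rmatch_le Km; rewrite distrC ger0_norm ?subr_ge0//.
 apply: (via (legint t' t)); last by rewrite lerDl mulr_ge0// ltW.
 apply: (legint_lower (y := y)) => //; [exact: le_trans ta'|exact: le_trans b1|].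
 move=> x /andP[h1 h2]; apply: near; apply: le_trans htt4.
 by rewrite distrC [leRHS]distrC !ger0_norm ?subr_ge0// lerB.
Qed.

End Leg.

(** * Minkowski's integral inequality *)

Section Minkowski.
Context {disp : measure_display} {X : measurableType disp}.
Notation mu := (@lebesgue_measure R).
Notation T := (measurableTypeR R).

Lemma tonelli_set (P : probability X R) (D : set T) (h : T * X -> \bar R) : measurable D ->
 meas h -> (forall z, 0 <= h z)%E ->
 (\int[mu]_(t in D) \int[P]_x h (t, x) = \int[P]_x \int[mu]_(t in D) h (t, x))%E /\
 meas (fun x : X => \int[mu]_(t in D) h (t, x))%E /\
 meas (fun t : T => \int[P]_x h (t, x))%E.
Proof.
move=> mD mh h0.
pose h' (z : T * X) : \bar R := (h z * (\1_D z.1 : R)%:E)%E.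
have mind : meas (fun z : T * X => (\1_D z.1 : R)%:E).
 by apply/measurable_EFinP; apply: (mcomp (\1_D : T -> R)).
have mh' : meas h' by apply: emeasurable_funM.
have h'0 z : (0 <= h' z)%E by rewrite mule_ge0// lee_fin.
have E1 x : (\int[mu]_(t in D) h (t, x) = \int[mu]_t h' (t, x))%E.
 by rewrite integral_mkcond epatch_indic.
have E2 : (\int[mu]_(t in D) \int[P]_x h (t, x) = \int[mu]_t \int[P]_x h' (t, x))%E.
 rewrite integral_mkcond epatch_indic; apply: eq_integral => t _ /=.
 rewrite /h'/= ge0_integralZr//.
 exact: (measurable_fun_pair2 _ mh).
have [F1 [F2 F3]] : (\int[mu]_t \int[P]_x h' (t, x) = \int[P]_x \int[mu]_t h' (t, x))%E /\
  meas (fun x : X => \int[mu]_t h' (t, x))%E /\ meas (fun t : T => \int[P]_x h (t, x))%E.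
 split; first exact: (@fubini_tonelli _ _ T X R mu P h' mh' h'0).
 split; first exact: (@measurable_fun_fubini_tonelli_G _ _ T X R mu h' mh' h'0).
 exact: (@measurable_fun_fubini_tonelli_F _ _ T X R P h mh h0).
split; first by rewrite E2 F1; apply: eq_integral => x _; rewrite E1.
by split => //; rewrite (_ : (fun x => _) = fun x => (\int[mu]_t h' (t, x))%E)//; apply/funext.
Qed.

Variables (P : probability X R) (q : R) (q1 : 1 <= q) (g : T -> X -> R).
Variables (mg : meas (fun z : T * X => g z.1 z.2)) (g0 : forall t x, 0 <= g t x).
Variables (eta : R) (eta0 : 0 < eta).

Let q0 : 0 < q. Proof. exact: lt_le_trans q1. Qed.

(** The graph of [x^q] lies above its tangent at [l], written without subtraction; it is Young's
    inequality for [x] and [l^(q - 1)]. *)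
Lemma powR_tangent (x l : R) : 0 <= x -> 0 < l -> l `^ q + q * l `^ (q - 1) * x <= x `^ q + q * l `^ q.
Proof.
move=> x0 l0; have [E|qn1] := eqVneq q 1.
 by rewrite E subrr powRr0 !mulr1 powRr1 ?(ltW l0)// powRr1//; lra.
have qm : 0 < q - 1 by rewrite subr_gt0 lt_def qn1.
pose r := q / (q - 1); have r0 : 0 < r by rewrite divr_gt0.
have qr : q^-1 + r^-1 = 1 by rewrite /r invf_div; field; rewrite gt_eqF.
have := conjugate_powR x0 (powR_ge0 l (q - 1)) q0 r0 qr.
rewrite -powRrM /r mulrCA mulfV ?(gt_eqF qm)// mulr1 invf_div.
have E1 : q * (x `^ q / q + l `^ q * ((q - 1) / q)) = x `^ q + l `^ q * (q - 1) by field; rewrite gt_eqF.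
rewrite -(ler_pM2l q0) E1 (_ : q * (x * _) = q * l `^ (q - 1) * x); last by ring.
lra.
Qed.

(** Jensen's inequality for the ratio [a / m] under the weight [m], by integrating the tangent
    inequality at the mean [l = J / I]. The right-hand side may be infinite. *)
Lemma weighted_jensen disp' (T' : measurableType disp') (nu : {measure set T' -> \bar R}) (D : set T')
  (mD : measurable D) (a m : T' -> R) :
 measurable_fun [set: T'] a -> measurable_fun [set: T'] m -> (forall r, 0 <= a r) -> (forall r, 0 < m r) ->
 (\int[nu]_(r in D) (a r)%:E)%E \is a fin_num -> (\int[nu]_(r in D) (m r)%:E)%E \is a fin_num ->
 0 < fine (\int[nu]_(r in D) (m r)%:E) ->
 (((fine (\int[nu]_(r in D) (a r)%:E)) `^ q * (fine (\int[nu]_(r in D) (m r)%:E)) `^ (1 - q))%:E <=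
  \int[nu]_(r in D) (a r `^ q * m r `^ (1 - q))%:E)%E.
Proof.
move=> ma mm a0 m0 afin mfin; set I := fine (\int[nu]_(r in D) (m r)%:E) => I0.
set J := fine _; have JE : (\int[nu]_(r in D) (a r)%:E = J%:E)%E by rewrite fineK.
have IE : (\int[nu]_(r in D) (m r)%:E = I%:E)%E by rewrite fineK.
have [J0|Jn] := eqVneq J 0.
 rewrite J0 powR0 ?gt_eqF// mul0r; apply: integral_ge0 => r _.
 by rewrite lee_fin mulr_ge0 ?powR_ge0.
have Jp : 0 < J by rewrite lt_def Jn fine_ge0// integral_ge0// => r _; rewrite lee_fin.
pose l := J / I; have l0 : 0 < l by rewrite divr_gt0.
pose h r : R := a r `^ q * m r `^ (1 - q).
pose c1 := l `^ q; pose c2 := q * l `^ (q - 1); pose c3 := q * l `^ q.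
have c10 : 0 <= c1 by exact: powR_ge0.
have c20 : 0 <= c2 by rewrite mulr_ge0 ?powR_ge0 ?ltW.
have c30 : 0 <= c3 by rewrite mulr_ge0 ?powR_ge0 ?ltW.
have h0 r : 0 <= h r by rewrite mulr_ge0 ?powR_ge0.
have mh : measurable_fun [set: T'] h.
 by apply: measurable_funM; exact: mpow.
have ED (f : T' -> R) : measurable_fun [set: T'] f -> measurable_fun D (fun r => (f r)%:E).
 by move=> mf; apply: mEFin.
have ZD c (f : T' -> R) : measurable_fun [set: T'] f -> measurable_fun D (fun r => c%:E * (f r)%:E)%E.
 by move=> mf; apply: (ED (fun r => c * f r)); exact: measurable_funM.
have Zi c (f : T' -> R) : 0 <= c -> measurable_fun [set: T'] f -> (forall r, 0 <= f r) ->
  (\int[nu]_(r in D) (c%:E * (f r)%:E) = c%:E * \int[nu]_(r in D) (f r)%:E)%E.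
 move=> c0 mf f0; apply: ge0_integralZl_EFin => //; last exact: ED.
 by move=> r _; rewrite lee_fin.
have mge0 r : 0 <= m r by exact: ltW.
have nn c (f : T' -> R) : 0 <= c -> (forall r, 0 <= f r) -> forall r, D r -> (0 <= c%:E * (f r)%:E)%E.
 by move=> c0 f0 r _; rewrite -EFinM lee_fin mulr_ge0.
have key : (\int[nu]_(r in D) (c1%:E * (m r)%:E + c2%:E * (a r)%:E) <=
  \int[nu]_(r in D) ((h r)%:E + c3%:E * (m r)%:E))%E.
 apply: ge0_le_integral; first exact: mD.
 - by move=> r Dr; apply: adde_ge0; apply: nn.
 - by apply: emeasurable_funD; exact: ZD.
 - by apply: emeasurable_funD; [exact: ED|exact: ZD].
 move=> r _; rewrite -!EFinM -!EFinD lee_fin.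
 have q0' : 0 <= a r / m r by rewrite divr_ge0.
 have := ler_wpM2r (mge0 r) (powR_tangent q0' l0); rewrite !mulrDl.
 rewrite -[X in _ + X <= _]mulrA divfK ?gt_eqF//.
 rewrite powRM ?invr_ge0// -powR_inv1// -powRrM mulN1r -[X in _ <= X + _]mulrA.
 have -> : m r `^ (- q) * m r = m r `^ (1 - q).
  by rewrite -{2}[m r]powRr1// -powRD ?(gt_eqF (m0 r)) ?implybT// addrC.
 by [].
have B0 : (0 <= \int[nu]_(r in D) (h r)%:E)%E by apply: integral_ge0 => r _; rewrite lee_fin.
rewrite (ge0_integralD nu mD (nn _ _ c10 mge0) (ZD _ _ mm) (nn _ _ c20 a0) (ZD _ _ ma)) in key.
rewrite (ge0_integralD nu mD _ (ED _ mh) (nn _ _ c30 mge0) (ZD _ _ mm)) in key; last by move=> r _; rewrite lee_fin.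
rewrite !Zi// IE JE in key.
move: B0 key; rewrite -/h; set B := (\int[nu]_(r in D) (h r)%:E)%E.
case: B => [B|_ _|//]; last by rewrite leey.
rewrite lee_fin => B0; rewrite -!EFinM -!EFinD !lee_fin /c1 /c2 /c3 => key.
have lI : l `^ q * I = l `^ (q - 1) * J.
 have lJ : l * I = J by rewrite /l divfK// gt_eqF.
 have lq : l `^ (q - 1) * l = l `^ q.
  by rewrite -{2}[l]powRr1 ?(ltW l0)// -powRD ?subrK// (gt_eqF l0) implybT.
 by rewrite -lq -mulrA lJ.
have -> : J `^ q * I `^ (1 - q) = l `^ (q - 1) * J.
 rewrite /l powRM ?invr_ge0 ?(ltW Jp) ?(ltW I0)// -powR_inv1 ?(ltW I0)// -powRrM mulN1r opprB.
 rewrite mulrAC; congr (_ * _); rewrite -{3}[J]powRr1 ?(ltW Jp)// -powRD ?(gt_eqF Jp) ?implybT//.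
 by rewrite subrK.
move: key; rewrite -!mulrA lI; lra.
Qed.

Definition pnorm2 (t : T) : \bar R := (\int[P]_x (g t x `^ q)%:E)%E.
(** The [L^q(P)] norm of [g t], made positive by [eta] so that it can serve as a weight. Once the
    total energy is finite, the default value of [fine] at infinity is met on a null set only. *)
Definition mink (t : T) : R := (fine (pnorm2 t) + eta) `^ q^-1.

Lemma measurable_gq : meas (fun z : T * X => (g z.1 z.2 `^ q)%:E).
Proof. by apply/measurable_EFinP; exact: mpow. Qed.

Lemma measurable_pnorm2 : meas pnorm2.
Proof.
have h0 (z : T * X) : (0 <= (g z.1 z.2 `^ q)%:E)%E by exact: EpowR_ge0.
by have [_ [_ h]] := tonelli_set P measurableT measurable_gq h0; exact: h.
Qed.

Lemma pnorm2_ge0 t : (0 <= pnorm2 t)%E.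
Proof. by apply: integral_ge0 => x _; exact: EpowR_ge0. Qed.

Lemma measurable_mink : meas mink.
Proof.
apply: mpow; apply: measurable_funD => //.
by apply: (mcomp fine); [exact: fine_measurable|exact: measurable_pnorm2].
Qed.

Lemma mink_gt0 t : 0 < mink t.
Proof. by rewrite powR_gt0// ltr_wpDl// fine_ge0// pnorm2_ge0. Qed.

Lemma minkq t : mink t `^ q = fine (pnorm2 t) + eta.
Proof.
rewrite /mink -powRrM mulVf ?gt_eqF// powRr1// addr_ge0 ?(ltW eta0)//.
by rewrite fine_ge0// pnorm2_ge0.
Qed.

Lemma fine_le_ereal (x : \bar R) : (0 <= x -> (fine x)%:E <= x)%E.
Proof. by case: x => [r|//|//]; rewrite /= ?lexx// leey. Qed.

Lemma mink_energy : (\int[mu]_(t in I01) (mink t `^ q)%:E <=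
 \int[mu]_(t in I01) pnorm2 t + eta%:E)%E.
Proof.
have mp D : measurable_fun D pnorm2 by apply: measurable_funS measurable_pnorm2.
have -> : eta%:E = (\int[mu]_(t in I01) eta%:E)%E.
 by rewrite integral_cst//= lebesgue_measure_itv/= lte_fin ltr01 -EFinB subr0 mule1.
rewrite -ge0_integralD//; first last.
- by move=> t _; rewrite lee_fin ltW.
- by move=> t _; exact: pnorm2_ge0.
apply: ge0_le_integral => //.
- by move=> *; exact: EpowR_ge0.
- apply: mEFin; apply: mpow.
 exact: measurable_mink.
- by apply: emeasurable_funD.
by move=> t _; rewrite minkq EFinD leeD2r// fine_le_ereal// pnorm2_ge0.
Qed.

Hypothesis Mfin : (\int[mu]_(t in I01) pnorm2 t < +oo)%E.
Variables (s t : R) (s0 : 0 <= s) (st : s <= t) (t1 : t <= 1).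
Let D : set T := `[s, t]%classic.

Lemma mink_fin : (\int[mu]_(x in D) (mink x)%:E)%E \is a fin_num.
Proof.
rewrite ge0_fin_numE; last by apply: integral_ge0 => x _; rewrite lee_fin ltW// mink_gt0.
have mm E : measurable_fun E (fun x : T => (mink x)%:E).
 by apply: mEFin; exact: measurable_mink.
have mmq E : measurable_fun E (fun x : T => (mink x `^ q)%:E).
 apply: mEFin; apply: mpow.
 exact: measurable_mink.
apply: (@le_lt_trans _ _ (\int[mu]_(x in I01) (mink x)%:E)%E).
 apply: ge0_subset_integral => //; first exact: measurable_itv.
 - by move=> x _; rewrite lee_fin ltW// mink_gt0.
 - by apply: subset_itv; rewrite bnd_simp.
apply: (@le_lt_trans _ _ (\int[mu]_(x in I01) (1%:E + (mink x `^ q)%:E))%E).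
 apply: ge0_le_integral => //.
 - by move=> x _; rewrite lee_fin ltW// mink_gt0.
 - by apply: emeasurable_funD.
 move=> x _; rewrite -EFinD lee_fin; have := mink_gt0 x => m0.
 have [m1|/ltW m1] := leP 1 (mink x); last by rewrite ler_wpDr// powR_ge0.
 by rewrite ler_wpDl// -[leLHS](powRr1 (ltW m0)) ler_powR.
rewrite ge0_integralD//; last by move=> *; exact: EpowR_ge0.
rewrite lte_add_pinfty//; first by rewrite integral_cst//= lebesgue_measure_itv/= lte_fin ltr01 -EFinB subr0 mule1 ltry.
by apply: le_lt_trans mink_energy _; rewrite lte_add_pinfty// ltry.
Qed.

(** Apply [weighted_jensen] with the weight [mink] for each [x], integrate over [P] and exchange the
    integrals: the integral over [x] is at most [mink^(1 - q) mink^q = mink]. It remains to multiply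
    by [I^(q - 1)]. *)
Lemma minkowski_integral : (forall x, (\int[mu]_(r in D) (g r x)%:E)%E \is a fin_num) ->
 (\int[P]_x ((fine (\int[mu]_(r in D) (g r x)%:E)) `^ q)%:E <=
  ((fine (\int[mu]_(r in D) (mink r)%:E)) `^ q)%:E)%E.
Proof.
move=> gfin; have mD : measurable D by exact: measurable_itv.
have [s_t|ts] := ltP s t; last first.
 have -> : D = [set s] by rewrite /D (_ : t = s) ?set_itv1//; apply/eqP; rewrite eq_le ts.
 under eq_integral do rewrite integral_set1/= powR0 ?gt_eqF//.
 by rewrite integral_cst// mul0e lee_fin powR_ge0.
set I := fine (\int[mu]_(r in D) (mink r)%:E).
have IE : (\int[mu]_(r in D) (mink r)%:E = I%:E)%E by rewrite fineK// mink_fin.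
have mm E : measurable_fun E (fun x : T => (mink x)%:E).
 by apply: mEFin; exact: measurable_mink.
have I0 : 0 < I.
 rewrite -lte_fin -IE; apply: (@lt_le_trans _ _ (\int[mu]_(r in D) (eta `^ q^-1)%:E)%E).
  rewrite integral_cst//= lebesgue_measure_itv/= lte_fin s_t -EFinB -EFinM lte_fin.
  by rewrite mulr_gt0 ?powR_gt0// subr_gt0.
 apply: ge0_le_integral => //; first by move=> *; exact: EpowR_ge0.
 move=> x _; rewrite lee_fin ge0_ler_powR ?invr_ge0 ?(ltW q0)// ?nnegrE ?(ltW eta0)//.
  by rewrite addr_ge0 ?(ltW eta0)// fine_ge0// pnorm2_ge0.
 by rewrite lerDr fine_ge0// pnorm2_ge0.
pose h (z : T * X) : \bar R := (g z.1 z.2 `^ q * mink z.1 `^ (1 - q))%:E.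
have mh : meas h.
 apply/measurable_EFinP; apply: measurable_funM; first by move/measurable_EFinP: measurable_gq.
 apply: mpow.
 by apply: (mcomp mink) => //; exact: measurable_mink.
have h0 z : (0 <= h z)%E by rewrite lee_fin mulr_ge0// powR_ge0.
have [sw [mB _]] := tonelli_set P mD mh h0.
have mgx x : meas (fun r : T => g r x) by exact: (measurable_fun_pair1 _ mg).
have mhx x : meas (fun r : T => h (r, x)) by exact: (measurable_fun_pair1 _ mh).
have jensen x : (((fine (\int[mu]_(r in D) (g r x)%:E)) `^ q * I `^ (1 - q))%:E <= \int[mu]_(r in D) h (r, x))%E.
 set J := fine _; have JE : (\int[mu]_(r in D) (g r x)%:E = J%:E)%E by rewrite fineK.
 have := @weighted_jensen _ _ mu D mD (fun r => g r x) mink (mgx x) measurable_mink (fun r => g0 r x) mink_gt0 (gfin x) mink_fin I0.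
 by [].
have mJ : meas (fun x : X => fine (\int[mu]_(r in D) (g r x)%:E)).
 have g0' (z : T * X) : (0 <= (g z.1 z.2)%:E)%E by rewrite lee_fin.
 have mgE : meas (fun z : T * X => (g z.1 z.2)%:E) by exact/measurable_EFinP.
 have [_ [mJ _]] := tonelli_set P mD mgE g0'.
 exact: (mcomp fine (fine_measurable measurableT) mJ).
pose J x := fine (\int[mu]_(r in D) (g r x)%:E).
have mJq : meas (fun x : X => J x `^ q) by exact: (mpow mJ).
have mK : meas (fun x : X => (J x `^ q * I `^ (1 - q))%:E).
 by apply/measurable_EFinP; exact: measurable_funM mJq (measurable_cst _).
have Iq0 : 0 < I `^ (1 - q) by rewrite powR_gt0.
have Iq1 : 0 < I `^ (q - 1) by rewrite powR_gt0.
have innerE r : (\int[P]_x h (r, x) = (mink r `^ (1 - q))%:E * pnorm2 r)%E.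
 have hE x : (h (r, x) = (mink r `^ (1 - q))%:E * (g r x `^ q)%:E)%E by rewrite /h/= -EFinM mulrC.
 rewrite (eq_integral (fun x => (mink r `^ (1 - q))%:E * (g r x `^ q)%:E)%E); last by move=> x _; exact: hE.
 apply: ge0_integralZl_EFin; [exact: measurableT| | |exact: powR_ge0].
 - by move=> *; exact: EpowR_ge0.
 - apply/measurable_EFinP; apply: mpow.
  exact: (measurable_fun_pair2 _ mg).
have step : (\int[P]_x ((J x `^ q * I `^ (1 - q))%:E) <= I%:E)%E.
 apply: (@le_trans _ _ (\int[P]_x \int[mu]_(r in D) h (r, x))%E).
  apply: ge0_le_integral; [exact: measurableT| |exact: mK|exact: mB|].
  - by move=> x _; rewrite lee_fin mulr_ge0 ?powR_ge0.
  - by move=> x _; exact: jensen.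
 rewrite -sw -IE (eq_integral (fun r => (mink r `^ (1 - q))%:E * pnorm2 r)%E); last by move=> r _; exact: innerE.
 have mp E : measurable_fun E pnorm2 by apply: measurable_funS measurable_pnorm2.
 have mmq : measurable_fun D (fun r : T => (mink r `^ (1 - q))%:E).
  apply: mEFin; apply: mpow.
  exact: measurable_mink.
 apply: ae_ge0_le_integral.
 - exact: mD.
 - by move=> r _; rewrite mule_ge0// ?pnorm2_ge0// lee_fin powR_ge0.
 - by apply: emeasurable_funM; [exact: mmq|exact: mp].
 - by move=> r _; rewrite lee_fin (ltW (mink_gt0 _)).
 - exact: mm.
 have ip : mu.-integrable (I01 : set T) pnorm2.
  apply/integrableP; split; first exact: mp.
  under eq_integral do rewrite gee0_abs ?pnorm2_ge0//.
  exact: Mfin.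
 have m01 : measurable (I01 : set T) by exact: measurable_itv.
 have := integrable_ae m01 ip; apply: filterS => r hr Dr.
 have pf : pnorm2 r \is a fin_num.
  by apply: hr; move: Dr; rewrite /D/= !in_itv/= => /andP[h1 h2]; rewrite (le_trans s0 h1) (le_trans h2 t1).
 rewrite -(fineK pf) -EFinM lee_fin; apply: (via (mink r `^ (1 - q) * mink r `^ q)).
  by rewrite ler_wpM2l ?powR_ge0// minkq lerDl ltW.
 by rewrite -powRD ?subrK ?(gt_eqF (mink_gt0 r)) ?implybT// powRr1// ltW// mink_gt0.
have JE x : ((J x `^ q)%:E = (I `^ (q - 1))%:E * (J x `^ q * I `^ (1 - q))%:E)%E.
 rewrite -EFinM; congr (_%:E); rewrite mulrCA -powRD ?(gt_eqF I0) ?implybT//.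
 by rewrite (_ : q - 1 + (1 - q) = 0) ?powRr0 ?mulr1//; ring.
rewrite (eq_integral (fun x => (I `^ (q - 1))%:E * (J x `^ q * I `^ (1 - q))%:E)%E); last by move=> x _; exact: JE.
rewrite ge0_integralZl_EFin; [|exact: measurableT| |exact: mK|exact: ltW].
 have -> : ((I `^ q)%:E = (I `^ (q - 1))%:E * I%:E)%E.
  rewrite -EFinM; congr (_%:E); rewrite -{3}[I]powRr1 ?(ltW I0)// -powRD ?subrK//.
  by rewrite (gt_eqF I0) implybT.
 by rewrite lee_pmul2l// lte_fin.
by move=> x _; rewrite lee_fin mulr_ge0 ?powR_ge0.
Qed.

End Minkowski.

(** * Frames adapted to a hyperplane *)

Section HyperplaneFrame.
Context {m n : nat}.
Notation vec := ('I_m.+2 -> C).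
Notation d := n.+1.
Variables (u : vec) (h : Hpoly m.+1 d) (hE : forall y, pe h y = dotc u y ^+ d).

Lemma pe_hnonzero N k (p : Hpoly N k) x : pe p x != 0 -> hnonzero p.
Proof.
move=> px; apply: contrapT => h0; move: px; rewrite /pe /heval big1 ?eqxx// => a /eqP da.
have [->|pa] := eqVneq (p a) 0; first by rewrite mul0r.
by case: h0; exists a.
Qed.

Lemma frame_swap (L : Gr m) (e f : vec) : frame L e f -> frame L f e.
Proof. by case=> e1 f1 ef gL; split => //; [rewrite dotcC ef conjc0|rewrite addrC]. Qed.

Lemma vunitE (x : vec) i : nr2 x != 0 -> vunit x i = ((vnorm x)^-1)%:C * x i.
Proof. by move=> x0; rewrite /vunit (negbTE x0). Qed.

(** A line not contained in the hyperplane orthogonal to [u] meets it in one point: from a frame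
    [e, f] it is [<u,f> e - <u,e> f], normalized to [v], and [w] completes the frame as in
    [frame_rot]. *)
Lemma hyper_frame : exists v w : Grm m -> vec,
 [/\ forall i, mcfun (fun L => v L i), forall i, mcfun (fun L => w L i) &
  forall L, nondeg h L -> [/\ frame L (w L) (v L), dotc u (v L) = 0 & dotc u (w L) != 0]].
Proof.
have [e [f [me mf ef]]] := frame_measurable h (ltn0Sn n).
pose a L := dotc u (f L); pose b L := - dotc u (e L).
have mdot (x : Grm m -> vec) : (forall i, mcfun (fun L => x L i)) -> mcfun (fun L => dotc u (x L)).
 by move=> mx; apply: mcfun_sum => i; apply: mcfunM => //; exact: mcfun_cst.
have ma : mcfun a by exact: mdot.
have mb : mcfun b by apply: mcfunN; exact: mdot.
have mlin (x y : Grm m -> vec) (al be : Grm m -> C) : (forall i, mcfun (fun L => x L i)) ->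
  (forall i, mcfun (fun L => y L i)) -> mcfun al -> mcfun be ->
  forall i, mcfun (fun L => lin2 (al L) (x L) (be L) (y L) i).
 by move=> mx my mal mbe i; apply: mcfunD; exact: mcfunM.
pose v0 L := lin2 (a L) (e L) (b L) (f L).
pose w0 L := lin2 (- conjc (b L)) (e L) (conjc (a L)) (f L).
exists (fun L => vunit (v0 L)), (fun L => vunit (w0 L)); split.
- by apply: mcfun_vunit; exact: mlin.
- by apply: mcfun_vunit; apply: mlin => //; [apply: mcfunN|]; exact: mcfun_conj.
move=> L /ef[fr]; rewrite hE expf_eq0/= => ufL.
pose D := cabs (a L) ^+ 2 + cabs (b L) ^+ 2.
have D0 : 0 < D by rewrite ltr_pwDl ?sqr_ge0// exprn_gt0// cabs_gt0.
have Nv : nr2 (v0 L) = D by rewrite (frame_nr2 _ _ fr).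
have Nw : nr2 (w0 L) = D by rewrite (frame_nr2 _ _ fr) cabsN !cabs_conj addrC.
have D0' : D != 0 by rewrite gt_eqF.
have vn : vnorm (v0 L) = Num.sqrt D by rewrite /vnorm Nv.
have wn : vnorm (w0 L) = Num.sqrt D by rewrite /vnorm Nw.
have sD : 0 < Num.sqrt D by rewrite sqrtr_gt0.
have c2 : cabs (((Num.sqrt D)^-1)%:C * a L) ^+ 2 + cabs (((Num.sqrt D)^-1)%:C * b L) ^+ 2 = 1.
 rewrite !cabsM cabs_real !exprMn -mulrDr ger0_norm ?invr_ge0 ?(ltW sD)// exprVn sqr_sqrtr ?(ltW D0)//.
 by rewrite mulVf.
have vE : vunit (v0 L) = lin2 (((Num.sqrt D)^-1)%:C * a L) (e L) (((Num.sqrt D)^-1)%:C * b L) (f L).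
 by apply/funext => i; rewrite vunitE ?Nv// vn /v0 /lin2; ring.
have wE : vunit (w0 L) = lin2 (- conjc (((Num.sqrt D)^-1)%:C * b L)) (e L) (conjc (((Num.sqrt D)^-1)%:C * a L)) (f L).
 apply/funext => i; rewrite vunitE ?Nw// wn /w0 /lin2 !conjcMm.
 by rewrite (_ : conjc ((Num.sqrt D)^-1)%:C = ((Num.sqrt D)^-1)%:C) ?conjc_real//; ring.
have frv := frame_rot fr c2; rewrite -vE -wE in frv.
split; first exact: frame_swap.
 by rewrite vE dotc_linr /a /b; ring.
rewrite wE dotc_linr !conjcMm.
have -> : dotc u (e L) = - b L by rewrite opprK.
rewrite -/(a L) mulrN mulNr opprK -!mulrA !conjcM_cabs -mulrDr -realcD addrC.
rewrite mulf_neq0//; first by rewrite conjc_eq0 -cabs_eq0 cabs_real normr_eq0 invr_eq0 gt_eqF.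
by rewrite -cabs_eq0 cabs_real normr_eq0 D0'.
Qed.

Lemma hyper_unit_unique (L : Gr m) (x y : vec) : nondeg h L -> mv (grm L) x =1 x -> mv (grm L) y =1 y ->
 nr2 x = 1 -> nr2 y = 1 -> dotc u x = 0 -> dotc u y = 0 -> exists2 c : C, cabs c = 1 & y =1 fun i => c * x i.
Proof.
move=> ndL Lx Ly x1 y1 ux uy; have [f fr] := frame_of x1 Lx.
have [z Lz] := ndL; rewrite hE expf_eq0/= => uz.
have yE := frame_lin fr Ly; have zE := frame_lin fr Lz.
have uf : dotc u f != 0.
 apply: contraNneq uz => uf; rewrite (_ : z = lin2 (dotc x z) x (dotc f z) f); last exact/funext.
 by rewrite dotc_linr ux uf !mulr0 addr0.
have b0 : dotc f y = 0.
 move/eqP: uy; rewrite {1}(funext yE) dotc_linr ux mulr0 add0r mulf_eq0 (negbTE uf) orbF.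
 by move/eqP.
have yx : y =1 fun i => dotc x y * x i by move=> i; rewrite yE b0 /lin2 mul0r addr0.
exists (dotc x y) => //; apply/eqP; rewrite -(@eqrXn2 _ 2)// expr1n; apply/eqP.
by have := congr1 nr2 (funext yx); rewrite y1 nr2_scale x1 mulr1.
Qed.

Variables (v w : Grm m -> vec) (mv_ : forall i, mcfun (fun L => v L i)) (mw_ : forall i, mcfun (fun L => w L i)).
Variables (p : Hpoly m.+1 d) (c : C) (c0 : c != 0).

Definition leg (t : R) : Hpoly m.+1 d := fun a => p a + t%:C * (c * h a).

Lemma pe_leg t y : pe (leg t) y = pe p y + t%:C * (c * dotc u y ^+ d).
Proof.
rewrite -hE /pe /heval !mulr_sumr -big_split/=; apply: eq_bigr => a _.
by rewrite /leg; ring.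
Qed.

Lemma deriv_size_lead (f : {poly C}) : size f = n.+2 -> size f^`() = n.+1 /\ lead_coef f^`() = n.+1%:R * lead_coef f.
Proof.
move=> sf; have l0 : lead_coef f != 0 by rewrite lead_coef_eq0 -size_poly_eq0 sf.
have cE : f^`()`_n = n.+1%:R * lead_coef f by rewrite coef_deriv lead_coefE sf/= mulr_natl.
have c0' : f^`()`_n != 0 by rewrite cE mulf_neq0// pnatr_eq0.
have sz : size f^`() = n.+1.
 apply/eqP; rewrite eqn_leq; apply/andP; split.
  by rewrite -ltnS -sf lt_size_deriv// -size_poly_eq0 sf.
 by rewrite ltnNge; apply: contra c0' => le; rewrite nth_default.
by rewrite lead_coefE sz.
Qed.

(** Critical times measurable in the line: the critical points are the roots of the derivative, made
    monic through its leading coefficient [(n + 1) p(v)]. *)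
Lemma leg_data : exists ys : seq (Grm m -> R), [/\ size ys = d,
 (forall y, List.In y ys -> meas y) &
 forall L, pe p (v L) != 0 -> dotc u (w L) != 0 -> exists xs,
  [/\ size xs = n, (lp p (w L) (v L))^`() = (n.+1%:R * pe p (v L)) *: \prod_(x <- xs) ('X - x%:P) &
    crit (lp p (w L) (v L)) xs (c * dotc u (w L) ^+ d) = [seq y L | y <- ys]]].
Proof.
pose P (L : Grm m) : {poly C} := if pe p (v L) == 0 then 'X^n
  else (n.+1%:R * pe p (v L))^-1 *: (lp p (w L) (v L))^`().
have mpv : mcfun (fun L => pe p (v L)) by exact: mcfun_pe.
have mP : mcpoly P.
 move=> i; rewrite /P; under eq_fun do rewrite (fun_if (fun q : {poly C} => q`_i)) coefZ coef_deriv.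
 apply: mcfun_if; [exact: measurable_mc_eq0|exact: mcfun_cst|].
 apply: mcfunM; first by apply: mcfunV; apply: mcfunM => //; exact: mcfun_cst.
 have mMn (g : Grm m -> C) k : mcfun g -> mcfun (fun L => g L *+ k).
  move=> mg; rewrite (_ : (fun L => _) = fun L => k%:R * g L); first by apply: mcfunM => //; exact: mcfun_cst.
  by apply/funext => L; rewrite mulr_natl.
 apply: mMn; move: (i.+1); apply: mcpoly_sum => a; apply: mcpolyM; first by move=> j; exact: mcfun_cst.
 apply: mcpoly_prod => j; apply: mcpolyXn; apply: mcpolyD; first exact: mcpolyC.
 by apply: mcpolyM; [exact: mcpolyX|exact: mcpolyC].
have n1 : n.+1%:R != 0 :> C by rewrite pnatr_eq0.
have dl L : pe p (v L) != 0 -> size (lp p (w L) (v L))^`() = n.+1 /\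
  lead_coef (lp p (w L) (v L))^`() = n.+1%:R * pe p (v L).
 by move=> pv; have [s1 s2] := lead_lp (w L) pv; have := deriv_size_lead s1; rewrite s2.
have monP L : P L \is monic.
 rewrite /P; case: eqP => [_|/eqP pf]; first exact: monicXn.
 by rewrite monicE lead_coefZ (dl _ pf).2 mulVf// mulf_neq0.
have sP L : size (P L) = n.+1.
 rewrite /P; case: eqP => [_|/eqP pf]; first by rewrite size_polyXn.
 by rewrite size_scale ?(dl _ pf).1// invr_eq0 mulf_neq0.
have [xs [sxs mxs Pxs]] := measurable_roots mP monP sP.
pose kap L := c * dotc u (w L) ^+ d.
have mkap : mcfun kap.
 apply: mcfunM; first exact: mcfun_cst.
 apply: mcfunX; apply: mcfun_sum => i; apply: mcfunM => //; exact: mcfun_cst.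
pose yf (s : Grm m -> C) (L : Grm m) : R := - Re (pe p (fun i => w L i + s L * v L i) / kap L).
have myf s : mcfun s -> meas (yf s).
 move=> ms; have [mre _] : mcfun (fun L => - (pe p (fun i => w L i + s L * v L i) / kap L)).
  apply: mcfunN; apply: mcfunM; last exact: mcfunV.
  by apply: mcfun_pe => i; apply: mcfunD => //; exact: mcfunM.
 by rewrite (_ : yf s = fun L => Re (- (pe p (fun i => w L i + s L * v L i) / kap L)))//; apply/funext => L; rewrite ReN.
exists (yf (fun=> 0) :: [seq yf x | x <- xs]); split.
- by rewrite /= size_map sxs.
- move=> y /= [<-|]; first by apply: myf; exact: mcfun_cst.
 elim: (xs) mxs => //= s t IH mst [<-|]; last by apply: IH => x xt; apply: mst; right.
 by apply: myf; apply: mst; left.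
move=> L pv uw; exists [seq x L | x <- xs]; split.
- by rewrite size_map.
- have := Pxs L; rewrite /P (negbTE pv) big_map => <-.
 by rewrite scalerA mulfV ?scale1r// mulf_neq0.
rewrite /crit /= /yf horner_lp; congr (_ :: _).
by rewrite -!map_comp; apply: eq_map => x; rewrite /= horner_lp.
Qed.

End HyperplaneFrame.

(** Every term is at most a maximum [M], and [M^q] is at most the sum of the powers. *)
Lemma sum_powR_le (q : R) (I : Type) (s : seq I) (b : I -> R) : 1 <= q -> (forall i, 0 <= b i) ->
 (\sum_(i <- s) b i) `^ q <= (size s)%:R `^ q * \sum_(i <- s) b i `^ q.
Proof.
move=> q1 b0; have q0 : 0 < q by exact: lt_le_trans q1.
have [M hM hMs] : exists2 M, 0 <= M & (forall i, List.In i s -> b i <= M) /\ M `^ q <= \sum_(i <- s) b i `^ q.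
 elim: s => [|i s [M M0 [hM Ms]]].
  by exists 0 => //; split => //; rewrite big_nil powR0 ?gt_eqF.
 have S0 : 0 <= \sum_(j <- s) b j `^ q by apply: sumr_ge0 => j _; exact: powR_ge0.
 have [bM|/ltW Mb] := leP (b i) M.
  exists M => //; split; first by move=> j /= [<-|/hM].
  by rewrite big_cons (le_trans Ms)// lerDr powR_ge0.
 exists (b i) => //; split; first by move=> j /= [<-|/hM /le_trans]; [|exact].
 by rewrite big_cons lerDl.
have [hM1 hM2] := hMs.
apply: (via (((size s)%:R * M) `^ q)).
 rewrite ge0_ler_powR ?(ltW q0)// ?nnegrE ?mulr_ge0//; first by apply: sumr_ge0.
 elim: (s) hM1 => [|i t IH] h; first by rewrite big_nil mul0r.
 rewrite big_cons/= -natr1 mulrDl mul1r addrC lerD//; last by apply: h; left.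
 by apply: IH => j jt; apply: h; right.
by rewrite powRM// ler_wpM2l// powR_ge0.
Qed.

(** * Energy of a leg *)

Section LegEstimate.
Context {m n : nat}.
Notation vec := ('I_m.+2 -> C).
Notation N := m.+2.
Notation d := n.+1.
Notation mu := (@lebesgue_measure R).
Notation T := (measurableTypeR R).
Variables (vol : probability (Grm m) R) (inv : Gr_invariant R m vol).
Variables (q th : R) (q1 : 1 <= q) (th0 : 0 < th) (thn : th * n.+1%:R <= 1) (th1 : th < 1).
Let b : R := ((2 * d) * 2 ^ (2 * N))%:R^-1.
Variables (sq : (1 - th) * q < 1) (tb : th * q < b).
Variables (u : vec) (u1 : nr2 u = 1) (h : Hpoly m.+1 d) (hE : forall y, pe h y = dotc u y ^+ d).

Let q0 : 0 < q. Proof. exact: lt_le_trans q1. Qed.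
Let b0 : 0 < b. Proof. by rewrite invr_gt0 ltr0n muln_gt0 expn_gt0. Qed.

Lemma hnz : hnonzero h.
Proof. by apply: (@pe_hnonzero _ _ h u); rewrite hE dotcxx u1 expr1n oner_eq0. Qed.

(** [line_sublevel] with the constraint [u]: a reflection along a vector orthogonal to [u] preserves
    the hyperplane, so it takes [v L] to a unimodular multiple of the vector [v] of the reflected
    line. A line inside the hyperplane stays inside, hence is never sent into [B]. *)
Lemma hyper_sublevel : exists2 A : R, 0 < A & forall (v : Grm m -> vec),
 (forall i, mcfun (fun L => v L i)) ->
 (forall L, nondeg h L -> [/\ mv (grm L) (v L) =1 v L, nr2 (v L) = 1 & dotc u (v L) = 0]) ->
 forall (p : Hpoly m.+1 d) c0 vs e,
 0 < c0 -> nr2 vs = 1 -> dotc u vs = 0 -> c0 <= cabs (pe p vs) -> 0 < e ->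
 (vol [set L | (cabs (pe p (v L)) < e)%R] <= (A * (e / c0) `^ b)%:E)%E.
Proof.
have [A A0 hA] := @line_sublevel m d vol inv (ltn0Sn n) u (or_introl u1).
exists A => // v mv_ hv p c0 vs e c00 vs1 uvs pvs e0.
pose B := [set L : Grm m | nondeg h L] `&` [set L : Grm m | cabs (pe p (v L)) < e].
have mpv : meas (fun L : Grm m => cabs (pe p (v L))).
 by apply: measurable_cabs; exact: mcfun_pe.
have mS : measurable [set L : Grm m | cabs (pe p (v L)) < e].
 by apply: measurable_ltf => //; exact: measurable_cst.
have mB : measurable B by apply: measurableI => //; exact: measurable_nondeg.
have nul : vol [set L | ~ nondeg h L] = 0%E by apply: (aenondegP inv (ltn0Sn n)); exact: hnz.
apply: (via (vol B)).
 apply: (via (vol (B `|` [set L | ~ nondeg h L]))).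
  apply: le_measure; rewrite ?inE//; first by apply: measurableU => //; exact: measurable_deg.
  by move=> L aL; have [nd|nd] := pselect (nondeg h L); [left; split|right].
 apply: le_trans (measureU2 _ mB (measurable_deg h)) _.
 by rewrite [X in (_ + X)%E](_ : _ = 0%E) ?adde0.
apply: (hA p c0 vs e B) => // L.
have [ndL|ndL] := pselect (nondeg h L); last first.
 exists vs; split => // a ua [ndU _]; case: ndL.
 have [z Uz] := ndU; rewrite hE expf_eq0/= => uz.
 exists (mv (hh a) z); last first.
  rewrite hE expf_eq0/=; apply: contra uz => /eqP E; apply/eqP; rewrite -E.
  rewrite (_ : mv (hh a) z = lin2 1 z (- (2 / nr2 a)%:C * dotc a z) a); last first.
   by apply/funext => i; rewrite mv_hh /lin2; ring.
  by rewrite dotc_linr ua mulr0 addr0 mul1r.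
 have HH : hh a *m hh a = 1%:M by rewrite -{1}adj_hh hh_unitary.
 have Ul := act_mv (hh_unitary a) Uz.
 move=> i; rewrite -[RHS]Ul; congr (mv _ _ i).
 by rewrite !grm_act ?hh_unitary// adj_hh !mulmxA HH mul1mx -mulmxA HH mulmx1.
have [Lv v1 uv] := hv L ndL; exists (v L); split => // a ua [ndU /= aU].
have [Uv' v1' uv'] := hv _ ndU.
have uU : dotc u (mv (hh a) (v L)) = 0.
 rewrite (_ : mv (hh a) (v L) = lin2 1 (v L) (- (2 / nr2 a)%:C * dotc a (v L)) a); last first.
  by apply/funext => i; rewrite mv_hh /lin2; ring.
 by rewrite dotc_linr ua uv !mulr0 addr0.
have [cc cc1 E] := hyper_unit_unique hE ndU Uv' (act_mv (hh_unitary a) Lv) v1'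
  (etrans (nr2_unitary _ (hh_unitary a)) v1) uv' uU.
by rewrite (pe_ext _ E) pe_scale cabsM cabsX cc1 expr1n mul1r.
Qed.

Let sg : 0 < 1 - th. Proof. by rewrite subr_gt0. Qed.
Let g := (1 - th) * q.
Let g0 : 0 < g. Proof. exact: mulr_gt0. Qed.

Definition tailcst (A b' g' : R) : R := 1 + A * (2 `^ g' / (1 - 2 `^ (g' - b'))).

Lemma tailcst_ge0 A b' g' : 0 <= A -> g' < b' -> 0 <= tailcst A b' g'.
Proof.
move=> A0 gb; rewrite addr_ge0// mulr_ge0// divr_ge0 ?powR_ge0// subr_ge0.
have l2 : 1 < 2 :> R by lra.
rewrite -[leRHS](powRr0 2) ler_powR ?(ltW l2)//; lra.
Qed.

Section OneLeg.
Variables (v w : Grm m -> vec) (mv_ : forall i, mcfun (fun L => v L i)) (mw_ : forall i, mcfun (fun L => w L i)).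
Variables (hvw : forall L, nondeg h L -> [/\ frame L (w L) (v L), dotc u (v L) = 0 & dotc u (w L) != 0]).
Variables (A c0 : R) (A0 : 0 <= A) (c00 : 0 < c0).
Variables (p : Hpoly m.+1 d) (tail : forall e, 0 < e -> (vol [set L | (cabs (pe p (v L)) < e)%R] <= (A * (e / c0) `^ b)%:E)%E).
Variables (vs : vec) (uvs : dotc u vs = 0) (pvs : pe p vs != 0).
Variables (c : C) (cn0 : c != 0).

Let a L := cabs (pe p (v L)).
Let ma : meas a. Proof. by apply: measurable_cabs; exact: mcfun_pe. Qed.
Let a0 L : 0 <= a L. Proof. exact: cabs_ge0. Qed.

Lemma tail_a : (\int[vol]_L (a L `^ (- (th * q)))%:E <= (tailcst (A * c0 `^ (- b)) b (th * q))%:E)%E.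
Proof.
apply: (@tail_integral _ _ vol (A * c0 `^ (- b)) b (th * q)) => //.
- by rewrite mulr_ge0 ?powR_ge0.
- by rewrite mulr_gt0.
move=> e e0; have := tail e0; rewrite powRM ?invr_ge0 ?(ltW e0) ?(ltW c00)//.
by rewrite -(powR_inv1 (ltW c00)) -powRrM mulN1r -mulrA [in X in _ -> X](mulrC (c0 `^ _)).
Qed.

Lemma a_null : vol [set L | a L = 0] = 0%E.
Proof.
have mS : measurable [set L : Grm m | a L = 0].
 have := measurable_mc_eq0 (mcfun_pe p mv_); rewrite (_ : [set L | _] = [set L | a L = 0])//.
 by apply/seteqP; split => L /=; rewrite -cabs_eq0 => /eqP.
apply/eqP; rewrite eq_le measure_ge0 andbT.
have fin := fin_num_measure vol _ mS.
rewrite -(fineK fin) lee_fin; apply: (@small_powR (A + 1) c0 b) => //; first by rewrite ltr_wpDl.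
move=> e e0; rewrite -lee_fin fineK//; apply: le_trans (le_trans (tail e0) _).
 apply: le_measure; rewrite ?inE//.
  by apply: measurable_ltf => //; exact: measurable_cst.
 by move=> L /= aL; rewrite -/(a L) aL.
by rewrite lee_fin ler_wpM2r ?powR_ge0// lerDl.
Qed.

(** The point [vs] lies on the hyperplane of [h], so all polynomials of the leg keep the value
    [p(vs)] there. *)
Lemma aenondeg_leg t : aenondeg vol (leg h p c t).
Proof.
apply: (aenondegP inv (ltn0Sn n)); apply: (@pe_hnonzero _ _ _ vs).
by rewrite (pe_leg hE) uvs exprS mul0r !mulr0 addr0.
Qed.

Definition legA : R := 2 * (3 * (d%:R * 4 ^+ n)).

Lemma legA_ge0 : 0 <= legA.
Proof. by rewrite !mulr_ge0// exprn_ge0. Qed.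

Section Speeds.
Variables (ys : seq (Grm m -> R)) (sys : size ys = d).
Variables (mys : forall y, List.In y ys -> meas y).

(** The speed bound is a product of [ampl], a function of the line alone, and of [lsum], whose
    energy in time is bounded uniformly in the line. So the two integrability conditions separate:
    [(1 - th) q < 1] for time, [th q < b] for lines. *)
Definition ampl (L : Grm m) : R := legA * (cabs c / a L) `^ th.
Definition lsum (t : T) (L : Grm m) : R := \sum_(y <- ys) `|t - y L| `^ (- (1 - th)).
Definition lspeed (t : T) (L : Grm m) : R := ampl L * lsum t L.

Lemma lsum_ge0 t L : 0 <= lsum t L.
Proof. by apply: sumr_ge0 => y _; exact: powR_ge0. Qed.

Lemma ampl_ge0 L : 0 <= ampl L. Proof. by rewrite mulr_ge0 ?legA_ge0// powR_ge0. Qed.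

Lemma lspeed_ge0 t L : 0 <= lspeed t L.
Proof. by rewrite mulr_ge0 ?ampl_ge0 ?lsum_ge0. Qed.

Lemma measurable_ampl : meas ampl.
Proof.
apply: measurable_funM => //; apply: mpow.
by apply: measurable_funM => //; exact: measurable_pos_inv.
Qed.

Lemma measurable_dist (y : Grm m -> R) (s : R) : meas y ->
 meas (fun z : T * Grm m => `|z.1 - y z.2| `^ s).
Proof.
move=> my; apply: mpow; apply: measurableT_comp => //.
apply: measurable_funB; first exact: measurable_fst.
exact: (measurableT_comp my measurable_snd).
Qed.

Lemma measurable_dist_sum s : meas (fun z : T * Grm m => \sum_(y <- ys) `|z.1 - y z.2| `^ s).
Proof.
elim: ys mys => [|y t IH] my; first by under eq_fun do rewrite big_nil; exact: measurable_cst.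
under eq_fun do rewrite big_cons; apply: measurable_funD.
 by apply: measurable_dist; apply: my; left.
by apply: IH => x xt; apply: my; right.
Qed.

Lemma measurable_lspeed : meas (fun z : T * Grm m => lspeed z.1 z.2).
Proof.
apply: measurable_funM; last exact: measurable_dist_sum.
exact: (measurableT_comp measurable_ampl measurable_snd).
Qed.

Definition legC : R := legA `^ q * (d%:R `^ q * (d%:R * tailcst 2 1 g)) * tailcst (A * c0 `^ (- b)) b (th * q).

Lemma lspeed_energy : (\int[mu]_(t in I01) pnorm2 vol q lspeed t <= (legC * cabs c `^ (th * q))%:E)%E.
Proof.
have m01 : measurable (I01 : set T) by exact: measurable_itv.
have mq := measurable_gq q measurable_lspeed.
have hq0 (z : T * Grm m) : (0 <= (lspeed z.1 z.2 `^ q)%:E)%E by exact: EpowR_ge0.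
have [sw [mI _]] := tonelli_set vol m01 mq hq0.
rewrite /pnorm2 sw.
pose B : R := d%:R `^ q * (d%:R * tailcst 2 1 g).
have B0 : 0 <= B by rewrite !mulr_ge0 ?powR_ge0// tailcst_ge0.
have K0 : 0 <= legA `^ q * B * cabs c `^ (th * q).
 by apply: mulr_ge0; [apply: mulr_ge0; [exact: powR_ge0|exact: B0]|exact: powR_ge0].
have amq L : (ampl L) `^ q = legA `^ q * cabs c `^ (th * q) * (a L) `^ (- (th * q)).
 have ai : 0 <= (a L)^-1 by rewrite invr_ge0.
 rewrite /ampl powRM ?legA_ge0 ?powR_ge0// -powRrM powRM//.
 rewrite -mulrA; congr (_ * (_ * _)); have [->|an] := eqVneq (a L) 0.
  have tq : th * q != 0 by rewrite gt_eqF// mulr_gt0.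
  by rewrite invr0 !powR0// oppr_eq0.
 by rewrite -(powR_inv1 (a0 L)) -powRrM mulN1r.
have inner L : (\int[mu]_(t in I01) (lspeed t L `^ q)%:E <= (ampl L `^ q * B)%:E)%E.
 pose F t := \sum_(y <- ys) `|t - y L| `^ (- g).
 have mdist (y : Grm m -> R) E : measurable_fun E (fun t : T => (`|t - y L| `^ (- g))%:E).
  apply: mEFin; apply: mpow.
  by apply: measurableT_comp => //; exact: measurable_funB.
 have mF E : measurable_fun E (fun t : T => (F t)%:E).
  apply: mEFin.
  apply: measurable_sum => y; apply: mpow.
  by apply: measurableT_comp => //; exact: measurable_funB.
 pose k := (ampl L) `^ q * d%:R `^ q.
 have k0 : 0 <= k by rewrite mulr_ge0 ?powR_ge0.
 have F0 t : 0 <= F t by apply: sumr_ge0 => y _; exact: powR_ge0.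
 apply: (@le_trans _ _ (\int[mu]_(t in I01) (k%:E * (F t)%:E))%E).
  apply: ge0_le_integral; first exact: m01.
  - by move=> *; exact: EpowR_ge0.
  - apply: mEFin; apply: mpow.
   exact: (measurable_fun_pair1 _ measurable_lspeed).
  - by apply: measurable_funeM; exact: mF.
  move=> t _; rewrite -EFinM lee_fin /lspeed powRM ?ampl_ge0 ?lsum_ge0//.
  rewrite /k -mulrA ler_wpM2l ?powR_ge0// -sys /F /lsum.
  rewrite [X in _ <= _ * X](eq_bigr (fun y : Grm m -> R => (`|t - y L| `^ (- (1 - th))) `^ q)); last first.
   by move=> y _; rewrite -powRrM mulNr.
  by apply: (sum_powR_le ys q1) => y; exact: powR_ge0.
 rewrite ge0_integralZl_EFin; [|exact: m01|by move=> t _; rewrite lee_fin|exact: mF|exact: k0].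
 rewrite /B mulrA -/k [leRHS]EFinM; apply: lee_pmul; [by rewrite lee_fin| |exact: lexx|].
  by apply: integral_ge0 => t _; rewrite lee_fin.
 rewrite /F; under eq_integral do rewrite -sumEFin.
 rewrite ge0_integral_sum; [|exact: m01|by move=> y; exact: mdist|by move=> *; exact: EpowR_ge0].
 apply: (@le_trans _ _ (\sum_(y <- ys) (tailcst 2 1 g)%:E)%E).
  by apply: lee_sum => y _; exact: abs_pow_integral.
 by rewrite sumEFin lee_fin big_const_seq count_predT iter_addr_0 sys mulr_natl.
apply: (@le_trans _ _ (\int[vol]_L ((legA `^ q * B * cabs c `^ (th * q))%:E * (a L `^ (- (th * q)))%:E))%E).
 apply: ge0_le_integral; [exact: measurableT| |exact: mI| |].
 - by move=> L _; apply: integral_ge0 => t _; exact: EpowR_ge0.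
 - by apply: measurable_funeM; apply/measurable_EFinP; exact: mpow.
 move=> L _; apply: le_trans (inner L) _; rewrite -EFinM lee_fin amq.
 by rewrite le_eqVlt; apply/orP; left; apply/eqP; ring.
rewrite ge0_integralZl_EFin; first last.
- exact: K0.
- by apply/measurable_EFinP; exact: mpow.
- by move=> *; exact: EpowR_ge0.
- exact: measurableT.
rewrite /legC -/B [in leRHS]mulrAC [leRHS]EFinM.
apply: lee_pmul; [by rewrite lee_fin| |exact: lexx|].
- by apply: integral_ge0 => L _; exact: EpowR_ge0.
- exact: tail_a.
Qed.

Lemma lspeed_fin s t L : 0 <= s -> t <= 1 -> (\int[mu]_(r in `[s, t]) (lspeed r L)%:E)%E \is a fin_num.
Proof.
move=> s0 t1; rewrite ge0_fin_numE; last by apply: integral_ge0 => x _; rewrite lee_fin lspeed_ge0.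
have mE (y : Grm m -> R) (D : set T) : measurable_fun D (fun r : T => (`|r - y L| `^ (- (1 - th)))%:E).
 apply: mEFin; apply: mpow.
 by apply: measurableT_comp => //; exact: measurable_funB.
have mL (D : set T) : measurable_fun D (fun r : T => (lspeed r L)%:E).
 by apply: mEFin; exact: (measurable_fun_pair1 _ measurable_lspeed).
have mF (D : set T) : measurable_fun D (fun r : T => (lsum r L)%:E).
 by apply: mEFin; exact: (measurable_fun_pair1 _ (measurable_dist_sum _)).
have m01 : measurable (I01 : set T) by exact: measurable_itv.
apply: (@le_lt_trans _ _ (\int[mu]_(r in I01) (lspeed r L)%:E)%E).
 apply: ge0_subset_integral; [exact: measurable_itv|exact: m01|exact: mL| |].
 - by move=> x _; rewrite lee_fin lspeed_ge0.
 - by apply: subset_itv; rewrite bnd_simp.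
rewrite (eq_integral (fun r => (ampl L)%:E * (lsum r L)%:E)%E); last by move=> r _.
rewrite ge0_integralZl_EFin; [|exact: m01|by move=> r _; rewrite lee_fin lsum_ge0|exact: mF|exact: ampl_ge0].
apply: lte_mul_pinfty; [by rewrite lee_fin ampl_ge0|by []|].
under eq_integral do rewrite /lsum -sumEFin.
rewrite ge0_integral_sum; [|exact: m01|by move=> y; exact: mE|by move=> *; exact: EpowR_ge0].
apply/lte_sum_pinfty => y _; apply: le_lt_trans (abs_pow_integral (y L) _ _) _; rewrite ?ltry//.
by rewrite gtrDl oppr_lt0.
Qed.

Definition goodL L := nondeg h L /\ a L != 0.

Variables (hys : forall L, pe p (v L) != 0 -> dotc u (w L) != 0 -> exists xs,
  [/\ size xs = n, (lp p (w L) (v L))^`() = (n.+1%:R * pe p (v L)) *: \prod_(x <- xs) ('X - x%:P) &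
    crit (lp p (w L) (v L)) xs (c * dotc u (w L) ^+ d) = [seq y L | y <- ys]]).

(** [leg_match] on a single line. There [kap = c <u,w>^d], and the derivative has leading
    coefficient [(n + 1) p(v)]; as [|<u,w>| <= 1], their ratio has modulus at most [|c| / a]. *)
Lemma good_match s t L e : 0 <= s -> s <= t -> t <= 1 -> goodL L -> 0 < e ->
 exists x y, [/\ lpts (leg h p c s) L x, lpts (leg h p c t) L y &
  forall i, (i < d)%N -> dFS R (nth point x i) (nth point y i) <= fine (\int[mu]_(r in `[s, t]) (lspeed r L)%:E) + e].
Proof.
move=> s0 st t1 [ndL aL] e0; have [fr uv uw] := hvw ndL.
have pv : pe p (v L) != 0 by rewrite -cabs_eq0.
have [xs [sxs dE cE]] := hys pv uw.
have [w1 v1 wv gL] := fr.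
set f := lp p (w L) (v L) in dE cE.
have [sf lf] := lead_lp (w L) pv; rewrite -/f in sf lf.
have c0' : n.+1%:R * pe p (v L) != 0 by rewrite mulf_neq0// pnatr_eq0.
have k0 : c * dotc u (w L) ^+ d != 0 by rewrite mulf_neq0// expf_neq0.
have [zs [ws [szs sws Pz Pw near]]] := leg_match w1 v1 wv dE c0' sxs sf k0 th0 thn th1 s0 st t1 e0.
have lpE r : lp (leg h p c r) (w L) (v L) = legpoly f (c * dotc u (w L) ^+ d) r.
 apply: horner_ext => z; rewrite horner_lp (pe_leg hE) /legpoly hornerD hornerC horner_lp.
 rewrite (_ : dotc u _ = dotc u (w L))//.
 rewrite (_ : (fun i => w L i + z * v L i) = lin2 1 (w L) z (v L)) ?dotc_linr ?uv ?mulr0 ?addr0 ?mul1r//.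
 by apply/funext => i; rewrite /lin2 mul1r.
have pvr r : pe (leg h p c r) (v L) = pe p (v L) by rewrite (pe_leg hE) uv exprS mul0r !mulr0 addr0.
have lcE r : lead_coef (legpoly f (c * dotc u (w L) ^+ d) r) = pe (leg h p c r) (v L).
 by rewrite (lead_legpoly sf) lf pvr.
have mk r us : size us = d -> legpoly f (c * dotc u (w L) ^+ d) r =
  lead_coef (legpoly f (c * dotc u (w L) ^+ d) r) *: \prod_(z <- us) ('X - z%:P) ->
  lpts (leg h p c r) L [seq pt (lin2 1 (w L) z (v L)) | z <- us].
 move=> sus E; exists (w L), (v L), us; split => //; first by rewrite pvr.
 by apply: roots_onP => //; rewrite lpE E lcE.
exists [seq pt (lin2 1 (w L) z (v L)) | z <- zs], [seq pt (lin2 1 (w L) z (v L)) | z <- ws].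
split; [exact: mk|exact: mk|].
move=> i id; rewrite (nth_map 0) ?szs// (nth_map 0) ?sws//; apply: le_trans (near i id) _.
rewrite lerD2r /legint.
have mS : meas (legspeed f xs (c * dotc u (w L) ^+ d) th) by exact: measurable_legspeed.
have sE r : legspeed f xs (c * dotc u (w L) ^+ d) th r = lsum r L.
 by rewrite /legspeed cE big_map.
rewrite (eq_integral (fun r => (lsum r L)%:E)); last by move=> r _; rewrite sE.
rewrite [in leRHS](eq_integral (fun r => (ampl L)%:E * (lsum r L)%:E)%E); last by move=> r _.
rewrite ge0_integralZl_EFin; [|exact: measurable_itv|by move=> r _; rewrite lee_fin lsum_ge0| |exact: ampl_ge0]; last first.
 by apply/measurable_EFinP; apply: measurable_funTS; rewrite (_ : (fun r => _) = legspeed f xs (c * dotc u (w L) ^+ d) th)//; apply/funext => r; rewrite sE.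
have G0 : 0 <= fine (\int[mu]_(r in `[s, t]) (lsum r L)%:E).
 by rewrite fine_ge0// integral_ge0// => r _; rewrite lee_fin lsum_ge0.
have legfin := legspeed_fin f xs (c * dotc u (w L) ^+ d) th0 th1 s0 t1.
have xfin : (\int[mu]_(r in `[s, t]) (lsum r L)%:E)%E \is a fin_num.
 by move: legfin; under eq_integral do rewrite sE.
rewrite fineM// ler_wpM2r// /legcst /ampl /legA.
rewrite -!mulrA; do 4 (rewrite ler_wpM2l// ?exprn_ge0//).
rewrite ge0_ler_powR ?(ltW th0)// ?nnegrE ?divr_ge0//.
rewrite !cabsM cabs_nat -mulrA ler_wpM2l// cabsX.
have uw1 : cabs (dotc u (w L)) <= 1 by apply: cs_unit.
have aL0 : 0 < a L by rewrite lt_def aL a0.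
apply: (via (1 / (n.+1%:R * a L))).
 by rewrite ler_wpM2r ?invr_ge0 ?mulr_ge0// exprn_ile1.
by rewrite mul1r lef_pV2 ?posrE ?mulr_gt0// ler_peMl// ler1n.
Qed.

(** This choice keeps the energy of [legm] of order [|c|^(th q)], so that it still tends to 0 with
    [c]. *)
Let eta := cabs c `^ (th * q).
Let eta0 : 0 < eta. Proof. by rewrite powR_gt0// cabs_gt0. Qed.
Definition legm : T -> R := mink vol q lspeed eta.

Lemma legm_ge0 t : 0 <= legm t.
Proof. exact: (ltW (mink_gt0 _ _ _ eta0 t)). Qed.

Lemma measurable_legm : meas legm.
Proof. exact: (measurable_mink vol q measurable_lspeed). Qed.

Lemma legm_energy : (\int[mu]_(t in I01) (legm t `^ q)%:E <= ((legC + 1) * eta)%:E)%E.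
Proof.
apply: le_trans (mink_energy vol q1 measurable_lspeed eta0) _.
rewrite mulrDl mul1r EFinD; apply: leeD; [exact: lspeed_energy|exact: lexx].
Qed.

Lemma Wq_leg s t : 0 <= s -> s <= t -> t <= 1 ->
 (Wq R q (muP vol (leg h p c s)) (muP vol (leg h p c t)) <= \int[mu]_(r in `[s, t]) (legm r)%:E)%E.
Proof.
move=> s0 st t1.
have Mfin : (\int[mu]_(t in I01) pnorm2 vol q lspeed t < +oo)%E.
 by apply: le_lt_trans lspeed_energy _; rewrite ltry.
have mfin := mink_fin q1 measurable_lspeed eta0 Mfin s0 t1.
have gfin L := lspeed_fin L s0 t1.
have mk := minkowski_integral q1 measurable_lspeed lspeed_ge0 eta0 Mfin s0 st t1 gfin.
rewrite /legm -(fineK mfin); set I := fine _ in mk *.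
have I0 : 0 <= I by rewrite fine_ge0// integral_ge0// => r _; rewrite lee_fin; exact: legm_ge0.
pose J L := fine (\int[mu]_(r in `[s, t]) (lspeed r L)%:E).
have mgE : meas (fun z : T * Grm m => (lspeed z.1 z.2)%:E).
 by apply/measurable_EFinP; exact: measurable_lspeed.
have g0' (z : T * Grm m) : (0 <= (lspeed z.1 z.2)%:E)%E by rewrite lee_fin lspeed_ge0.
have mst : measurable (`[s, t]%classic : set T) by exact: measurable_itv.
have [_ [mJ' _]] := tonelli_set vol mst mgE g0'.
have mJ : meas J.
 exact: (mcomp fine (fine_measurable measurableT) mJ').
have J0 L : 0 <= J L by rewrite fine_ge0// integral_ge0// => r _; rewrite lee_fin lspeed_ge0.
have ma0 : measurable [set L : Grm m | a L = 0].
 have := measurable_mc_eq0 (mcfun_pe p mv_); rewrite (_ : [set L | _] = [set L | a L = 0])//.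
 by apply/seteqP; split => L /=; rewrite -cabs_eq0 => /eqP.
pose B : set (Grm m) := [set L | ~ nondeg h L] `|` [set L | a L = 0].
have mB : measurable B by apply: measurableU => //; exact: measurable_deg.
have vB : vol B = 0%E.
 apply/eqP; rewrite eq_le measure_ge0 andbT.
 apply: le_trans (measureU2 _ (measurable_deg h) ma0) _.
 rewrite [X in (X + _)%E](_ : _ = 0%E); last by apply: (aenondegP inv (ltn0Sn n)); exact: hnz.
 by rewrite [X in (_ + X)%E](_ : _ = 0%E) ?adde0//; exact: a_null.
have goodB L : ~ B L -> goodL L.
 move=> nB; split; first by apply: contrapT => nd; apply: nB; left.
 by apply/eqP => aL; apply: nB; right.
(* On the null set [B] of bad lines no matching is known, and the diameter bound [pi] is used
   instead. *)
pose K L := J L + @trigo.pi R * \1_B L.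
have mK : meas K.
 apply: measurable_funD; first exact: mJ.
 by apply: measurable_funM; [exact: measurable_cst|exact: measurable_indic].
have mpow (F : Grm m -> R) : meas F -> meas (fun L : Grm m => (F L `^ q)%:E).
 by move=> mF; apply/measurable_EFinP; exact: (mpow mF).
apply: (@Wq_muP_le m d vol (ltn0Sn n) q (leg h p c s) (leg h p c t) K I q1 (aenondeg_leg s) (aenondeg_leg t) mK _ I0).
 move=> L nds ndt e e0; have [BL|/goodB gL] := pselect (B L).
  have lex (p' : Hpoly m.+1 d) : nondeg p' L -> exists x, lpts p' L x.
   move=> nd; have [zs [_ _ hz]] := labelled_roots p' (ltn0Sn n).
   by have [e' [f' [ss [h1 h2 h3 _]]]] := hz L nd; exists [seq pt (lin2 1 e' s f') | s <- ss], e', f', ss.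
  have [x hx] := lex _ nds; have [y hy] := lex _ ndt; exists x, y; split => // i id.
  apply: le_trans (dFS_lepi _ _) _; rewrite /K indicE mem_set// mulr1 -addrA addrCA lerDl.
  by rewrite addr_ge0// ltW.
 have [x [y [hx hy near]]] := good_match s0 st t1 gL e0; exists x, y; split => // i id.
 by apply: le_trans (near i id) _; rewrite lerD2r /K lerDl mulr_ge0// trigo.pi_ge0.
apply: le_trans mk; apply: ae_ge0_le_integral.
- exact: measurableT.
- by move=> *; exact: EpowR_ge0.
- exact: mpow.
- by move=> *; exact: EpowR_ge0.
- exact: (mpow J).
exists B; split => // L /= nle; apply: contrapT => nB; apply: nle => _.
by rewrite /K indicE memNset// mulr0 addr0.
Qed.

End Speeds.
End OneLeg.

(** [K] depends on [p] only through the lower bound [c0] for [|p(vs)|], hence is uniform near a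
    given polynomial. After a [q]-th root, a leg costs at most [K^(1/q) |c|^th]. For [c = 0] the leg
    is constant and is treated apart. *)
Theorem leg_estimate (vs : vec) (c0 : R) : nr2 vs = 1 -> dotc u vs = 0 -> 0 < c0 ->
 exists2 K : R, 0 <= K & forall (p : Hpoly m.+1 d) (c : C), c0 <= cabs (pe p vs) ->
  (forall t, hnonzero (leg h p c t)) /\
  exists f : R -> R, [/\ meas f, forall t, 0 <= f t,
   (\int[mu]_(t in I01) (f t `^ q)%:E <= (K * cabs c `^ (th * q))%:E)%E &
   forall s t, 0 <= s -> s <= t -> t <= 1 ->
    (Wq R q (muP vol (leg h p c s)) (muP vol (leg h p c t)) <= \int[mu]_(r in `[s, t]) (f r)%:E)%E].
Proof.
move=> vs1 uvs c00; have [v [w [mv_ mw_ hvw]]] := hyper_frame hE.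
have [A A0 hA] := hyper_sublevel.
have hv L : nondeg h L -> [/\ mv (grm L) (v L) =1 v L, nr2 (v L) = 1 & dotc u (v L) = 0].
 move=> nd; have [fr uv _] := hvw L nd; split => //; last by case: fr.
 have := frame_mv 0 1 fr; rewrite (_ : lin2 0 (w L) 1 (v L) = v L)//.
 by apply/funext => i; rewrite /lin2 mul0r add0r mul1r.
have K0 : 0 <= legC A c0.
 by rewrite !mulr_ge0 ?powR_ge0 ?tailcst_ge0// mulr_ge0 ?powR_ge0// ltW.
exists (legC A c0 + 1) => [|p c pc]; first by rewrite addr_ge0.
have pvs : pe p vs != 0 by rewrite -cabs_gt0; exact: lt_le_trans pc.
have hn t : hnonzero (leg h p c t).
 by apply: (@pe_hnonzero _ _ _ vs); rewrite (pe_leg hE) uvs exprS mul0r !mulr0 addr0.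
split => //; have [->|cn0] := eqVneq c 0.
 exists (fun=> 0); split => //.
 - by rewrite powR0 ?gt_eqF// integral0 lee_fin mulr_ge0 ?powR_ge0// addr_ge0.
 - move=> s t _ _ _; rewrite integral0.
  have lE r : leg h p 0 r = p by apply/funext => a; rewrite /leg mul0r mulr0 addr0.
  have aen : aenondeg vol p by apply: (aenondegP inv (ltn0Sn n)); exact: pe_hnonzero pvs.
  have [P hP] := muP_prob (ltn0Sn n) aen.
  by rewrite !lE (Wq_ext q hP hP) Wq_refl.
have tail e : 0 < e -> (vol [set L | (cabs (pe p (v L)) < e)%R] <= (A * (e / c0) `^ b)%:E)%E.
 exact: (hA v mv_ hv p c0 vs e c00 vs1 uvs pc).
have [ys [sys mys hys]] := leg_data u mv_ mw_ p c.
exists (legm v p c ys); split.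
- exact: measurable_legm.
- by move=> t; exact: legm_ge0.
- exact: (legm_energy mv_ (ltW A0) c00 tail cn0 sys mys).
- exact: (Wq_leg mv_ hvw (ltW A0) c00 tail uvs pvs cn0 sys mys hys).
Qed.

End LegEstimate.

(** * Absolutely continuous functions and metric derivatives *)

Section Measures.
Notation T := (measurableTypeR R).

Section Density.
Context d (X : measurableType d) (nu : {measure set X -> \bar R}) (f : X -> \bar R).
Variables (mf : meas f) (f0 : forall x, (0 <= f x)%E).

Definition density (A : set X) : \bar R := let _ := (mf, f0) in (\int[nu]_(x in A) f x)%E.

Let density0 : density set0 = 0%E. Proof. by rewrite /density integral_set0. Qed.

Let density_ge0 A : (0 <= density A)%E. Proof. exact: integral_ge0. Qed.

Let density_sigma_additive : semi_sigma_additive density.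
Proof.
move=> F mF tF mUF; rewrite /density; apply: cvg_toP.
 apply: ereal_nondecreasing_is_cvgn => i j ij.
 apply: lee_sum_nneg_natr => // k _ _; exact: integral_ge0.
by rewrite ge0_integral_bigcup//; exact: measurable_funS mf.
Qed.

HB.instance Definition _ := isMeasure.Build _ _ _ density density0 density_ge0 density_sigma_additive.

Lemma density_measure : exists k : {measure set X -> \bar R}, forall A, k A = (\int[nu]_(x in A) f x)%E.
Proof. by exists density. Qed.

End Density.

Section Stieltjes.
Variables (F : R -> R) (nd : {homo F : x y / x <= y}) (rc : right_continuous F).

Definition stfun : R -> R := let _ := (nd, rc) in F.

HB.instance Definition _ := isCumulative.Build R _ R stfun nd rc.

Lemma stieltjes_exists : exists nu : {measure set T -> \bar R},
 (forall a b, a <= b -> nu `]a, b]%classic = (F b - F a)%:E) /\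
 forall k : {measure set T -> \bar R}, (forall a b, a <= b -> k `]a, b]%classic = (F b - F a)%:E) ->
  forall A, measurable A -> nu A = k A.
Proof.
have E a b : a <= b -> lebesgue_stieltjes_measure (stfun : cumulative R R) `]a, b]%classic = (F b - F a)%:E.
 move=> ab; rewrite /lebesgue_stieltjes_measure /measure_extension measurable_mu_extE/=; last exact: is_ocitv.
 by rewrite wlength_itv_bnd.
exists (lebesgue_stieltjes_measure (stfun : cumulative R R)); split => // k kE A mA.
apply: lebesgue_stieltjes_measure_unique => // X [[a b] _ <-] /=.
have [ab|ba] := leP a b; first by rewrite kE// E.
by rewrite set_itv_ge ?measure0// bnd_simp -leNgt ltW.
Qed.

End Stieltjes.
End Measures.

Section MetricDerivative.
Notation mu := (@lebesgue_measure R).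
Notation T := (measurableTypeR R).
Implicit Types (f m : R -> R).

Definition prim f (t : R) : R := (\int[mu]_(x in `]-oo, t]) f x)%R.
Definition L1 f := mu.-integrable [set: R] (EFin \o f).

Lemma L1S f (D : set R) : measurable D -> L1 f -> mu.-integrable D (EFin \o f).
Proof. by move=> mD; apply: integrableS. Qed.

Lemma primB f s t : L1 f -> s <= t -> prim f t - prim f s = (\int[mu]_(x in `]s, t]) f x)%R.
Proof. by move=> If st; rewrite /prim Rintegral_itvB//; exact: L1S. Qed.

Lemma prim_right f (t e : R) : L1 f -> 0 < e -> exists2 d, 0 < d & forall y, t <= y -> y <= t + d -> `|prim f y - prim f t| <= e.
Proof.
move=> If e0; have t1 : t < t + 1 by rewrite ltrDl.
have := parameterized_integral_cvg_left t1 (L1S (measurable_itv _) If).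
move/cvgrPdist_le => /(_ e e0) [d /= d0 hd].
exists (d / 2) => [|y ty yt]; first by rewrite divr_gt0.
rewrite primB// Rintegral_itv_obnd_cbnd; last exact: L1S.
have := hd y; rewrite sub0r normrN; apply.
rewrite /ball_/= distrC ger0_norm ?subr_ge0//; lra.
Qed.

Lemma prim_ftc f : L1 f -> exists2 Nn : set T, measurable Nn /\ mu Nn = 0%E & forall t, ~ Nn t ->
 forall e, 0 < e -> exists2 d, 0 < d & forall h, `|h| < d -> `|prim f (t + h) - prim f t - h * f t| <= e * `|h|.
Proof.
move=> If; have lf : locally_integrable [set: R] f by apply: open_integrable_locally => //; exact: openT.
have [Nn [mN N0 hN]] := lebesgue_differentiation lf.
exists Nn => // t nt e e0; have pt_t : lebesgue_pt f t by apply: contrapT => h; apply: nt; exact: hN.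
have tt1 : t < t + 1 by rewrite ltrDl.
have [dF Ft] := FTC1_lebesgue_pt tt1 (L1S (measurable_itv `]-oo, (t + 1)%R]) If) (ltNyr t) pt_t.
have dF' : derivable (prim f) t 1 by exact: dF.
have Ft' : 'D_1 (prim f) t = f t by rewrite -derive1E; exact: Ft.
have cv : h^-1 *: ((prim f \o shift t) (h *: 1) - prim f t) @[h --> 0^'] --> 'D_1 (prim f) t by exact: dF'.
rewrite Ft' in cv; move/cvgrPdist_le : cv => /(_ e e0)[d /= d0 hd].
exists d => // h hd'; have [->|h0] := eqVneq h 0; first by rewrite addr0 subrr mul0r subrr normr0 mulr0.
have := hd h; rewrite /ball_/= sub0r normrN => /(_ hd' h0).
rewrite [h *: 1]mulr1 (addrC h) -[_ *: _]/(_ * _) => H.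
have -> : prim f (t + h) - prim f t - h * f t = - (h * (f t - h^-1 * (prim f (t + h) - prim f t))) by field.
by rewrite normrN normrM mulrC ler_wpM2r.
Qed.

Lemma eqle (x y : \bar R) : x = y -> (x <= y)%E. Proof. by move=> ->. Qed.

Lemma null_union (A B : set T) : measurable A /\ mu A = 0%E -> measurable B /\ mu B = 0%E ->
 measurable (A `|` B) /\ mu (A `|` B) = 0%E.
Proof.
move=> [mA A0] [mB B0]; split; first exact: measurableU.
apply/eqP; rewrite eq_le measure_ge0 andbT; apply: le_trans (measureU2 _ mA mB) _.
by apply: le_trans (leeD (eqle A0) (eqle B0)) _; rewrite adde0.
Qed.

Lemma null_bigcup (A : nat -> set T) : (forall k, measurable (A k) /\ mu (A k) = 0%E) ->
 measurable (\bigcup_k A k) /\ mu (\bigcup_k A k) = 0%E.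
Proof.
move=> h; have mA : measurable (\bigcup_k A k) by apply: bigcup_measurable => k _; exact: (h k).1.
split => //; have : mu.-negligible (\bigcup_k A k).
 by apply: negligible_bigcup => k; apply/negligibleP; [exact: (h k).1|exact: (h k).2].
by move/negligibleP => /(_ mA).
Qed.

Lemma ae_bound f m : L1 f -> L1 m -> (forall s t, s <= t -> `|prim f t - prim f s| <= prim m t - prim m s) ->
 exists2 Nn : set T, measurable Nn /\ mu Nn = 0%E & forall t, ~ Nn t -> `|f t| <= m t.
Proof.
move=> If Im h; have [N1 n1 h1] := prim_ftc If; have [N2 n2 h2] := prim_ftc Im.
exists (N1 `|` N2) => [|t nt]; first exact: null_union.
apply/ler_addgt0Pr => e e0; have e2 : 0 < e / 2 by rewrite divr_gt0.
have [d1 d10 k1] := h1 t (fun x => nt (or_introl x)) _ e2.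
have [d2 d20 k2] := h2 t (fun x => nt (or_intror x)) _ e2.
pose y := Num.min d1 d2 / 2.
have md : 0 < Num.min d1 d2 by rewrite lt_min d10.
have y0 : 0 < y by rewrite divr_gt0.
have yl : y < Num.min d1 d2 by rewrite /y; lra.
have y1 : `|y| < d1 by rewrite gtr0_norm//; apply: lt_le_trans yl _; rewrite ge_min lexx.
have y2 : `|y| < d2 by rewrite gtr0_norm//; apply: lt_le_trans yl _; rewrite ge_min lexx orbT.
have := k1 _ y1; have := k2 _ y2; have := h t (t + y); rewrite lerDl (ltW y0) => /(_ isT).
rewrite (gtr0_norm y0); set A := prim f _ - _; set B := prim m _ - _ => hAB hB hA.
rewrite -(ler_pM2l y0) -{1}(gtr0_norm y0) -normrM.
have a1 : `|y * f t| <= `|A| + e / 2 * y.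
 have -> : y * f t = A - (A - y * f t) by ring.
 by apply: le_trans (ler_normB _ _) _; rewrite lerD2l.
move: hB; rewrite ler_norml => /andP[_ hB]; lra.
Qed.

(** With [M] the primitive of [m], [phi + M] and [M - phi] are nondecreasing and right continuous,
    and their Stieltjes measures add up to [2 m dx]. So the first has a density [g] by
    Radon--Nikodym, and [g - m] is a derivative of [phi]; it is truncated to satisfy [|f| <= m]
    everywhere. *)
Lemma ac_derivative (phi m : R -> R) : L1 m -> (forall t, 0 <= m t) ->
 (forall s t, s <= t -> `|phi t - phi s| <= prim m t - prim m s) ->
 exists f, [/\ L1 f, forall t, `|f t| <= m t & forall s t, s <= t -> phi t - phi s = prim f t - prim f s].
Proof.
move=> Im m0 h.
have mono s t : s <= t -> prim m s <= prim m t.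
 by move=> st; rewrite -subr_ge0; apply: le_trans (h s t st).
have rcm (F : R -> R) : (forall s t, s <= t -> `|F t - F s| <= 2 * (prim m t - prim m s)) -> right_continuous F.
 move=> hF x; apply/cvgrPdist_le => e e0; have e2 : 0 < e / 2 by rewrite divr_gt0.
 have [d d0 hd] := prim_right x Im e2.
 near=> y; have xy : x <= y by near: y; exact: nbhs_right_ge.
 have yd : y <= x + d.
  by near: y; apply: nbhs_right_le; rewrite ltrDl.
 rewrite distrC; apply: le_trans (hF x y xy) _.
 have := hd y xy yd; rewrite ger0_norm ?subr_ge0 ?mono//; lra.
pose F t := phi t + prim m t; pose F' t := prim m t - phi t.
have ndF : {homo F : x y / x <= y}.
 by move=> x y /h; rewrite ler_norml /F => /andP[]; lra.
have ndF' : {homo F' : x y / x <= y}.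
 by move=> x y /h; rewrite ler_norml /F' => /andP[]; lra.
have rF : right_continuous F.
 by apply: rcm => s t /h; rewrite !ler_norml /F => /andP[h1 h2]; apply/andP; split; lra.
have rF' : right_continuous F'.
 by apply: rcm => s t /h; rewrite !ler_norml /F' => /andP[h1 h2]; apply/andP; split; lra.
have ndG : {homo (fun t => F t + F' t) : x y / x <= y} by move=> x y xy; apply: lerD; [exact: ndF|exact: ndF'].
have rG : right_continuous (fun t => F t + F' t) by move=> x; apply: cvgD; [exact: rF|exact: rF'].
have [nu [nuE _]] := stieltjes_exists ndF rF.
have [nu' [nu'E _]] := stieltjes_exists ndF' rF'.
have [nG [nGE nGu]] := stieltjes_exists ndG rG.
have mm : meas m by have /integrableP[/measurable_EFinP] := Im.
have m2 : meas (fun t : T => (2 * m t)%:E).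
 by apply/measurable_EFinP; apply: measurable_funM.
have m20 (t : T) : (0 <= (2 * m t)%:E)%E by rewrite lee_fin mulr_ge0.
have [k kE] := density_measure mu m2 m20.
have L1fin (g : R -> R) (D : set R) : measurable D -> L1 g -> (\int[mu]_(x in D) (g x)%:E)%E \is a fin_num.
 by move=> mD Ig; apply: integrable_fin_num => //; exact: L1S.
have L12 : L1 (fun t => 2 * m t).
 by apply: eq_integrable (integrableZl _ 2 Im) => // t _; rewrite /= EFinM.
have nGk A : measurable A -> nG A = k A.
 apply: nGu => a b ab; rewrite kE -[LHS]fineK; last by apply: L1fin.
 congr (_%:E); rewrite -/(Rintegral _ _ _) RintegralZl//; last exact: L1S.
 by rewrite -primB// /F /F'; ring.
have nuk A : measurable A -> (nu A <= k A)%E.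
 move=> mA; rewrite -(nGk A mA) (nGu (measure_add nu nu') _ A mA).
  by apply: le_trans _ (eqle (esym (measure_addE nu nu' A))); exact: leeDl.
 move=> a b ab; apply: etrans (measure_addE nu nu' _) _; rewrite nuE// nu'E// -EFinD; congr (_%:E); ring.
have nufin : (nu [set: T] < +oo)%E.
 apply: le_lt_trans (nuk _ measurableT) _; rewrite kE.
 by have := L1fin _ _ measurableT L12; rewrite fin_numE => /andP[_]; rewrite ltey.
have dom : mfrestr measurableT nufin `<< mu.
 apply/null_content_dominatesP => A mA A0.
 rewrite /mfrestr/= /mrestr setIT; apply/eqP; rewrite eq_le measure_ge0 andbT.
 apply: le_trans (nuk A mA) _; rewrite kE null_set_integral//.
 exact: measurable_funTS.
have [g [g0 gf Ig gE]] := radon_nikodym_sigma_finite dom.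
pose f0 t := fine (g t) - m t.
have Ig' : L1 (fine \o g).
 by apply: eq_integrable Ig => // t _; rewrite /= fineK.
have If0 : L1 f0 by apply: eq_integrable (integrableB measurableT Ig' Im) => // t _.
have f0E s t : s <= t -> phi t - phi s = prim f0 t - prim f0 s.
 move=> st; rewrite primB// /f0 RintegralB//; try exact: L1S.
 have pm := primB Im st; rewrite -pm.
 have E : nu (`]s, t]%classic `&` setT) = (\int[mu]_(x in `]s, t]) g x)%E by exact: (gE _ (measurable_itv _)).
 rewrite setIT nuE// in E.
 have -> : (\int[mu]_(x in `]s, t]) fine (g x))%R = F t - F s.
  rewrite /Rintegral; under eq_integral do rewrite fineK//.
  by rewrite -E.
 by rewrite /F; ring.
have [Nn [mN N0] hN] : exists2 Nn : set T, measurable Nn /\ mu Nn = 0%E & forall t, ~ Nn t -> `|f0 t| <= m t.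
 by apply: ae_bound => // s t st; rewrite -f0E//; exact: h.
pose f t := Num.max (- m t) (Num.min (f0 t) (m t)).
have fm t : `|f t| <= m t.
 by rewrite ler_norml le_max lexx/= ge_max ge_min lexx orbT andbT; have := m0 t; lra.
have mf : meas f.
 have mf0 : meas f0 by have /integrableP[/measurable_EFinP] := If0.
 by apply: measurable_maxr; [exact: measurableT_comp|exact: measurable_minr].
have If : L1 f.
 apply: (le_integrable measurableT _ _ Im); first exact/measurable_EFinP.
 by move=> t _ /=; rewrite lee_fin (ger0_norm (m0 t)).
exists f; split => // s t st; rewrite f0E// !primB//.
rewrite /Rintegral; congr fine; apply: ae_eq_integral => //.
- by apply: mEFin; have /integrableP[/measurable_EFinP] := If0.
- by apply: mEFin.
exists Nn; split => // x /= nx; apply: contrapT => nNx; apply: nx => _.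
have := hN x nNx; rewrite ler_norml => /andP[h1 h2].
by rewrite /f (min_l h2) (max_r h1).
Unshelve. all: by end_near. Qed.

Lemma rat_dense_right (s e : R) : 0 < e -> exists k, s <= ratr (odflt 0 (@unpickle rat k)) :> R /\
 ratr (odflt 0 (@unpickle rat k)) <= s + e :> R.
Proof.
move=> e0; have se : s < s + e by rewrite ltrDl.
have [r] := rat_in_itvoo se; rewrite in_itv/= => /andP[h1 h2].
by exists (pickle r); rewrite pickleK/= !ltW.
Qed.

Variables (W : R -> R -> R) (W0 : forall s t, 0 <= W s t) (Ws : forall s t, W s t = W t s).
Variables (Wt : forall s t u, W s u <= W s t + W t u).
Variables (m : R -> R) (Im : L1 m) (m0 : forall t, 0 <= m t).
Variable (Wm : forall s t, s <= t -> W s t <= prim m t - prim m s).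

Let r (k : nat) : R := ratr (odflt 0 (@unpickle rat k)).

(* the derivative is the supremum of the derivatives of the distances to a dense sequence of times *)
Theorem metric_derivative : exists md : R -> R,
 [/\ L1 md, forall t, 0 <= md t, forall t, md t <= m t,
  forall s t, s <= t -> W s t <= prim md t - prim md s &
  exists2 Nn : set T, measurable Nn /\ mu Nn = 0%E & forall t, ~ Nn t -> forall e, 0 < e ->
   exists2 d, 0 < d & forall h, h != 0 -> `|h| < d -> `|W (t + h) t / `|h| - md t| <= e].
Proof.
have lip k s t : `|W (r k) t - W (r k) s| <= W s t.
 rewrite ler_norml; apply/andP; split.
  by have := Wt (r k) t s; rewrite (Ws t s); lra.
 by have := Wt (r k) s t; lra.
have /choice[psi hpsi] : forall k, exists f, [/\ L1 f, forall t, `|f t| <= m t &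
  forall s t, s <= t -> W (r k) t - W (r k) s = prim f t - prim f s].
 move=> k; apply: ac_derivative => // s t st; apply: le_trans (Wm st); exact: lip.
pose md t := sups (fun k => `|psi k t|) 0.
have ub t : has_ubound (range (fun k => `|psi k t|)).
 by exists (m t) => _ [k _ <-]; have [_ + _] := hpsi k; apply.
have sdE t : sdrop (fun k => `|psi k t|) 0 = range (fun k => `|psi k t|).
 by rewrite /sdrop; apply/seteqP; split => x [k _ <-]; exists k.
have mdE t : md t = reals.sup (range (fun k => `|psi k t|)) by congr reals.sup; exact: sdE.
have psi_md k t : `|psi k t| <= md t.
 by rewrite mdE; apply: ub_le_sup => //; exists k.
have md_m t : md t <= m t.
 rewrite mdE; apply: ge_sup; first by exists `|psi 0%N t|; exists 0%N.
 by move=> _ [k _ <-]; have [_ + _] := hpsi k; apply.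
have md0 t : 0 <= md t by apply: le_trans (psi_md 0%N t).
have md_ex t e : 0 < e -> exists k, md t - e < `|psi k t|.
 move=> e0; have hs : has_sup (range (fun k => `|psi k t|)).
  by split => //; exists `|psi 0%N t|; exists 0%N.
 have [_ [k _ <-] hk] := sup_adherent e0 hs; exists k.
 by rewrite mdE.
have mpsi k : meas (psi k).
 by have [Ik _ _] := hpsi k; have /integrableP[/measurable_EFinP] := Ik.
have mmd : meas md.
 apply: measurable_fun_sups; first by move=> t _; exact: ub.
 by move=> k; exact: measurableT_comp.
have Imd : L1 md.
 apply: (le_integrable measurableT _ _ Im); first exact/measurable_EFinP.
 by move=> t _ /=; rewrite lee_fin !ger0_norm.
(* Take a time [r k] of the dense sequence just after [s]: [W (r k) s] is small, and the increment
   of the distance to [r k] is the integral of [psi k <= md]. *)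
have Wmd s t : s <= t -> W s t <= prim md t - prim md s.
 move=> st; apply/ler_addgt0Pr => e e0; have e2 : 0 < e / 2 by rewrite divr_gt0.
 have [d d0 hd] := prim_right s Im e2.
 have [k []] := rat_dense_right s d0; rewrite -/(r k) => sr rs.
 have near : W (r k) s <= e / 2.
  by rewrite Ws; apply: le_trans (Wm sr) _; apply: le_trans (ler_norm _) (hd _ sr rs).
 have [Ik bk Ek] := hpsi k.
 have up : W (r k) t - W (r k) s <= prim md t - prim md s.
  rewrite (Ek s t st) (primB Ik st) (primB Imd st); apply: le_Rintegral => //; try exact: L1S.
  by move=> x _; apply: le_trans (ler_norm _) (psi_md k x).
 have := Wt s (r k) t; rewrite (Ws s (r k)); lra.
exists md; split => //.
have [N0 n0 h0] := prim_ftc Imd.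
have /choice[N hN] : forall k, exists Nn : set T, (measurable Nn /\ mu Nn = 0%E) /\ forall t, ~ Nn t ->
  forall e, 0 < e -> exists2 d, 0 < d & forall h, `|h| < d -> `|prim (psi k) (t + h) - prim (psi k) t - h * psi k t| <= e * `|h|.
 by move=> k; have [Ik _ _] := hpsi k; have [Nn n hn] := prim_ftc Ik; exists Nn.
exists (N0 `|` \bigcup_k N k) => [|t nt e e0].
 by apply: null_union => //; apply: null_bigcup => k; exact: (hN k).1.
have e2 : 0 < e / 2 by rewrite divr_gt0.
have [d1 d10 k1] := h0 t (fun x => nt (or_introl x)) _ e2.
(* The difference quotient is bounded above through [md] and [Wmd], and below through a single
   [psi k] that is almost [md] at [t]. *)
have [k hk] := md_ex t _ e2.
have ntk : ~ N k t by move=> x; apply: nt; right; exists k.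
have [d2 d20 k2] := (hN k).2 t ntk _ e2.
exists (Num.min d1 d2) => [|h hn]; first by rewrite lt_min d10.
rewrite lt_min => /andP[hd1 hd2]; have ah : 0 < `|h| by rewrite normr_gt0.
have H1 := k1 _ hd1; have H2 := k2 _ hd2.
have Wup : W (t + h) t <= `|prim md (t + h) - prim md t|.
 have [hp|/ltW hm] := leP 0 h.
  by rewrite Ws; apply: le_trans (ler_norm _); apply: Wmd; rewrite lerDl.
 by rewrite distrC; apply: le_trans (ler_norm _); apply: Wmd; rewrite gerDl.
have [_ _ Ek] := hpsi k.
have Wlow : `|prim (psi k) (t + h) - prim (psi k) t| <= W (t + h) t.
 have [hp|/ltW hm] := leP 0 h.
  by rewrite Ws -Ek ?lerDl//; exact: lip.
 by rewrite distrC -Ek ?gerDl//; exact: lip.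
have up : W (t + h) t <= `|h| * md t + e / 2 * `|h|.
 apply: le_trans Wup _; rewrite -(subrK (h * md t) (prim md (t + h) - prim md t)) addrC.
 by apply: le_trans (ler_normD _ _) _; rewrite normrM (ger0_norm (md0 t)) lerD2l.
have low : `|h| * `|psi k t| <= W (t + h) t + e / 2 * `|h|.
 rewrite -normrM -(subKr (prim (psi k) (t + h) - prim (psi k) t) (h * psi k t)).
 by apply: le_trans (ler_normB _ _) _; rewrite lerD.
have low2 : `|h| * (md t - e / 2) <= `|h| * `|psi k t| by rewrite ler_pM2l// ltW.
by rewrite ler_distl; apply/andP; split; [rewrite ler_pdivlMr//|rewrite ler_pdivrMr//]; lra.
Qed.

End MetricDerivative.

(** * Integrals without measurability; affine changes of time *)

Section NonMeasurable.
Context {d : measure_display} {X : measurableType d}.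
Variable nu : {measure set X -> \bar R}.

Lemma le_integral_any (D : set X) (f g : X -> \bar R) : (forall x, D x -> 0 <= f x)%E ->
 (forall x, D x -> f x <= g x)%E -> (\int[nu]_(x in D) f x <= \int[nu]_(x in D) g x)%E.
Proof.
move=> f0 fg; have g0 x : D x -> (0 <= g x)%E by move=> Dx; apply: le_trans (f0 x Dx) (fg x Dx).
rewrite (ge0_integralE _ f0) (ge0_integralE _ g0); apply: ereal_sup_le => _ [h hf <-].
exists h => // x; apply: le_trans (hf x) _; rewrite !patchE.
by case: ifPn => // /set_mem; exact: fg.
Qed.

(* f will be the metric speed, whose measurability is not known *)
Lemma ae_integral_any (D : set X) (f g : X -> \bar R) (Nn : set X) : measurable D -> measurable Nn -> nu Nn = 0%E ->
 measurable_fun D g -> (forall x, D x -> 0 <= f x)%E -> (forall x, D x -> 0 <= g x)%E ->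
 (forall x, D x -> ~ Nn x -> f x = g x) -> (\int[nu]_(x in D) f x = \int[nu]_(x in D) g x)%E.
Proof.
move=> mD mN N0 mg f0 g0 fg.
(* [f] is squeezed between the measurable functions [g1] and [g2], equal to 0 and to infinity on the
   null set and to [g] elsewhere. *)
pose g1 := g \_ (~` Nn); pose g2 x := if x \in Nn then +oo%E else g x.
have mNC : measurable (~` Nn) by exact: measurableC.
have mN' : measurable_fun D (fun x => x \in Nn).
 have E : (fun x => x \in Nn) @^-1` [set true] = Nn by apply/seteqP; split => x /=; [move/set_mem|move/mem_set].
 by apply: measurable_funTS; apply: (measurable_fun_bool true); rewrite ?setTI E.
have mg1 : measurable_fun D g1.
 rewrite (_ : g1 = fun x => if x \in Nn then 0%E else g x); last first.
  by apply/funext => x; rewrite /g1 patchE in_setC; case: (x \in Nn).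
 apply: measurable_fun_if => //; exact: measurable_funS mg.
have mg2 : measurable_fun D g2.
 by apply: measurable_fun_if => //; exact: measurable_funS mg.
have aeq (h : X -> \bar R) : measurable_fun D h -> (forall x, D x -> 0 <= h x)%E -> (forall x, ~ Nn x -> h x = g x) ->
  (\int[nu]_(x in D) h x = \int[nu]_(x in D) g x)%E.
 move=> mh h0 hg; apply: ge0_ae_eq_integral => //.
 by exists Nn; split => // x /= nx; apply: contrapT => nN; apply: nx => _; exact: hg.
apply/eqP; rewrite eq_le; apply/andP; split.
 rewrite -(aeq g2)//.
 - apply: le_integral_any => // x Dx; rewrite /g2; case: ifPn => [_|/negP nx]; first exact: leey.
  by rewrite fg// => Nx; apply: nx; exact: mem_set.
 - by move=> x Dx; rewrite /g2; case: ifPn => // _; exact: g0.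
 - by move=> x nx; rewrite /g2 memNset.
rewrite -(aeq g1)//.
- apply: le_integral_any => x Dx; rewrite /g1 patchE in_setC; case: ifPn => //= /negP nx; try exact: g0; try exact: f0.
 by rewrite fg// => Nx; apply: nx; exact: mem_set.
- by move=> x Dx; rewrite /g1 patchE; case: ifPn => // _; exact: g0.
- by move=> x nx; rewrite /g1 patchE in_setC memNset.
Qed.

End NonMeasurable.

Section PushForward.
Context d1 d2 (X : measurableType d1) (Y : measurableType d2).
Variables (phi : X -> Y) (mphi : meas phi) (nu : {measure set X -> \bar R}).

Lemma pushforward_exists : exists k : {measure set Y -> \bar R}, (forall A, k A = nu (phi @^-1` A)) /\
 forall D (f : Y -> \bar R), measurable D -> measurable_fun D f -> (forall y, 0 <= f y)%E ->
  (\int[k]_(y in D) f y = \int[nu]_(x in phi @^-1` D) f (phi x))%E.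
Proof.
unshelve refine (ex_intro _ (pushforward nu phi : {measure set Y -> \bar R}) _); first exact: mphi.
split => [//|D f mD mf f0].
by apply: (ge0_integral_pushforward mphi) => // y _.
Qed.

End PushForward.

Section AffineChange.
Notation mu := (@lebesgue_measure R).
Notation T := (measurableTypeR R).

(** The image of Lebesgue measure under the affine map, scaled by [|al|], has the right value on
    half-open intervals for either sign of [al]; uniqueness of Lebesgue measure does the rest. *)
Lemma affine_integral (al be : R) (f : R -> \bar R) (D : set R) : al != 0 -> measurable D ->
 meas f -> (forall x, 0 <= f x)%E ->
 (\int[mu]_(x in D) f x = `|al|%:E * \int[mu]_(x in (fun x : R => (al * x + be)%R) @^-1` D) f (al * x + be)%R)%E.
Proof.
move=> al0 mD mf f0; pose phi (x : T) : T := al * x + be.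
have mphi : meas phi.
 by apply: measurable_funD => //; exact: measurable_funM.
have aal : 0 < `|al| by rewrite normr_gt0.
pose k : {nonneg R} := NngNum (ltW aal).
have [pk [pkE pkI]] := pushforward_exists mphi mu.
have mm : forall A : set T, measurable A -> mu A = mscale k pk A.
 have E A : mscale k pk A = (`|al|%:E * mu (phi @^-1` A))%E by rewrite -pkE.
 apply: lebesgue_measure_unique => _ [[a b] _ <-]; apply: etrans (esym (E _)).
 have [ab|ba] := leP a b; last first.
  by rewrite set_itv_ge ?preimage_set0 ?measure0 ?mule0// bnd_simp -leNgt ltW.
 have [alp|aln] := ltP 0 al.
  have -> : phi @^-1` `]a, b] = `](a - be) / al, (b - be) / al]%classic.
   apply/seteqP; split => x /=; rewrite /phi !in_itv/= ltr_pdivrMr// ler_pdivlMr// ltrBlDr lerBrDr mulrC//.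
  rewrite !lebesgue_measure_itv/= !lte_fin ltr_pM2r ?invr_gt0// ltrD2r.
  case: ifP => _; last by rewrite mule0.
  by rewrite -!EFinB -EFinM (gtr0_norm alp); congr (_%:E); field; rewrite gt_eqF.
 have aln' : al < 0 by rewrite lt_neqAle al0.
 have -> : phi @^-1` `]a, b] = `[(b - be) / al, (a - be) / al[%classic.
  apply/seteqP; split => x /=; rewrite /phi !in_itv/= ltr_ndivlMr// ler_ndivrMr// ltrBlDr lerBrDr mulrC => /andP[h1 h2]; by apply/andP.
 rewrite !lebesgue_measure_itv/= !lte_fin ltr_nM2r ?invr_lt0// ltrD2r.
 case: ifP => _; last by rewrite mule0.
 by rewrite -!EFinB -EFinM (ltr0_norm aln'); congr (_%:E); field; rewrite lt_eqF.
have mfD : measurable_fun D f by apply: measurable_funS mf.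
rewrite (eq_measure_integral (mscale k pk)); last by move=> A mA _; exact: mm.
rewrite ge0_integral_mscale//; congr (_ * _)%E.
by rewrite pkI.
Qed.

End AffineChange.

Section Projective.
Context {m d : nat}.
Implicit Types p : Hpoly m.+1 d.

Lemma hprop_refl p : hprop R p p.
Proof. by exists 1; split; [exact: oner_neq0|move=> a _; rewrite mul1r]. Qed.

Lemma hprop_sym p p' : hprop R p p' -> hprop R p' p.
Proof.
move=> [c [c0 h]]; exists c^-1; split; first by rewrite invr_eq0.
by move=> a da; rewrite h// mulKf.
Qed.

Lemma mult_hprop p p' L z : hprop R p p' -> mult R p L z = mult R p' L z.
Proof.
move=> [c [c0 h]]; rewrite /mult /=.
set g := heval _ _ p _; set g' := heval _ _ p' _.
have -> : g' = c%:P * g.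
 rewrite /g /g' /heval mulr_sumr; apply: eq_bigr => a /eqP da.
 by rewrite h// polyCM mulrA.
by rewrite mul_polyC scaler_eq0 (negbTE c0)/= mupZ0.
Qed.

Lemma muP_hprop (vol : probability (Grm m) R) p p' : hprop R p p' -> muP vol p = muP vol p'.
Proof.
move=> h; apply/funext => A; rewrite /muP.
have E : (fun L => (lineCount R p L A)%:E) = (fun L => (lineCount R p' L A)%:E).
 apply/funext => L; rewrite /lineCount; congr (_%:E).
 by apply: eq_fsbigr => z _; rewrite (mult_hprop _ _ h).
by rewrite E.
Qed.

End Projective.

Section AffineItv.
Notation mu := (@lebesgue_measure R).

Lemma affine_itv (al be s t : R) (f : R -> R) : al != 0 -> meas f -> (forall x, 0 <= f x) ->
 (\int[mu]_(x in `[Num.min (al * s + be)%R (al * t + be)%R, Num.max (al * s + be)%R (al * t + be)%R]) (f x)%:E =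
  \int[mu]_(x in `[Num.min s t, Num.max s t]) (`|al| * f (al * x + be))%:E)%E.
Proof.
move=> al0 mf f0; have mF : meas (EFin \o f) by apply/measurable_EFinP.
have maf : meas (fun x : R => al * x + be).
 by apply: measurable_funD => //; apply: measurable_funM.
rewrite (@affine_integral al be (EFin \o f) _ al0 (measurable_itv _) mF (fun x => f0 x)).
have -> : (fun x : R => al * x + be) @^-1` `[Num.min (al * s + be) (al * t + be), Num.max (al * s + be) (al * t + be)]%classic =
  `[Num.min s t, Num.max s t]%classic.
 apply/seteqP; split => x /=; rewrite !in_itv/= !ge_min !le_max !lerD2r;
 have [a0|a0|a0] := ltgtP al 0; rewrite ?(ler_nM2l a0) ?(ler_pM2l a0)//; move: al0; rewrite ?a0 ?eqxx// => _;
 by move=> /andP[/orP[->|->] /orP[->|->]]; rewrite ?orbT.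
rewrite -ge0_integralZl//; last 2 first.
- by apply: mEFin; exact: (measurableT_comp mf maf).
- by move=> x _; rewrite lee_fin.
Qed.

Lemma affine_itv_pos (al be s t : R) (f : R -> R) : 0 < al -> s <= t -> meas f -> (forall x, 0 <= f x) ->
 (\int[mu]_(x in `[(al * s + be)%R, (al * t + be)%R]) (f x)%:E = \int[mu]_(x in `[s, t]) (al * f (al * x + be))%:E)%E.
Proof.
move=> a0 st mf f0; have h : al * s + be <= al * t + be by rewrite lerD2r ler_pM2l.
have := affine_itv be s t (lt0r_neq0 a0) mf f0.
by rewrite (min_l h) (max_r h) (min_l st) (max_r st) (gtr0_norm a0).
Qed.

Lemma flip_itv (s t : R) (f : R -> R) : s <= t -> meas f -> (forall x, 0 <= f x) ->
 (\int[mu]_(x in `[(1 - t)%R, (1 - s)%R]) (f x)%:E = \int[mu]_(x in `[s, t]) (f (1 - x))%:E)%E.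
Proof.
move=> st mf f0; have h : 1 - t <= 1 - s by rewrite lerD2l lerN2.
have := @affine_itv (-1) 1 s t f; rewrite oppr_eq0 oner_eq0 => /(_ isT mf f0).
rewrite !mulN1r !(addrC _ 1) (min_r h) (max_l h) (min_l st) (max_r st) => ->.
by apply: eq_integral => x _; rewrite normrN1 mul1r mulN1r (addrC _ 1).
Qed.

Lemma le_all_gt (x y : \bar R) : (0 <= y)%E -> (forall r : R, 0 < r -> (y < r%:E)%E -> (x <= r%:E)%E) -> (x <= y)%E.
Proof.
case: y => [y| |] //= y0 h; last by rewrite leey.
apply/lee_addgt0Pr => e e0; rewrite -EFinD; apply: h; last by rewrite lte_fin ltrDl.
by rewrite ltr_wpDl// -lee_fin.
Qed.

End AffineItv.

(** * The inner distance *)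

Section Action.
Context {m d : nat}.
Notation mu := (@lebesgue_measure R).
Notation hp := (Hpoly m.+1 d).
Variables (vol : probability (Grm m) R) (inv : Gr_invariant R m vol) (d0 : (0 < d)%N).
Variables (q : R) (q1 : 1 <= q).
Implicit Types (p : hp) (f : R -> R) (g : R -> hp).

Let q0 : 0 < q. Proof. exact: lt_le_trans q1. Qed.

Definition wq p p' : \bar R := Wq R q (muP vol p) (muP vol p').

Lemma muP_is_prob p : hnonzero p -> exists P : probability (CPm m.+1) R, forall A, measurable A -> muP vol p A = P A.
Proof. by move=> hp0; apply: (muP_prob d0); exact: (aenondegP inv). Qed.

Lemma wq_ge0 p p' : (0 <= wq p p')%E. Proof. exact: Wq_ge0. Qed.

Lemma wq_fin p p' : hnonzero p -> hnonzero p' -> wq p p' \is a fin_num.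
Proof.
move=> /muP_is_prob[P hP] /muP_is_prob[P' hP'].
by rewrite /wq (Wq_ext q hP hP'); exact: Wq_fin.
Qed.

Lemma wq_refl p : hnonzero p -> wq p p = 0%E.
Proof. by move=> /muP_is_prob[P hP]; rewrite /wq (Wq_ext q hP hP); exact: Wq_refl. Qed.

Lemma wq_sym p p' : wq p p' = wq p' p. Proof. exact: Wq_sym. Qed.

Lemma wq_tri p1 p2 p3 : hnonzero p1 -> hnonzero p2 -> hnonzero p3 -> (wq p1 p3 <= wq p1 p2 + wq p2 p3)%E.
Proof.
move=> /muP_is_prob[P1 h1] /muP_is_prob[P2 h2] /muP_is_prob[P3 h3].
apply: le_trans (eqle (Wq_ext q h1 h3)) _; apply: le_trans (Wq_tri q1 P1 P2 P3) _.
by apply: leeD; apply: eqle; apply/esym; exact: Wq_ext.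
Qed.

(* curves of finite q-energy, with an upper bound f for their metric speed *)
Definition mpath (p0 p1 : hp) (g : R -> hp) (f : R -> R) := [/\ hprop R (g 0) p0 /\ hprop R (g 1) p1,
 forall t, 0 <= t <= 1 -> hnonzero (g t), meas f /\ forall t, 0 <= f t,
 (\int[mu]_(t in I01) (f t `^ q)%:E < +oo)%E &
 forall s t, 0 <= s -> s <= t -> t <= 1 -> (wq (g s) (g t) <= \int[mu]_(x in `[s, t]) (f x)%:E)%E].

(** Curves are extended by constants beyond [[0, 1]], because [metric_derivative] deals with a
    distance between all pairs of real times. *)
Definition clamp (t : R) : R := Num.max 0 (Num.min t 1).

Lemma clamp_itv t : 0 <= clamp t <= 1.
Proof. by rewrite /clamp le_max lexx/= ge_max ler01 ge_min lexx orbT. Qed.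

Lemma clamp_id t : 0 <= t <= 1 -> clamp t = t.
Proof. by move=> /andP[t0 t1]; rewrite /clamp (min_l t1) (max_r t0). Qed.

Lemma clamp_le s t : s <= t -> clamp s <= clamp t.
Proof.
move=> st; rewrite /clamp ge_max le_max lexx/= le_max; apply/orP; right.
by rewrite le_min !ge_min st lexx !orbT.
Qed.

Lemma measurable_powRq_fun f (D : set R) : meas f -> measurable_fun D (fun t => (f t `^ q)%:E).
Proof. by move=> mf; apply: mEFin; exact: (mpow mf). Qed.

Lemma mpath_L1 f : meas f -> (forall t, 0 <= f t) ->
 (\int[mu]_(t in I01) (f t `^ q)%:E < +oo)%E -> L1 (f \_ `[0%R, 1%R]).
Proof.
move=> mf f0 fq; have m01 : measurable (I01 : set R) by exact: measurable_itv.
have : mu.-integrable I01 (EFin \o f).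
 apply/integrableP; split; first by apply: mEFin.
 under eq_integral do rewrite /= (ger0_norm (f0 _)).
 apply: (@le_lt_trans _ _ (\int[mu]_(x in I01) (1%:E + (f x `^ q)%:E))%E).
  apply: ge0_le_integral => //.
  - by move=> x _; rewrite lee_fin.
  - by apply: mEFin.
  - by apply: emeasurable_funD => //; exact: measurable_powRq_fun.
  move=> x _; rewrite -EFinD lee_fin.
  have [f1|/ltW f1] := leP 1 (f x); last by rewrite ler_wpDr// powR_ge0.
  by rewrite ler_wpDl// -[leLHS](powRr1 (f0 x)) ler_powR.
 rewrite ge0_integralD//; first last.
 - exact: measurable_powRq_fun.
 - by move=> *; exact: EpowR_ge0.
 by rewrite lte_add_pinfty// integral_cst//= lebesgue_measure_itv/= lte_fin ltr01 -EFinB subr0 mule1 ltry.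
by move=> h; rewrite /L1 -restrict_EFin; apply/integrable_restrict => //; rewrite setTI.
Qed.

Lemma prim_clamp f s t : meas f -> (forall t, 0 <= f t) -> L1 (f \_ `[0%R, 1%R]) -> s <= t ->
 (\int[mu]_(x in `[clamp s, clamp t]) (f x)%:E <= (prim (f \_ `[0%R, 1%R]) t - prim (f \_ `[0%R, 1%R]) s)%:E)%E.
Proof.
move=> mf f0 If st; rewrite primB// /Rintegral fineK; last first.
 by apply: integrable_fin_num => //; exact: L1S.
have mE (D : set R) (h : R -> R) : meas h -> measurable_fun D (EFin \o h).
 by move=> mh; apply: mEFin.
have r0 x : 0 <= (f \_ `[0%R, 1%R]) x by rewrite patchE; case: ifPn.
have mr : meas (f \_ `[0%R, 1%R]).
 by apply/(measurable_restrictT _ _).1 => //; exact: measurable_funTS.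
rewrite -(@integral_itv_obnd_cbnd _ (clamp s) (BRight (clamp t)) (EFin \o f)); last exact: mE.
apply: (@le_trans _ _ (\int[mu]_(x in `]clamp s, clamp t]) ((f \_ `[0%R, 1%R]) x)%:E)%E).
 apply: eqle; apply: eq_integral => x; rewrite inE/= in_itv/= => /andP[h1 h2]; rewrite patchE mem_set//= in_itv/=.
 have /andP[a1 _] := clamp_itv s; have /andP[_ a2] := clamp_itv t.
 by rewrite (le_trans a1 (ltW h1)) (le_trans h2 a2).
apply: ge0_subset_integral => //; [exact: mE|by move=> x _; rewrite lee_fin|].
move=> x /=; rewrite !in_itv/= => /andP[h1 h2].
have s0 : 0 <= clamp s by have /andP[] := clamp_itv s.
have t1 : clamp t <= 1 by have /andP[] := clamp_itv t.
have x0 : 0 < x by apply: le_lt_trans h1.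
have x1 : x <= 1 by apply: le_trans t1.
apply/andP; split.
- rewrite ltNge; apply/negP => xs; have := clamp_le xs.
 by rewrite (clamp_id (t := x)) ?(ltW x0) ?x1// leNgt h1.
- rewrite leNgt; apply/negP => tx; have := clamp_le (ltW tx); rewrite (clamp_id (t := x)) ?(ltW x0) ?x1// => ctx.
 have E : clamp t = x by apply/eqP; rewrite eq_le ctx.
 move: tx x0 x1; rewrite -E /clamp; case: (leP t 1) => [t1'|t1'].
  by rewrite lt_max ltxx orbF => t_0; rewrite lt_max ltxx/= => t0; move: (lt_trans t_0 t0); rewrite ltxx.
 by rewrite (max_r ler01) => h _ _; move: (lt_trans h t1'); rewrite ltxx.
Qed.

(** [action] integrates the limit [speed], which agrees almost everywhere on [[0, 1]] with the
    measurable metric derivative. The latter is again a bound for the curve and lies below [f]. So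
    [Win] can be handled as an infimum over pairs of a curve and a bound. *)
Theorem action_mpath p0 p1 g f : mpath p0 p1 g f -> exists f' : R -> R,
 [/\ mpath p0 p1 g f', forall t, 0 <= t <= 1 -> f' t <= f t &
  action R q (fun t => muP vol (g t)) = (\int[mu]_(t in I01) (f' t `^ q)%:E)%E].
Proof.
move=> [gp gn [mf f0] fq fW]; have If := mpath_L1 mf f0 fq.
pose W s t := fine (wq (g (clamp s)) (g (clamp t))).
have hn t : hnonzero (g (clamp t)) by apply: gn; exact: clamp_itv.
have WE s t : (W s t)%:E = wq (g (clamp s)) (g (clamp t)) by rewrite fineK// wq_fin.
have WF s t : W s t = fine (wq (g (clamp s)) (g (clamp t))) by [].
clearbody W.
have W0 s t : 0 <= W s t by rewrite WF fine_ge0// wq_ge0.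
have Ws s t : W s t = W t s by rewrite !WF wq_sym.
have Wt s t u : W s u <= W s t + W t u.
 by have := wq_tri (hn s) (hn t) (hn u); rewrite -(WE s u) -(WE s t) -(WE t u) -EFinD lee_fin.
have Wm s t : s <= t -> W s t <= prim (f \_ `[0%R, 1%R]) t - prim (f \_ `[0%R, 1%R]) s.
 move=> st; rewrite -lee_fin WE; apply: le_trans (prim_clamp mf f0 If st).
 have /andP[a1 _] := clamp_itv s; have /andP[_ a2] := clamp_itv t.
 by apply: fW => //; exact: clamp_le.
have r0 x : 0 <= (f \_ `[0%R, 1%R]) x by rewrite patchE; case: ifPn.
have [md [Imd md0 mdf Wmd [Nn [mN N0] hN]]] := metric_derivative Ws Wt If r0 Wm.
have mmd : meas md by have /integrableP[/measurable_EFinP] := Imd.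
have mdf' t : 0 <= t <= 1 -> md t <= f t.
 by move=> t01; apply: le_trans (mdf t) _; rewrite patchE; case: ifPn.
exists md; split; [|exact: mdf'|].
 split; [exact: gp|exact: gn|by []| |].
 - apply: le_lt_trans fq; apply: ge0_le_integral => //.
  + by move=> *; exact: EpowR_ge0.
  + exact: measurable_powRq_fun.
  + exact: measurable_powRq_fun.
  + move=> x /=; rewrite in_itv/= => x01; rewrite lee_fin ge0_ler_powR ?nnegrE ?(ltW q0)//.
   exact: mdf'.
 - move=> s t s0 st t1; have := Wmd s t st; rewrite -lee_fin WE.
  rewrite (clamp_id (t := s)) ?s0 ?(le_trans st t1)// (clamp_id (t := t)) ?t1 ?(le_trans s0 st)//.
  move=> h; apply: le_trans h _; rewrite primB// /Rintegral fineK; last first.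
   by apply: integrable_fin_num => //; exact: L1S.
  by rewrite integral_itv_obnd_cbnd//; apply: mEFin.
rewrite /action; apply: (@ae_integral_any _ _ _ _ _ _ (Nn `|` [set 0; 1])) => //.
- by apply: measurableU => //; apply: measurableU; exact: measurable_set1.
- apply: (null_union _ _).2 => //; apply: null_union; split; try exact: measurable_set1; exact: lebesgue_measure_set1.
- exact: measurable_powRq_fun.
- by move=> *; exact: EpowR_ge0.
- by move=> *; exact: EpowR_ge0.
move=> t; rewrite /= in_itv/= => /andP[t0 t1] nt; congr ((_ `^ _)%:E).
have t0' : 0 < t by rewrite lt_def t0 andbT; apply/eqP => E; apply: nt; right; left.
have t1' : t < 1 by rewrite lt_def t1 andbT; apply/eqP => E; apply: nt; right; right.
have nN : ~ Nn t by move=> h; apply: nt; left.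
rewrite /speed; apply/cvg_lim => //.
apply/cvgrPdist_le => e e0; have [dl dl0 hdl] := hN t nN e e0.
exists (Num.min dl (Num.min t (1 - t))) => /=; first by rewrite !lt_min dl0 t0' subr_gt0.
move=> h; rewrite /ball_/= sub0r normrN !lt_min => /andP[h1 /andP[h2 h3]] h0.
have th : 0 <= t + h <= 1 by move: h2 h3; rewrite !ltr_norml => /andP[a1 a2] /andP[a3 a4]; apply/andP; split; lra.
have := hdl h h0 h1; rewrite distrC WF (clamp_id th) (clamp_id (t := t)) ?t0 ?t1//.
Qed.

Notation Win := (Win R vol q).

Lemma mpath_adm p0 p1 g f : mpath p0 p1 g f -> admissible R vol q p0 p1 g.
Proof.
move=> [[g0 g1] gn [mf f0] fq fW]; do 3 (split; first by []).
exists f; split; [exact: measurable_funTS|split; last exact: fW].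
by under eq_integral do rewrite (ger0_norm (f0 _)).
Qed.

Lemma adm_mpath p0 p1 g : admissible R vol q p0 p1 g -> exists f, mpath p0 p1 g f.
Proof.
move=> [g0 [g1 [gn [f [mf [fq fW]]]]]].
have m01 : measurable (I01 : set R) by exact: measurable_itv.
have mnf : measurable_fun (I01 : set R) (fun t => `|f t|) by exact: measurableT_comp.
exists ((fun t => `|f t|) \_ `[0%R, 1%R]); split; [by []|by []| | |].
- split; first by apply/(measurable_restrictT _ _).1.
 by move=> t; rewrite patchE; case: ifPn.
- apply: le_lt_trans fq; apply: eqle; apply: eq_integral => t t01.
 by rewrite patchE t01.
move=> s t s0 st t1; apply: le_trans (fW s t s0 st t1) _.
have sub : `[s, t]%classic `<=` (I01 : set R).
 by move=> x /=; rewrite !in_itv/= => /andP[h1 h2]; rewrite (le_trans s0 h1) (le_trans h2 t1).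
have mst : measurable (`[s, t]%classic : set R) by exact: measurable_itv.
rewrite (_ : (\int[mu]_(x in `[s, t]) (((fun t => `|f t|) \_ `[0%R, 1%R]) x)%:E)%E = (\int[mu]_(x in `[s, t]) `|(f x)%:E|)%E).
 have mst' : measurable_fun (`[s, t]%classic : set R) (EFin \o f).
  by apply/measurable_EFinP; exact: measurable_funS mf.
 by apply: le_trans (le_abse_integral mu mst mst'); exact: lee_abs.
apply: eq_integral => x xst; rewrite patchE mem_set//; apply: sub; by rewrite inE in xst.
Qed.

Lemma action_ge0 (mt : R -> set (CPm m.+1) -> \bar R) : (0 <= action R q mt)%E.
Proof. by apply: integral_ge0 => t _; exact: EpowR_ge0. Qed.

Lemma Win_ge0 p0 p1 : (0 <= Win p0 p1)%E. Proof. exact: poweR_ge0. Qed.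

Lemma Win_le p0 p1 g f r : mpath p0 p1 g f -> 0 <= r ->
 (\int[mu]_(t in I01) (f t `^ q)%:E <= (r `^ q)%:E)%E -> (Win p0 p1 <= r%:E)%E.
Proof.
move=> gf r0 fr; have [f' [gf' ff' E]] := action_mpath gf.
have [_ _ [mf f0] _ _] := gf; have [_ _ [mf' f0'] _ _] := gf'.
apply: (@root_inf_le q q0 _ _ (action R q (fun t => muP vol (g t)))); last first.
- rewrite E; apply: le_trans fr; apply: ge0_le_integral; first exact: measurable_itv.
 + by move=> *; exact: EpowR_ge0.
 + exact: measurable_powRq_fun.
 + exact: measurable_powRq_fun.
 move=> x /=; rewrite in_itv/= => x01; rewrite lee_fin ge0_ler_powR ?nnegrE ?(ltW q0)//.
 exact: ff'.
- exact: r0.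
- by exists g; [exact: mpath_adm gf|].
- by move=> s [g' _ <-]; exact: action_ge0.
Qed.

Lemma Win_lt p0 p1 r : (Win p0 p1 < r%:E)%E -> exists g f, mpath p0 p1 g f /\
 (\int[mu]_(t in I01) (f t `^ q)%:E < (r `^ q)%:E)%E.
Proof.
move=> /(@root_inf_lt q q0)[|s [g gadm <-] sr]; first by move=> s [g' _ <-]; exact: action_ge0.
have [f gf] := adm_mpath gadm; have [f' [gf' _ E]] := action_mpath gf.
by exists g, f'; split; [exact: gf'|rewrite -E; exact: sr].
Qed.

Lemma Win_hprop0 p0 p1 : hnonzero p0 -> hprop R p0 p1 -> Win p0 p1 = 0%E.
Proof.
move=> p00 p01; apply/eqP; rewrite eq_le Win_ge0 andbT.
have z : (\int[mu]_(t in I01) (cst 0 t `^ q)%:E = 0 :> \bar R)%E.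
 by rewrite integral0_eq// => x _; rewrite powR0// gt_eqF.
apply: (@Win_le _ _ (fun _ => p0) (cst 0)) => //; last by rewrite z lee_fin powR_ge0.
split => //; [by split; [exact: hprop_refl|]|by rewrite z ltry|].
by move=> s t _ _ _; rewrite wq_refl// integral_ge0.
Qed.

(** [wq p0 p1] is at most the integral of the bound [f], hence by Jensen on [[0, 1]] at most the
    [q]-th root of its energy. *)
Lemma Win0_wq0 p0 p1 : hnonzero p0 -> hnonzero p1 -> Win p0 p1 = 0%E -> wq p0 p1 = 0%E.
Proof.
move=> p00 p10 W0; apply/eqP; rewrite eq_le wq_ge0 andbT.
apply: le_all_gt => // r r0 _; have : (Win p0 p1 < r%:E)%E by rewrite W0 lte_fin.
move=> /Win_lt[g [f [[[g0 g1] gn [mf f0] fq fW] fr]]].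
have E : wq p0 p1 = wq (g 0) (g 1) by rewrite /wq (muP_hprop vol g0) (muP_hprop vol g1).
rewrite E; apply: le_trans (fW 0 1 (lexx 0) ler01 (lexx 1)) _.
clear W0 fW E p00 p10; have If : (\int[mu]_(x in I01) (f x)%:E)%E \is a fin_num.
 have h : (0 <= \int[mu]_(x in I01) (f x)%:E)%E by apply: integral_ge0 => x _; rewrite lee_fin.
 rewrite (ge0_fin_numE h).
 have := mpath_L1 mf f0 fq; rewrite /L1 -restrict_EFin => /integrable_restrict.
 rewrite setTI => /(_ (measurable_itv _) measurableT) /integrableP[_].
 by under eq_integral do rewrite /= (ger0_norm (f0 _)).
have m1 : (\int[mu]_(x in I01) (cst 1 x)%:E = 1 :> \bar R)%E.
 transitivity (1%:E * mu `[0%R, 1%R])%E; first exact: (@integral_cst _ _ _ mu _ (measurable_itv _) 1).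
 by rewrite mul1e lebesgue_measure_itv/= lte_fin ltr01 -EFinB subr0.
have := @weighted_jensen q q1 _ _ mu `[0%R, 1%R] (measurable_itv _) f (cst 1) mf _ f0 (fun _ => ltr01) If.
rewrite m1 /= => /(_ (measurable_cst _) isT ltr01).
rewrite powR1 mulr1 => h.
have : ((fine (\int[mu]_(x in I01) (f x)%:E) `^ q)%:E <= (r `^ q)%:E)%E.
 apply: le_trans h _; apply: le_trans (ltW fr); apply: eqle; apply: eq_integral => x _.
 by rewrite mulr1.
rewrite lee_fin => h2; rewrite -(fineK If) lee_fin leNgt; apply/negP => h3.
have : r `^ q < fine (\int[mu]_(x in I01) (f x)%:E) `^ q.
 by apply: gt0_ltr_powR => //; rewrite nnegrE ?(ltW r0)// (le_trans (ltW r0) (ltW h3)).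
by rewrite ltNge h2.
Qed.

Lemma mpath_flip p0 p1 g f : mpath p0 p1 g f -> mpath p1 p0 (fun t => g (1 - t)) (fun t => f (1 - t)).
Proof.
move=> [[g0 g1] gn [mf f0] fq fW]; have mfl : meas (fun t : R => 1 - t) by exact: measurable_funB.
split.
- by rewrite subr0 subrr.
- by move=> t /andP[t0 t1]; apply: gn; rewrite subr_ge0 t1 gerBl.
- by split => //; exact: (measurableT_comp mf mfl).
- have := @flip_itv 0 1 (fun t => f t `^ q) ler01; rewrite subrr subr0 => <- //; last by move=> x; exact: powR_ge0.
 exact: (mpow mf).
move=> s t s0 st t1; rewrite wq_sym -(flip_itv st mf f0); apply: fW.
- by rewrite subr_ge0.
- by rewrite lerD2l lerN2.
- by rewrite gerBl.
Qed.

Lemma Win_sym_le p0 p1 : (Win p0 p1 <= Win p1 p0)%E.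
Proof.
apply: le_all_gt; first exact: Win_ge0.
move=> r r0 /Win_lt[g [f [gf fr]]]; apply: (Win_le (mpath_flip gf) (ltW r0)).
have [_ _ [mf f0] _ _] := gf.
have := @flip_itv 0 1 (fun t => f t `^ q) ler01; rewrite subrr subr0 => <-.
- exact: ltW.
- exact: (mpow mf).
- by move=> x; exact: powR_ge0.
Qed.

Lemma Win_sym p0 p1 : Win p0 p1 = Win p1 p0.
Proof. by apply/eqP; rewrite eq_le !Win_sym_le. Qed.

Section Concat.
Variables (p0 p1 p2 : hp) (g1 g2 : R -> hp) (f1 f2 : R -> R).
Variables (m1 : mpath p0 p1 g1 f1) (m2 : mpath p1 p2 g2 f2) (l : R) (l0 : 0 < l) (l1 : l < 1).

Let k : R := (1 - l)^-1.
Let k0 : 0 < k. Proof. by rewrite invr_gt0 subr_gt0. Qed.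
(** Concatenation at time [l]. The term [+ 0] keeps both halves in the affine form of
    [affine_itv_pos]. *)
Definition cgu t := if t <= l then g1 (l^-1 * t + 0) else g2 (k * t + (- (k * l))).
Definition cfu t := if t <= l then l^-1 * f1 (l^-1 * t + 0) else k * f2 (k * t + (- (k * l))).

Let kE : k + (- (k * l)) = 1. Proof. by rewrite -[X in X + _]mulr1 -mulrBr mulVf// subr_eq0 gt_eqF. Qed.

Lemma left01 t : 0 <= t -> t <= l -> 0 <= l^-1 * t + 0 <= 1.
Proof. by move=> t0 tl; rewrite addr0 mulr_ge0 ?invr_ge0 ?(ltW l0)//= mulrC ler_pdivrMr// mul1r. Qed.

Lemma right01 t : l < t -> t <= 1 -> 0 <= k * t + (- (k * l)) <= 1.
Proof. by move=> lt t1; rewrite subr_ge0 ler_pM2l// (ltW lt)/= -[leRHS]kE lerD2r -[leRHS]mulr1 ler_pM2l. Qed.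

Let one01 : 0 <= (1%R : R) <= 1. Proof. by rewrite ler01 lexx. Qed.

Lemma measurable_cfu : meas cfu.
Proof.
have [_ _ [mf1 _] _ _] := m1; have [_ _ [mf2 _] _ _] := m2.
apply: measurable_fun_ifT; first by apply: measurable_fun_ler.
- by apply: measurable_funM => //; apply: (measurableT_comp mf1); apply: measurable_funD => //; exact: measurable_funM.
- by apply: measurable_funM => //; apply: (measurableT_comp mf2); apply: measurable_funD => //; exact: measurable_funM.
Qed.

Lemma cfu_ge0 t : 0 <= cfu t.
Proof.
have [_ _ [_ f10] _ _] := m1; have [_ _ [_ f20] _ _] := m2.
by rewrite /cfu; case: ifP => _; apply: mulr_ge0; rewrite ?f10 ?f20 ?(ltW k0) ?invr_ge0 ?(ltW l0).
Qed.

Lemma cfu_left (h : R -> R) s t : 0 <= s -> s <= t -> t <= l ->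
 (\int[mu]_(x in `[s, t]) (h (cfu x))%:E = \int[mu]_(x in `[s, t]) (h (l^-1 * f1 (l^-1 * x + 0)))%:E)%E.
Proof.
move=> s0 st tl; apply: eq_integral => x; rewrite inE/= in_itv/= => /andP[_ xt].
by rewrite /cfu (le_trans xt tl).
Qed.

Lemma cfu_right (h : R -> R) s t : meas h -> l <= s -> s <= t ->
 (\int[mu]_(x in `[s, t]) (h (cfu x))%:E = \int[mu]_(x in `[s, t]) (h (k * f2 (k * x + (- (k * l)))))%:E)%E.
Proof.
move=> mh ls st; have [_ _ [mf2 _] _ _] := m2.
rewrite -[LHS]integral_itv_obnd_cbnd; last first.
 by apply: mEFin; exact: (measurableT_comp mh measurable_cfu).
rewrite -[RHS]integral_itv_obnd_cbnd; last first.
 apply: mEFin; apply: (measurableT_comp mh); apply: measurable_funM => //.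
 by apply: (measurableT_comp mf2); apply: measurable_funD => //; exact: measurable_funM.
apply: eq_integral => x; rewrite inE/= in_itv/= => /andP[sx _].
by rewrite /cfu leNgt (le_lt_trans ls sx).
Qed.

Lemma cint_left s t : 0 <= s -> s <= t -> t <= l ->
 (wq (g1 (l^-1 * s + 0)) (g1 (l^-1 * t + 0)) <= \int[mu]_(x in `[s, t]) (cfu x)%:E)%E.
Proof.
move=> s0 st tl; have [_ _ [mf1 f10] _ W1] := m1; have li : 0 < l^-1 by rewrite invr_gt0.
rewrite (cfu_left id s0 st tl) -(affine_itv_pos 0 li st mf1 f10); apply: W1.
- by rewrite addr0 mulr_ge0// ltW.
- by rewrite lerD2r ler_pM2l.
- by rewrite addr0 mulrC ler_pdivrMr// mul1r.
Qed.

Lemma cint_right s t : l <= s -> s <= t -> t <= 1 ->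
 (wq (g2 (k * s + (- (k * l)))) (g2 (k * t + (- (k * l)))) <= \int[mu]_(x in `[s, t]) (cfu x)%:E)%E.
Proof.
move=> ls st t1; have [_ _ [mf2 f20] _ W2] := m2.
rewrite (cfu_right (h := id) _ ls st)// -(affine_itv_pos _ k0 st mf2 f20); apply: W2.
- by rewrite subr_ge0 ler_pM2l.
- by rewrite lerD2r ler_pM2l.
- by rewrite -[leRHS]kE lerD2r -[leRHS]mulr1 ler_pM2l.
Qed.

(** A curve run in time [l] instead of 1 has its speed multiplied by [1 / l], hence its energy by
    [l^(1 - q)]. *)
Lemma cenergy : (\int[mu]_(t in I01) (cfu t `^ q)%:E =
 (l `^ (1 - q))%:E * \int[mu]_(t in I01) (f1 t `^ q)%:E +
 ((1 - l) `^ (1 - q))%:E * \int[mu]_(t in I01) (f2 t `^ q)%:E)%E.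
Proof.
have [_ _ [mf1 f10] _ _] := m1; have [_ _ [mf2 f20] _ _] := m2; have li : 0 < l^-1 by rewrite invr_gt0.
have mp (f : R -> R) : meas f -> meas (fun t : R => f t `^ q).
 by move=> mf; exact: (mpow mf).
rewrite (ge0_integral_itv_split (ltW l0) (ltW l1)); first last.
- by move=> *; exact: EpowR_ge0.
- by apply/measurable_EFinP; apply: mp; exact: measurable_cfu.
have -> := cfu_left (fun x => x `^ q) (lexx 0) (ltW l0) (lexx l).
have -> := cfu_right (measurable_powR q) (lexx l) (ltW l1).
congr (_ + _)%E.
- have := affine_itv_pos 0 li (ltW l0) (mp _ mf1) (fun x => powR_ge0 (f1 x) q).
 rewrite mulr0 !addr0 mulVf ?gt_eqF// => ->.
 rewrite -ge0_integralZl//; last 3 first.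
 + apply: mEFin; apply: measurable_funM => //; apply: (measurableT_comp (mp _ mf1)).
  by apply: measurable_funD => //; exact: measurable_funM.
 + by move=> x _; rewrite lee_fin mulr_ge0 ?(ltW li)// powR_ge0.
 + exact: EpowR_ge0.
 apply: eq_integral => x _; rewrite -EFinM; congr (_%:E).
 rewrite powRM ?(ltW li)// mulrA; congr (_ * _).
 rewrite -[l^-1 in LHS]powR_inv1 ?(ltW l0)// -[l^-1 in RHS]powR_inv1 ?(ltW l0)//.
 by rewrite -powRrM -powRD ?(gt_eqF l0) ?implybT//; congr (_ `^ _); lra.
- have l1' : 0 < 1 - l by rewrite subr_gt0.
 have := affine_itv_pos (- (k * l)) k0 (ltW l1) (mp _ mf2) (fun x => powR_ge0 (f2 x) q).
 rewrite mulr1 kE subrr => ->.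
 rewrite -ge0_integralZl//; last 3 first.
 + apply: mEFin; apply: measurable_funM => //; apply: (measurableT_comp (mp _ mf2)).
  by apply: measurable_funD => //; exact: measurable_funM.
 + by move=> x _; rewrite lee_fin mulr_ge0 ?(ltW k0)// powR_ge0.
 + exact: EpowR_ge0.
 apply: eq_integral => x _; rewrite -EFinM; congr (_%:E).
 rewrite powRM ?(ltW k0)// mulrA; congr (_ * _); rewrite /k.
 rewrite -[(1 - l)^-1 in LHS]powR_inv1 ?(ltW l1')// -[(1 - l)^-1 in RHS]powR_inv1 ?(ltW l1')//.
 by rewrite -powRrM -powRD ?(gt_eqF l1') ?implybT//; congr (_ `^ _); lra.
Qed.

Lemma mpath_concat : mpath p0 p2 cgu cfu.
Proof.
have [[g10 g11] gn1 [mf1 f10] fq1 W1] := m1; have [[g20 g21] gn2 [mf2 f20] fq2 W2] := m2.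
have li : 0 < l^-1 by rewrite invr_gt0.
split.
- by split; rewrite /cgu; [rewrite (ltW l0) mulr0 addr0|rewrite leNgt l1/= mulr1 kE].
- move=> t /andP[t0 t1]; rewrite /cgu; have [tl|tl] := leP t l; first exact: gn1 (left01 t0 tl).
 exact: gn2 (right01 tl t1).
- by split; [exact: measurable_cfu|exact: cfu_ge0].
- rewrite cenergy lte_add_pinfty// lte_mul_pinfty// ?lee_fin ?powR_ge0//.
move=> s t s0 st t1; rewrite /cgu; have [tl|tl] := leP t l; have [sl|sl] := leP s l.
- exact: cint_left.
- by exfalso; move: (lt_le_trans sl (le_trans st tl)); rewrite ltxx.
- have E : wq (g2 0) (g2 (k * t + (- (k * l)))) = wq (g1 1) (g2 (k * t + (- (k * l)))).
  by rewrite /wq (muP_hprop vol g20) (muP_hprop vol g11).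
 have TR := wq_tri (gn1 _ (left01 s0 sl)) (gn1 1 one01) (gn2 _ (right01 tl t1)).
 apply: (le_trans TR).
 rewrite (ge0_integral_itv_split sl (ltW tl)); first last.
 + by move=> x; rewrite lee_fin cfu_ge0.
 + by apply/measurable_EFinP; exact: measurable_cfu.
 apply: leeD.
 + by have := cint_left s0 sl (lexx l); rewrite addr0 (mulVf (lt0r_neq0 l0)) addr0.
 + by have := cint_right (lexx l) (ltW tl) t1; rewrite subrr E.
- exact: cint_right (ltW sl) st t1.
Qed.

End Concat.

(** Curves of energies below [a^q] and [b^q] are run in times proportional to [a] and [b]: with
    [l = a / (a + b)] the total is below [a (a + b)^(q - 1) + b (a + b)^(q - 1) = (a + b)^q]. *)
Lemma Win_tri p0 p1 p2 : (Win p0 p2 <= Win p0 p1 + Win p1 p2)%E.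
Proof.
have W1 := Win_ge0 p0 p1; have W2 := Win_ge0 p1 p2.
case E1 : (Win p0 p1) W1 => [w1| |] // W1; last by rewrite addye ?leey// gt_eqF// (lt_le_trans _ W2)// ltNye.
case E2 : (Win p1 p2) W2 => [w2| |] // W2; last by rewrite addey ?leey.
apply/lee_addgt0Pr => e e0; have e2 : 0 < e / 2 by rewrite divr_gt0.
pose a := w1 + e / 2; pose b := w2 + e / 2.
have a0 : 0 < a by rewrite /a ltr_wpDl// -lee_fin.
have b0 : 0 < b by rewrite /b ltr_wpDl// -lee_fin.
have -> : (w1%:E + w2%:E + e%:E = (a + b)%:E)%E by rewrite -!EFinD; congr (_%:E); rewrite /a /b; lra.
have /Win_lt[g1 [f1 [m1 h1]]] : (Win p0 p1 < a%:E)%E by rewrite E1 lte_fin ltrDl.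
have /Win_lt[g2 [f2 [m2 h2]]] : (Win p1 p2 < b%:E)%E by rewrite E2 lte_fin ltrDl.
have ab0 : 0 < a + b by rewrite addr_gt0.
have l0 : 0 < a / (a + b) by rewrite divr_gt0.
have l1 : a / (a + b) < 1 by rewrite ltr_pdivrMr// mul1r ltrDl.
apply: (Win_le (mpath_concat m1 m2 l0 l1) (ltW ab0)).
rewrite (cenergy m1 m2 l0 l1).
have X (c : R) (I : \bar R) : 0 < c -> (I < (c `^ q)%:E)%E -> (((c / (a + b)) `^ (1 - q))%:E * I <= (c * (a + b) `^ (q - 1))%:E)%E.
 move=> c0 hI; apply: le_trans (lee_wpmul2l _ (ltW hI)) _; first by exact: EpowR_ge0.
 rewrite -EFinM lee_fin powRM ?invr_ge0 ?(ltW c0) ?(ltW ab0)// mulrAC -powRD ?(gt_eqF c0) ?implybT//.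
 rewrite subrK powRr1 ?(ltW c0)// -powR_inv1 ?(ltW ab0)// -powRrM mulN1r opprB.
 by [].
have E : 1 - a / (a + b) = b / (a + b) by field; rewrite gt_eqF.
rewrite E; apply: le_trans (leeD (X a _ a0 h1) (X b _ b0 h2)) _.
rewrite -EFinD lee_fin -mulrDl -[X in X * _](powRr1 (ltW ab0)) -powRD ?(gt_eqF ab0) ?implybT//.
by rewrite (addrC 1) subrK.
Qed.

End Action.

(** * Forms as combinations of powers of linear forms *)

Section Multinomial.
Context {n d : nat}.
Implicit Types (a : mono n d) (f : {ffun 'I_d -> 'I_n.+1}).

(** [f] is a word of [d] variables and [occ f] the exponent vector of its product; counting words
    with a given [occ] makes [mnom] the multinomial coefficient. *)
Definition occ f : mono n d := [ffun i => inord #|[pred k | f k == i]|].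

Lemma occE f i : occ f i = #|[pred k | f k == i]| :> nat.
Proof. by rewrite ffunE inordK// ltnS -[leqRHS]card_ord max_card. Qed.

Lemma mdeg_occ f : mdeg (occ f) = d.
Proof.
rewrite /mdeg (eq_bigr (fun i => \sum_(k < d) (f k == i : nat))%N); last first.
 by move=> i _; rewrite occE -sum1_card big_mkcond/=; apply: eq_bigr => k _; rewrite unfold_in/=; case: eqP.
rewrite exchange_big/= (eq_bigr (fun _ => 1%N)) ?sum1_card ?card_ord// => k _.
by rewrite (bigD1 (f k))//= eqxx big1 ?addn0// => i; rewrite eq_sym => /negbTE ->.
Qed.

Definition mnom a : nat := #|[pred f | occ f == a]|.

Lemma multinomial (S : comNzRingType) (x : 'I_n.+1 -> S) :
 (\sum_i x i) ^+ d = \sum_(a : mono n d | mdeg a == d) (mnom a)%:R * \prod_i x i ^+ a i.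
Proof.
have E f : \prod_k x (f k) = \prod_i x i ^+ occ f i.
 rewrite (partition_big f xpredT)//=; apply: eq_bigr => i _.
 rewrite (eq_bigr (fun _ => x i)); last by move=> k /eqP ->.
 by rewrite prodr_const occE; congr (_ ^+ _); exact: eq_card.
have -> : (\sum_i x i) ^+ d = \prod_(k < d) \sum_i x i by rewrite prodr_const card_ord.
rewrite bigA_distr_bigA/= (eq_bigr _ (fun f _ => E f)).
rewrite (partition_big occ (fun a => mdeg a == d))/=; last by move=> f _; rewrite mdeg_occ.
apply: eq_bigr => a _; rewrite (eq_bigr (fun _ => \prod_i x i ^+ a i)); last by move=> f /eqP ->.
by rewrite sumr_const mulr_natl; congr (_ *+ _); exact: eq_card.
Qed.

Lemma mnom_gt0 a : mdeg a = d -> (0 < mnom a)%N.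
Proof.
move=> da; pose s := flatten [seq nseq (a i) i | i <- enum 'I_n.+1].
have ss : size s = d.
 rewrite -[RHS]da /s size_flatten /shape -map_comp sumnE big_map /mdeg big_enum/=.
 by apply: eq_bigr => i _; rewrite size_nseq.
have cs i : count_mem i s = a i.
 rewrite /s count_flatten -map_comp sumnE big_map big_enum/= (bigD1 i)//= big1 ?addn0.
  by rewrite count_nseq/= eqxx mul1n.
 by move=> j ji; rewrite count_nseq/= (negbTE ji).
apply/card_gt0P; exists [ffun k : 'I_d => nth ord0 s k]; rewrite unfold_in/=; apply/eqP/ffunP => i.
apply: val_inj; rewrite /= occE -cs -sum1_count (big_nth ord0) ss big_mkord sum1_card.
by apply: eq_card => k; rewrite !unfold_in/= ffunE.
Qed.

End Multinomial.

Section Waring.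
Context {m n : nat}.
Notation d := n.+1.
Notation vec := ('I_m.+2 -> C).
Notation hp := (Hpoly m.+1 d).
Notation kp := (@kpt m.+1 d).

(** The coefficients of the [d]-th power of the linear form with coefficient vector [kpt s]. *)
Definition kform (s : C) : hp := fun a => (mnom a)%:R * s ^+ kcode a.

Lemma pe_kform s (y : vec) : pe (kform s) y = (\sum_i kp s i * y i) ^+ d.
Proof.
rewrite multinomial /pe /heval; apply: eq_bigr => a _.
rewrite /kform -prod_kpt -mulrA -big_split/=; congr (_ * _); apply: eq_bigr => i _.
by rewrite exprMn.
Qed.

(* p0 vanishes on the hyperplane sum_i s^((d+1)^i) y_i = 0 for finitely many s only *)
Lemma good_nodes (p0 : hp) : hnonzero p0 -> exists2 B : {poly C}, B != 0 &
 forall s, B.[s] != 0 -> s != 0 /\ exists2 y, pe p0 y != 0 & \sum_i kp s i * y i = 0.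
Proof.
move=> /hnonzero_pe[t pt0]; pose y0 : vec := kp t.
have t0 : t != 0.
 apply: contraNneq pt0 => t0; have -> : pe p0 (kp t) = pe p0 (fun i => 0 * y0 i).
  by apply: pe_ext => i; rewrite mul0r /kpt t0 expr0n expn_eq0/=.
 by rewrite pe_scale expr0n mul0r.
pose e0 : vec := fun i => - (i == ord0)%:R.
(* [y0 + w(s) e0] must satisfy the linear equation, in which the first variable has coefficient [s]
   since [(d + 1)^0 = 1]; dividing by [s] lowers all exponents by 1. *)
pose w : {poly C} := \sum_i y0 i *: 'X^(d.+1 ^ i - 1).
have wd : w`_d != 0.
 rewrite /w coef_sum (bigD1 (lift ord0 ord0))//= big1 ?addr0.
  by rewrite coefZ coefXn /bump/= addn0 expn1 subn1 eqxx mulr1 expf_neq0.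
 move=> i i1; rewrite coefZ coefXn (_ : (d == _) = false) ?mulr0//; apply/negbTE.
 apply: contraNneq i1 => E; apply/eqP/val_inj; rewrite /= /bump/= addn0.
 have : (d.+1 ^ i = d.+1 ^ 1)%N by rewrite expn1 [in RHS]E subn1 prednK// expn_gt0.
 by move=> /eqP; rewrite eqn_exp2l// => /eqP.
(* A nonconstant [w] makes the composition of the nonzero [r] with [w] nonzero. *)
have ws : (1 < size w)%N.
 by rewrite ltnNge; apply/negP => h; move: wd; rewrite nth_default ?eqxx// (leq_trans h).
pose r := lp p0 y0 e0.
have rs s : r.[s] = pe p0 (fun i => y0 i + s * e0 i) by rewrite horner_lp.
have r0 : r != 0.
 apply: contraNneq pt0 => r0; have <- : pe p0 (fun i => y0 i + 0 * e0 i) = pe p0 (kp t).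
  by apply: pe_ext => i; rewrite mul0r addr0.
 by rewrite -rs r0 horner0.
exists ('X * (r \Po w)); first by rewrite mulf_neq0 ?polyX_eq0// comp_poly_eq0.
move=> s; rewrite hornerM hornerX mulf_eq0 negb_or => /andP[s0]; rewrite horner_comp rs => h; split => //.
eexists; first exact: h.
rewrite (eq_bigr (fun i => kp s i * y0 i + w.[s] * (kp s i * e0 i))); last by move=> i _; ring.
rewrite big_split/= -mulr_sumr [X in w.[s] * X](bigD1 ord0)//= [X in w.[s] * (_ + X)]big1; last first.
 by move=> i /negbTE i0; rewrite /e0 i0 oppr0 mulr0.
rewrite /e0 eqxx addr0 /kpt expn0 expr1 mulrN1 mulrN; apply/eqP; rewrite subr_eq0; apply/eqP.
rewrite /w horner_sum mulr_suml; apply: eq_bigr => i _.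
by rewrite hornerZ hornerXn mulrC -mulrA -exprSr subn1 prednK ?expn_gt0.
Qed.

Lemma nonroots (B : {poly C}) k : B != 0 -> exists xs : seq C, [/\ size xs = k, uniq xs & all (fun x => B.[x] != 0) xs].
Proof.
move=> B0; pose L : seq C := [seq i%:R | i <- iota 0 (k + size B)].
have uL : uniq L by rewrite map_inj_uniq ?iota_uniq// => i j /eqP; rewrite eqr_nat => /eqP.
have c1 : (count (root B) L < size B)%N.
 by rewrite -size_filter max_poly_roots ?filter_uniq// ?filter_all.
have sL : size L = (k + size B)%N by rewrite size_map size_iota.
have c2 : (k <= count (predC (root B)) L)%N.
 by have := count_predC (root B) L; rewrite sL; lia.
exists (take k (seq.filter (predC (root B)) L)); split.
- by rewrite size_take size_filter; case: ltngtP c2.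
- by rewrite take_uniq ?filter_uniq.
- by apply/allP => x /mem_take; rewrite mem_filter => /andP[].
Qed.

(** Up to the positive factors [mnom a], the coefficients of the [kform s] at distinct nodes are the
    rows [kcode a] of a Vandermonde matrix. Its inverse gives the [c j] linearly in [g], whence the
    bound; rows that encode no monomial get the value 0. *)
Lemma waring (xs : seq C) : uniq xs -> (forall a : mono m.+1 d, (kcode a < size xs)%N) ->
 exists2 A : R, 0 <= A & forall (g : hp) (e : R), 0 <= e -> (forall a, mdeg a = d -> cabs (g a) <= e) ->
  exists c : 'I_(size xs) -> C, (forall a, mdeg a = d -> g a = \sum_j c j * kform (nth 0 xs j) a) /\
   forall j, cabs (c j) <= A * e.
Proof.
move=> uxs kxs; set K := size xs.
pose v : 'rV[C]_K := \row_j nth 0 xs j; pose V := Vandermonde K v.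
have Vu : V \in unitmx.
 rewrite unitmxE det_Vandermonde unitfE; apply/prodf_neq0 => i _; apply/prodf_neq0 => j ij.
 by rewrite !mxE subr_eq0 nth_uniq// gtn_eqF.
pose A : R := \sum_j \sum_i cabs (invmx V j i).
have A0 : 0 <= A by apply: sumr_ge0 => j _; apply: sumr_ge0.
exists A => // g e e0 ge.
pose b : 'cV[C]_K := \col_i (if [pick a : mono m.+1 d | (mdeg a == d) && (kcode a == i)] is Some a then g a / (mnom a)%:R else 0).
have be i : cabs (b i 0) <= e.
 rewrite mxE; case: pickP => [a /andP[/eqP da _]|_]; last by rewrite cabs0.
 have := ge _ da; have := mnom_gt0 da; rewrite cabsM cabsV cabs_nat => h1 h2.
 by rewrite ler_pdivrMr ?ltr0n//; apply: le_trans h2 _; rewrite ler_peMr// ler1n.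
exists (fun j => (invmx V *m b) j 0); split.
- move=> a da; have := mulKVmx Vu b => /matrixP/(_ (Ordinal (kxs a)) 0).
 rewrite mxE [RHS]mxE; case: pickP => [a' /andP[_ /eqP/kcode_inj ->]|/(_ a)]; last by rewrite da !eqxx.
 move=> E; have m0 : (mnom a)%:R != 0 :> C by rewrite pnatr_eq0 -lt0n mnom_gt0.
 rewrite -[LHS](divfK m0) -E mulr_suml; apply: eq_bigr => j _.
 by rewrite !mxE /kform/=; ring.
- move=> j; rewrite mxE; apply: le_trans (cabs_sum _ _ _) _.
 have -> : A * e = \sum_j' \sum_i cabs (invmx V j' i) * e.
  by rewrite /A mulr_suml; apply: eq_bigr => k _; rewrite mulr_suml.
 apply: (via (\sum_i cabs (invmx V j i) * e)).
  by apply: ler_sum => i _; rewrite cabsM ler_wpM2l.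
 rewrite [leRHS](bigD1 j)//= ler_wpDr//; apply: sumr_ge0 => j' _; apply: sumr_ge0 => i _.
 by rewrite mulr_ge0.
Qed.

Lemma node_frame (p0 : hp) s y : s != 0 -> pe p0 y != 0 -> \sum_i kp s i * y i = 0 ->
 exists (u vs : vec) (h : hp) (r : C), [/\ nr2 u = 1 /\ nr2 vs = 1, dotc u vs = 0, pe p0 vs != 0,
  forall z, pe h z = dotc u z ^+ d & forall a, kform s a = r * h a].
Proof.
move=> s0 py ly; pose k : vec := kp s.
have k0 : 0 < nr2 k by rewrite nr2_gt0; apply/existsP; exists ord0; rewrite expf_neq0.
have r0 : 0 < vnorm k by rewrite sqrtr_gt0.
pose r : C := (vnorm k)%:C; have rn0 : r != 0 by rewrite -cabs_gt0 cabs_real normr_gt0 gt_eqF.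
have [vs [vs1 pvs [c c0 vsE]]] := unit_pe (ltn0Sn n) py.
pose u : vec := fun i => ((vnorm k)^-1)%:C * conjc (k i).
have uE z : dotc u z = r^-1 * \sum_i k i * z i.
 rewrite /dotc mulr_sumr; apply: eq_bigr => i _.
 by rewrite /u conjcMm conjcK conjc_real /r mulrA fmorphV.
exists u, vs, (fun a => r^-1 ^+ d * kform s a), (r ^+ d); split => //.
- split => //; rewrite /u nr2_scale cabs_real ger0_norm ?invr_ge0 ?(ltW r0)//.
 have -> : nr2 (fun i => conjc (k i)) = nr2 k by apply: eq_bigr => i _; rewrite -!sqr_cabs cabs_conj.
 by rewrite -sqr_vnorm -exprMn mulVf ?gt_eqF// expr1n.
- rewrite uE (eq_bigr (fun i => c * (k i * y i))); last by move=> i _; rewrite vsE; ring.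
 by rewrite -mulr_sumr ly !mulr0.
- move=> z; rewrite uE exprMn -pe_kform /pe /heval mulr_sumr; apply: eq_bigr => a _.
 exact: esym (mulrA _ _ _).
- by move=> a; rewrite mulrA -exprMn mulfV// expr1n mul1r.
Qed.

(** The nodes avoid the zeros of the polynomial of [good_nodes], so [p0] does not vanish identically
    on any of the hyperplanes; the scalings to unit vectors [u] are absorbed in [A]. *)
Theorem waring_frames (p0 : hp) : hnonzero p0 -> exists (K : nat) (u vs : 'I_K -> vec) (h : 'I_K -> hp) (A : R),
 [/\ 0 <= A, forall j, nr2 (u j) = 1 /\ nr2 (vs j) = 1, forall j, dotc (u j) (vs j) = 0 /\ pe p0 (vs j) != 0,
  forall j z, pe (h j) z = dotc (u j) z ^+ d &
  forall (g : hp) (e : R), 0 <= e -> (forall a, mdeg a = d -> cabs (g a) <= e) ->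
   exists c : 'I_K -> C, (forall a, mdeg a = d -> g a = \sum_j c j * h j a) /\ forall j, cabs (c j) <= A * e].
Proof.
move=> p00; have [B B0 hB] := good_nodes p00.
have [xs [sxs uxs /allP nxs]] := nonroots (\max_(a : mono m.+1 d) kcode a).+1 B0.
have [A A0 hA] := waring uxs (fun a => eq_ind_r (fun k => (kcode a < k)%N) (leq_bigmax a : (kcode a < _.+1)%N) sxs).
have : forall j : 'I_(size xs), exists z : (vec * vec) * (hp * C), [/\ nr2 z.1.1 = 1 /\ nr2 z.1.2 = 1, dotc z.1.1 z.1.2 = 0, pe p0 z.1.2 != 0,
  forall y, pe z.2.1 y = dotc z.1.1 y ^+ d & forall a, kform (nth 0 xs j) a = z.2.2 * z.2.1 a].
 move=> j; have [s0 [y py ly]] := hB _ (nxs _ (mem_nth 0 (ltn_ord j))).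
 by have [u [vs [h [r H]]]] := node_frame s0 py ly; exists ((u, vs), (h, r)).
move=> /choice[Z hZ]; pose S : R := \sum_j cabs (Z j).2.2.
exists (size xs), (fun j => (Z j).1.1), (fun j => (Z j).1.2), (fun j => (Z j).2.1), (A * S).
have S0 : 0 <= S by apply: sumr_ge0.
split; [by rewrite mulr_ge0|by move=> j; have [] := hZ j|by move=> j; have [] := hZ j|by move=> j; have [] := hZ j|].
move=> g e e0 ge; have [c [gc ce]] := hA g e e0 ge.
exists (fun j => c j * (Z j).2.2); split.
 by move=> a da; rewrite (gc a da); apply: eq_bigr => j _; have [_ _ _ _ ->] := hZ j; rewrite mulrA.
move=> j; rewrite cabsM mulrAC ler_pM// /S (bigD1 j)//= lerDl; exact: sumr_ge0.
Qed.

End Waring.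

Lemma pos_lower_bound K (c : 'I_K -> R) : (forall j, 0 < c j) -> exists2 e, 0 < e & forall j, e <= c j.
Proof.
move=> c0; have S0 : 0 <= \sum_j (c j)^-1 by apply: sumr_ge0 => j _; rewrite invr_ge0 ltW.
have p : 0 < 1 + \sum_j (c j)^-1 by rewrite ltr_pwDl.
exists (1 + \sum_j (c j)^-1)^-1; first by rewrite invr_gt0.
move=> j; rewrite -[leRHS]invrK lef_pV2 ?posrE ?invr_gt0// (bigD1 j)//= addrCA lerDl addr_ge0//.
by apply: sumr_ge0 => i _; rewrite invr_ge0 ltW.
Qed.

Lemma big_ord_ltS (V : nmodType) K (F : 'I_K -> V) k (kK : (k < K)%N) :
 \sum_(i < K | (i < k.+1)%N) F i = \sum_(i < K | (i < k)%N) F i + F (Ordinal kK).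
Proof.
rewrite (bigD1 (Ordinal kK))//= addrC; congr (_ + _); apply: eq_bigl => i.
by rewrite ltnS ltn_neqAle andbC -(inj_eq val_inj).
Qed.

(** * Smallness and finiteness of the inner distance *)

Section Near.
Context {m n : nat}.
Notation d := n.+1.
Notation vec := ('I_m.+2 -> C).
Notation hp := (Hpoly m.+1 d).
Variables (vol : probability (Grm m) R) (inv : Gr_invariant R m vol).
Variables (q th : R) (q1 : 1 <= q) (th0 : 0 < th) (thn : th * n.+1%:R <= 1) (th1 : th < 1).
Variables (sq : (1 - th) * q < 1) (tb : th * q < ((2 * n.+1) * 2 ^ (2 * m.+2))%:R^-1).
Notation Win := (Win R vol q).
Let d0 : (0 < d)%N. Proof. by []. Qed.
Let q0 : 0 < q. Proof. exact: lt_le_trans q1. Qed.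
Implicit Types p : hp.

Lemma pe_close p p' (x : vec) e : nr2 x = 1 -> (forall a, mdeg a = d -> cabs (p a - p' a) <= e) ->
 cabs (pe p x - pe p' x) <= #|{: mono m.+1 d}|%:R * e.
Proof.
move=> x1 pe1; have x1' i : cabs (x i) <= 1 by have := cabs_le_vnorm x i; rewrite /vnorm x1 sqrtr1.
rewrite /pe /heval -sumrB; apply: le_trans (cabs_sum _ _ _) _.
rewrite big_mkcond mulr_natl -sumr_const; apply: ler_sum => a _.
case: eqP => [da|_]; last first.
 by apply: le_trans (pe1 (occ [ffun _ => ord0]) _); rewrite ?cabs_ge0// mdeg_occ.
rewrite -mulrBl cabsM -[leRHS]mulr1 ler_pM// ?pe1// cabs_prod.
by apply: prodr_ile1 => i _; rewrite cabs_ge0 cabsX exprn_ile1 ?cabs_ge0.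
Qed.

(** The difference [p - p0] is spread over the [K] directions, one leg for each. [d1] keeps all
    intermediate polynomials above [c0 / 2] at the points [vs j], so that the constants of
    [leg_estimate] apply throughout; [d2] brings each [|c_j|^th] below [e / (S + 1)], so that the
    costs sum to at most [e]. *)
Lemma Win_near p0 e : hnonzero p0 -> 0 < e -> exists2 del, 0 < del &
 forall p, (forall a, mdeg a = d -> cabs (p a - p0 a) <= del) -> (Win p0 p <= e%:E)%E.
Proof.
move=> p00 e0; have [K [u [vs [h [A [A0 uv1 uv0 hE hA]]]]]] := waring_frames p00.
have [c0 c00 c0h] : exists2 c0 : R, 0 < c0 & forall j, c0 <= cabs (pe p0 (vs j)).
 by apply: pos_lower_bound => j; rewrite cabs_gt0; have [] := uv0 j.
have c02 : 0 < c0 / 2 by rewrite divr_gt0.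
pose Z j := cid2 (leg_estimate inv q1 th0 thn th1 sq tb (uv1 j).1 (hE j) (uv1 j).2 (uv0 j).1 c02).
pose KK j := s2val (Z j); have hKK j : 0 <= KK j := s2valP (Z j).
pose Hs := \sum_j \sum_a cabs (h j a); pose M : R := #|{: mono m.+1 d}|%:R.
have Hs0 : 0 <= Hs by apply: sumr_ge0 => j _; apply: sumr_ge0.
have M0 : 0 <= M by exact: ler0n.
pose S := \sum_j KK j `^ q^-1; have S0 : 0 <= S by apply: sumr_ge0 => j _; exact: powR_ge0.
have S1 : 0 < S + 1 by rewrite ltr_wpDl.
pose d1 := c0 / 2 / (M * A * Hs + 1); pose d2 := (e / (S + 1)) `^ th^-1 / (A + 1).
have MA1 : 0 < M * A * Hs + 1 by rewrite ltr_wpDl// !mulr_ge0.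
have A1 : 0 < A + 1 by rewrite ltr_wpDl.
pose del := Num.min d1 d2.
have delp : 0 < del by rewrite lt_min !divr_gt0// powR_gt0// divr_gt0.
have del0 := ltW delp; exists del => // p pp0.
have [c [gc cA]] := hA (fun a => p a - p0 a) del del0 pp0.
have dl1 : M * (A * del * Hs) <= c0 / 2.
 have : del <= d1 by rewrite /del ge_min lexx.
 rewrite /d1 ler_pdivlMr// => h1; apply: le_trans h1.
 by rewrite mulrDr mulr1 (_ : M * (A * del * Hs) = del * (M * A * Hs)) ?lerDl//; ring.
have dl2 : (A * del) `^ th <= e / (S + 1).
 have : del <= d2 by rewrite /del ge_min lexx orbT.
 rewrite /d2 ler_pdivlMr// => h1; have eS : 0 <= e / (S + 1) by rewrite divr_ge0// ltW.
 have E : e / (S + 1) = ((e / (S + 1)) `^ th^-1) `^ th by rewrite -powRrM mulVf ?gt_eqF// powRr1.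
 rewrite E ge0_ler_powR ?nnegrE ?powR_ge0 ?(ltW th0) ?mulr_ge0//.
 by apply: le_trans h1; rewrite mulrDr mulr1 (mulrC A) lerDl.
pose Q k : hp := fun a => p0 a + \sum_(i < K | (i < k)%N) c i * h i a.
have QS k (kK : (k < K)%N) : Q k.+1 = leg (h (Ordinal kK)) (Q k) (c (Ordinal kK)) 1.
 by apply/funext => a; rewrite /Q /leg (big_ord_ltS _ kK) addrA mul1r.
have Qclose k a : cabs (Q k a - p0 a) <= A * del * Hs.
 rewrite /Q addrC addKr; apply: le_trans (cabs_sum _ _ _) _.
 rewrite /Hs mulr_sumr big_mkcond; apply: ler_sum => j _; case: ifP => _; last first.
  by rewrite !mulr_ge0//; apply: sumr_ge0.
 have hj : cabs (h j a) <= \sum_a' cabs (h j a') by rewrite (bigD1 a)//= lerDl; apply: sumr_ge0.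
 by rewrite cabsM; apply: ler_pM (cA j) hj.
have Qpe k j : c0 / 2 <= cabs (pe (Q k) (vs j)).
 have h1 := pe_close (uv1 j).2 (fun a (_ : mdeg a = d) => Qclose k a).
 have h2 := cabs_leB (pe p0 (vs j)) (pe (Q k) (vs j)); rewrite cabsB in h2.
 by have h3 := c0h j; rewrite -/M in h1; lra.
have claim k : (k <= K)%N -> hnonzero (Q k) /\
  (Win p0 (Q k) <= (\sum_(i < K | (i < k)%N) KK i `^ q^-1 * cabs (c i) `^ th)%:E)%E.
 elim: k => [_|k IH kK].
  rewrite big_pred0//; have E : Q 0%N = p0 by apply/funext => a; rewrite /Q big_pred0// addr0.
  by rewrite E; split => //; rewrite (Win_hprop0 inv d0 q1 p00 (hprop_refl p0)).
 have [Qn QW] := IH (ltnW kK); set j := Ordinal kK; have [ln [f [mf f0 fe fW]]] := s2valP' (Z j) (Q k) (c j) (Qpe k j).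
 have legb : leg (h j) (Q k) (c j) 0 = Q k by apply/funext => a; rewrite /leg mul0r addr0.
 split; first by rewrite QS; exact: ln.
 rewrite (big_ord_ltS _ kK) EFinD -/j; apply: le_trans (Win_tri inv d0 q1 _ (Q k) _) _.
 apply: leeD => //.
 have mp : mpath vol q (Q k) (Q k.+1) (leg (h j) (Q k) (c j)) f.
  split.
  - by split; [rewrite legb|rewrite QS]; exact: hprop_refl.
  - by move=> t _; exact: ln.
  - by split.
  - by apply: le_lt_trans fe _; rewrite ltry.
  - exact: fW.
 apply: (Win_le inv d0 q1 mp); first by rewrite mulr_ge0 ?powR_ge0.
 apply: le_trans fe _; rewrite lee_fin powRM ?powR_ge0// -!powRrM mulVf ?gt_eqF//.
 by rewrite powRr1.
have [Qn QW] := claim K (leqnn K).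
have Qp : hprop R (Q K) p.
 exists 1; split; first exact: oner_neq0.
 move=> a da; rewrite mul1r /Q (eq_bigl xpredT) => [|i]; last by rewrite ltn_ord.
 by rewrite -gc// addrC subrK.
apply: le_trans (Win_tri inv d0 q1 _ (Q K) _) _.
rewrite (Win_hprop0 inv d0 q1 Qn Qp) adde0; apply: le_trans QW _; rewrite lee_fin.
apply: (via (S * (e / (S + 1)))); last first.
 by rewrite mulrCA ler_piMr ?(ltW e0)// ler_pdivrMr// mul1r lerDl.
rewrite /S mulr_suml big_mkcond; apply: ler_sum => j _; rewrite ltn_ord ler_wpM2l ?powR_ge0//.
by apply: le_trans dl2; rewrite ge0_ler_powR ?nnegrE ?(ltW th0) ?mulr_ge0.
Qed.

(** The segment from [p] to [p'] avoids 0 when the two are not proportional, and [creep] chains the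
    local bounds of [Win_near] along it; the numerical argument of [creep] is kept at 0, as only
    finiteness is propagated. *)
Lemma Win_fin p p' : hnonzero p -> hnonzero p' -> (Win p p' < +oo)%E.
Proof.
move=> pn pn'; have [pp'|npp'] := pselect (hprop R p p').
 by rewrite (Win_hprop0 inv d0 q1 pn pp') ltry.
pose ga (t : R) : hp := fun a => (1 - t)%:C * p a + t%:C * p' a.
have ga0 t : hnonzero (ga t).
 apply: contrapT => h; have {}h a : mdeg a = d -> (1 - t)%:C * p a + t%:C * p' a = 0.
  by move=> da; apply/eqP/negPn/negP => ha; apply: h; exists a.
 have [t0|t0] := eqVneq t 0.
  have [a [da pa]] := pn; have := h a da; rewrite t0 subr0 mul1r mul0r addr0.
  by move/eqP; rewrite (negbTE pa).
 have tc : t%:C != 0 :> C by rewrite -cabs_gt0 cabs_real normr_gt0.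
 have [t1|t1] := eqVneq t 1.
  have [a [da pa]] := pn'; have := h a da; rewrite t1 subrr mul1r mul0r add0r.
  by move/eqP; rewrite (negbTE pa).
 apply: npp'; exists (- ((1 - t)%:C / t%:C)); split.
  by rewrite oppr_eq0 mulf_neq0 ?invr_eq0// -cabs_gt0 cabs_real normr_gt0 subr_eq0 eq_sym.
 move=> a da; have /eqP := h a da; rewrite addrC addr_eq0 => /eqP E.
 by rewrite mulNr mulrAC -mulNr -E mulrC mulKf.
pose S := \sum_a cabs (p' a - p a); have S0 : 0 <= S by apply: sumr_ge0.
have gaE s t a : cabs (ga t a - ga s a) <= `|t - s| * S.
 have -> : ga t a - ga s a = (t - s)%:C * (p' a - p a).
  by rewrite /ga !rmorphB/=; ring.
 by rewrite cabsM cabs_real ler_wpM2l// /S (bigD1 a)//= lerDl; apply: sumr_ge0.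
have near t : exists2 e, 0 < e & forall t', `|t' - t| <= e -> (Win (ga t) (ga t') <= 1%:E)%E.
 have [del del0 hdel] := Win_near (ga0 t) ltr01.
 have S1 : 0 < S + 1 by rewrite ltr_wpDl.
 exists (del / (S + 1)); first by rewrite divr_gt0.
 move=> t' ht; apply: hdel => a _; apply: le_trans (gaE _ _ _) _.
 move: ht; rewrite ler_pdivlMr// => ht; apply: le_trans ht.
 by rewrite ler_wpM2l// lerDl.
have := @creep (fun s t _ => (Win (ga s) (ga t) < +oo)%E) (fun _ _ => 0) 0 1 ler01.
have -> : ga 0 = p by apply/funext => a; rewrite /ga subr0 mul1r mul0r addr0.
have -> : ga 1 = p' by apply/funext => a; rewrite /ga subrr mul1r mul0r add0r.
apply => //.
- by move=> s t v _ _ h1 h2; apply: le_lt_trans (Win_tri inv d0 q1 _ (ga t) _) _; rewrite lte_add_pinfty.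
- move=> t _; have [e e0 he] := near t; exists e => // t' _ ht; split => _.
  by apply: le_lt_trans (he _ ht) _; rewrite ltry.
 by rewrite (Win_sym inv d0 q1); apply: le_lt_trans (he _ ht) _; rewrite ltry.
Qed.

End Near.

(** * Compactness from the unit sphere of coefficients *)

Section Coordinates.
Context {m d : nat}.
Notation k := m.+1.
Notation hp := (Hpoly k d).
Notation I := {a : mono k d | mdeg a == d}.
Notation J := (I * bool)%type.
Notation V := 'rV[R]_#|{: J}|.

Definition poly_of (x : V) : hp := fun a =>
 if insub a is Some i then (x 0 (enum_rank ((i : I), false)) +i* x 0 (enum_rank ((i : I), true)))%C else 0.

Definition coords (p : hp) : V :=
 \row_j if (enum_val j).2 then Im (p (val (enum_val j).1)) else Re (p (val (enum_val j).1)).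

Lemma coordsK p a : mdeg a = d -> poly_of (coords p) a = p a.
Proof.
move=> da; rewrite /poly_of; case: insubP => [i _ ia|]; last by rewrite da eqxx.
by rewrite !mxE !enum_rankK/= ia; case: (p a).
Qed.

Lemma coord_le (x : V) j : `|x 0 j| <= `|x|.
Proof.
rewrite [leRHS]/Num.norm /= mx_normrE; apply/bigmax_geP; right => /=.
by exists (0, j).
Qed.

Lemma poly_of_close (x y : V) a : cabs (poly_of x a - poly_of y a) <= 2 * `|x - y|.
Proof.
rewrite /poly_of; case: insubP => [i _ _|_]; last by rewrite subrr cabs0 mulr_ge0.
apply: le_trans (cabs_ReIm _) _ => /=.
have h (b : bool) := coord_le (x - y) (enum_rank ((i : I), b)); have := h false; have := h true.
by rewrite !mxE; lra.
Qed.

Lemma poly_of_nonzero (x : V) : x != 0 -> hnonzero (poly_of x).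
Proof.
move=> x0; have [j xj] : exists j, x 0 j != 0.
 apply: contrapT => h; move/eqP: x0; apply; apply/rowP => j; rewrite mxE.
 by apply/eqP/negPn/negP => xj; apply: h; exists j.
case E : (enum_val j) => [i b]; exists (val i); split; first exact/eqP/(valP i).
rewrite /poly_of valK; have Ej : j = enum_rank (i, b) by rewrite -E enum_valK.
by case: b {E} Ej xj => <- xj; rewrite eq_complex/= negb_and xj ?orbT.
Qed.

Lemma normalize p : hnonzero p -> exists2 x : V, `|x| = 1 & hprop R p (poly_of x).
Proof.
move=> [a [da pa]]; have x0 : coords p != 0.
 apply: contraNneq pa => x0; rewrite -(coordsK p da) x0 /poly_of.
 by case: insub => [i|//]; rewrite !mxE.
have n0 : 0 < `|coords p| by rewrite normr_gt0.
exists (`|coords p|^-1 *: coords p).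
 by rewrite normrZ ger0_norm ?invr_ge0// mulVf// gt_eqF.
exists ((`|coords p|^-1)%:C); split.
 by rewrite -cabs_gt0 cabs_real normr_gt0 invr_eq0 gt_eqF.
move=> b db; rewrite -[p b](coordsK p db) /poly_of; case: insubP => [i _ _|]; last by rewrite db eqxx.
by rewrite !mxE; apply/eqP; rewrite eq_complex/= !mul0r subr0 addr0 !eqxx.
Qed.

Lemma sphere_compact : compact [set x : V | `|x| = 1].
Proof.
apply: bounded_closed_compact.
 exists 1; split => // M M1 x /= ->; exact: ltW.
have -> : [set x : V | `|x| = 1] = (fun x : V => `|x|) @^-1` [set 1] by [].
by apply: closed_comp => [x _|]; [exact: norm_continuous|exact: closed_eq].
Qed.

(** [near] makes [D]-neighborhoods contain coefficient neighborhoods, and normalizing a polynomial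
    costs distance 0, so a cover restricts to an open cover of the sphere and a finite subcover
    lifts back. *)
Lemma compact_of_near (D : hp -> hp -> \bar R) :
 (forall p0 e, hnonzero p0 -> 0 < e -> exists2 del, 0 < del &
  forall p, (forall a, mdeg a = d -> cabs (p a - p0 a) <= del) -> (D p0 p <= e%:E)%E) ->
 (forall p p' : hp, hnonzero p -> hprop R p p' -> D p p' = 0%E) ->
 (forall p p' p'', (D p p'' <= D p p' + D p' p'')%E) ->
 is_compact_metric (hnonzero : hp -> Prop) D.
Proof.
move=> near D0 Dtri F Fopen Fcov.
have /choice[Z hZ] : forall x : V, exists z : (set hp * R), `|x| = 1 ->
  [/\ F z.1, 0 < z.2 & forall y p, `|x - y| < z.2 -> `|y| = 1 -> hprop R p (poly_of y) -> hnonzero p -> z.1 p].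
 move=> x; have [x1|x1] := pselect (`|x| = 1); last by exists (set0, 0).
 have xn : hnonzero (poly_of x) by apply: poly_of_nonzero; rewrite -normr_gt0 x1.
 have [U FU Ux] := Fcov _ xn; have [r [r0 hr]] := Fopen U FU _ Ux xn.
 have r2 : 0 < r / 2 by rewrite divr_gt0.
 have [del del0 hdel] := near _ _ xn r2.
 exists (U, del / 2) => _; split => //=; first by rewrite divr_gt0.
 move=> y p xy y1 py pn; apply: hr => //.
 apply: le_lt_trans (Dtri _ (poly_of y) _) _.
 rewrite (D0 _ p) ?adde0; last 2 first.
 - by apply: poly_of_nonzero; rewrite -normr_gt0 y1.
 - exact: hprop_sym.
 apply: (@le_lt_trans _ _ (r / 2)%:E); last by rewrite lte_fin ltr_pdivrMr// ltr_pMr// ltr1n.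
 apply: hdel => a _; apply: le_trans (poly_of_close _ _ _) _.
 by rewrite distrC; move: xy; rewrite ltr_pdivlMr// mulrC => /ltW.
have := sphere_compact; rewrite compact_cover => /(_ _ [set x | `|x| = 1] (fun x => ball x (Z x).2)).
case=> [x x1|x x1|D' D'S cov]; first exact: ball_open.
 by exists x => //; have [_ h _] := hZ x x1; exact: ballxx.
exists (size (finmap.enum_fset D')), (fun i => (Z (nth 0 (finmap.enum_fset D') i)).1); split.
 by move=> i; have := D'S _ (mem_nth 0 (ltn_ord i)); rewrite inE => /hZ[].
move=> p pn; have [y y1 py] := normalize pn.
have [x /= xD xy] := cov y y1.
have xi : (index x (finmap.enum_fset D') < size (finmap.enum_fset D'))%N by rewrite index_mem.
exists (Ordinal xi) => /=; rewrite nth_index//.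
have := D'S x xD; rewrite inE => x1; have [_ _ h] := hZ x x1.
by apply: (h y) => //; move: xy; rewrite -ball_normE.
Qed.

End Coordinates.

(** * Orders of vanishing and local comparison of two polynomials *)

Section OrderOfVanishing.
Implicit Types (P Q U V : {poly C}).

(** Write [U = X^a U1] with [U1(0)] not 0. If [X^(a + 1)] divided [V], with quotient [W], then
    [|U1(t)| <= c |t| |W(t)|] for small [t], contradicting [U1(0) != 0]. *)
Lemma mup_le_of_bound U V (c r : R) : 0 < r -> U != 0 ->
 (forall t : C, cabs t < r -> cabs U.[t] <= c * cabs V.[t]) -> V != 0 /\ (mup 0 V <= mup 0 U)%N.
Proof.
move=> r0 U0 UV; pose a := mup 0 U.
have /dvdpP[U1 U1E] : ('X - 0%:P) ^+ a %| U by rewrite -mup_geq.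
have U10 : U1.[0] != 0.
 apply/negP => /eqP/rootP/factor_theorem[W WE].
 have : (a.+1 <= mup 0 U)%N by rewrite mup_geq// exprS [X in _ %| X]U1E WE -mulrA dvdp_mulIr.
 by rewrite ltnn.
suff nd : ~~ (('X - 0%:P) ^+ a.+1 %| V).
 have V0 : V != 0 by apply: contraNneq nd => ->; rewrite dvdp0.
 by rewrite mup_leq.
apply/negP => /dvdpP[W WE]; clearbody a.
have u0 : 0 < cabs U1.[0] by rewrite cabs_gt0.
have c1 : 0 < `|c| + 1 by rewrite ltr_wpDl.
have [r1 r10 h1] := @poly_near_small (U1 - (U1.[0])%:P) 0 (cabs U1.[0] / 2) ltac:(by rewrite /root !hornerE subrr) ltac:(by rewrite divr_gt0).
have [r2 r20 h2] := @poly_near_small ('X * W) 0 (cabs U1.[0] / 2 / (`|c| + 1)) ltac:(by rewrite /root hornerM hornerX mul0r) ltac:(by rewrite !divr_gt0).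
pose t : R := Num.min r (Num.min r1 r2) / 2.
have m0 : 0 < Num.min r (Num.min r1 r2) by rewrite !lt_min r0 r10.
have t0 : 0 < t by rewrite divr_gt0.
have tm : t < Num.min r (Num.min r1 r2) by rewrite ltr_pdivrMr// ltr_pMr// ltr1n.
move: tm; rewrite !lt_min => /andP[tr /andP[tr1 tr2]].
have ct : cabs (t%:C : C) = t by rewrite cabs_real gtr0_norm.
have := UV (t%:C) ltac:(by rewrite ct).
have := h1 (t%:C) ltac:(by rewrite subr0 ct); have := h2 (t%:C) ltac:(by rewrite subr0 ct).
rewrite U1E WE subr0 !hornerE exprS /= !cabsM ct cabsX ct => k2 k1 k3.
have ta : 0 < t ^+ a by rewrite exprn_gt0.
have {}k3 : cabs U1.[t%:C] <= c * (t * cabs W.[t%:C]).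
 have E : c * (cabs W.[t%:C] * (t * t ^+ a)) = c * (t * cabs W.[t%:C]) * t ^+ a.
  by rewrite (mulrCA (cabs _)) !mulrA.
 by rewrite E (ler_pM2r ta) in k3.
have k4 : c * (t * cabs W.[t%:C]) <= cabs U1.[0] / 2.
 apply: (via ((`|c| + 1) * (t * cabs W.[t%:C]))).
  have cc : c <= `|c| + 1 by rewrite ler_wpDr// ler_norm.
  by apply: (ler_wpM2r _ cc); rewrite mulr_ge0 ?(ltW t0).
 by rewrite mulrC -ler_pdivlMr// ltW.
have := cabs_leB U1.[0] U1.[t%:C]; rewrite cabsB => k5.
by move: k1; rewrite -/(U1.[0] - U1.[0]); lra.
Qed.

(** Order at 0 with the convention of [mult] for the zero polynomial. *)
Definition ord0p P : nat := if P == 0 then 0%N else mup 0 P.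

Lemma mup_exp P k : P != 0 -> mup 0 (P ^+ k) = (k * mup 0 P)%N.
Proof.
move=> P0; elim: k => [|k IH]; first by rewrite expr0 mupNroot// root1.
by rewrite exprS mupM ?expf_neq0// IH mulSn.
Qed.

Lemma ord_power_bound P Q k k' (c r : R) : 0 < r -> (forall t : C, cabs t < r ->
  cabs P.[t] ^+ k' <= c * cabs Q.[t] ^+ k /\ cabs Q.[t] ^+ k <= c * cabs P.[t] ^+ k') ->
 (k' * ord0p P = k * ord0p Q)%N.
Proof.
move=> r0 PQ; have h1 (t : C) : cabs t < r -> cabs (P ^+ k').[t] <= c * cabs (Q ^+ k).[t].
 by move=> /PQ[]; rewrite !horner_exp !cabsX.
have h2 (t : C) : cabs t < r -> cabs (Q ^+ k).[t] <= c * cabs (P ^+ k').[t].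
 by move=> /PQ[_]; rewrite !horner_exp !cabsX.
have e0 (A B : {poly C}) i : A != 0 -> A = B ^+ i -> (i * ord0p B)%N = mup 0 A.
 move=> A0 AE; rewrite /ord0p; have [B0|B0] := eqVneq B 0; last by rewrite AE mup_exp.
 by move: A0; rewrite AE B0; case: i {AE} => [|i]; [rewrite expr0 mupNroot ?root1|rewrite exprS mul0r eqxx].
have e1 (B : {poly C}) i : B ^+ i = 0 -> (i * ord0p B)%N = 0%N.
 by move/eqP; rewrite expf_eq0 => /andP[_ /eqP ->]; rewrite /ord0p eqxx muln0.
have [U0|U0] := eqVneq (P ^+ k') 0; have [V0|V0] := eqVneq (Q ^+ k) 0.
- by rewrite !e1.
- by have [] := mup_le_of_bound r0 V0 h2; rewrite U0 eqxx.
- by have [] := mup_le_of_bound r0 U0 h1; rewrite V0 eqxx.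
have [_ l1] := mup_le_of_bound r0 U0 h1; have [_ l2] := mup_le_of_bound r0 V0 h2.
rewrite (e0 _ _ _ U0 erefl) (e0 _ _ _ V0 erefl).
by apply/eqP; rewrite eqn_leq l1 l2.
Qed.

End OrderOfVanishing.

Lemma count_nth_eq (S T : Type) (s0 : S) (t0 : T) (a : pred S) (b : pred T) s t : size s = size t ->
 (forall i, (i < size s)%N -> a (nth s0 s i) = b (nth t0 t i)) -> count a s = count b t.
Proof.
elim: s t => [|x s IH] [|y t]//= [st] h; rewrite (h 0%N isT) (IH t st)// => i si.
exact: (h i.+1 si).
Qed.

Lemma seq_gap (s : seq C) : exists2 r : R, 0 < r & forall z, z \in s -> z != 0 -> r <= cabs z.
Proof.
elim: s => [|w s [r r0 h]]; first by exists 1.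
have [w0|w0] := eqVneq w 0.
 by exists r => // z; rewrite inE => /orP[/eqP ->|]; [rewrite w0 eqxx|exact: h].
exists (Num.min r (cabs w)); first by rewrite lt_min r0 cabs_gt0.
move=> z; rewrite inE => /orP[/eqP -> _|zs z0]; first by rewrite ge_min lexx orbT.
by rewrite ge_min h.
Qed.

Lemma prod_cabs_bounds (s : seq C) k (a b : R) : 0 < a -> a <= 1 -> 1 <= b -> (size s <= k)%N ->
 (forall z, z \in s -> a <= cabs z <= b) -> a ^+ k <= \prod_(z <- s) cabs z <= b ^+ k.
Proof.
move=> a0 a1 b1; have b0 : 0 <= b by apply: le_trans b1.
elim: s k => [|z s IH] k.
 by move=> _ _; rewrite big_nil exprn_ile1 ?(ltW a0)//= exprn_ege1.
case: k => [|k] //= sk h; rewrite big_cons !exprS.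
have /andP[z1 z2] := h z (mem_head _ _).
have /andP[p1 p2] := IH k sk (fun z' (zs : z' \in s) => h z' ltac:(by rewrite inE zs orbT)).
by rewrite !ler_pM// ?(ltW a0) ?exprn_ge0 ?(ltW a0)//; apply: le_trans p1; rewrite exprn_ge0 ?(ltW a0).
Qed.

Lemma count_diff (T : eqType) (s t : seq T) : size s <> size t ->
 exists2 x, x \in s ++ t & count_mem x s != count_mem x t.
Proof.
move=> st; have : ~~ perm_eq s t by apply/negP => /perm_size.
by rewrite -has_predC => /hasP[x xs h]; exists x.
Qed.

Lemma tight_sum (a b k l : nat) : (a <= k)%N -> (b <= l)%N -> (k + l <= a + b)%N -> a = k /\ b = l.
Proof. lia. Qed.

Lemma ex_min_by (T : Type) (P : T -> Prop) (h : T -> nat) : (exists x, P x) ->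
 exists2 x, P x & forall y, P y -> (h x <= h y)%N.
Proof.
move=> [x Px]; have [k] := ubnP (h x); elim: k x Px => // k IH x Px; rewrite ltnS => hx.
have [hm|] := pselect (forall y, P y -> (h x <= h y)%N); first by exists x.
move=> /existsNP[y /not_implyP[Py /negP]]; rewrite -ltnNge => hyx.
exact: (IH y Py (leq_trans hyx hx)).
Qed.

Section Roots.
Context {n d : nat}.
Notation vec := ('I_n.+1 -> C).
Notation hp := (Hpoly n d).
Implicit Types (f g : hp) (y v : vec).

Definition rts f v y (ws : seq C) := size ws = d /\ lp f y v = pe f v *: \prod_(w <- ws) ('X - w%:P).
(** Multiplicity at [y] along the direction [v]. With [f(v)] nonzero the restriction to any line of
    that direction has degree exactly [d], so multiplicities at nearby points can be compared
    through roots. *)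
Definition mz f v y := mup 0 (lp f y v).

Lemma rts_exists f v y : pe f v != 0 -> exists ws, rts f v y ws.
Proof.
move=> fv; have [sl ll] := lead_lp y fv.
have l0 : lp f y v != 0 by rewrite -size_poly_eq0 sl.
by have [ws sw E] := poly_roots l0; exists ws; split; rewrite ?sw ?sl// {1}E ll.
Qed.

Lemma rts_mz f v y ws z : pe f v != 0 -> rts f v y ws -> mz f v (fun i => y i + z * v i) = count_mem z ws.
Proof.
move=> fv [sw E]; have -> : mz f v (fun i => y i + z * v i) = mup 0 (\prod_(w <- [seq w - z | w <- ws]) ('X - w%:P)).
 rewrite /mz -[RHS](mupZ0 _ fv); congr (mup 0 _); apply: horner_ext => s.
 rewrite horner_lp hornerZ horner_prodXsubC big_map.
 have := congr1 (fun P : {poly C} => P.[z + s]) E; rewrite horner_lp hornerZ horner_prodXsubC => h.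
 have -> : pe f (fun i => y i + z * v i + s * v i) = pe f (fun i => y i + (z + s) * v i).
  by apply: pe_ext => i; ring.
 rewrite h.
 by congr (_ * _); apply: eq_bigr => w _; ring.
rewrite mu_prod_XsubC count_map; apply: eq_count => w /=.
by rewrite subr_eq0.
Qed.

Lemma rts_mz0 f v y ws : pe f v != 0 -> rts f v y ws -> mz f v y = count_mem 0 ws.
Proof.
move=> fv h; rewrite -(rts_mz 0 fv h) /mz; congr (mup 0 _); apply: horner_ext => s.
by rewrite !horner_lp; apply: pe_ext => i; rewrite mul0r addr0.
Qed.

Lemma rts_value f v y ws : rts f v y ws -> cabs (pe f y) = cabs (pe f v) * \prod_(w <- ws) cabs w.
Proof.
move=> [_ E]; have := congr1 (fun P : {poly C} => P.[0]) E.
rewrite horner_lp hornerZ horner_prodXsubC (pe_ext f (y := y)) => [->|i]; last by rewrite mul0r addr0.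
by rewrite cabsM cabs_prod; congr (_ * _); apply: eq_bigr => w _; rewrite sub0r cabsN.
Qed.

Lemma rts_near f v y0 zs (e : R) : pe f v != 0 -> rts f v y0 zs -> 0 < e -> exists2 r : R, 0 < r &
 forall y, (forall i, cabs (y i - y0 i) < r) -> exists ws, rts f v y ws /\ forall i, cabs (nth 0 zs i - nth 0 ws i) < e.
Proof.
move=> fv [szs E] e0; have [dl dl0 hdl] := roots_cont zs e0.
have fv0 : 0 < cabs (pe f v) by rewrite cabs_gt0.
have H : pcvg (vnbhs y0) (fun y => lp f y v) (lp f y0 v).
 apply: pcvg_lp => [a|i|i]; [exact: ccvg_cst|exact: ccvg_vnbhs|exact: ccvg_cst].
have : vnbhs y0 [set y | forall i : 'I_d.+1, cabs ((lp f y v)`_i - (lp f y0 v)`_i) < dl * cabs (pe f v)].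
 have := @filter_forall _ _ (fun (i : 'I_d.+1) y => cabs ((lp f y v)`_i - (lp f y0 v)`_i) < dl * cabs (pe f v)) (vnbhs y0).
 by move=> h; exact: (h (vnbhs_filter y0) (fun i => H i _ (mulr_gt0 dl0 fv0))).
case=> r r0 hr; exists r => // y /hr hy.
pose Q := (pe f v)^-1 *: lp f y v; have [sl ll] := lead_lp y fv.
have fvi : (pe f v)^-1 != 0 by rewrite invr_eq0.
have Qm : Q \is monic by rewrite monicE lead_coefZ ll mulVf.
have sQ : size Q = (size zs).+1 by rewrite size_scale// sl szs.
have [|ws [sw QE near]] := hdl Q Qm sQ.
 move=> i; have -> : \prod_(z <- zs) ('X - z%:P) = (pe f v)^-1 *: lp f y0 v by rewrite E scalerA mulVf// scale1r.
 rewrite !coefZ -mulrBr cabsM cabsV mulrC ler_pdivrMr//.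
 have [id|id] := ltnP i d.+1; first by apply: ltW; exact: (hy (Ordinal id)).
 by rewrite !nth_default ?subrr ?cabs0 ?mulr_ge0 ?(ltW dl0)//; apply: leq_trans (size_lp _ _ _) id.
exists ws; split => //; split; first by rewrite sw.
by rewrite -QE /Q scalerA mulfV// scale1r.
Qed.

(** Roots that start at 0 stay below [r / 4], the others stay above [3 r / 4]. *)
Lemma small_count f v y0 y zs ws (r : R) : rts f v y0 zs -> rts f v y ws ->
 (forall z, z \in zs -> z != 0 -> r <= cabs z) -> 0 < r ->
 (forall i, cabs (nth 0 zs i - nth 0 ws i) < r / 4) ->
 count (fun w => cabs w < r / 2) ws = count_mem 0 zs.
Proof.
move=> [szs _] [sws _] gap r0 near; apply: (count_nth_eq (s0 := 0) (t0 := 0)); first by rewrite sws.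
move=> i iw; have h := near i; rewrite /=; have [z0|z0] := eqVneq (nth 0 zs i) 0.
 by rewrite z0 sub0r cabsN in h; apply: lt_trans h _; rewrite ltr_pM2l// ltf_pV2 ?posrE// ltr_nat.
have g := gap _ (mem_nth 0 (_ : (i < size zs)%N)) z0; apply/negbTE; rewrite -leNgt.
have {}g : r <= cabs (nth 0 zs i) by apply: g; rewrite szs -sws.
by have := cabs_leB (nth 0 zs i) (nth 0 ws i); lra.
Qed.

(* near y0 the roots of f and g that are small all coincide, by minimality of the sum of multiplicities *)
Lemma local_bound f g v y0 : pe f v != 0 -> pe g v != 0 -> mz f v y0 != mz g v y0 ->
 (forall y, mz f v y != mz g v y -> (mz f v y0 + mz g v y0 <= mz f v y + mz g v y)%N) ->
 exists r c : R, 0 < r /\ forall y, (forall i, cabs (y i - y0 i) < r) ->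
  cabs (pe f y) ^+ mz g v y0 <= c * cabs (pe g y) ^+ mz f v y0 /\
  cabs (pe g y) ^+ mz f v y0 <= c * cabs (pe f y) ^+ mz g v y0.
Proof.
move=> fv gv kk' kmin; set k := mz f v y0 in kk' kmin *; set k' := mz g v y0 in kk' kmin *.
have [zs rz] := rts_exists y0 fv; have [zs' rz'] := rts_exists y0 gv.
have kE : k = count_mem 0 zs by rewrite -(rts_mz0 fv rz).
have k'E : k' = count_mem 0 zs' by rewrite -(rts_mz0 gv rz').
have [rho rho0 gap] := seq_gap (zs ++ zs').
have gapf z : z \in zs -> z != 0 -> rho <= cabs z by move=> h; apply: gap; rewrite mem_cat h.
have gapg z : z \in zs' -> z != 0 -> rho <= cabs z by move=> h; apply: gap; rewrite mem_cat h orbT.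
have rho4 : 0 < rho / 4 by rewrite divr_gt0.
have [r1 r10 n1] := rts_near fv rz rho4; have [r2 r20 n2] := rts_near gv rz' rho4.
pose a := Num.min (rho / 2) 1; pose b := 1 + \sum_(z <- zs ++ zs') cabs z + rho.
have a0 : 0 < a by rewrite lt_min divr_gt0//=.
have a1 : a <= 1 by rewrite ge_min lexx orbT.
have Sz : 0 <= \sum_(z <- zs ++ zs') cabs z by apply: sumr_ge0.
have b1 : 1 <= b by rewrite /b -addrA lerDl addr_ge0// ltW.
have zb z : z \in zs ++ zs' -> cabs z <= b - rho.
 move=> zz; rewrite /b addrK (perm_big _ (perm_to_rem zz))/= big_cons addrCA lerDl addr_ge0//.
 by apply: sumr_ge0.
(* at points y near y0 with common small root z : |f(y)| is comparable to |z|^mult *)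
have key (h : hp) us ws y z : pe h v != 0 -> rts h v y0 us -> rts h v y ws -> {subset us <= zs ++ zs'} ->
  (forall i, cabs (nth 0 us i - nth 0 ws i) < rho / 4) ->
  all (pred1 z) (seq.filter (fun w => cabs w < rho / 2) ws) ->
  cabs (pe h v) * a ^+ d * cabs z ^+ count_mem 0 us <= cabs (pe h y) <= cabs (pe h v) * b ^+ d * cabs z ^+ count_mem 0 us.
 move=> hv ru rw sub near /all_pred1P allz.
 have cE : count_mem 0 us = count (fun w => cabs w < rho / 2) ws.
  by rewrite (small_count ru rw _ rho0 near)// => u /sub; exact: gap.
 rewrite (rts_value rw) (bigID (fun w => cabs w < rho / 2))/= -big_filter allz.
 have -> k0 : \prod_(i <- nseq k0 z) cabs i = cabs z ^+ k0.
  by elim: k0 => [|k0 IH]; rewrite ?big_nil ?expr0// big_cons IH exprS.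
 rewrite size_filter -cE.
 have hv0 : 0 < cabs (pe h v) by rewrite cabs_gt0.
 rewrite -[X in _ <= _ * (_ * X) <= _]big_filter.
 have /andP[p1 p2] : a ^+ d <= \prod_(w <- [seq w <- ws | ~~ (cabs w < rho / 2)]) cabs w <= b ^+ d.
  apply: prod_cabs_bounds => //; first by rewrite size_filter -rw.1 count_size.
  move=> w; rewrite mem_filter -leNgt => /andP[w1 /(nthP 0)[i iw wE]].
  rewrite ge_min w1/=; have iu : (i < size us)%N by rewrite ru.1 -rw.1.
  have := zb _ (sub _ (mem_nth 0 iu)); have := near i; rewrite wE.
  by have := cabs_leB w (nth 0 us i); rewrite cabsB; lra.
 rewrite -!mulrA (mulrC (cabs z ^+ _)) !(ler_pM2l hv0).
 by rewrite !ler_wpM2r ?exprn_ge0.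
pose c1 := cabs (pe f v) * a ^+ d; pose c2 := cabs (pe f v) * b ^+ d.
pose e1 := cabs (pe g v) * a ^+ d; pose e2 := cabs (pe g v) * b ^+ d.
have c10 : 0 < c1 by rewrite mulr_gt0 ?cabs_gt0 ?exprn_gt0.
have e10 : 0 < e1 by rewrite mulr_gt0 ?cabs_gt0 ?exprn_gt0.
have b0 : 0 <= b by apply: le_trans b1.
have c20 : 0 <= c2 by rewrite mulr_ge0 ?exprn_ge0.
have e20 : 0 <= e2 by rewrite mulr_ge0 ?exprn_ge0.
exists (Num.min r1 r2), (c2 ^+ k' / e1 ^+ k + e2 ^+ k / c1 ^+ k'); split; first by rewrite lt_min r10.
move=> y yy; have [ws [rw nw]] : exists ws, rts f v y ws /\ forall i, cabs (nth 0 zs i - nth 0 ws i) < rho / 4.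
 by apply: n1 => i; apply: lt_le_trans (yy i) _; rewrite ge_min lexx.
have [ws' [rw' nw']] : exists ws, rts g v y ws /\ forall i, cabs (nth 0 zs' i - nth 0 ws i) < rho / 4.
 by apply: n2 => i; apply: lt_le_trans (yy i) _; rewrite ge_min lexx orbT.
pose P (w : C) := cabs w < rho / 2; pose A := seq.filter P ws; pose A' := seq.filter P ws'.
have sA : size A = k by rewrite size_filter (small_count rz rw gapf rho0 nw) kE.
have sA' : size A' = k' by rewrite size_filter (small_count rz' rw' gapg rho0 nw') k'E.
(* There are [k] small roots of [f] and [k'] of [g], and [k] differs from [k'], so some [z] is
   counted differently. By minimality its two counts add up to at least [k + k'], hence all small
   roots of both coincide with [z]. *)
have [z zA zc] : exists2 z, z \in A ++ A' & count_mem z A != count_mem z A'.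
 by apply: count_diff; rewrite sA sA'; exact/eqP.
have zP : P z by move: zA; rewrite mem_cat !mem_filter => /orP[] /andP[].
have cnt (us : seq C) : count_mem z (seq.filter P us) = count_mem z us.
 rewrite count_filter; apply: eq_count => w /=; case: eqP => [->|//]; exact: zP.
have mf : mz f v (fun i => y i + z * v i) = count_mem z A by rewrite (rts_mz z fv rw) cnt.
have mg : mz g v (fun i => y i + z * v i) = count_mem z A' by rewrite (rts_mz z gv rw') cnt.
have := kmin (fun i => y i + z * v i); rewrite mf mg => /(_ zc) km.
have q1 : (count_mem z A <= k)%N by rewrite -sA count_size.
have q2 : (count_mem z A' <= k')%N by rewrite -sA' count_size.
have [q1' q2'] := tight_sum q1 q2 km.
have al : all (pred1 z) A by rewrite all_count sA q1'.
have al' : all (pred1 z) A' by rewrite all_count sA' q2'.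
have subf : {subset zs <= zs ++ zs'} by move=> u uz; rewrite mem_cat uz.
have subg : {subset zs' <= zs ++ zs'} by move=> u uz; rewrite mem_cat uz orbT.
have := key f zs ws y z fv rz rw subf nw al; rewrite -kE -/c1 -/c2 => /andP[f1 f2].
have := key g zs' ws' y z gv rz' rw' subg nw' al'; rewrite -k'E -/e1 -/e2 => /andP[g1 g2].
set zz := cabs z in f1 f2 g1 g2; have zz0 : 0 <= zz by exact: cabs_ge0.
have gen (x y' zz' s1 t1 : R) i j : 0 <= x -> 0 <= s1 -> 0 < t1 -> 0 <= zz' -> x <= s1 * zz' ^+ i -> t1 * zz' ^+ j <= y' ->
  x ^+ j <= s1 ^+ j / t1 ^+ i * y' ^+ i.
 move=> x0 s10 t0 z0 h1 h2.
 have y0' : 0 <= y' by apply: le_trans h2; rewrite mulr_ge0 ?exprn_ge0 ?(ltW t0).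
 have s0 : 0 <= s1 * zz' ^+ i by apply: le_trans h1.
 apply: (via ((s1 * zz' ^+ i) ^+ j)); first by rewrite lerXn2r ?nnegrE.
 rewrite exprMn -exprM mulnC exprM.
 rewrite -mulrA ler_wpM2l ?exprn_ge0// mulrC ler_pdivlMr ?exprn_gt0// -exprMn lerXn2r ?nnegrE//.
 - by rewrite mulr_ge0 ?exprn_ge0 ?(ltW t0).
 - by rewrite mulrC.
have y1 : 0 <= cabs (pe g y) ^+ k by rewrite exprn_ge0.
have y2 : 0 <= cabs (pe f y) ^+ k' by rewrite exprn_ge0.
split.
- apply: le_trans (gen _ _ _ _ _ _ _ (cabs_ge0 _) c20 e10 zz0 f2 g1) _.
 by rewrite ler_wpM2r// lerDl divr_ge0 ?exprn_ge0 ?(ltW c10).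
- apply: le_trans (gen _ _ _ _ _ _ _ (cabs_ge0 _) e20 c10 zz0 g2 f1) _.
 by rewrite ler_wpM2r// lerDr divr_ge0 ?exprn_ge0 ?(ltW e10).
Qed.

End Roots.

(** * Points and lines near a given one *)

Section Nearby.
Context {m : nat}.
Notation N := m.+2.
Notation vec := ('I_N -> C).
Notation dFS := (@dFS R _).
Implicit Types (x y v : vec) (L : Gr m).

Lemma half_close (a b : C) : cabs (a - b) < cabs b / 2 -> cabs b / 2 <= cabs a.
Proof. by move=> h; have := cabs_leB b a; rewrite cabsB; lra. Qed.

Lemma near_le (a b : C) (S : R) : cabs (a - b) < 1 -> cabs b <= S -> cabs a <= 2 + S.
Proof. by move=> h h'; have := cabs_leB a b; lra. Qed.

(** The representative of [pt x] closest to [y0] is the projection [<x,y0> x], at distance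
    [vnorm y0] times the sine of the angle. *)
Lemma ball_points y0 (r : R) : nr2 y0 != 0 -> 0 < r -> exists2 r' : R, 0 < r' &
 forall x, nr2 x = 1 -> dFS (pt y0) (pt x) <= r' -> dotc x y0 != 0 /\ forall i, cabs (dotc x y0 * x i - y0 i) < r.
Proof.
move=> y00 r0; have yp : 0 < nr2 y0 by rewrite lt_def y00 nr2_ge0.
have vp : 0 < vnorm y0 by rewrite sqrtr_gt0.
have rv : 0 < r / (2 * vnorm y0) by rewrite divr_gt0// mulr_gt0.
exists (Num.min (2^-1) (r / (2 * vnorm y0))); first by rewrite lt_min invr_gt0 ltr0n.
move=> x x1; rewrite le_min => /andP[h1 h2]; set D := dFS _ _ in h1 h2.
have D0 : 0 <= D by exact: dFS_ge0.
have ctrE : ctr (pt y0) (pt x) = cabs (dotc x y0) ^+ 2 / nr2 y0.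
 by rewrite (ctr_pt y00 (nr2_neq0 x1)) x1 mulr1 (dotcC x y0) cabs_conj.
have := ctr_le_dFS (pt y0) (pt x); rewrite -/D ctrE => h3.
have D2 : D ^+ 2 <= 4^-1.
 by have : D ^+ 2 <= 2^-1 ^+ 2; [rewrite lerXn2r ?nnegrE ?invr_ge0|rewrite exprVn -natrX].
have cE : cabs (dotc x y0) ^+ 2 = nr2 y0 * (cabs (dotc x y0) ^+ 2 / nr2 y0) by rewrite mulrC divfK.
split.
 apply/eqP => d0; move: h3; rewrite d0 cabs0 expr0n mul0r subr0; lra.
move=> i; have := cabs_le_vnorm (lin2 (dotc x y0) x (-1) y0) i.
rewrite /lin2 mulN1r => h4; apply: le_lt_trans h4 _.
have hn : nr2 (lin2 (dotc x y0) x (-1) y0) <= (vnorm y0 * D) ^+ 2.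
 rewrite nr2_lin2 x1 mulr1 cabsN cabs1 expr1n mul1r mulrN1 mulNr conjcM_cabs ReN /=.
 rewrite exprMn sqr_vnorm.
 have h5 : nr2 y0 * (1 - cabs (dotc x y0) ^+ 2 / nr2 y0) <= nr2 y0 * D ^+ 2 by rewrite ler_wpM2l// nr2_ge0.
 by move: h5; rewrite mulrBr mulr1 -cE; lra.
apply: (@le_lt_trans _ _ (vnorm y0 * D)).
 by rewrite -[leRHS]ger0_norm ?mulr_ge0 ?(ltW vp)// -sqrtr_sqr /vnorm ler_sqrt// ?sqr_ge0.
apply: (@le_lt_trans _ _ (vnorm y0 * (r / (2 * vnorm y0)))); first by rewrite ler_wpM2l// ltW.
have -> : vnorm y0 * (r / (2 * vnorm y0)) = r / 2 by field; rewrite gt_eqF.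
by rewrite ltr_pdivrMr// ltr_pMr// ltr1n.
Qed.

Lemma pt_near y0 (r : R) : nr2 y0 != 0 -> 0 < r -> exists2 e : R, 0 < e &
 forall y, (forall i, cabs (y i - y0 i) <= e) -> nr2 y != 0 /\ dFS (pt y0) (pt y) <= r.
Proof.
move=> y00 r0; have yp : 0 < nr2 y0 by rewrite lt_def y00 nr2_ge0.
have vp : 0 < vnorm y0 by rewrite sqrtr_gt0.
have [i0 yi0] : exists i, y0 i != 0 by apply/existsP; rewrite -nr2_gt0.
have ci0 : 0 < cabs (y0 i0) by rewrite cabs_gt0.
have e10 : 0 < r * vnorm y0 / (3 * N%:R) by rewrite divr_gt0 ?mulr_gt0.
exists (Num.min (r * vnorm y0 / (3 * N%:R)) (cabs (y0 i0) / 2)); first by rewrite lt_min e10 divr_gt0.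
set e := Num.min _ _ => y ye; have e0 : 0 <= e by apply: le_trans (ye i0).
have y0' : nr2 y != 0.
 apply/eqP => /eqP; rewrite nr2_eq0 => /forallP/(_ i0)/eqP yi; have := ye i0.
 by rewrite yi sub0r cabsN le_min => /andP[_]; lra.
split => //; rewrite dFSC; apply: le_trans (dFS_pt_le y0' y00) _.
have h : vnorm (fun i => y0 i - y i) <= N%:R * e.
 rewrite -[leRHS]ger0_norm ?mulr_ge0// -sqrtr_sqr /vnorm ler_sqrt ?sqr_ge0//.
 apply: (via (\sum_(i < N) e ^+ 2)).
  by apply: ler_sum => i _; apply: cnorm2_le; rewrite cabsB.
 have -> : \sum_(i < N) e ^+ 2 = N%:R * e ^+ 2 by rewrite sumr_const card_ord mulr_natl.
 rewrite exprMn; apply: ler_wpM2r; first exact: sqr_ge0.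
 by rewrite expr2 ler_peMl// ler1n.
rewrite mulrA ler_pdivrMr//; apply: (via (3 * (N%:R * e))); first by rewrite ler_pM2l.
have : e <= r * vnorm y0 / (3 * N%:R) by rewrite ge_min lexx.
by rewrite ler_pdivlMr ?mulr_gt0// mulrC mulrA.
Qed.

Lemma mv_near (L0 L : Gr m) x i : mv (grm L0) x =1 x ->
 cabs (mv (grm L) x i - x i) <= dmx R (grm L0) (grm L) * \sum_j cabs (x j).
Proof.
move=> h; rewrite -[X in _ - X](h i) /mv -sumrB; apply: le_trans (cabs_sum _ _ _) _.
rewrite mulr_sumr; apply: ler_sum => j _; rewrite -mulrBl cabsM ler_wpM2r//.
by rewrite cabsB dmxE; exact: le_sum_cnorm2.
Qed.

Lemma line_through x y : nr2 x != 0 -> (forall c : C, ~ (y =1 fun i => c * x i)) ->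
 exists L, mv (grm L) x =1 x /\ mv (grm L) y =1 y.
Proof.
move=> x0 xy; have xp : 0 < vnorm x by rewrite sqrtr_gt0 lt_def x0 nr2_ge0.
pose e := vunit x; have e1 : nr2 e = 1 := nr2_vunit x.
have eE i : e i = ((vnorm x)^-1)%:C * x i by rewrite /e /vunit (negbTE x0).
have vx0 : (vnorm x)%:C != 0 :> C by rewrite -cabs_gt0 cabs_real normr_gt0 gt_eqF.
have xE : x =1 fun i => (vnorm x)%:C * e i by move=> i; rewrite eE mulrA -realcM mulfV ?gt_eqF// mul1r.
pose w := lin2 1 y (- dotc e y) e.
have w0 : nr2 w != 0.
 rewrite nr2_eq0; apply/negP => /forallP h; apply: (xy (dotc e y * ((vnorm x)^-1)%:C)) => i.
 by have /eqP := h i; rewrite /w /lin2 mul1r mulNr => /eqP; rewrite subr_eq0 => /eqP ->; rewrite eE mulrA.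
have wp : 0 < vnorm w by rewrite sqrtr_gt0 lt_def w0 nr2_ge0.
pose f := vunit w; have f1 : nr2 f = 1 := nr2_vunit w.
have fE i : f i = ((vnorm w)^-1)%:C * w i by rewrite /f /vunit (negbTE w0).
have ew : dotc e w = 0 by rewrite /w dotc_linr dotcxx e1 mul1r mulr1 subrr.
have ef : dotc e f = 0.
 have -> : dotc e f = ((vnorm w)^-1)%:C * dotc e w.
  by rewrite /dotc mulr_sumr; apply: eq_bigr => i _; rewrite fE mulrCA.
 by rewrite ew mulr0.
have fe : dotc f e = 0 by rewrite dotcC ef conjc0.
have P : is_proj R 2 (outer e + outer f).
 apply/and3P; split.
 - by rewrite adjmx_add !outer_adj.
 - by rewrite mulmxDl !mulmxDr !outer_mul ef fe !dotcxx e1 f1 !scale0r !scale1r addr0 add0r.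
 - by rewrite mxtraceD !tr_outer e1 f1.
pose L := @MkGr R m _ P; have fr : frame L e f by split.
have mve (u u' : vec) : u =1 u' -> mv (grm L) u =1 mv (grm L) u'.
 by move=> uu i; apply: eq_bigr => j _; rewrite uu.
exists L; split.
- have E : x =1 lin2 (vnorm x)%:C e 0 f by move=> i; rewrite /lin2 mul0r addr0; exact: xE.
 by move=> i; rewrite (mve _ _ E) (frame_mv _ _ fr) E.
- have E : y =1 lin2 (dotc e y) e (vnorm w)%:C f.
  move=> i; rewrite /lin2 fE mulrA -realcM mulfV ?gt_eqF// mul1r /w /lin2; ring.
 by move=> i; rewrite (mve _ _ E) (frame_mv _ _ fr) E.
Qed.

End Nearby.

(** * Injectivity of the measure *)

Section Injective.
Context {m d : nat}.
Notation vec := ('I_m.+2 -> C).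
Notation hp := (Hpoly m.+1 d).
Notation dFS := (@dFS R _).
Variables (vol : probability (Grm m) R) (inv : Gr_invariant R m vol) (d0 : (0 < d)%N).
Implicit Types (f g : hp) (y v x : vec) (L : Gr m).

(** The comparison of [|f|^k'] with [|g|^k] near [y0] restricts to every line through a nearby
    point, in the basis used by [mult] up to scaling; [ord_power_bound] then relates the orders,
    also when both restrictions vanish identically. *)
Lemma mult_relation f g y0 k k' (r c : R) L x : 0 < r ->
 (forall y, (forall i, cabs (y i - y0 i) < r) ->
  cabs (pe f y) ^+ k' <= c * cabs (pe g y) ^+ k /\ cabs (pe g y) ^+ k <= c * cabs (pe f y) ^+ k') ->
 nr2 x = 1 -> dotc x y0 != 0 -> (forall i, cabs (dotc x y0 * x i - y0 i) < r / 2) ->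
 (k' * mult R f L (pt x) = k * mult R g L (pt x))%N.
Proof.
move=> r0 fg x1 a0 ax; have [c1 c10 wE] := vec_of_outer (nr2_neq0 x1).
rewrite /mult (cpm_pt1 x1) /=; set w := vec_of R (outer x) in wE *; set w' := vec_of R _.
set a := dotc x y0 in a0 ax; pose b := c1 / a; have b0 : b != 0 by rewrite mulf_neq0 ?invr_eq0.
have cb : 0 < cabs b by rewrite cabs_gt0.
pose S := 1 + \sum_i cabs (w' i); have S0 : 0 < S by rewrite ltr_pwDl// sumr_ge0.
pose be := cabs b ^+ d; have be0 : 0 < be by rewrite exprn_gt0.
pose Y (t : C) : vec := fun i => a * x i + t / b * w' i.
have YE (p : hp) (t : C) : cabs (lp p w w').[t] = be * cabs (pe p (Y t)).
 rewrite horner_lp (_ : pe p _ = pe p (fun i => b * Y t i)); first by rewrite pe_scale cabsM cabsX.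
 apply: pe_ext => i; rewrite wE /Y /b; field; rewrite c10 a0//.
apply: (@ord_power_bound _ _ _ _ (`|c| * (be ^+ k' / be ^+ k + be ^+ k / be ^+ k')) (cabs b * (r / 2) / S)).
 by rewrite divr_gt0// mulr_gt0// divr_gt0.
move=> t; rewrite ltr_pdivlMr// => tb.
have Yr i : cabs (Y t i - y0 i) < r.
 have -> : Y t i - y0 i = (a * x i - y0 i) + t / b * w' i by rewrite /Y; ring.
 apply: le_lt_trans (cabs_le _ _) _; have := ax i.
 have : cabs (t / b * w' i) <= r / 2.
  rewrite !cabsM cabsV mulrAC ler_pdivrMr// (mulrC (r / 2)); apply: ltW; apply: le_lt_trans tb.
  rewrite ler_wpM2l// /S (bigD1 i)//= addrCA lerDl addr_ge0// sumr_ge0//.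
 lra.
have [h1 h2] := fg _ Yr; rewrite !YE !exprMn.
have key (A B : R) i j : 0 <= B -> A <= c * B -> be ^+ i * A <= `|c| * (be ^+ i / be ^+ j) * (be ^+ j * B).
 move=> B0 AB; have -> : `|c| * (be ^+ i / be ^+ j) * (be ^+ j * B) = be ^+ i * (`|c| * B).
  by field; rewrite expf_neq0// gt_eqF.
 rewrite ler_pM2l ?exprn_gt0//; apply: le_trans AB _; apply: ler_wpM2r => //; exact: ler_norm.
have bb i j : 0 <= be ^+ i / be ^+ j by rewrite divr_ge0 ?exprn_ge0 ?(ltW be0).
have b1 : 0 <= cabs (pe g (Y t)) ^+ k by rewrite exprn_ge0.
have b2 : 0 <= cabs (pe f (Y t)) ^+ k' by rewrite exprn_ge0.
split.
- apply: le_trans (key _ _ k' k b1 h1) _; rewrite ler_wpM2r ?mulr_ge0 ?exprn_ge0 ?(ltW be0)//.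
 by rewrite ler_wpM2l// lerDl.
- apply: le_trans (key _ _ k k' b2 h2) _; rewrite ler_wpM2r ?mulr_ge0 ?exprn_ge0 ?(ltW be0)//.
 by rewrite ler_wpM2l// lerDr.
Qed.

Lemma lineCount_ge1 f L y (A : set (CP m.+1)) : nondeg f L -> mv (grm L) y =1 y -> nr2 y != 0 -> pe f y = 0 ->
 A (pt y) -> 1 <= lineCount R f L A.
Proof.
move=> nd Ly y0 fy Ay; have [e [w [_ _ /(_ L nd)[fr fw]]]] := frame_measurable f d0.
have [zs rz] := roots_on_exists (e L) fw; rewrite (lineCountE A fr fw rz).
have yE := frame_lin fr Ly; set a := dotc _ y in yE; set b := dotc (w L) y in yE.
have := fy; rewrite (pe_ext f yE) rz.2 => /eqP; rewrite mulf_eq0 (negbTE fw)/= prodf_seq_eq0.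
move=> /hasP[s szs /= /eqP/subr0_eq bs].
have a0 : a != 0.
 apply/eqP => a0; move: y0; rewrite (_ : nr2 y = nr2 (lin2 a (e L) b (w L))); last first.
  by apply: eq_bigr => i _; rewrite yE.
 by rewrite (frame_nr2 _ _ fr) bs a0 mul0r !cabs0 expr0n addr0 eqxx.
have ptE : pt y = pt (lin2 1 (e L) s (w L)).
 rewrite -(pt_scale (lin2 1 (e L) s (w L)) a0); congr pt; apply/funext => i.
 by rewrite yE bs /lin2 mul1r mulrDr mulrA.
rewrite (perm_big _ (perm_to_rem szs))/= big_cons -ptE mem_set// lerDl.
by apply: sumr_ge0.
Qed.

Lemma measurable_lineCount f (A : set (CPm m.+1)) : hnonzero f -> measurable A ->
 meas (fun L : Grm m => lineCount R f L A).
Proof.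
move=> fn mA; have [z [mz _ hz]] := muP_labels d0 (aenondegP inv d0 fn).
have -> : (fun L : Grm m => lineCount R f L A) =
  (fun L : Grm m => (\sum_(i < d) \1_A (z i L)) * \1_[set L | nondeg f L] L).
 apply/funext => L; rewrite [\1_[set L | nondeg f L] L]indicE.
 have [nd|nd] := pselect (nondeg f L).
  rewrite mem_set// mulr1 (lpts_count _ (hz L nd)) big_map big_enum/=.
  by apply: eq_bigr => i _; rewrite indicE.
 by rewrite memNset// mulr0 lineCount_deg.
apply: measurable_funM; last by apply: measurable_indic; exact: measurable_nondeg.
by apply: measurable_sum => i; apply: (measurableT_comp _ (mz i)); exact: measurable_indic.
Qed.

Lemma lineCount_ge0 f L A : 0 <= lineCount R f L A.
Proof. by apply: fsumr_ge0 => z _. Qed.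

(** Take a line through [y0] and [v]. On all lines close to it, [f] is small at the projection of
    [y0] but not at that of [v], so [root_of_lead] gives a zero near [y0]; these lines have positive
    measure by [ball_pos]. *)
Lemma muP_ball_pos f v y0 (r : R) : pe f v != 0 -> pe f y0 = 0 -> nr2 y0 != 0 -> 0 < r ->
 (0 < muP vol f [set z | (dFS (pt y0) z <= r)%R])%E.
Proof.
move=> fv fy0 y00 r0; have fn := pe_hnonzero fv.
have fv0 : 0 < cabs (pe f v) by rewrite cabs_gt0.
have [L0 [Ly0 Lv]] : exists L, mv (grm L) y0 =1 y0 /\ mv (grm L) v =1 v.
 apply: line_through => // c vE; move: fv; rewrite (pe_ext f vE) pe_scale fy0 mulr0 eqxx//.
have [e e0 he] := pt_near y00 r0.
pose Sv := 2 + \sum_j cabs (v j); have Sv0 : 0 < Sv by rewrite ltr_pwDl// sumr_ge0.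
pose s1 := e / 2 / Sv; have s10 : 0 < s1 by rewrite !divr_gt0.
have cv1 : vnbhs v [set y | cabs (pe f y - pe f v) < cabs (pe f v) / 2].
 have : ccvg (vnbhs v) (fun y => pe f y) (pe f v).
  by apply: ccvg_pe => [a|i]; [exact: ccvg_cst|exact: ccvg_vnbhs].
 by apply; rewrite divr_gt0.
have cv2 : vnbhs y0 [set y | cabs (pe f y - pe f y0) < s1 ^+ d * (cabs (pe f v) / 2)].
 have : ccvg (vnbhs y0) (fun y => pe f y) (pe f y0).
  by apply: ccvg_pe => [a|i]; [exact: ccvg_cst|exact: ccvg_vnbhs].
 by apply; rewrite mulr_gt0 ?exprn_gt0 ?divr_gt0.
case: cv1 => r1 r10 h1; case: cv2 => r2 r20 h2.
pose eta := Num.min (Num.min r1 r2) (Num.min (e / 2) 1).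
have eta0 : 0 < eta by rewrite !lt_min r10 r20 divr_gt0//=.
pose S := 1 + \sum_j cabs (v j) + \sum_j cabs (y0 j).
have sv0 : 0 <= \sum_j cabs (v j) by apply: sumr_ge0.
have sy0 : 0 <= \sum_j cabs (y0 j) by apply: sumr_ge0.
have S0 : 0 < S by rewrite /S -addrA ltr_pwDl// addr_ge0.
pose B : set (Grm m) := [set L | dmx R (grm L0) (grm L) < eta / S].
have Bpos : (0 < vol B)%E by apply: (ball_pos inv); rewrite divr_gt0.
have mB : measurable B by exact: measurable_dmx_ball.
pose A : set (CPm m.+1) := [set z | dFS (pt y0) z <= r].
have mA : measurable A by exact: measurable_cball.
have BL (L : Grm m) : B L -> 1 <= lineCount R f L A.
 rewrite /B/= ltr_pdivlMr// => LB.
 have nv i : cabs (mv (grm L) v i - v i) < eta.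
  apply: le_lt_trans (mv_near L i Lv) _; apply: le_lt_trans LB; rewrite ler_wpM2l ?sqrtr_ge0//.
  by rewrite /S addrAC addrC lerDl addr_ge0.
 have ny i : cabs (mv (grm L) y0 i - y0 i) < eta.
  apply: le_lt_trans (mv_near L i Ly0) _; apply: le_lt_trans LB; rewrite ler_wpM2l ?sqrtr_ge0//.
  by rewrite /S addrC lerDl addr_ge0.
 have k1 : cabs (pe f (mv (grm L) v) - pe f v) < cabs (pe f v) / 2.
  by apply: h1 => i; apply: lt_le_trans (nv i) _; rewrite !ge_min lexx.
 have k2 : cabs (pe f (mv (grm L) y0)) < s1 ^+ d * (cabs (pe f v) / 2).
  rewrite -[pe f _]subr0 -fy0; apply: h2 => i; apply: lt_le_trans (ny i) _.
  by rewrite !ge_min lexx !orbT.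
 have k3 : cabs (pe f v) / 2 <= cabs (pe f (mv (grm L) v)).
  exact: half_close k1.
 have fLv : pe f (mv (grm L) v) != 0 by rewrite -cabs_gt0; apply: lt_le_trans k3; rewrite divr_gt0.
 have [sl ll] := lead_lp (mv (grm L) y0) fLv.
 have [s rs hs] := root_of_lead 0 sl d0; rewrite ll sub0r cabsN in hs.
 have P0 : (lp f (mv (grm L) y0) (mv (grm L) v)).[0] = pe f (mv (grm L) y0).
  by rewrite horner_lp; apply: pe_ext => i; rewrite mul0r addr0.
 rewrite P0 in hs.
 have ss1 : cabs s <= s1.
  have : cabs s ^+ d <= s1 ^+ d.
   have c2 : 0 < cabs (pe f v) / 2 by rewrite divr_gt0.
   have k4 := ltW (le_lt_trans hs k2).
   rewrite -(ler_pM2l c2) [leRHS]mulrC; apply: le_trans k4.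
   by apply: ler_wpM2r k3; rewrite exprn_ge0.
  by rewrite ler_pXn2r ?nnegrE ?(ltW s10).
 pose y : vec := fun i => mv (grm L) y0 i + s * mv (grm L) v i.
 have fy : pe f y = 0 by move/rootP: rs; rewrite horner_lp.
 have [yn yr] : nr2 y != 0 /\ dFS (pt y0) (pt y) <= r.
  apply: he => i; have -> : y i - y0 i = (mv (grm L) y0 i - y0 i) + s * mv (grm L) v i by rewrite /y; ring.
  apply: le_trans (cabs_le _ _) _; rewrite cabsM.
  have t1 : cabs (mv (grm L) y0 i - y0 i) <= e / 2.
   by apply: ltW; apply: lt_le_trans (ny i) _; rewrite !ge_min lexx !orbT.
  have t2 : cabs (mv (grm L) v i) <= Sv.
   apply: (near_le (b := v i)); first by apply: lt_le_trans (nv i) _; rewrite !ge_min lexx !orbT.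
   by rewrite (bigD1 i)//= lerDl sumr_ge0.
  have t3 : cabs s * cabs (mv (grm L) v i) <= e / 2.
   by apply: le_trans (ler_pM _ _ ss1 t2) _ => //; rewrite /s1 divfK// gt_eqF.
  by rewrite [leRHS](splitr e) lerD.
 apply: (@lineCount_ge1 f L y) => //.
 - by exists (mv (grm L) v) => //; exact: mv_grm_idem.
 - have E : y =1 lin2 1 (mv (grm L) y0) s (mv (grm L) v) by move=> i; rewrite /lin2 mul1r.
  have mE : mv (grm L) y =1 mv (grm L) (lin2 1 (mv (grm L) y0) s (mv (grm L) v)).
   by move=> i; apply: eq_bigr => j _; rewrite E.
  by move=> i; rewrite mE mv_lin2 !mv_grm_idem /y mul1r.
rewrite /muP mule_gt0 ?lte_fin ?invr_gt0 ?ltr0n//; apply: lt_le_trans Bpos _.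
have <- : (\int[vol]_L (\1_B L)%:E = vol B)%E by rewrite integral_indic// setIT.
apply: ge0_le_integral => //.
- by apply/measurable_EFinP; exact: measurable_indic.
- by apply/measurable_EFinP; exact: measurable_lineCount.
- move=> L _; rewrite indicE lee_fin; have [LB|LB] := pselect (B L); first by rewrite mem_set//; exact: BL.
 by rewrite memNset// lineCount_ge0.
Qed.

Lemma wq0_ball (q : R) f g z (r : R) : 1 <= q -> hnonzero f -> hnonzero g -> wq vol q f g = 0%E ->
 muP vol f [set w | (dFS z w <= r)%R] = muP vol g [set w | (dFS z w <= r)%R].
Proof.
move=> q1 /(muP_is_prob inv d0)[P hP] /(muP_is_prob inv d0)[Q hQ]; rewrite /wq (Wq_ext q hP hQ) => W0.
rewrite hP ?hQ; [exact: Wq0_ball q1 _ _ _ _ W0|exact: measurable_cball|exact: measurable_cball].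
Qed.

(** On the line joining a point where [f] does not vanish to one where [g] does not, both
    restrictions are nonzero polynomials, so some point avoids the roots of their product. *)
Lemma common_nonzero f g : hnonzero f -> hnonzero g -> exists v, pe f v != 0 /\ pe g v != 0.
Proof.
move=> /hnonzero_pe[s fs] /hnonzero_pe[t gt]; set x := kpt s in fs; set y := kpt t in gt.
pose w : vec := fun i => y i - x i.
have P0 : lp f x w != 0.
 apply: contraNneq fs => P0; have := horner_lp f x w 0; rewrite P0 horner0 => E.
 by apply/eqP; rewrite [RHS]E; apply: pe_ext => i; rewrite mul0r addr0.
have Q0 : lp g x w != 0.
 apply: contraNneq gt => Q0; have := horner_lp g x w 1; rewrite Q0 horner0 => E.
 by apply/eqP; rewrite [RHS]E; apply: pe_ext => i; rewrite mul1r /w addrC subrK.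
have [[|u us]] := nonroots 1 (mulf_neq0 P0 Q0); first by case.
move=> [_ _ /andP[]]; rewrite hornerM mulf_eq0 negb_or !horner_lp => /andP[h1 h2] _.
by eexists; split; [exact: h1|exact: h2].
Qed.

(** On each line of direction [v] the restrictions have the same roots with multiplicity and leading
    coefficients [f(v)] and [g(v)], so their ratio is the same constant everywhere. *)
Lemma same_orders_hprop f g v : pe f v != 0 -> pe g v != 0 -> (forall y, mz f v y = mz g v y) -> hprop R f g.
Proof.
move=> fv gv E; pose c := pe g v / pe f v; have c0 : c != 0 by rewrite mulf_neq0 ?invr_eq0.
have fg y : pe g y = c * pe f y.
 have [zs rf] := rts_exists y fv; have [ws rg] := rts_exists y gv.
 have zw : perm_eq zs ws.
  by apply/allP => z _; rewrite /= -(rts_mz z fv rf) -(rts_mz z gv rg) E.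
 have h1 := congr1 (fun P : {poly C} => P.[0]) rf.2; have h2 := congr1 (fun P : {poly C} => P.[0]) rg.2.
 move: h1 h2; rewrite !horner_lp !hornerZ (perm_big _ zw)/=.
 have e (p : hp) : pe p (fun i => y i + 0 * v i) = pe p y by apply: pe_ext => i; rewrite mul0r addr0.
 by rewrite !e => -> ->; rewrite /c mulrA divfK.
exists c; split => // a da; apply/eqP; rewrite -subr_eq0; apply/negPn/negP => ga.
have /hnonzero_pe[s /negP] : hnonzero (fun b => g b - c * f b : C) by exists a.
apply; apply/eqP; set x := kpt s; have -> : pe (fun b => g b - c * f b : C) x = pe g x - c * pe f x.
 by rewrite /pe /heval mulr_sumr -sumrB; apply: eq_bigr => b _; ring.
by rewrite fg subrr.
Qed.

Theorem muP_injective f g : hnonzero f -> hnonzero g ->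
 (forall z (r : R), muP vol f [set w | (dFS z w <= r)%R] = muP vol g [set w | (dFS z w <= r)%R]) -> hprop R f g.
Proof.
move=> fn gn mfg; have [v [fv gv]] := common_nonzero fn gn.
have [E|/existsNP E] := pselect (forall y, mz f v y = mz g v y); first exact: same_orders_hprop E.
have [y0 /eqP y0ne ymin] := @ex_min_by _ (fun y => mz f v y <> mz g v y) (fun y => mz f v y + mz g v y)%N E.
have [|r [c [r0 hrc]]] := local_bound fv gv y0ne.
 by move=> y /eqP; exact: ymin.
set k := mz f v y0 in y0ne hrc; set k' := mz g v y0 in y0ne hrc.
have zero (h : hp) : pe h v != 0 -> (0 < mz h v y0)%N -> pe h y0 = 0.
 move=> hv hm; have l0 : lp h y0 v != 0 by rewrite -size_poly_eq0 (lead_lp y0 hv).1.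
 have : root (lp h y0 v) 0 by rewrite -dvdp_XsubCl XsubC_dvd.
 by move/rootP; rewrite horner_lp => <-; apply: pe_ext => i; rewrite mul0r addr0.
(* The minimum is taken over vectors, and the zero vector must be excluded: along [v] through 0 all
   [d] roots are 0, so both multiplicities are [d]. *)
have y00 : nr2 y0 != 0.
 apply/eqP => n0; have yz i : y0 i = 0 by move/eqP: n0; rewrite nr2_eq0 => /forallP/(_ i)/eqP.
 have dE (h : hp) : pe h v != 0 -> mz h v y0 = d.
  move=> hv; have rt : rts h v y0 (nseq d 0).
   split; first exact: size_nseq.
   apply: horner_ext => s; rewrite horner_lp hornerZ horner_prodXsubC big_nseq.
   have -> : pe h (fun i => y0 i + s * v i) = pe h (fun i => s * v i) by apply: pe_ext => i; rewrite yz add0r.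
   by rewrite pe_scale mulrC subr0 iter_mulr_1.
  by rewrite (rts_mz0 hv rt) count_nseq/= eqxx mul1n.
 by move: y0ne; rewrite /k /k' !dE ?eqxx.
have r2 : 0 < r / 2 by rewrite divr_gt0.
have [r' r'0 hball] := ball_points y00 r2.
pose A : set (CPm m.+1) := [set z | (dFS (pt y0) z <= r')%R].
have mA : measurable A by exact: measurable_cball.
have LC L : k'%:R * lineCount R f L A = k%:R * lineCount R g L A.
 rewrite /lineCount !mulr_fsumr; apply: eq_fsbigr => z; rewrite inE => -[zA _].
 have [x x1 zE] := CPP z; have [a0 ax] : dotc x y0 != 0 /\ forall i, cabs (dotc x y0 * x i - y0 i) < r / 2.
  by apply: hball => //; rewrite -zE.
 by rewrite -!natrM zE (mult_relation L r0 hrc x1 a0 ax).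
have dp : (0 <= (d%:R : R)^-1) by rewrite invr_ge0.
have mL (h : hp) : hnonzero h -> meas (fun L : Grm m => (lineCount R h L A)%:E).
 by move=> hn; apply/measurable_EFinP; exact: measurable_lineCount.
have muE (h : hp) (j : nat) : hnonzero h ->
  (j%:R%:E * muP vol h A = (d%:R^-1)%:E * \int[vol]_L (j%:R * lineCount R h L A)%:E)%E.
 move=> hn; rewrite /muP muleCA -ge0_integralZl//; [exact: mL|].
 by move=> L _; rewrite lee_fin lineCount_ge0.
have EQ : (k'%:R%:E * muP vol f A = k%:R%:E * muP vol f A)%E.
 have I : (\int[vol]_L (k'%:R * lineCount R f L A)%:E = \int[vol]_L (k%:R * lineCount R g L A)%:E)%E.
  by apply: eq_integral => L _; rewrite LC.
 have h : muP vol g A = muP vol f A := esym (mfg (pt y0) r').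
 by rewrite (muE f k' fn) I -(muE g k gn) h.
have [P hP] := muP_is_prob inv d0 fn.
have x0 : muP vol f A = 0%E.
 move: EQ; rewrite hP//; have : P A \is a fin_num by exact: fin_num_measure.
 move=> /fineK <-; rewrite -!EFinM => -[] /eqP; rewrite -subr_eq0 -mulrBl mulf_eq0 subr_eq0 eqr_nat eq_sym.
 by rewrite (negbTE y0ne) => /eqP ->.
(* One of [k] and [k'] is positive since they differ; that polynomial vanishes at [y0] and gives the
   ball positive mass. *)
have [kp|kp] := posnP k; last first.
 by have := muP_ball_pos fv (zero f fv kp) y00 r'0; rewrite -/A x0 ltxx.
have k'p : (0 < k')%N by rewrite lt0n; apply: contraNneq y0ne => ->; rewrite kp.
by have := muP_ball_pos gv (zero g gv k'p) y00 r'0; rewrite -mfg -/A x0 ltxx.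
Qed.

End Injective.

End ProjectiveSpace.

(** * Choice of the exponent and conclusion *)

Lemma exponent_bounds (R : realFieldType) (M n : nat) (q : R) : (0 < M)%N -> 1 <= q ->
 q * ((4 * M * n.+1)%:R - 1) < (4 * M * n.+1)%:R ->
 let th := (4 * M * n.+1)%:R^-1 : R in
 [/\ 0 < th, th * n.+1%:R <= 1, th < 1, (1 - th) * q < 1 & th * q < ((2 * n.+1) * M)%:R^-1].
Proof.
move=> M0 q1 hq th; set k : R := (4 * M * n.+1)%:R in hq th *.
have n1 : 1 <= n.+1%:R :> R by rewrite ler1n.
have M1 : 1 <= M%:R :> R by rewrite ler1n.
have kE : k = 4 * (M%:R * n.+1%:R) by rewrite /k !natrM mulrA.
have Mn : 1 <= M%:R * n.+1%:R :> R by nra.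
have k0 : 0 < k by lra.
split.
- by rewrite invr_gt0.
- by rewrite mulrC ler_pdivrMr// mul1r kE; nra.
- by rewrite invf_lt1//; lra.
- by rewrite -(ltr_pM2r k0) mul1r mulrAC mulrBl mul1r mulVf ?gt_eqF// mulrC.
- rewrite mulrC ltr_pdivrMr// !natrM.
 have -> : (2 * n.+1%:R * M%:R)^-1 * k = 2 by rewrite kE; field; rewrite !gt_eqF//; lra.
 nra.
Qed.

Theorem mainTheorem19 :
 forall (R : realType) (m : nat),
 exists e : nat, (0 < e)%N /\
  forall vol : probability (Grm R m) R, Gr_invariant R m vol ->
  forall (d : nat) (q : R), (0 < d)%N -> 1 <= q ->
   q * ((e * d)%:R - 1) < (e * d)%:R ->
   is_finite_distance (@hnonzero R m.+1 d) (@hprop R m.+1 d) (Win R vol q) /\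
   is_compact_metric (@hnonzero R m.+1 d) (Win R vol q).
Proof.
move=> R m; exists (4 * 2 ^ (2 * m.+2))%N; split; first by rewrite muln_gt0 expn_gt0.
move=> vol inv [//|n] q d0 q1 hq.
have [th0 thn th1 sq tb] := exponent_bounds (expn_gt0 2 _) q1 hq.
set th := _^-1 in th0 thn th1 sq tb.
have near := Win_near inv q1 th0 thn th1 sq tb.
split; last first.
 exact: (compact_of_near near (fun p p' => @Win_hprop0 _ _ _ _ inv d0 _ q1 p p') (Win_tri inv d0 q1)).
split.
- by move=> p p' pn pn'; rewrite Win_ge0/= (Win_fin inv q1 th0 thn th1 sq tb pn pn').
- move=> p p' pn pn'; split; last exact: (Win_hprop0 inv d0 q1 pn).
 move=> /(Win0_wq0 inv d0 q1 pn pn') W0; apply: (muP_injective inv d0 pn pn') => z r.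
 exact: (wq0_ball inv d0 _ _ q1 pn pn' W0).
- by move=> p p' _ _; exact: (Win_sym inv d0 q1).
- by move=> p p' p'' _ _ _; exact: (Win_tri inv d0 q1).
Qed.
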